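(* Assume the following. (a) (Weak $B$-condition) There are a strictly positive self-adjoint $B\in L(H)$ with $A^*B\in L(H)$ and $c_0\ge0$ such that $-A^*B+c_0B\ge0$. (b) $b$ and $\sigma$ are continuous on $H\times\Lambda_0$ and there is $C>0$ such that $\|b(x,a)-b(x',a)\|_H\le C\|x-x'\|_{-1}$, $\|\sigma(x,a)-\sigma(x',a)\|_{L_2(\Xi,H)}\le C\|x-x'\|_{-1}$, $\|b(x,a)\|_H\le C(1+\|x\|_H+\|a\|_\Lambda)$ and $\|\sigma(x,a)\|_{L_2(\Xi,H)}\le C(1+\|x\|_H+\|a\|_\Lambda)$ for all $x,x'\in H$, $a\in\Lambda_0$. (c) $l$ is continuous on $H\times\Lambda_0$ and there is $C>0$ such that $|l(x,a)-l(x',a)|\le C\|x-x'\|_{-1}$, $|l(x,a)|\le C(1+\|x\|_H+\|a\|_\Lambda^2)$ and $|g(x)-g(x')|\le C\|x-x'\|_{-1}$ for all $x,x'\in H$, $a\in\Lambda_0$; moreover, if $\Lambda_0$ is unbounded, $l$ and $g$ are bounded from below. (d) $b:H\times\Lambda\to H$ and $\sigma:H\times\Lambda\to L_2(\Xi,H)$ are Fréchet differentiable in the first variable and there is $C>0$ such that $\|(D_xb(x,a)-D_xb(x',a))(x-x')\|_{-1}\le C\|x-x'\|_{-1}^2$ and $\|(D_x\sigma(x,a)-D_x\sigma(x',a))(x-x')\|_{L_2(\Xi,H_{-1})}\le C\|x-x'\|_{-1}^2$ for all $x,x'\in H$, $a\in\Lambda_0$. (e) $l(\cdot,a)$ is semiconcave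 in $H_{-1}$ uniformly in $a\in\Lambda_0$ (i.e. with constant independent of $a$), and $g$ is semiconcave in $H_{-1}$. Then, for every $t\in[0,T]$, the function $V(t,\cdot)$ is semiconcave in $H_{-1}$ with semiconcavity constant $C_1\mathrm e^{C_2(T-t)}$ for some $C_1,C_2\ge0$ independent of $t,T$.
   Context: $H$ and $\Xi$ are real separable Hilbert spaces, $\Lambda$ is a real separable Banach space, $\Lambda_0\subset\Lambda$ is convex, $p>2$ and $0<T<\infty$ are fixed. $L(H)$ denotes bounded linear operators on $H$, $L_2(\cdot,\cdot)$ Hilbert--Schmidt operators. For $C\in L(H)$, $C\ge0$ means $\langle Cx,x\rangle_H\ge0$ for all $x$; a self-adjoint $B$ is strictly positive if $\langle Bx,x\rangle_H>0$ for $x\neq0$; $\|x\|_{-1}^2:=\langle Bx,x\rangle_H$ and $H_{-1}$ is the completion of $H$ in this norm, a Hilbert space with $\langle x,y\rangle_{-1}=\langle B^{1/2}x,B^{1/2}y\rangle_H$. $A:\mathcal D(A)\subset H\to H$ is linear, densely defined and maximal dissipative; it generates a $C_0$-semigroup of contractions $(\mathrm e^{sA})_{s\ge 0}$. The coefficients are $b:H\times\Lambda\to H$, $\sigma:H\times\Lambda\to L_2(\Xi,H)$, $l:H\times\Lambda\to\mathbb R$, $g:H\to\mathbb R$. A function $v:H\to\mathbb R$ is semiconcave in $H_{-1}$ with semiconcavity constant $C$ if $\lambda v(x)+(1-\lambda)v(x')-v(\lambda x+(1-\lambda)x')\le C\lambda(1-\lambda)\|x-x'\|_{-1}^2$ for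 all $\lambda\in[0,1]$, $x,x'\in H$. For $t\in[0,T]$, a reference probability space $(\Omega,\mathscr F,(\mathscr F^t_s)_{s\in[t,T]},\mathbb P,(W(s))_{s\in[t,T]})$ is fixed: $(\Omega,\mathscr F,\mathbb P)$ is complete, $W$ is a cylindrical Wiener process in $\Xi$ with $W(t)=0$ $\mathbb P$-a.s., and $\mathscr F^t_s$ is generated by $\{W(\tau):t\le\tau\le s\}$ and the $\mathbb P$-null sets. $\mathcal U_t$ is the set of all $\mathscr F^t_s$-progressively measurable $a(\cdot):[t,T]\times\Omega\to\Lambda_0$ with $\mathbb E\int_t^T\|a(s)\|_\Lambda^p\,\mathrm ds<\infty$. $X(\cdot;t,x,a(\cdot))$ is the mild solution with continuous trajectories of $\mathrm dX(s)=[AX(s)+b(X(s),a(s))]\mathrm ds+\sigma(X(s),a(s))\mathrm dW(s)$, $X(t)=x$, i.e. $X(s)=\mathrm e^{(s-t)A}x+\int_t^s\mathrm e^{(s-r)A}b(X(r),a(r))\mathrm dr+\int_t^s\mathrm e^{(s-r)A}\sigma(X(r),a(r))\mathrm dW(r)$. Further $J(t,x;a(\cdot))=\mathbb E\big[\int_t^T l(X(s),a(s))\mathrm ds+g(X(T))\big]$ with $X(s)=X(s;t,x,a(\cdot))$, and the value function is $V(t,x)=\inf_{a(\cdot)\in\mathcal U_t}J(t,x;a(\cdot))$. *)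

(* Defs.v *)
From HB Require Import structures.
From mathcomp Require Import all_boot all_order all_algebra.
From mathcomp Require Import all_classical all_reals all_analysis.
From mathcomp Require Import ring lra.

Set Implicit Arguments.
Unset Strict Implicit.
Unset Printing Implicit Defensive.

Import Order.TTheory GRing.Theory Num.Theory.
Import numFieldNormedType.Exports.

Local Open Scope classical_set_scope.
Local Open Scope ring_scope.

Definition separable (T : topologicalType) : Prop :=
  exists2 D : set T, countable D & dense D.

HB.mixin Record isInnerProduct (R : realType) V of CompleteNormedModule R V := {
  hdot : V -> V -> R;
  hdotC : forall x y, hdot x y = hdot y x;
  hdotDl : forall x y z, hdot (x + y) z = hdot x z + hdot y z;
  hdotZl : forall c x y, hdot (c *: x) y = c * hdot x y;
  hdotxx : forall x, hdot x x = `|x| ^+ 2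
}.

#[short(type="hilbertType")]
HB.structure Definition Hilbert (R : realType) :=
  {V of isInnerProduct R V & CompleteNormedModule R V}.

Definition lin_span (R : realType) (V : lmodType R) (E : set V) : set V :=
  [set x | exists n (c : 'I_n -> R) (e : 'I_n -> V),
    (forall k, E (e k)) /\ x = \sum_(k < n) c k *: e k].

Record onb (R : realType) (Xi : hilbertType R) := Onb {
  onb_set :> set Xi;
  onb_orthonormal : forall e f, onb_set e -> onb_set f ->
    hdot e f = (e == f)%:R;
  onb_total : dense (lin_span onb_set)
}.

(* The seminorm [N] on the target is a parameter because the same operator is
   measured both in L_2(Xi, H) and in L_2(Xi, H_{-1}). *)
Definition hs_sum (R : realType) (Xi : hilbertType R) (E : set Xi) (V : Type)
    (N : V -> R) (f : Xi -> V) : \bar R :=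
  (\esum_(e in E) ((N (f e)) ^+ 2)%:E)%E.

Definition hs_norm (R : realType) (Xi : hilbertType R) (E : set Xi) (V : Type)
    (N : V -> R) (f : Xi -> V) : R :=
  Num.sqrt (fine (hs_sum E N f)).

Definition hs_pred (R : realType) (Xi H : hilbertType R) (E : onb Xi)
    : {pred Xi -> H} :=
  fun f => `[< [/\ linear f, continuous f &
                  (hs_sum E (@Num.norm R H) f < +oo)%E] >].

(* L_2(Xi, H), as a normed space; the norm does not depend on the
   orthonormal basis [E]. *)
Record hs (R : realType) (Xi : hilbertType R) (E : onb Xi) (H : hilbertType R)
  := Hs { hs_fun :> Xi -> H; hs_funP : hs_fun \in hs_pred E }.

Section hs_theory.
Context (R : realType) (Xi : hilbertType R) (E : onb Xi) (H : hilbertType R).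

HB.instance Definition _ := [isSub for @hs_fun R Xi E H].
HB.instance Definition _ := [Choice of hs E H by <:].

Local Notation ss := (hs_sum E (@Num.norm R H)).

Lemma hs_sum_ge0 f : (0 <= ss f)%E.
Proof. by apply: esum_ge0 => e _; rewrite lee_fin sqr_ge0. Qed.

Let esumZ_le (c : R) (a : Xi -> R) : 0 < c -> (forall e, 0 <= a e) ->
  (\esum_(e in E) (c * a e)%:E <= c%:E * \esum_(e in E) (a e)%:E)%E.
Proof.
move=> c0 a0; apply: ge_ereal_sup => _ [X [finX XE]] <-.
have -> : (\sum_(i \in X) (c * a i)%:E = c%:E * \sum_(i \in X) (a i)%:E)%E.
  rewrite ge0_mule_fsumr; last by move=> i; rewrite lee_fin.
  by apply: eq_fsbigr => i _; rewrite EFinM.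
rewrite lee_pmul2l//; apply: esum_ge; exists X => //; exact: lexx.
Qed.

Let esumZ (c : R) (a : Xi -> R) : 0 < c -> (forall e, 0 <= a e) ->
  (\esum_(e in E) (c * a e)%:E = c%:E * \esum_(e in E) (a e)%:E)%E.
Proof.
move=> c0 a0; apply/eqP; rewrite eq_le esumZ_le//=.
have := @esumZ_le c^-1 (fun e => c * a e); rewrite invr_gt0 => /(_ c0).
move=> /(_ (fun e => mulr_ge0 (ltW c0) (a0 e))); rewrite lee_pdivlMl//.
apply: le_trans; rewrite lee_pmul2l// le_esum// => e _.
by rewrite mulrA mulVf ?gt_eqF// mul1r.
Qed.

Lemma hs_sumZ c f : ss (c *: f) = ((c ^+ 2)%:E * ss f)%E.
Proof.
have [->|c0] := eqVneq c 0.
  rewrite expr0n mul0e /hs_sum esum1// => e _.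
  by rewrite scale0r normr0 expr0n.
rewrite /hs_sum -esumZ//; last first.
  by rewrite lt_def sqrf_eq0 c0 sqr_ge0.
by apply: eq_esum => e _; rewrite normrZ exprMn real_normK// num_real.
Qed.

Lemma hs_sumD_young (t : R) f g : 0 < t ->
  (ss (f + g)%R <= (1 + t)%:E * ss f + (1 + t^-1)%:E * ss g)%E.
Proof.
move=> t0; rewrite /hs_sum -!esumZ ?addr_gt0 ?invr_gt0//.
rewrite -esumD; first last.
- by move=> e _; rewrite lee_fin mulr_ge0 ?sqr_ge0// addr_ge0// invr_ge0 ltW.
- by move=> e _; rewrite lee_fin mulr_ge0 ?sqr_ge0// addr_ge0// ltW.
apply: le_esum => e _; rewrite -EFinD lee_fin.
set u := `|f e|; set v := `|g e|.
have uv : `|(f + g) e| <= u + v by exact: ler_normD.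
apply: (@le_trans _ _ ((u + v) ^+ 2)).
  by apply: lerXn2r; rewrite ?nnegrE ?addr_ge0 ?normr_ge0.
rewrite -subr_ge0.
have -> : (1 + t) * u ^+ 2 + (1 + t^-1) * v ^+ 2 - (u + v) ^+ 2
        = t^-1 * (t * u - v) ^+ 2.
  have t0' : t != 0 by rewrite gt_eqF.
  by field.
by rewrite mulr_ge0 ?invr_ge0 ?sqr_ge0// ltW.
Qed.

Local Notation nn := (hs_norm E (@Num.norm R H)).

Lemma hs_norm_sqr f : (ss f < +oo)%E -> ss f = (nn f ^+ 2)%:E.
Proof.
move=> foo; rewrite sqr_sqrtr ?fine_ge0 ?hs_sum_ge0// fineK//.
by rewrite ge0_fin_numE ?hs_sum_ge0.
Qed.

Lemma hs_sumD_fin f g : (ss f < +oo)%E -> (ss g < +oo)%E ->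
  (ss (f + g)%R < +oo)%E.
Proof.
move=> foo goo; apply: (le_lt_trans (hs_sumD_young f g ltr01)).
by rewrite (hs_norm_sqr foo) (hs_norm_sqr goo) -2!EFinM -EFinD ltry.
Qed.

Lemma hs_norm_ge0 f : 0 <= nn f. Proof. exact: sqrtr_ge0. Qed.

Lemma hs_normD f g : (ss f < +oo)%E -> (ss g < +oo)%E ->
  nn (f + g) <= nn f + nn g.
Proof.
move=> foo goo.
have young t : 0 < t ->
    nn (f + g) ^+ 2 <= (1 + t) * nn f ^+ 2 + (1 + t^-1) * nn g ^+ 2.
  move=> t0; have := hs_sumD_young f g t0.
  rewrite (hs_norm_sqr (hs_sumD_fin foo goo)) (hs_norm_sqr foo).
  by rewrite (hs_norm_sqr goo) -2!EFinM -EFinD lee_fin.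
have f0 := hs_norm_ge0 f; have g0 := hs_norm_ge0 g.
have fg0 := hs_norm_ge0 (f + g).
apply/ler_addgt0Pr => e e0.
rewrite -(@ler_pXn2r _ 2) ?nnegrE ?addr_ge0 ?(ltW e0)//.
have fe : 0 < nn f + e / 2 by rewrite ltr_wpDl// divr_gt0.
have ge : 0 < nn g + e / 2 by rewrite ltr_wpDl// divr_gt0.
set u := nn f + e / 2 in fe; set v := nn g + e / 2 in ge.
have -> : nn f + nn g + e = u + v by rewrite /u /v; field.
have := young (v / u) (divr_gt0 ge fe); rewrite invf_div => /le_trans; apply.
have -> : (u + v) ^+ 2 = (1 + v / u) * u ^+ 2 + (1 + u / v) * v ^+ 2.
  by field; rewrite ?gt_eqF.
apply: lerD; rewrite ler_wpM2l//.
- by rewrite addr_ge0// divr_ge0// ltW.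
- by rewrite lerXn2r// ?nnegrE ?(ltW fe)// /u lerDl divr_ge0// ltW.
- by rewrite addr_ge0// divr_ge0// ltW.
- by rewrite lerXn2r// ?nnegrE ?(ltW ge)// /v lerDl divr_ge0// ltW.
Qed.

Lemma hs_submod_closed : submod_closed (hs_pred (H := H) E).
Proof.
split.
  apply/asboolP; split.
  - by move=> a x y; rewrite scaler0 addr0.
  - exact: cst_continuous.
  - rewrite (_ : 0 = 0 *: (0 : Xi -> H)) ?scale0r// -/(hs_sum _ _ _).
    by rewrite /hs_sum esum1// => e _; rewrite normr0 expr0n.
move=> c f g /asboolP[lf cf foo] /asboolP[lg cg goo]; apply/asboolP; split.
- move=> a x y; rewrite !fctE lf lg !scalerDr !scalerA [c * a]mulrC.
  by rewrite addrACA.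
- by move=> x; apply: cvgD; [apply: cvgZr; exact: cf | exact: cg].
- apply: hs_sumD_fin => //; rewrite hs_sumZ hs_norm_sqr// -EFinM.
  exact: ltry.
Qed.

HB.instance Definition _ :=
  GRing.isSubmodClosed.Build R (Xi -> H) (hs_pred (H := H) E) hs_submod_closed.
HB.instance Definition _ := [SubChoice_isSubLmodule of hs E H by <:].

Lemma hs_fin (f : hs E H) : (ss f < +oo)%E.
Proof. by have /asboolP[] := hs_funP f. Qed.

Let ler_norm_hs (f g : hs E H) : nn (f + g)%R <= nn f + nn g.
Proof. exact: hs_normD (hs_fin f) (hs_fin g). Qed.

Let norm_hsZ c (f : hs E H) : nn (c *: f)%R = `|c| * nn f.
Proof.
rewrite /hs_norm -[X in _ = _ * Num.sqrt X]/(fine (ss f)).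
have -> : ss (c *: f)%R = ((c ^+ 2)%:E * ss f)%E by exact: hs_sumZ.
by rewrite hs_norm_sqr ?hs_fin//= -exprMn !sqrtr_sqr normrM.
Qed.

Let norm_hs_eq0 (f : hs E H) : nn f = 0 -> f = 0.
Proof.
have /asboolP[lf cf foo] := hs_funP f => f0.
have fE e : onb_set E e -> f e = 0.
  move=> Ee; apply/eqP; rewrite -normr_eq0 -sqrf_eq0 eq_le sqr_ge0 andbT.
  rewrite -lee_fin -[X in (_ <= X%:E)%E](expr0n _ 2) -f0 -hs_norm_sqr//.
  apply: esum_ge; exists [set e]; first by split=> // _ ->.
  by rewrite fsbig_set1.
have fspan x : lin_span E x -> f x = 0.
  move=> [n [c [e [Ee ->]]]].
  pose lff := GRing.isLinear.Build _ _ _ _ (f : Xi -> H) lf.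
  pose F : {linear Xi -> H} := HB.pack (f : Xi -> H) lff.
  rewrite -[LHS]/(F _) linear_sum big1// => k _.
  by rewrite linearZ /= /F /= fE ?scaler0.
apply: val_inj => /=; apply/funext => x; apply: contrapT => fx.
have oO : open (f @^-1` [set~ 0]).
  have /continuousP := cf; apply; apply: closed_openC.
  apply: accessible_closed_set1; apply: hausdorff_accessible.
  exact: norm_hausdorff.
have [] := @onb_total _ _ E (f @^-1` [set~ 0]) _ oO; first by exists x.
by move=> y [/= fy /fspan].
Qed.

HB.instance Definition _ := @Lmodule_isNormed.Build R (hs E H)
  (fun f => nn f) ler_norm_hs norm_hsZ norm_hs_eq0.

Lemma hs_normE (f : hs E H) : `|f| = hs_norm E (@Num.norm R H) f.
Proof. by []. Qed.

End hs_theory.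

Section operators.
Context (R : realType) (H : hilbertType R).

(* An unbounded operator is a pair (domain, function); the values of the
   function outside the domain are irrelevant. *)
Definition linear_on (D : set H) (A : H -> H) : Prop :=
  D 0 /\ forall c x y, D x -> D y ->
    D (c *: x + y) /\ A (c *: x + y) = c *: A x + A y.

Definition dissipative (D : set H) (A : H -> H) : Prop :=
  forall x, D x -> hdot (A x) x <= 0.

Definition maximal_dissipative (D : set H) (A : H -> H) : Prop :=
  dissipative D A /\
  forall (D' : set H) (A' : H -> H), linear_on D' A' -> dissipative D' A' ->
    D `<=` D' -> (forall x, D x -> A' x = A x) -> D' `<=` D.

(* y is in the domain of the adjoint of (D, A), and is mapped to z. *)
Definition adjoint_graph (D : set H) (A : H -> H) (y z : H) : Prop :=
  forall x, D x -> hdot (A x) y = hdot x z.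

Record contraction_semigroup (S : R -> {linear H -> H}) : Prop := {
  semigroup0 : forall x, S 0 x = x;
  semigroupD : forall r s x, 0 <= r -> 0 <= s -> S (r + s) x = S r (S s x);
  semigroup_contraction : forall s x, 0 <= s -> `|S s x| <= `|x|;
  semigroup_cvg0 : forall x, S s x @[s --> 0^'+] --> x
}.

Definition generates (D : set H) (A : H -> H) (S : R -> {linear H -> H})
    : Prop :=
  forall x y, (D x /\ A x = y) <->
    (h^-1 *: (S h x - x) @[h --> 0^'+] --> y).

Record strictly_positive_selfadjoint (B : {linear H -> H}) : Prop := {
  sps_bounded : continuous B;
  sps_selfadjoint : forall x y, hdot (B x) y = hdot x (B y);
  sps_pos : forall x, x != 0 -> 0 < hdot (B x) x
}.

(* The norm of H_{-1}, on H; only elements of H are ever measured. *)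
Definition norm_m1 (B : H -> H) (x : H) : R := Num.sqrt (hdot (B x) x).

Definition semiconcave_m1 (B : H -> H) (v : H -> R) (C : R) : Prop :=
  forall lam x x', 0 <= lam <= 1 ->
    lam * v x + (1 - lam) * v x' - v (lam *: x + (1 - lam) *: x')
    <= C * lam * (1 - lam) * norm_m1 B (x - x') ^+ 2.

(* AB plays the role of A^* B. *)
Definition weak_B_condition (D : set H) (A : H -> H) (B : {linear H -> H})
    : Prop :=
  exists (AB : {linear H -> H}) (c0 : R),
    [/\ continuous AB, forall y, adjoint_graph D A (B y) (AB y), 0 <= c0
      & forall x, 0 <= hdot (- AB x + c0 *: B x) x].

End operators.

Section bochner.
Context (R : realType) (H : hilbertType R).
Local Notation mu := (@lebesgue_measure R).

Record step_fun := StepFun {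
  step_size : nat;
  step_set : 'I_step_size -> set R;
  step_val : 'I_step_size -> H
}.

Definition step_eval (z : step_fun) (r : R) : H :=
  \sum_(k < step_size z) (\1_(step_set k) r : R) *: step_val k.

Definition step_int (D : set R) (z : step_fun) : H :=
  \sum_(k < step_size z) fine (mu (step_set k `&` D)) *: step_val k.

(* f is Bochner integrable on D (for the Lebesgue measure), with integral I. *)
Definition is_bochner_integral (D : set R) (f : R -> H) (I : H) : Prop :=
  (forall U : set H, open U -> measurable (D `&` f @^-1` U)) /\
  exists z : nat -> step_fun,
    [/\ forall n (k : 'I_(step_size (z n))), measurable (step_set k),
        (\int[mu]_(r in D) (`|f r - step_eval (z n) r|)%:E)%E
          @[n --> \oo] --> 0%E
      & step_int D (z n) @[n --> \oo] --> I].

End bochner.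

Section stochastic.
Context (R : realType) (Xi : hilbertType R).
Context (d : measure_display) (Om : measurableType d) (P : probability Om R).
Local Notation mu := (@lebesgue_measure R).

(* A cylindrical process in Xi is given by its coordinates
   W s e = <W s, e>. *)
Definition wiener_filtration (W : R -> Xi -> Om -> R) (t s : R)
    : set (set Om) :=
  <<s [set C | (exists r e (V : set R),
                  [/\ t <= r <= s, measurable V & C = W r e @^-1` V])
               \/ P.-negligible C] >>.

Record reference_space (t T : R) (W : R -> Xi -> Om -> R) : Prop := {
  ref_complete : measure_is_complete P;
  ref_measurable : forall s e, t <= s <= T -> measurable_fun setT (W s e);
  ref_linear : forall s c e e', t <= s <= T ->
    {ae P, forall w, W s (c *: e + e') w = c * W s e w + W s e' w};
  ref_start : forall e, {ae P, forall w, W t e w = 0};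
  ref_continuous : forall e,
    {ae P, forall w, {within `[t, T], continuous (fun s => W s e w)}};
  (* increments are N(0, (s - r) |e|^2); [normal_prob] takes the standard
     deviation *)
  ref_gaussian : forall r s e (V : set R), t <= r -> r < s -> s <= T ->
    e != 0 -> measurable V ->
    P [set w | V (W s e w - W r e w)]
    = normal_prob 0 (Num.sqrt (s - r) * `|e|) V;
  ref_indep : forall r s e (C : set Om) (V : set R),
    t <= r -> r <= s -> s <= T ->
    wiener_filtration W t r C -> measurable V ->
    P (C `&` [set w | V (W s e w - W r e w)])
    = (P C * P [set w | V (W s e w - W r e w)%R])%E
}.

Definition progressive (Y : topologicalType) (F : R -> set (set Om)) (t T : R)
    (f : R -> Om -> Y) : Prop :=
  forall s, t <= s <= T -> forall U : set Y, open U ->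
    <<s `[t, s] `*` [set: Om],
        [set Q | exists (I : set R) (C : set Om),
           [/\ measurable I, I `<=` `[t, s], F s C & Q = I `*` C]] >>
      ((`[t, s] `*` [set: Om]) `&` [set z : R * Om | U (f z.1 z.2)]).

Context (H : hilbertType R).

(* The process
     sum_k 1_(]lo k, hi k]) 1_(ev k) <., xi k> h k
   with values in the operators of finite rank from Xi to H. *)
Record elem_process := ElemProcess {
  ep_size : nat;
  ep_lo : 'I_ep_size -> R;
  ep_hi : 'I_ep_size -> R;
  ep_ev : 'I_ep_size -> set Om;
  ep_xi : 'I_ep_size -> Xi;
  ep_h : 'I_ep_size -> H
}.

Definition ep_adapted (F : R -> set (set Om)) (t s : R) (Z : elem_process)
    : Prop :=
  forall k : 'I_(ep_size Z),
    [/\ t <= ep_lo k, ep_lo k <= ep_hi k, ep_hi k <= s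
      & F (ep_lo k) (ep_ev k)].

Definition ep_eval (Z : elem_process) (r : R) (w : Om) (e : Xi) : H :=
  \sum_(k < ep_size Z)
    ((\1_(`]ep_lo k, ep_hi k]) r : R) * (\1_(ep_ev k) w : R)
     * hdot e (ep_xi k)) *: ep_h k.

Definition ep_int (W : R -> Xi -> Om -> R) (Z : elem_process) (w : Om) : H :=
  \sum_(k < ep_size Z)
    ((\1_(ep_ev k) w : R)
     * (W (ep_hi k) (ep_xi k) w - W (ep_lo k) (ep_xi k) w)) *: ep_h k.

(* I is a version of the Ito integral of Phi over [t, s], i.e. the limit in
   probability of the integrals of elementary processes whose distance to Phi
   in L^2([t, s]; L_2(Xi, H)) tends to 0 in probability. *)
Definition is_ito_integral (E : onb Xi) (W : R -> Xi -> Om -> R) (t s : R)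
    (Phi : R -> Om -> Xi -> H) (I : Om -> H) : Prop :=
  [/\ forall e,
        progressive (wiener_filtration W t) t s (fun r w => Phi r w e),
      forall U : set H, open U -> measurable (I @^-1` U)
    & exists Z : nat -> elem_process,
      [/\ forall n, ep_adapted (wiener_filtration W t) t s (Z n),
          forall eps : R, 0 < eps ->
            P [set w | (eps%:E < \int[mu]_(r in `[t, s])
                 hs_sum E (@Num.norm R H)
                   (fun e => (Phi r w e - ep_eval (Z n) r w e)%R))%E]
              @[n --> \oo] --> 0%E
        & forall eps : R, 0 < eps ->
            P [set w | eps < `|I w - ep_int W (Z n) w|]
              @[n --> \oo] --> 0%E]].

Context (Lambda : normedModType R).

Definition admissible (Lambda0 : set Lambda) (p : R)
    (W : R -> Xi -> Om -> R) (t T : R) : set (R -> Om -> Lambda) :=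
  [set a | [/\ forall s w, t <= s <= T -> Lambda0 (a s w),
               progressive (wiener_filtration W t) t T a
             & (\int[P]_w \int[mu]_(s in `[t, T]) (`|a s w| `^ p)%:E
                 < +oo)%E]].

Definition is_mild_solution (E : onb Xi) (S : R -> {linear H -> H})
    (b : H -> Lambda -> H) (sigma : H -> Lambda -> hs E H)
    (W : R -> Xi -> Om -> R) (t T : R) (x : H) (a : R -> Om -> Lambda)
    (X : R -> Om -> H) : Prop :=
  [/\ progressive (wiener_filtration W t) t T X,
      forall w, {within `[t, T], continuous (fun s => X s w)}
    & forall s, t <= s <= T ->
      exists2 I : Om -> H,
        is_ito_integral E W t s
          (fun r w e => S (s - r) (sigma (X r w) (a r w) e)) I
        & {ae P, forall w, exists2 J : H,
            is_bochner_integral `[t, s]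
              (fun r => S (s - r) (b (X r w) (a r w))) J
            & X s w = S (s - t) x + J + I w}].

Definition cost (l : H -> Lambda -> R) (g : H -> R) (t T : R)
    (a : R -> Om -> Lambda) (X : R -> Om -> H) : \bar R :=
  (\int[P]_w (\int[mu]_(s in `[t, T]) (l (X s w) (a s w))%:E
              + (g (X T w))%:E))%E.

(* X x a is the state process started at x and driven by the control a. *)
Definition value_function (Lambda0 : set Lambda) (p : R)
    (l : H -> Lambda -> R) (g : H -> R) (W : R -> Xi -> Om -> R) (t T : R)
    (X : H -> (R -> Om -> Lambda) -> R -> Om -> H) (x : H) : \bar R :=
  ereal_inf [set cost l g t T a (X x a) | a in admissible Lambda0 p W t T].

End stochastic.

(* Main.v *)
(**
  Fix a control and let X0, X1, X2 be the states started at x0, x1 and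
  lam x0 + (1 - lam) x1.  The weak B-condition makes the semigroup
  quasi-contractive for the norm of H_{-1}.  Gronwall's lemma for the mild
  equation therefore bounds E |X0 - X1|_{-1}^4 by a multiple of
  |x0 - x1|_{-1}^4; no moment of the solutions is known beforehand, so that it is
  applied to the solution truncated at the exit time of an energy.  By Taylor's
  formula and (d), the coefficients of the equation of
  Z = lam X0 + (1 - lam) X1 - X2 are bounded by a multiple of
  |Z|_{-1} + lam (1 - lam) |X0 - X1|_{-1}^2, and the same argument bounds E |Z|_{-1}
  by a multiple of lam (1 - lam) |x0 - x1|_{-1}^2.  As l and g are semiconcave and
  Lipschitz, the cost of a fixed control is semiconcave in the initial state, with a
  constant independent of the control, and this survives the infimum.
*)
Require Import Defs.
From HB Require Import structures.
From mathcomp Require Import all_boot all_order all_algebra.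
From mathcomp Require Import all_classical all_reals all_analysis.
From mathcomp Require Import measurable_realfun.
From mathcomp Require Import ring lra.

Set Implicit Arguments.
Unset Strict Implicit.
Unset Printing Implicit Defensive.

Import Order.TTheory GRing.Theory Num.Theory.
Import numFieldNormedType.Exports.

Local Open Scope classical_set_scope.
Local Open Scope ring_scope.

(** A mild solution is in general no semimartingale, and with [S (s - r)] under the integral the
    stochastic convolution is no martingale in [s]. Each time [s] is therefore treated separately,
    without Ito's formula: for fixed [s] the stochastic term is one Ito integral, and its moments of
    order 2 and 4 are limits of those of discrete martingales. As the energy [q] of the coefficients
    is only known to be finite almost surely, two localized inequalities are combined: the
    expectation of [N I ^ (2 p)] on [q <= M] is bounded by that of [min (q, M) ^ p], by stopping
    elementary integrands; and the latter by the time integral of the coefficients over the times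
    [r] with [q r <= M]. This closes Gronwall's inequality with constants free of [M]. The discount
    chosen in the estimate makes the energy of every convolution at most a single integral up to
    time [s]. The fourth moment of [X0 - X1] is required because its square is a source in the
    equation of [Z], whose second moment is estimated. All constants are built from those of the
    hypotheses before the horizon and the control appear. *)

(** * Seminorms of nonnegative symmetric operators *)

(** Both [B] and [idfun] are instances. The second makes [norm_m1] the norm of [H], so one moment
    estimate serves for the states and, with [B], for their differences. *)
Record psd (R : realType) (H : hilbertType R) (B : {linear H -> H}) : Prop := {
  psd_cont : continuous B;
  psd_sym : forall x y, hdot (B x) y = hdot x (B y);
  psd_ge0 : forall x, 0 <= hdot (B x) x
}.

Section psd_theory.
Context (R : realType) (H : hilbertType R) (B : {linear H -> H}).
Hypothesis hB : psd B.

Definition psd_form (x y : H) : R := hdot (B x) y.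
Local Notation g := psd_form.
Local Notation N := (norm_m1 B).

Lemma formC x y : g x y = g y x.
Proof. by rewrite /g (psd_sym hB) hdotC. Qed.

Lemma formDl x y z : g (x + y) z = g x z + g y z.
Proof. by rewrite /g linearD hdotDl. Qed.

Lemma formZl c x z : g (c *: x) z = c * g x z.
Proof. by rewrite /g linearZ hdotZl. Qed.

Lemma formDr x y z : g z (x + y) = g z x + g z y.
Proof. by rewrite formC formDl !(formC z). Qed.

Lemma formZr c x z : g z (c *: x) = c * g z x.
Proof. by rewrite formC formZl (formC z). Qed.

Lemma formNl x z : g (- x) z = - g x z.
Proof. by rewrite -scaleN1r formZl mulN1r. Qed.

Lemma formNr x z : g z (- x) = - g z x.
Proof. by rewrite -scaleN1r formZr mulN1r. Qed.

Lemma form0l z : g 0 z = 0.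
Proof. by rewrite -(scale0r (0 : H)) formZl mul0r. Qed.

Lemma form0r z : g z 0 = 0.
Proof. by rewrite formC form0l. Qed.

Lemma form_sumr (I : Type) (s : seq I) (F : I -> H) z :
  g z (\sum_(i <- s) F i) = \sum_(i <- s) g z (F i).
Proof.
elim: s => [|i s ih]; first by rewrite !big_nil form0r.
by rewrite !big_cons formDr ih.
Qed.

Lemma formxx_ge0 x : 0 <= g x x. Proof. exact: psd_ge0. Qed.

Lemma norm_m1_ge0 x : 0 <= N x. Proof. exact: sqrtr_ge0. Qed.

Lemma norm_m1_sqr x : N x ^+ 2 = g x x.
Proof. by rewrite /norm_m1 sqr_sqrtr// formxx_ge0. Qed.

Lemma form_cs x y : `|g x y| <= N x * N y.
Proof.
have key (u v : H) : g u v <= N u * N v.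
  (* The form may be degenerate: instead of dividing by seminorms, nonnegativity is used at
     [(N v + e) *: u - (N u + e) *: v], and [e] tends to 0 afterwards. *)
  have e0 (e : R) : 0 < e -> g u v <= (N u + e) * (N v + e).
    move=> e0; have a0 : 0 < N u + e by rewrite ltr_wpDl// norm_m1_ge0.
    have b0 : 0 < N v + e by rewrite ltr_wpDl// norm_m1_ge0.
    have : 0 <= g ((N v + e) *: u - (N u + e) *: v)
                  ((N v + e) *: u - (N u + e) *: v) by exact: formxx_ge0.
    rewrite !(formDl, formDr, formNl, formNr, formZl, formZr) -!norm_m1_sqr.
    rewrite (formC v u) => h.
    have h2 : 2 * ((N v + e) * (N u + e)) * g u v <=
      (N v + e) ^+ 2 * N u ^+ 2 + (N u + e) ^+ 2 * N v ^+ 2 by nra.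
    have h3 : (N v + e) ^+ 2 * N u ^+ 2 <= (N v + e) ^+ 2 * (N u + e) ^+ 2.
      rewrite ler_wpM2l ?sqr_ge0// lerXn2r ?nnegrE ?norm_m1_ge0 ?ltW//.
      by rewrite ltrDl.
    have h4 : (N u + e) ^+ 2 * N v ^+ 2 <= (N u + e) ^+ 2 * (N v + e) ^+ 2.
      rewrite ler_wpM2l ?sqr_ge0// lerXn2r ?nnegrE ?norm_m1_ge0 ?ltW//.
      by rewrite ltrDl.
    have ab : 0 < (N v + e) * (N u + e) by rewrite mulr_gt0.
    rewrite -(ler_pM2l ab); nra.
  have nu := norm_m1_ge0 u; have nv := norm_m1_ge0 v.
  apply/ler_addgt0Pr => e e1.
  (* Since [d <= 1], the excess [d * (N u + N v + d)] is at most [e]. *)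
  pose d := Num.min 1 (e / (N u + N v + 1)).
  have s0 : 0 < N u + N v + 1 by rewrite ltr_wpDl// addr_ge0.
  have d0 : 0 < d by rewrite lt_min ltr01 divr_gt0.
  have d1 : d <= 1 by rewrite ge_min lexx.
  have d2 : d * (N u + N v + 1) <= e.
    by rewrite -ler_pdivlMr// ge_min lexx orbT.
  apply: (le_trans (e0 _ d0)); nra.
rewrite ler_norml key andbT lerNl -formNl (le_trans (key _ _))//.
by rewrite ler_wpM2r ?norm_m1_ge0// /norm_m1 -/(g _ _) formNl formNr opprK.
Qed.

Lemma norm_m1Z c x : N (c *: x) = `|c| * N x.
Proof.
by rewrite /norm_m1 -!/(g _ _) formZl formZr mulrA -expr2 sqrtrM ?sqr_ge0//
  sqrtr_sqr.
Qed.

Lemma norm_m1N x : N (- x) = N x.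
Proof. by rewrite -scaleN1r norm_m1Z normrN normr1 mul1r. Qed.

Lemma norm_m1_0 : N 0 = 0.
Proof. by rewrite /norm_m1 -/(g _ _) form0l sqrtr0. Qed.

Lemma norm_m1D x y : N (x + y) <= N x + N y.
Proof.
rewrite -(@ler_pXn2r _ 2) ?nnegrE ?addr_ge0 ?norm_m1_ge0//.
rewrite norm_m1_sqr !(formDl, formDr) -!norm_m1_sqr (formC y x).
have := le_trans (ler_norm _) (form_cs x y); nra.
Qed.

Lemma norm_m1_sum (I : Type) (s : seq I) (F : I -> H) :
  N (\sum_(i <- s) F i) <= \sum_(i <- s) N (F i).
Proof.
elim: s => [|i s ih]; first by rewrite !big_nil norm_m1_0.
by rewrite !big_cons (le_trans (norm_m1D _ _))// lerD2l.
Qed.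

Lemma ler_norm_m1B x y : N x - N y <= N (x - y).
Proof. by rewrite lerBlDr -{1}(subrK y x) norm_m1D. Qed.

Lemma norm_m1_subC x y : N (x - y) = N (y - x).
Proof. by rewrite -norm_m1N opprB. Qed.

Lemma ler_dist_norm_m1 x y : `|N x - N y| <= N (x - y).
Proof.
by rewrite ler_norml ler_norm_m1B andbT lerNl opprB norm_m1_subC ler_norm_m1B.
Qed.

End psd_theory.

(** * Hilbert space geometry and orthonormalization for a degenerate form *)

Section hilbert.
Context (R : realType) (H : hilbertType R).

Lemma psd_id : psd (idfun : {linear H -> H}).
Proof. by split => [x| |x]; rewrite /= ?hdotxx ?sqr_ge0//; exact: cvg_id. Qed.

Lemma norm_m1_id (x : H) : norm_m1 (idfun : {linear H -> H}) x = `|x|.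
Proof. by rewrite /norm_m1 /= hdotxx sqrtr_sqr normr_id. Qed.

Lemma hdot_cs (x y : H) : `|hdot x y| <= `|x| * `|y|.
Proof. by have := form_cs psd_id x y; rewrite !norm_m1_id. Qed.

Lemma hdotDr (x y z : H) : hdot z (x + y) = hdot z x + hdot z y.
Proof. exact: (formDr psd_id). Qed.

Lemma hdotZr c (x z : H) : hdot z (c *: x) = c * hdot z x.
Proof. exact: (formZr psd_id). Qed.

Lemma hdotNr (x z : H) : hdot z (- x) = - hdot z x.
Proof. exact: (formNr psd_id). Qed.

Lemma hdotNl (x z : H) : hdot (- x) z = - hdot x z.
Proof. exact: (formNl (idfun : {linear H -> H})). Qed.

Lemma hdot0r (z : H) : hdot z 0 = 0.
Proof. exact: (form0r psd_id). Qed.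

Lemma hdot_sumr (I : Type) (s : seq I) (F : I -> H) z :
  hdot z (\sum_(i <- s) F i) = \sum_(i <- s) hdot z (F i).
Proof. exact: (form_sumr psd_id). Qed.

Lemma linear_bound (V : normedModType R) (L : {linear H -> V}) :
  continuous L -> exists2 k : R, 0 < k & forall x, `|L x| <= k * `|x|.
Proof.
move=> cL; have /linear_boundedP[r [_ hr]] : bounded_near L (nbhs (0 : H)).
  by apply/linear_bounded_continuous.
exists (`|r| + 1) => [|x]; first by rewrite ltr_wpDl.
by apply: hr; rewrite (le_lt_trans (ler_norm _))// ltrDl.
Qed.

Lemma norm_m1_bound (B : {linear H -> H}) : psd B ->
  exists2 k : R, 0 < k & forall x, norm_m1 B x <= k * `|x|.
Proof.
move=> hB; have [k k0 hk] := linear_bound (psd_cont hB).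
exists (k + 1) => [|x]; first by rewrite addr_gt0.
rewrite -(@ler_pXn2r _ 2) ?nnegrE ?norm_m1_ge0 ?mulr_ge0 ?addr_ge0 ?(ltW k0)//.
rewrite norm_m1_sqr//.
apply: (le_trans (le_trans (ler_norm _) (hdot_cs _ _))).
apply: (le_trans (ler_wpM2r _ (hk x))) => //.
have := normr_ge0 x; nra.
Qed.

Lemma norm_m1_continuous (B : {linear H -> H}) : psd B ->
  continuous (norm_m1 B : H -> R).
Proof.
move=> hB x; have [k k0 hk] := norm_m1_bound hB.
apply/cvgrPdist_le => e e0; near=> y.
rewrite (le_trans (ler_dist_norm_m1 hB _ _))// (le_trans (hk _))//.
rewrite -ler_pdivlMl// mulrC.
by near: y; apply: cvgr_dist_le; [exact: cvg_id|rewrite divr_gt0].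
Unshelve. all: by end_near. Qed.

Lemma form_continuous (B : {linear H -> H}) : psd B -> forall u,
  continuous (psd_form B u : H -> R).
Proof.
move=> hB u x; have [k k0 hk] := norm_m1_bound hB.
apply/cvgrPdist_le => e e0; near=> y.
rewrite -formNr// -formDr// (le_trans (form_cs hB _ _))//.
have nu := norm_m1_ge0 B u.
apply: (@le_trans _ _ ((norm_m1 B u + 1) * (k * `|x - y|))).
  by rewrite ler_pM ?norm_m1_ge0// lerDl.
rewrite mulrA -ler_pdivlMl ?mulr_gt0 ?ltr_wpDl// mulrC.
near: y; apply: cvgr_dist_le; first exact: cvg_id.
by rewrite divr_gt0// mulr_gt0// ltr_wpDl// norm_m1_ge0.
Unshelve. all: by end_near. Qed.

(* Gram-Schmidt for the possibly degenerate form: vectors of zero seminorm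
   are dropped. *)
Lemma gram_schmidt (B : {linear H -> H}) n (h : 'I_n -> H) : psd B ->
  exists u : seq H, forall c : 'I_n -> R,
    norm_m1 B (\sum_(k < n) c k *: h k) ^+ 2
    = \sum_(v <- u) psd_form B v (\sum_(k < n) c k *: h k) ^+ 2.
Proof.
move=> hB; pose N := norm_m1 B; pose g := psd_form B.
pose pr u x := \sum_(v <- u) g v x *: v.
have prD u x y : pr u (x + y) = pr u x + pr u y.
  rewrite /pr -big_split/=; apply: eq_bigr => v _.
  by rewrite /g formDr// scalerDl.
have prZ u c x : pr u (c *: x) = c *: pr u x.
  rewrite /pr scaler_sumr; apply: eq_bigr => v _.
  by rewrite /g formZr// scalerA.
have prB u x y : pr u (x - y) = pr u x - pr u y.
  by rewrite prD -scaleN1r prZ scaleN1r.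
have null x y : N x = 0 -> g y x = 0.
  move=> x0; apply/eqP; rewrite -normr_le0 (le_trans (form_cs hB _ _))//.
  by rewrite -/(N x) x0 mulr0.
(* Every combination of the [h k] then differs from its projection [pr u] by a vector of zero
   seminorm, and such vectors are orthogonal to everything by Cauchy-Schwarz. *)
suff [u [orth hu]] : exists u : seq H,
    (forall x, forall v, v \in u -> g v (pr u x) = g v x) /\
    forall k, N (h k - pr u (h k)) = 0.
  exists u => c; set x := \sum_(k < n) _.
  have xn : N (x - pr u x) = 0.
    apply/eqP; rewrite eq_le norm_m1_ge0 andbT.
    have -> : x - pr u x = \sum_(k < n) c k *: (h k - pr u (h k)).
      have -> : pr u x = \sum_(k < n) c k *: pr u (h k).
        rewrite /x; elim/big_rec2: _ => [|k y1 y2 _ <-].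
          by rewrite -[X in pr u X](scale0r (0 : H)) prZ scale0r.
        by rewrite prD prZ.
      by rewrite -sumrB; apply: eq_bigr => k _; rewrite scalerBr.
    rewrite (le_trans (norm_m1_sum hB _ _))// big1// => k _.
    by rewrite norm_m1Z// -/(N _) hu mulr0.
  rewrite norm_m1_sqr//.
  have -> : psd_form B x x = g x (pr u x).
    have : g x (x - pr u x) = 0 by exact: null.
    by rewrite /g formDr// formNr// => /eqP; rewrite subr_eq0 => /eqP.
  rewrite /pr /g form_sumr//; apply: eq_bigr => v _.
  by rewrite formZr// (formC hB x) expr2.
elim: n h => [h|n ih h]; first by exists [::]; split => // -[].
have [u [orth hu]] := ih (fun k => h (lift ord_max k)).
pose r := h ord_max - pr u (h ord_max).
have hmax k : k = ord_max \/ exists k', k = lift ord_max k'.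
  by case: (unliftP ord_max k) => [j ->|->]; [right; exists j|left].
have [r0|r0] := eqVneq (N r) 0.
  by exists u; split=> // k; have [->//|[k' ->]] := hmax _ k.
have Nr : 0 < N r by rewrite lt_neqAle eq_sym r0 norm_m1_ge0.
pose w := (N r)^-1 *: r.
have ww : g w w = 1.
  rewrite /g -norm_m1_sqr// norm_m1Z// ger0_norm ?invr_ge0 ?norm_m1_ge0//.
  by rewrite mulVf// expr1n.
have uw v : v \in u -> g v w = 0.
  move=> vu; rewrite /w /g formZr// /r formDr// formNr// -/g orth//.
  by rewrite subrr mulr0.
have prw x : pr (w :: u) x = g w x *: w + pr u x by rewrite /pr big_cons.
exists (w :: u); split.
  move=> x v; rewrite prw inE => /predU1P[->|vu].
    rewrite /g formDr// formZr// -/g ww mulr1 /pr /g form_sumr//.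
    rewrite big_seq big1 ?addr0// => v' v'u; rewrite formZr// (formC hB w).
    by rewrite -/g uw// mulr0.
  by rewrite /g formDr// formZr// -/g uw// mulr0 add0r orth.
move=> k; rewrite prw; have {}hmax := hmax n k.
have gwpr x : g w (pr u x) = 0.
  rewrite /pr /g form_sumr// big_seq big1// => v' v'u.
  by rewrite formZr// (formC hB w) -/g uw// mulr0.
have [->|[k' ->]] := hmax.
  have -> : g w (h ord_max) = N r.
    have -> : h ord_max = r + pr u (h ord_max) by rewrite /r subrK.
    rewrite /g formDr// -/g gwpr addr0 /w /g formZl// -norm_m1_sqr//.
    by rewrite expr2 mulrA mulVf// mul1r.
  rewrite /w scalerA mulfV// scale1r opprD addrCA addrC -/r.
  by rewrite -[X in X - r]/r subrr /N norm_m1_0.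
have -> : g w (h (lift ord_max k')) = 0.
  have -> : h (lift ord_max k') = (h (lift ord_max k') -
    pr u (h (lift ord_max k'))) + pr u (h (lift ord_max k')) by rewrite subrK.
  by rewrite /g formDr// -/g gwpr addr0 null.
by rewrite scale0r add0r hu.
Qed.

End hilbert.

(** * Orthonormal bases and Hilbert-Schmidt sums *)

Section onb_theory.
Context (R : realType) (Xi : hilbertType R) (E : onb Xi).

(** This bound, opposite to Bessel's, rests on totality: the projection [p] onto finitely many basis
    vectors is at least as close to [eta] as any of their combinations, and such combinations are
    dense. *)
Lemma parseval_le (eta : Xi) :
  ((`|eta| ^+ 2)%:E <= \esum_(e in E) (hdot e eta ^+ 2)%:E)%E.
Proof.
apply/lee_addgt0Pr => eps eps0.
pose d := Num.sqrt eps.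
have d0 : 0 < d by rewrite sqrtr_gt0.
have [y [yb [n [c [e [Ee yE]]]]]] : ball eta d `&` lin_span E !=set0.
  by apply: (@onb_total _ _ E); [exists eta; exact: ballxx|exact: ball_open].
pose s := undup (codom e).
have sE v : v \in s -> onb_set E v by rewrite mem_undup => /codomP[k ->].
have us : uniq s by exact: undup_uniq.
pose p := \sum_(v <- s) hdot v eta *: v.
have zs v : v \in s -> hdot v (eta - p) = 0.
  move=> vs; rewrite hdotDr hdotNr /p hdot_sumr (bigD1_seq v)//=.
  rewrite hdotZr (onb_orthonormal (sE _ vs) (sE _ vs)) eqxx mulr1.
  rewrite big_seq_cond big1 ?addr0 ?subrr// => v' /andP[v's vv'].
  rewrite hdotZr (onb_orthonormal (sE _ vs) (sE _ v's)) eq_sym.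
  by rewrite (negbTE vv') mulr0.
have zy : hdot (eta - p) y = 0.
  rewrite yE hdot_sumr big1// => k _; rewrite hdotZr (hdotC _ (e k)) zs ?mulr0//.
  by rewrite mem_undup codom_f.
have zp : hdot (eta - p) p = 0.
  rewrite {2}/p hdot_sumr big_seq big1// => v vs.
  by rewrite hdotZr (hdotC _ v) zs ?mulr0.
have zz : `|eta - p| <= `|eta - y|.
  have [->//|z0] := eqVneq `|eta - p| 0.
  have z1 : 0 < `|eta - p| by rewrite lt_neqAle eq_sym z0 normr_ge0.
  rewrite -(ler_pM2l z1) -expr2 -hdotxx {2}[eta - p]addrC hdotDr hdotNr zp.
  rewrite oppr0 add0r (_ : hdot _ _ = hdot (eta - p) (eta - y)).
    exact: le_trans (ler_norm _) (hdot_cs _ _).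
  by rewrite hdotDr hdotNr zy oppr0 addr0.
have e1 : `|eta - p| ^+ 2 <= eps.
  rewrite -[leRHS]sqr_sqrtr ?(ltW eps0)// lerXn2r ?nnegrE ?sqrtr_ge0//.
  by rewrite (le_trans zz)// ltW//; have := yb; rewrite -ball_normE.
have -> : `|eta| ^+ 2 = \sum_(v <- s) hdot v eta ^+ 2 + `|eta - p| ^+ 2.
  have <- : hdot p eta = \sum_(v <- s) hdot v eta ^+ 2.
    rewrite hdotC {1}/p hdot_sumr; apply: eq_bigr => v _.
    by rewrite hdotZr (hdotC eta) expr2.
  rewrite -!hdotxx [in hdot (eta - p) _]hdotDr hdotNr zp oppr0 addr0.
  by rewrite hdotDl hdotNl addrCA subrr addr0.
rewrite EFinD leeD// ?lee_fin//.
apply: esum_ge; exists [set` s]; first by split=> [|v /sE//]; exact: finite_seq.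
by rewrite -fsbig_seq// -sumEFin.
Qed.

(** Distinct elements of an orthonormal set are at distance [sqrt 2], so choosing for each a point
    of the countable dense set within [1/2] is injective. Countability makes Hilbert-Schmidt sums
    measurable functions of time and chance. *)
Lemma onb_countable : separable Xi -> countable E.
Proof.
move=> [D cD dD].
have ex (e : Xi) : exists d, D d /\ `|e - d| < 1/2.
  have [d [eb Dd]] : ball e (1/2 : R) `&` D !=set0.
    by apply: dD; [exists e; apply: ballxx; lra|exact: ball_open].
  by exists d; split=> //; move: eb; rewrite -ball_normE.
have [f hf] := choice ex.
have fE : set_inj E f.
  move=> e e' /set_mem Ee /set_mem Ee' ff; apply/eqP/negPn/negP => ee'.
  have h1 : `|e - e'| < 1.
    have -> : e - e' = (e - f e) - (e' - f e') by rewrite ff opprB addrA subrK.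
    by rewrite (le_lt_trans (ler_normB _ _))//; have := (hf e).2; have := (hf e').2; lra.
  have h2 : `|e - e'| ^+ 2 = 2.
    rewrite -hdotxx hdotDr hdotNr (hdotC _ e) (hdotC _ e') !hdotDr !hdotNr.
    rewrite (onb_orthonormal Ee Ee) (onb_orthonormal Ee' Ee').
    rewrite (onb_orthonormal Ee Ee') (onb_orthonormal Ee' Ee) !eqxx.
    by rewrite (eq_sym e' e) (negbTE ee')/=; lra.
  have := normr_ge0 (e - e'); nra.
have : countable (f @` E) by apply: sub_countable cD; apply: subset_card_le => _ [e _ <-]; exact: (hf e).1.
by rewrite (eq_countable (inj_card_eq fE)).
Qed.

Lemma hs_sum_le2 (V1 V2 V3 : Type) (N1 : V1 -> R) (N2 : V2 -> R) (N3 : V3 -> R)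
    (a b : R) f1 f2 f3 : 0 <= a -> 0 <= b ->
  (forall e, onb_set E e ->
     N1 (f1 e) ^+ 2 <= a * N2 (f2 e) ^+ 2 + b * N3 (f3 e) ^+ 2) ->
  (hs_sum E N1 f1 <= a%:E * hs_sum E N2 f2 + b%:E * hs_sum E N3 f3)%E.
Proof.
move=> a0 b0 h; apply: ge_ereal_sup => _ [X [finX XE]] <-.
apply: (@le_trans _ _ (a%:E * \sum_(i \in X) (N2 (f2 i) ^+ 2)%:E
   + b%:E * \sum_(i \in X) (N3 (f3 i) ^+ 2)%:E)%E).
  rewrite !fsbig_finite//= !sumEFin -!EFinM -EFinD lee_fin !mulr_sumr.
  rewrite -big_split/= !big_seq; apply: ler_sum => e.
  by rewrite in_fset_set// => /set_mem/XE; exact: h.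
by apply: leeD; apply: lee_wpmul2l => //; rewrite ?lee_fin//;
  apply: esum_ge; exists X => //; exact: lexx.
Qed.

Lemma hs_sum_le1 (V1 V2 : Type) (N1 : V1 -> R) (N2 : V2 -> R)
    (a : R) f1 f2 : 0 <= a ->
  (forall e, onb_set E e -> N1 (f1 e) ^+ 2 <= a * N2 (f2 e) ^+ 2) ->
  (hs_sum E N1 f1 <= a%:E * hs_sum E N2 f2)%E.
Proof.
move=> a0 h.
have := @hs_sum_le2 V1 V2 V2 N1 N2 N2 a 0 f1 f2 f2 a0 (lexx _).
rewrite mul0e adde0; apply => e Ee.
by rewrite mul0r addr0 h.
Qed.

Lemma hs_sum_nneg (V : Type) (N : V -> R) f : (0 <= hs_sum E N f)%E.
Proof. by apply: esum_ge0 => e _; rewrite lee_fin sqr_ge0. Qed.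

End onb_theory.

(** * Integrals by truncation, and Gaussian moments *)

Section truncation.
Context (R : realType) (d : measure_display) (Om : measurableType d).
Context (mu : {measure set Om -> \bar R}).

(** A bound uniform in the truncation level passes to [f] by monotone convergence, so that it
    suffices to treat bounded functions. *)
Lemma integral_trunc_le (D : set Om) (f : Om -> R) (C : \bar R) : measurable D ->
  measurable_fun D f -> (forall w, 0 <= f w) ->
  (forall n : nat, (\int[mu]_(w in D) (Num.min (f w) n%:R)%:E <= C)%E) ->
  (\int[mu]_(w in D) (f w)%:E <= C)%E.
Proof.
move=> mD mf f0 h.
have cvgf w : (Num.min (f w) n%:R)%:E @[n --> \oo] --> (f w)%:E.
  apply: cvg_near_cst; near=> n; congr EFin; apply/min_idPl.
  by near: n; exact: nbhs_infty_ger.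
have -> : (\int[mu]_(w in D) (f w)%:E = \int[mu]_(w in D)
    lim ((Num.min (f w) n%:R)%:E @[n --> \oo]))%E.
  by apply: eq_integral => w _; apply/esym/cvg_lim => //; exact: cvgf.
rewrite monotone_convergence//.
- apply: lime_le; first apply: ereal_nondecreasing_is_cvgn.
    move=> m n mn; apply: ge0_le_integral => //.
    + by move=> w _; rewrite lee_fin le_min f0 ler0n.
    + by apply/measurable_EFinP/measurable_minr => //; exact: measurable_cst.
    + by apply/measurable_EFinP/measurable_minr => //; exact: measurable_cst.
    + move=> w _; rewrite lee_fin le_min !ge_min lexx/=.
      by rewrite ler_nat mn !orbT.
  by apply: nearW => n; exact: h.
- by move=> n; apply/measurable_EFinP/measurable_minr => //; exact: measurable_cst.
- by move=> n w _; rewrite lee_fin le_min f0 ler0n.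
- move=> w _ m n mn; rewrite lee_fin le_min !ge_min lexx/=.
  by rewrite ler_nat mn !orbT.
Unshelve. all: by end_near. Qed.

End truncation.

Section normal_moments.
Context (R : realType).
Local Notation mu := (@lebesgue_measure R).

(** The density enters through the Radon-Nikodym derivative, which asks for an integrable integrand;
    hence the truncation at [n]. *)
Lemma integral_normal_prob_le (s : R) (f : R -> R) (C : \bar R) : measurable_fun setT f ->
  (forall x, 0 <= f x) ->
  (\int[mu]_x (f x * normal_pdf 0 s x)%:E <= C)%E ->
  (\int[normal_prob 0 s]_x (f x)%:E <= C)%E.
Proof.
move=> mf f0 fC; apply: integral_trunc_le => // n.
have mfn : measurable_fun setT (fun x => Num.min (f x) n%:R).
  by apply: measurable_minr => //; exact: measurable_cst.
have fn0 x : 0 <= Num.min (f x) n%:R by rewrite le_min f0 ler0n.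
apply: le_trans fC.
have dom := normal_prob_dominates (0 : R) s.
rewrite -(Radon_Nikodym_change_of_variables dom)//=; last first.
  apply: measurable_bounded_integrable => //.
    by rewrite (le_lt_trans (probability_le1 _ _))// ltry.
  exists n%:R; split; first exact: num_real.
  move=> y ny x _; rewrite /= ger0_norm// (le_trans _ (ltW ny))//.
  by rewrite ge_min lexx orbT.
rewrite (_ : integral _ _ _ =
  \int[mu]_x ((Num.min (f x) n%:R)%:E * (normal_pdf 0 s x)%:E))%E; last first.
  apply: ae_eq_integral => //.
  - apply: emeasurable_funM; first exact/measurable_EFinP.
    apply: (measurable_int mu).
    exact: Radon_Nikodym_integrable.
  - apply: emeasurable_funM; first exact/measurable_EFinP.
    by apply/measurable_EFinP; exact: measurable_normal_pdf.
  - apply: ae_eqe_mul2l => /=.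
    rewrite Radon_NikodymE/=.
    case: cid => /= h [h1 h2 h3].
    apply: integral_ae_eq => //=.
    + by apply/measurable_EFinP; exact: measurable_normal_pdf.
    + by move=> A _ mA; rewrite -h3.
apply: ge0_le_integral => //=.
- by move=> x _; rewrite mule_ge0// lee_fin// normal_pdf_ge0.
- apply: emeasurable_funM; first exact/measurable_EFinP.
  by apply/measurable_EFinP; exact: measurable_normal_pdf.
- apply/measurable_EFinP; apply: measurable_funM => //.
  exact: measurable_normal_pdf.
- move=> x _; rewrite -EFinM lee_fin ler_wpM2r ?normal_pdf_ge0//.
  by rewrite ge_min lexx.
Qed.

Lemma exprn_le_expR (x : R) n : 0 <= x -> x ^+ n <= n`!%:R * expR x.
Proof.
case: n => [|n] x0.
  by rewrite expr0 fact0 mul1r -expR0 ler_expR.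
rewrite mulrC -ler_pdivrMr ?ltr0n ?fact_gt0//.
by apply: le_trans (expR_ge1Dxn n x0); rewrite lerDr.
Qed.

(** Half of the Gaussian exponent absorbs the power. With [y = x ^ 2 / (4 s ^ 2)], the density of
    variance [s ^ 2] is [sqrt 2 * exp (- y)] times that of variance [2 s ^ 2], and
    [y ^ n * exp (- y) <= n!]; the constant follows from [sqrt 2 <= 2]. *)
Lemma normal_moment (s : R) n : 0 < s ->
  (\int[normal_prob 0 s]_x ((x ^+ 2) ^+ n)%:E
   <= (2 * n`!%:R * (4 * s ^+ 2) ^+ n)%:E)%E.
Proof.
move=> s0; apply: integral_normal_prob_le.
- by do 2 apply: measurable_funX.
- by move=> x; rewrite exprn_ge0// sqr_ge0.
pose s' := Num.sqrt 2 * s.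
have r2 : 0 < Num.sqrt 2 :> R by rewrite sqrtr_gt0.
have s'0 : 0 < s' by rewrite mulr_gt0.
have s'2 : s' ^+ 2 = 2 * s ^+ 2 by rewrite exprMn sqr_sqrtr.
pose c := 2 * n`!%:R * (4 * s ^+ 2) ^+ n.
have c0 : 0 <= c by rewrite !mulr_ge0// exprn_ge0// mulr_ge0// sqr_ge0.
apply: (@le_trans _ _ (\int[mu]_x (c%:E * (normal_pdf 0 s' x)%:E))%E); last first.
  rewrite ge0_integralZl ?integral_normal_pdf ?mule1//.
  - by apply/measurable_EFinP; exact: measurable_normal_pdf.
  - by move=> x _; rewrite lee_fin normal_pdf_ge0.
apply: ge0_le_integral => //.
- move=> x _; rewrite lee_fin; apply: mulr_ge0; last exact: normal_pdf_ge0.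
  by apply: exprn_ge0; exact: sqr_ge0.
- apply/measurable_EFinP; apply: measurable_funM; last exact: measurable_normal_pdf.
  by do 2 apply: measurable_funX.
- apply/measurable_EFinP; apply: measurable_funM => //.
  exact: measurable_normal_pdf.
suff H (z : R) : z ^+ 2 ^+ n * normal_pdf 0 s z <= c * normal_pdf 0 s' z.
  by move=> x _; rewrite -EFinM lee_fin; exact: H.
rename z into x; rewrite !normal_pdfE ?gt_eqF// /normal_peak.
have pk : Num.sqrt (s ^+ 2 * pi *+ 2) = (Num.sqrt 2)^-1 * Num.sqrt (s' ^+ 2 * pi *+ 2) :> R.
  rewrite s'2 -(mulrA 2) -(@mulrnAr _ 2%R) [X in _ = _ * X]sqrtrM//.
  by rewrite mulrA mulVf ?gt_eqF// mul1r.
rewrite pk invfM invrK.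
set q := (Num.sqrt _)^-1.
have q0 : 0 <= q by rewrite invr_ge0 sqrtr_ge0.
rewrite /normal_fun subr0 s'2.
set y := x ^+ 2 / (4 * s ^+ 2).
have sn0 : s != 0 by rewrite gt_eqF.
have -> : - (x ^+ 2) / (s ^+ 2 *+ 2) = - y + - y.
  by rewrite /y -mulr_natr; field.
have -> : - (x ^+ 2) / (2 * s ^+ 2 *+ 2) = - y.
  by rewrite /y -mulr_natr; field.
have -> : x ^+ 2 = 4 * s ^+ 2 * y by rewrite /y; field.
rewrite exprMn expRD.
have y0 : 0 <= y by rewrite /y divr_ge0 ?sqr_ge0// mulr_ge0// sqr_ge0.
have h1 := exprn_le_expR n y0.
have h2 : y ^+ n * expR (- y) <= n`!%:R.
  by rewrite expRN ler_pdivrMr ?expR_gt0.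
set A := (4 * s ^+ 2) ^+ n.
have A0 : 0 <= A by rewrite exprn_ge0// mulr_ge0// sqr_ge0.
have r22 : Num.sqrt 2 <= 2 :> R.
  rewrite -(@ler_pXn2r _ 2) ?nnegrE ?sqrtr_ge0//.
  by rewrite sqr_sqrtr// expr2; lra.
have -> : A * y ^+ n * (Num.sqrt 2 * q * (expR (- y) * expR (- y))) =
  (y ^+ n * expR (- y)) * (A * Num.sqrt 2 * q * expR (- y)) by ring.
have -> : c * (q * expR (- y)) = n`!%:R * (A * 2 * q * expR (- y)).
  by rewrite /c -/A; ring.
apply: ler_pM => //.
- by rewrite mulr_ge0 ?exprn_ge0// expR_ge0.
- by rewrite !mulr_ge0 ?expR_ge0// sqrtr_ge0.
- by rewrite ler_wpM2r ?expR_ge0// ler_wpM2r// ler_wpM2l.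
Qed.

End normal_moments.

(** * Random variables with moments of all orders *)

Section all_moments.
Context (R : realType) (d : measure_display) (Om : measurableType d).
Context (P : probability Om R).
Implicit Types (f g : Om -> R) (A : set Om).

Lemma int_probability_cst c : (\int[P]_w c%:E = c%:E)%E.
Proof. by have := expectation_cst P c; rewrite unlock. Qed.

(** Contains the indicators and the Wiener increments and is closed under sums and products, so that
    polynomials in these can be expanded under the expectation with no further integrability
    argument. *)
Definition all_moments f := measurable_fun setT f /\
  forall n, (\int[P]_w (`|f w| ^+ n)%:E < +oo)%E.

Definition Ex f : R := fine (\int[P]_w (f w)%:E).

Lemma am_meas f : all_moments f -> measurable_fun setT f. Proof. by case. Qed.

Lemma am_bounded f (c : R) : measurable_fun setT f -> (forall w, `|f w| <= c) ->
  all_moments f.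
Proof.
move=> mf fc; split=> // n.
apply: (@le_lt_trans _ _ (\int[P]_w (cst (c ^+ n)%:E w))%E).
  apply: ge0_le_integral => //.
  - apply/measurable_EFinP; apply: measurable_funX.
    exact: measurableT_comp.
  - by move=> w _; rewrite lee_fin lerXn2r// nnegrE (le_trans _ (fc w)).
by rewrite int_probability_cst ltry.
Qed.

Lemma am_cst c : all_moments (cst c).
Proof. by apply: (@am_bounded _ `|c|). Qed.

Lemma am_indic A : measurable A -> all_moments (\1_A).
Proof.
move=> mA; apply: (@am_bounded _ 1); first exact: measurable_indic.
by move=> w; rewrite indicE; case: (_ \in _); rewrite ?normr1 ?normr0.
Qed.

Lemma am_mul f g : all_moments f -> all_moments g ->
  all_moments (fun w => f w * g w).
Proof.
move=> [mf hf] [mg hg]; split=> [|n]; first exact: measurable_funM.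
apply: (@le_lt_trans _ _ (\int[P]_w ((`|f w| ^+ (n + n))%:E
    + (`|g w| ^+ (n + n))%:E))%E).
  apply: ge0_le_integral => //.
  - apply/measurable_EFinP; apply: measurable_funX.
    by apply: measurableT_comp => //; exact: measurable_funM.
  - apply: emeasurable_funD; apply/measurable_EFinP; apply: measurable_funX;
    exact: measurableT_comp.
  - move=> w _; rewrite -EFinD lee_fin normrM exprMn !exprD.
    have := exprn_ge0 n (normr_ge0 (f w)); have := exprn_ge0 n (normr_ge0 (g w)).
    nra.
rewrite ge0_integralD//; first exact: lte_add_pinfty (hf _) (hg _).
- by apply/measurable_EFinP; apply: measurable_funX; exact: measurableT_comp.
- by apply/measurable_EFinP; apply: measurable_funX; exact: measurableT_comp.
Qed.

Lemma am_add f g : all_moments f -> all_moments g ->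
  all_moments (fun w => f w + g w).
Proof.
move=> [mf hf] [mg hg]; split=> [|n]; first exact: measurable_funD.
apply: (@le_lt_trans _ _ (\int[P]_w (((2 ^+ n)%:E * (`|f w| ^+ n)%:E)
    + ((2 ^+ n)%:E * (`|g w| ^+ n)%:E)))%E).
  apply: ge0_le_integral => //.
  - apply/measurable_EFinP; apply: measurable_funX.
    by apply: measurableT_comp => //; exact: measurable_funD.
  - apply: emeasurable_funD; apply: emeasurable_funM => //;
    apply/measurable_EFinP; apply: measurable_funX;
    exact: measurableT_comp.
  - move=> w _; rewrite -!EFinM -EFinD lee_fin -!exprMn.
    apply: (@le_trans _ _ ((`|f w| + `|g w|) ^+ n)).
      by rewrite lerXn2r ?nnegrE ?addr_ge0// ler_normD.
    have [fg|gf] := leP `|f w| `|g w|.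
      apply: (@le_trans _ _ ((2 * `|g w|) ^+ n)).
        rewrite lerXn2r ?nnegrE ?addr_ge0 ?mulr_ge0//.
        by rewrite mulr2n mulrDl mul1r lerD2r.
      by rewrite lerDr exprn_ge0// mulr_ge0.
    apply: (@le_trans _ _ ((2 * `|f w|) ^+ n)).
      rewrite lerXn2r ?nnegrE ?addr_ge0 ?mulr_ge0//.
      by rewrite mulr2n mulrDl mul1r lerD2l ltW.
    by rewrite lerDl exprn_ge0// mulr_ge0.
have h f' : measurable_fun setT f' -> (\int[P]_w (`|f' w| ^+ n)%:E < +oo)%E ->
    (\int[P]_w ((2 ^+ n)%:E * (`|f' w| ^+ n)%:E) < +oo)%E.
  move=> mf' hf'; rewrite ge0_integralZl//.
  - rewrite lte_mul_pinfty// ?lee_fin ?exprn_ge0//.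
  - by apply/measurable_EFinP; apply: measurable_funX; exact: measurableT_comp.
rewrite ge0_integralD//; first exact: lte_add_pinfty (h _ _ (hf _)) (h _ _ (hg _)).
- apply: emeasurable_funM => //; apply/measurable_EFinP; apply: measurable_funX.
  exact: measurableT_comp.
- apply: emeasurable_funM => //; apply/measurable_EFinP; apply: measurable_funX.
  exact: measurableT_comp.
Qed.

Lemma am_scale c f : all_moments f -> all_moments (fun w => c * f w).
Proof. by move=> hf; apply: (am_mul (am_cst c)). Qed.

Lemma am_sum (I : Type) (s : seq I) (F : I -> Om -> R) :
  (forall i, all_moments (F i)) -> all_moments (fun w => \sum_(i <- s) F i w).
Proof.
move=> hF; elim: s => [|i s ih].
  by rewrite (_ : (fun _ => _) = cst 0); [exact: am_cst|];
    apply/funext => w; rewrite big_nil.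
rewrite (_ : (fun _ => _) = fun w => F i w + \sum_(j <- s) F j w).
  exact: am_add.
by apply/funext => w; rewrite big_cons.
Qed.

Lemma am_exp f n : all_moments f -> all_moments (fun w => f w ^+ n).
Proof.
move=> hf; elim: n => [|n ih].
  by rewrite (_ : (fun _ => _) = cst 1); [exact: am_cst|];
    apply/funext => w; rewrite expr0.
rewrite (_ : (fun _ => _) = fun w => f w * f w ^+ n); first exact: am_mul.
by apply/funext => w; rewrite exprS.
Qed.

Lemma am_integrable f : all_moments f -> P.-integrable setT (EFin \o f).
Proof.
move=> [mf hf]; apply/integrableP; split; first exact/measurable_EFinP.
exact: (hf 1%N).
Qed.

Lemma ExE f : all_moments f -> (\int[P]_w (f w)%:E = (Ex f)%:E)%E.
Proof.
by move=> /am_integrable hf; rewrite /Ex fineK//; exact: integrable_fin_num.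
Qed.

Lemma ExD f g : all_moments f -> all_moments g ->
  Ex (fun w => f w + g w) = Ex f + Ex g.
Proof.
move=> hf hg; apply: EFin_inj; rewrite EFinD -!ExE//; last exact: am_add.
by rewrite -integralD//; exact: am_integrable.
Qed.

Lemma Ex_scale c f : all_moments f -> Ex (fun w => c * f w) = c * Ex f.
Proof.
move=> hf; apply: EFin_inj; rewrite EFinM -!ExE//; last exact: am_scale.
by rewrite -integralZl//; exact: am_integrable.
Qed.

Lemma Ex_cst c : Ex (cst c) = c.
Proof.
by rewrite /Ex int_probability_cst.
Qed.

Lemma Ex_sum (I : Type) (s : seq I) (F : I -> Om -> R) :
  (forall i, all_moments (F i)) ->
  Ex (fun w => \sum_(i <- s) F i w) = \sum_(i <- s) Ex (F i).
Proof.
move=> hF; elim: s => [|i s ih].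
  rewrite big_nil -[RHS](Ex_cst 0); congr Ex.
  by apply/funext => w; rewrite big_nil.
rewrite big_cons -ih -ExD//; last exact: am_sum.
by congr Ex; apply/funext => w; rewrite big_cons.
Qed.

Lemma Ex_ge0 f : (forall w, 0 <= f w) -> 0 <= Ex f.
Proof. by move=> f0; rewrite /Ex fine_ge0// integral_ge0// => w _; rewrite lee_fin. Qed.

Lemma Ex_le f g : all_moments f -> all_moments g -> (forall w, f w <= g w) ->
  Ex f <= Ex g.
Proof.
move=> hf hg fg; rewrite -lee_fin -!ExE//; apply: le_integral => //;
by [exact: am_integrable|move=> w _; rewrite lee_fin].
Qed.

Lemma Ex_ae f g : measurable_fun setT f -> measurable_fun setT g ->
  {ae P, forall w, f w = g w} -> Ex f = Ex g.
Proof.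
move=> mf mg fg; rewrite /Ex; congr fine.
apply: ae_eq_integral => //; [exact/measurable_EFinP|exact/measurable_EFinP|].
by apply: filterS fg => w /= ->.
Qed.

(** By uniqueness of the product measure the law of the pair is the product of the laws, and
    Fubini's theorem factors the integral of the product. *)
Lemma Ex_indep f g : all_moments f -> all_moments g ->
  (forall U V, measurable U -> measurable V ->
     P (f @^-1` U `&` g @^-1` V) = (P (f @^-1` U) * P (g @^-1` V))%E) ->
  Ex (fun w => f w * g w) = Ex f * Ex g.
Proof.
move=> hf hg ind.
have mf := am_meas hf; have mg := am_meas hg.
pose HB1 := isMeasurableFun.Build _ _ _ _ f mf.
pose HB2 := isMeasurableFun.Build _ _ _ _ g mg.
have mfg : measurable_fun setT (fun w => (f w, g w)).
  exact: measurable_fun_pair.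
pose HB3 := isMeasurableFun.Build _ _ _ _ (fun w => (f w, g w)) mfg.
pose F : {RV P >-> R} := HB.pack f HB1.
pose G : {RV P >-> R} := HB.pack g HB2.
pose FG : {RV P >-> (R * R)%type} := HB.pack (fun w => (f w, g w)) HB3.
pose mu1 := distribution P F; pose mu2 := distribution P G.
pose m12 := distribution P FG.
have m12E X : measurable X -> (mu1 \x mu2)%E X = m12 X.
  by move=> mX; apply: product_measure_unique => //= A B mA mB; rewrite -ind.
have mxy : measurable_fun [set: R * R] (fun z : R * R => (z.1 * z.2)%:E).
  by apply/measurable_EFinP; apply: measurable_funM.
have mid : measurable_fun [set: R] (fun y : R => y%:E) by exact/measurable_EFinP.
have mabs : measurable_fun [set: R] (fun y : R => `|y|%:E).
  by apply/measurable_EFinP; exact: normr_measurable.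
have ifg : P.-integrable setT ((fun z : R * R => (z.1 * z.2)%:E) \o FG).
  exact: am_integrable (am_mul hf hg).
have I12 : (mu1 \x mu2)%E.-integrable setT (fun z : R * R => (z.1 * z.2)%:E).
  apply/integrableP; split => //.
  rewrite (eq_measure_integral m12); last by move=> A mA _; exact: m12E.
  rewrite ge0_integral_distribution//; last exact: measurableT_comp.
  by have /integrableP[] := ifg.
have -> : Ex (fun w => f w * g w) =
    fine (\int[(mu1 \x mu2)%E]_z (z.1 * z.2)%:E)%E.
  rewrite /Ex; congr fine.
  rewrite (eq_measure_integral m12); last by move=> A mA _; exact: m12E.
  by rewrite integral_distribution.
rewrite -(integral12_prod_meas1 I12)/=.
have iF : (\int[mu1]_x x%:E = (Ex f)%:E)%E.
  by rewrite integral_distribution//; [exact: ExE|exact: am_integrable hf].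
have iG : (\int[mu2]_x x%:E = (Ex g)%:E)%E.
  by rewrite integral_distribution//; [exact: ExE|exact: am_integrable hg].
have fin1 (X : {RV P >-> R}) : all_moments X ->
    (distribution P X).-integrable setT (fun y : R => y%:E).
  move=> hX; apply/integrableP; split => //.
  rewrite ge0_integral_distribution//.
  by have /integrableP[] := am_integrable hX.
have inner x : (\int[mu2]_y (x * y)%:E = x%:E * (Ex g)%:E)%E.
  by rewrite -iG -integralZl//; exact: (fin1 G hg).
have -> : (\int[mu1]_x fubini_F mu2 (fun z : R * R => (z.1 * z.2)%:E) x =
    \int[mu1]_x (x%:E * (Ex g)%:E))%E.
  by apply: eq_integral => x _; exact: inner.
by rewrite integralZr//; [rewrite iF|exact: (fin1 F hf)].
Qed.

End all_moments.

(** * Increments of the cylindrical Wiener process *)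

Section wiener.
Context (R : realType) (Xi : hilbertType R).
Context (d : measure_display) (Om : measurableType d) (P : probability Om R).
Context (t T : R) (W : R -> Xi -> Om -> R).
Hypothesis hW : reference_space P t T W.
Local Notation F := (wiener_filtration P W t).

(** The generators of [wiener_filtration], named so that the generated sigma-algebra becomes a
    measurable type; adapted functions are then measurable functions on it. *)
Definition wiener_gen (s : R) : set (set Om) :=
  [set C | (exists r e (V : set R),
              [/\ t <= r <= s, measurable V & C = W r e @^-1` V])
           \/ P.-negligible C].

Definition adapted_fun (r : R) (f : Om -> R) :=
  @measurable_fun _ _ (g_sigma_algebraType (wiener_gen r)) R setT f.

Lemma filtration_mono r s : r <= s -> F r `<=` F s.
Proof.
move=> rs; apply: sub_sigma_algebra2 => C [[u [e [V [/andP[tu ur] mV ->]]]]|nC].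
  by left; exists u, e, V; rewrite tu (le_trans ur rs).
by right.
Qed.

(** Completeness of the probability space enters here: the negligible sets among the generators have
    to be measurable. *)
Lemma filtration_measurable r : r <= T -> F r `<=` measurable.
Proof.
move=> rT; apply: smallest_sub; first exact: sigma_algebra_measurable.
move=> C [[u [e [V [/andP[tu ur] mV ->]]]]|nC].
  rewrite -[X in measurable X]setTI.
  by apply: (ref_measurable hW) => //; rewrite tu (le_trans ur rT).
exact: (ref_complete hW).
Qed.

Lemma adapted_mono r s f : r <= s -> adapted_fun r f -> adapted_fun s f.
Proof. by move=> rs hf _ V mV; apply: (filtration_mono rs); exact: hf. Qed.

Lemma adapted_measurable r f : r <= T -> adapted_fun r f -> measurable_fun setT f.
Proof.
by move=> rT hf mT V mV; apply: (filtration_measurable rT); exact: hf.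
Qed.

Lemma adapted_indic r C : F r C -> adapted_fun r (\1_C).
Proof.
by move=> FC; apply: (@measurable_indic _ (g_sigma_algebraType (wiener_gen r))).
Qed.

Lemma adapted_wiener r s e : t <= r -> r <= s -> adapted_fun s (W r e).
Proof.
move=> tr rs _ V mV; rewrite setTI; apply: sub_sigma_algebra; left.
by exists r, e, V; rewrite tr rs.
Qed.

Definition incr r s e w := W s e w - W r e w.

Lemma incr_adapted u r s e : t <= r -> r <= u -> t <= s -> s <= u ->
  adapted_fun u (incr r s e).
Proof. by move=> *; apply: measurable_funB; exact: adapted_wiener. Qed.

Lemma incr_meas r s e : t <= r <= T -> t <= s <= T -> measurable_fun setT (incr r s e).
Proof. by move=> *; apply: measurable_funB; exact: (ref_measurable hW). Qed.

Lemma wiener_lin s n (c : 'I_n -> R) (e : 'I_n -> Xi) : t <= s <= T ->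
  {ae P, forall w, W s (\sum_(k < n) c k *: e k) w = \sum_(k < n) c k * W s (e k) w}.
Proof.
move=> ts; have W0 : {ae P, forall w, W s 0 w = 0}.
  have := ref_linear hW 1 0 0 ts; apply: filterS => w.
  by rewrite scaler0 addr0 mul1r => /eqP; rewrite -subr_eq subrr eq_sym => /eqP.
elim: n c e => [c e|n ih c e].
  by apply: filterS W0 => w W0; rewrite !big_ord0.
have := ih (fun k => c (lift ord0 k)) (fun k => e (lift ord0 k)).
apply: filterS2 (ref_linear hW (c ord0) (e ord0)
  (\sum_(k < n) c (lift ord0 k) *: e (lift ord0 k)) ts) => w h1 h2.
by rewrite !big_ord_recl h1 h2.
Qed.

Lemma incr_lin r s n (c : 'I_n -> R) (e : 'I_n -> Xi) : t <= r <= T -> t <= s <= T ->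
  {ae P, forall w, incr r s (\sum_(k < n) c k *: e k) w
    = \sum_(k < n) c k * incr r s (e k) w}.
Proof.
move=> tr ts; apply: filterS2 (wiener_lin c e tr) (wiener_lin c e ts) => w h1 h2.
by rewrite /incr h1 h2 -sumrB; apply: eq_bigr => k _; rewrite mulrBr.
Qed.

Lemma incr0 r s : t <= r <= T -> t <= s <= T -> {ae P, forall w, incr r s 0 w = 0}.
Proof.
move=> tr ts; have := @incr_lin r s 0 (fun=> 0) (fun=> 0) tr ts.
by apply: filterS => w; rewrite !big_ord0.
Qed.

Lemma incrN r s e : t <= r <= T -> t <= s <= T ->
  {ae P, forall w, incr r s (- e) w = - incr r s e w}.
Proof.
move=> tr ts; have := @incr_lin r s 1 (fun=> -1) (fun=> e) tr ts.
by apply: filterS => w; rewrite !big_ord1 scaleN1r mulN1r.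
Qed.

Lemma incr_moment_fin r s e n : t <= r -> r <= s -> s <= T ->
  (\int[P]_w ((incr r s e w ^+ 2) ^+ n)%:E
   <= (2 * n`!%:R * (4 * ((s - r) * `|e| ^+ 2)) ^+ n)%:E)%E.
Proof.
move=> tr rs sT.
have trT : t <= r <= T by rewrite tr (le_trans rs sT).
have tsT : t <= s <= T by rewrite (le_trans tr rs) sT.
(* The law of an increment is prescribed only for [r < s] and [e != 0]; in the two remaining cases
   the increment vanishes almost surely, which this reduces to. *)
have zero : (forall m, \int[P]_w ((incr r s e w ^+ 2) ^+ m)%:E =
     \int[P]_w ((0 ^+ 2) ^+ m)%:E)%E -> (s - r) * `|e| ^+ 2 = 0 ->
  (\int[P]_w ((incr r s e w ^+ 2) ^+ n)%:E
   <= (2 * n`!%:R * (4 * ((s - r) * `|e| ^+ 2)) ^+ n)%:E)%E.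
  move=> -> ->; rewrite mulr0 expr0n/= int_probability_cst lee_fin.
  rewrite expr0n; case: n => [|n]/=; last by rewrite mulr0.
  by rewrite fact0; lra.
have [rs'|sr] := ltP r s; last first.
  have sr' : s = r by apply/eqP; rewrite eq_le rs sr.
  apply: zero; last by rewrite sr' subrr mul0r.
  by move=> m; apply: eq_integral => w _; rewrite /incr sr' subrr.
have [e0|e0] := eqVneq e 0.
  apply: zero; last by rewrite e0 normr0 expr0n/= mulr0.
  move=> m; apply: ae_eq_integral => //.
  - apply/measurable_EFinP; do 2 apply: measurable_funX.
    exact: incr_meas.
  - rewrite e0; apply: filterS (incr0 trT tsT) => w h _.
    by rewrite h.
have s0 : 0 < Num.sqrt (s - r) * `|e|.
  by rewrite mulr_gt0 ?sqrtr_gt0 ?subr_gt0 ?normr_gt0.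
have mY : measurable_fun setT (incr r s e : Om -> measurableTypeR R).
  by move=> mT V mV; exact: incr_meas e trT tsT mT V mV.
pose HB1 := isMeasurableFun.Build _ _ _ (measurableTypeR R) (incr r s e) mY.
pose Y : {RV P >-> measurableTypeR R} := HB.pack (incr r s e) HB1.
have -> : (\int[P]_w ((incr r s e w ^+ 2) ^+ n)%:E =
    \int[distribution P Y]_x ((x ^+ 2) ^+ n)%:E)%E.
  rewrite ge0_integral_distribution//.
    by apply/measurable_EFinP; do 2 apply: measurable_funX.
  by move=> x; rewrite lee_fin exprn_ge0// sqr_ge0.
rewrite (eq_measure_integral (normal_prob 0 (Num.sqrt (s - r) * `|e|))); last first.
  by move=> V mV _; exact: (ref_gaussian hW tr rs' sT e0 mV).
apply: (le_trans (normal_moment n s0)).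
by rewrite [(_ * `|e|) ^+ 2]exprMn sqr_sqrtr// subr_ge0.
Qed.

Lemma incr_am r s e : t <= r -> r <= s -> s <= T -> all_moments P (incr r s e).
Proof.
move=> tr rs sT; split.
  by apply: incr_meas; rewrite ?tr ?sT ?(le_trans rs sT) ?(le_trans tr rs).
move=> n.
have m1 m : measurable_fun setT (fun w => ((incr r s e w ^+ 2) ^+ m)%:E).
  apply/measurable_EFinP; do 2 apply: measurable_funX.
  by apply: incr_meas; rewrite ?tr ?sT ?(le_trans rs sT) ?(le_trans tr rs).
apply: (@le_lt_trans _ _ (\int[P]_w (1 + ((incr r s e w ^+ 2) ^+ n)%:E))%E).
  apply: ge0_le_integral => //.
  - apply/measurable_EFinP; apply: measurable_funX.
    apply: measurableT_comp => //.
    by apply: incr_meas; rewrite ?tr ?sT ?(le_trans rs sT) ?(le_trans tr rs).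
  - by apply: emeasurable_funD => //; exact: m1.
  - move=> w _; rewrite -EFinD lee_fin -(real_normK (num_real (incr r s e w))) exprAC; have := exprn_ge0 n (normr_ge0 (incr r s e w)); nra.
rewrite ge0_integralD//; last first.
  by move=> w _; rewrite lee_fin exprn_ge0// sqr_ge0.
rewrite int_probability_cst lte_add_pinfty ?ltry//.
by rewrite (le_lt_trans (incr_moment_fin e n tr rs sT))// ltry.
Qed.

(** The constants [8] here and [64] in the next lemma are [2 * n! * 4 ^ n] for [n = 1] and
    [n = 2]. *)
Lemma Ex_incr2 r s e : t <= r -> r <= s -> s <= T ->
  Ex P (fun w => incr r s e w ^+ 2) <= 8 * ((s - r) * `|e| ^+ 2).
Proof.
move=> tr rs sT; have h := incr_moment_fin e 1 tr rs sT.
rewrite -lee_fin -ExE; last exact/am_exp/incr_am.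
by apply: (le_trans h); rewrite lee_fin expr1 (_ : 1`! = 1)%N//; lra.
Qed.

Lemma Ex_incr4 r s e : t <= r -> r <= s -> s <= T ->
  Ex P (fun w => (incr r s e w ^+ 2) ^+ 2) <= 64 * ((s - r) * `|e| ^+ 2) ^+ 2.
Proof.
move=> tr rs sT; have h := incr_moment_fin e 2 tr rs sT.
rewrite -lee_fin -ExE; last exact/am_exp/am_exp/incr_am.
by apply: (le_trans h); rewrite lee_fin exprMn (_ : 2`! = 2)%N//; lra.
Qed.

(** The mean vanishes by symmetry: the increments in the directions [e] and [- e] have the same law
    and are almost surely opposite. *)
Lemma Ex_incr r s e : t <= r -> r <= s -> s <= T -> Ex P (incr r s e) = 0.
Proof.
move=> tr rs sT.
have trT : t <= r <= T by rewrite tr (le_trans rs sT).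
have tsT : t <= s <= T by rewrite (le_trans tr rs) sT.
have hN : Ex P (incr r s (- e)) = - Ex P (incr r s e).
  rewrite -mulN1r -Ex_scale; last exact: incr_am.
  apply: Ex_ae; first exact: incr_meas.
    exact/am_meas/am_scale/incr_am.
  by apply: filterS (incrN e trT tsT) => w ->; rewrite mulN1r.
suff : Ex P (incr r s (- e)) = Ex P (incr r s e) by move: hN => ->; lra.
have [rs'|sr] := ltP r s; last first.
  have E0 e' : Ex P (incr r s e') = 0.
    rewrite -(Ex_cst P 0); congr Ex; apply/funext => w.
    by rewrite /incr (_ : s = r) ?subrr//; apply/eqP; rewrite eq_le rs sr.
  by rewrite !E0.
have [->|e0] := eqVneq e 0; first by rewrite oppr0.
have e0' : - e != 0 by rewrite oppr_eq0.
have law e' : e' != 0 -> `|e'| = `|e| -> Ex P (incr r s e') =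
    fine (\int[normal_prob 0 (Num.sqrt (s - r) * `|e|)]_x x%:E)%E.
  move=> e'0 e'e.
  have mY : measurable_fun setT (incr r s e' : Om -> measurableTypeR R).
    by move=> mT V mV; exact: incr_meas e' trT tsT mT V mV.
  pose HB1 := isMeasurableFun.Build _ _ _ (measurableTypeR R) (incr r s e') mY.
  pose Y : {RV P >-> measurableTypeR R} := HB.pack (incr r s e') HB1.
  have -> : Ex P (incr r s e') = fine (\int[distribution P Y]_x x%:E)%E.
    rewrite integral_distribution//.
    by apply: (@am_integrable _ _ _ P (incr r s e')); exact: incr_am.
  congr fine; apply: eq_measure_integral => V mV _.
  by rewrite -e'e; exact: (ref_gaussian hW tr rs' sT e'0 mV).
by rewrite !law// normrN.
Qed.

Lemma Ex_incr_indep r s e f n : t <= r -> r <= s -> s <= T -> adapted_fun r f ->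
  all_moments P f ->
  Ex P (fun w => f w * incr r s e w ^+ n) = Ex P f * Ex P (fun w => incr r s e w ^+ n).
Proof.
move=> tr rs sT af mf; apply: Ex_indep => //; first exact/am_exp/incr_am.
move=> U V mU mV.
have -> : (fun w => incr r s e w ^+ n) @^-1` V =
    [set w | ((fun x : R => x ^+ n) @^-1` V) (W s e w - W r e w)] by [].
apply: (@ref_indep _ _ _ _ _ _ _ _ hW r s e (f @^-1` U) ((fun x : R => x ^+ n) @^-1` V)) => //.
  by have := af measurableT U mU; rewrite setTI.
rewrite -[X in measurable X]setTI.
by apply: (exprn_measurable n).
Qed.

End wiener.

(** * Discrete martingales: moments of order 2 and 4, and stopping *)

(** The constant of the fourth moment in [mart4'], which also covers the [8] of the second moment;
    locked so that the numeral stays opaque. *)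
Definition mart_const (R : numDomainType) : R := locked 4480%:R.

Lemma mart_const_ge0 (R : numDomainType) : 0 <= mart_const R.
Proof. by rewrite /mart_const -lock ler0n. Qed.

Lemma sum_cs (R : realType) (I : Type) (s : seq I) (x y : I -> R) :
  (\sum_(i <- s) x i * y i) ^+ 2 <=
  (\sum_(i <- s) x i ^+ 2) * (\sum_(i <- s) y i ^+ 2).
Proof.
elim: s => [|i s ih]; first by rewrite !big_nil expr0n/= mulr0.
rewrite !big_cons; move: ih.
set L := \sum_(_ <- _) _ * _; set X := \sum_(_ <- _) x _ ^+ 2.
set Y := \sum_(_ <- _) y _ ^+ 2 => ih.
have X0 : 0 <= X by apply: sumr_ge0 => j _; exact: sqr_ge0.
have Y0 : 0 <= Y by apply: sumr_ge0 => j _; exact: sqr_ge0.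
suff : 2 * (L * (x i * y i)) <= X * y i ^+ 2 + x i ^+ 2 * Y by nra.
set p := X * _; set q := _ * Y.
have p0 : 0 <= p by rewrite mulr_ge0// sqr_ge0.
have q0 : 0 <= q by rewrite mulr_ge0// sqr_ge0.
have h : (L * (x i * y i)) ^+ 2 <= p * q.
  rewrite exprMn /p /q; have := ler_wpM2r (sqr_ge0 (x i * y i)) ih.
  by move=> /le_trans; apply; rewrite le_eqVlt; apply/orP; left; apply/eqP; ring.
have pq0 : 0 <= p + q by rewrite addr_ge0.
apply: (le_trans (ler_norm _)).
rewrite -(@ler_pXn2r _ 2) ?nnegrE// real_normK ?num_real// exprMn.
have := sqr_ge0 (p - q); nra.
Qed.

Section adapted_ops.
Context (R : realType) (Xi : hilbertType R).
Context (d : measure_display) (Om : measurableType d) (P : probability Om R).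
Context (t : R) (W : R -> Xi -> Om -> R) (r : R).
Local Notation ad := (adapted_fun P t W r).

Lemma adapted_mul f g : ad f -> ad g -> ad (fun w => f w * g w).
Proof. exact: measurable_funM. Qed.

Lemma adapted_add f g : ad f -> ad g -> ad (fun w => f w + g w).
Proof. exact: measurable_funD. Qed.

Lemma adapted_cst c : ad (cst c).
Proof. exact: measurable_cst. Qed.

Lemma adapted_sum (I : Type) (s : seq I) (f : I -> Om -> R) :
  (forall i, ad (f i)) -> ad (fun w => \sum_(i <- s) f i w).
Proof. by move=> h; apply: measurable_sum. Qed.

Lemma adapted_prod (I : Type) (s : seq I) (f : I -> Om -> R) :
  (forall i, ad (f i)) -> ad (fun w => \prod_(i <- s) f i w).
Proof. move=> h; elim: s => [|i s ih].
  rewrite (_ : (fun _ => _) = cst 1); first exact: adapted_cst.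
  by apply/funext => w; rewrite big_nil.
rewrite (_ : (fun _ => _) = fun w => f i w * \prod_(j <- s) f j w).
  exact: adapted_mul.
by apply/funext => w; rewrite big_cons. Qed.

End adapted_ops.

Section discrete.
Context (R : realType) (Xi : hilbertType R).
Context (d : measure_display) (Om : measurableType d) (P : probability Om R).
Context (t T : R) (W : R -> Xi -> Om -> R).
Hypothesis hW : reference_space P t T W.
Local Notation F := (wiener_filtration P W t).
Local Notation am := (all_moments P).
Local Notation ad := (adapted_fun P t W).
Local Notation Ex := (Ex P).

Lemma adapted_indicI r (A : set Om) : r <= T -> F r A -> am (\1_A).
Proof. by move=> rT FA; apply/am_indic/(filtration_measurable hW rT). Qed.

(** Random coefficients that depend only on which of the events [A k] occur take finitely many
    values. On each of these patterns the coefficients are frozen, and the indicator of the pattern,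
    known at time [r], joins the weight [f]; this is conditioning on the past without conditional
    expectations. *)
Lemma pattern_le r n (A : 'I_n -> set Om) (K : R)
    (G G' : ('I_n -> R) -> Om -> R) f : r <= T -> (forall k, F r (A k)) ->
  (forall c, am (G c)) -> (forall c, am (G' c)) ->
  (forall (c : 'I_n -> R) f, ad r f -> am f -> (forall w, 0 <= f w) ->
     Ex (fun w => f w * G c w) <= K * Ex (fun w => f w * G' c w)) ->
  ad r f -> am f -> (forall w, 0 <= f w) ->
  Ex (fun w => f w * G (fun k => \1_(A k) w) w) <=
    K * Ex (fun w => f w * G' (fun k => \1_(A k) w) w).
Proof.
move=> rT FA aG aG' hK adf amf f0.
pose cr (c : {ffun 'I_n -> bool}) (k : 'I_n) : R := (c k)%:R.
(* The indicator of the pattern [c], written as a polynomial in the indicators of the events so that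
   its adaptedness is algebraic. *)
pose chi (c : {ffun 'I_n -> bool}) (w : Om) : R :=
  \prod_(k < n) (1 - (cr c k - \1_(A k) w) ^+ 2).
have chiE c w : chi c w = (c == [ffun k => w \in A k])%:R.
  have [->|cn] := eqVneq c.
    by rewrite /chi big1// => k _; rewrite /cr ffunE indicE subrr expr0n subr0.
  have [k ck] : exists k, c k != (w \in A k).
    apply/existsP; apply: contraNT cn; rewrite negb_exists => /forallP h.
    by apply/eqP/ffunP => k; rewrite ffunE; have := h k; rewrite negbK => /eqP.
  rewrite /chi (bigD1 k)//= /cr indicE.
  by case: (c k) ck; case: (w \in A k) => // _;
    rewrite ?subr0 ?sub0r ?sqrrN expr1n subrr mul0r.
have chiS (f' : ('I_n -> R) -> R) w : f' (fun k => \1_(A k) w) = \sum_c chi c w * f' (cr c).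
  rewrite (bigD1 [ffun k => w \in A k])//= chiE eqxx mul1r.
  rewrite big1 ?addr0 => [|c cn]; last by rewrite chiE (negbTE cn) mul0r.
  by congr f'; apply/funext => k; rewrite /cr ffunE indicE.
have adchi c : ad r (chi c).
  apply: adapted_prod => k; apply: adapted_add; first exact: adapted_cst.
  rewrite (_ : (fun _ => _) = fun w => -1 * ((cr c k - \1_(A k) w) * (cr c k - \1_(A k) w))); last first.
    by apply/funext => w; rewrite mulN1r expr2.
  have h : ad r (fun w => cr c k - \1_(A k) w).
    rewrite (_ : (fun _ => _) = fun w => cr c k + -1 * \1_(A k) w); last first.
      by apply/funext => w; rewrite mulN1r.
    apply: adapted_add; first exact: adapted_cst.
    by apply: adapted_mul; [exact: adapted_cst|exact: adapted_indic].
  by apply: adapted_mul; [exact: adapted_cst|exact: adapted_mul].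
have amchi c : am (chi c).
  apply: (@am_bounded _ _ _ _ _ 1); first exact: adapted_measurable hW _ _ rT (adchi c).
  by move=> w; rewrite chiE; case: (_ == _); rewrite ?normr1 ?normr0.
have E1 (G0 : ('I_n -> R) -> Om -> R) : (forall c, am (G0 c)) ->
    Ex (fun w => f w * G0 (fun k => \1_(A k) w) w) =
    \sum_c Ex (fun w => (f w * chi c w) * G0 (cr c) w).
  move=> aG0; rewrite -Ex_sum => [|c]; last by apply: am_mul => //; exact: am_mul.
  congr Ex; apply/funext => w.
  rewrite (chiS (fun z => G0 z w)) mulr_sumr; apply: eq_bigr => c _.
  by rewrite mulrA.
rewrite !E1// mulr_sumr; apply: ler_sum => c _.
apply: hK; [exact: adapted_mul|exact: am_mul|].
by move=> w; rewrite mulr_ge0// chiE ler0n.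
Qed.

(** The joint law of two increments is avoided: Young's inequality with weights [q / p] and [p / q],
    where [p] and [q] are the squared norms of the directions, leaves two fourth moments and
    reproduces the product scaling. *)
Lemma Ex_incr2_pair r s (e e' : Xi) f : t <= r -> r <= s -> s <= T ->
  ad r f -> am f -> (forall w, 0 <= f w) ->
  Ex (fun w => f w * (incr W r s e w ^+ 2 * incr W r s e' w ^+ 2)) <=
  64 * (((s - r) * `|e| ^+ 2) * ((s - r) * `|e'| ^+ 2)) * Ex f.
Proof.
move=> tr rs sT adf amf f0.
have trT : t <= r <= T by rewrite tr (le_trans rs sT).
have tsT : t <= s <= T by rewrite (le_trans tr rs) sT.
have ai z : am (incr W r s z) by exact: (incr_am hW).
have Exf : 0 <= Ex f by exact: Ex_ge0.
have zero z z' : z = 0 \/ z' = 0 ->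
    Ex (fun w => f w * (incr W r s z w ^+ 2 * incr W r s z' w ^+ 2)) = 0.
  move=> zz; rewrite -[RHS](Ex_cst P 0); apply: Ex_ae.
  - by apply: (@am_meas _ _ _ P); apply: am_mul => //; apply: am_mul; exact: am_exp.
  - exact: measurable_cst.
  - have [->|->] := zz.
    + by apply: filterS (incr0 hW trT tsT) => w ->; rewrite expr0n/= mul0r mulr0.
    + by apply: filterS (incr0 hW trT tsT) => w ->; rewrite expr0n/= !mulr0.
have [e0|e0] := eqVneq e 0; first by rewrite zero; [rewrite e0 normr0 expr0n/= !(mulr0,mul0r)|left].
have [e'0|e'0] := eqVneq e' 0; first by rewrite zero; [rewrite e'0 normr0 expr0n/= !(mulr0,mul0r)|right].
set p := `|e| ^+ 2; set q := `|e'| ^+ 2.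
have p0 : 0 < p by rewrite exprn_gt0 ?normr_gt0.
have q0 : 0 < q by rewrite exprn_gt0 ?normr_gt0.
set y := incr W r s e; set y' := incr W r s e'.
have ay : am y by exact: ai.
have ay' : am y' by exact: ai.
have := Ex_incr4 hW e tr rs sT; have := Ex_incr4 hW e' tr rs sT.
rewrite -/p -/q -/y -/y'.
have e4 z : (fun w => (incr W r s z w ^+ 2) ^+ 2) = (fun w => incr W r s z w ^+ 4).
  by apply/funext => w; rewrite -exprM.
rewrite !e4 -/y -/y' => h' h.
apply: (@le_trans _ _ (Ex (fun w => (q / p / 2) * (f w * y w ^+ 4) + (p / q / 2) * (f w * y' w ^+ 4)))).
  apply: Ex_le.
  - by apply: am_mul => //; apply: am_mul; exact: am_exp.
  - by apply: am_add; apply: am_scale; apply: am_mul => //; exact: am_exp.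
  move=> w; rewrite !(mulrCA _ (f w)) -mulrDr ler_wpM2l// -subr_ge0.
  have -> : q / p / 2 * y w ^+ 4 + p / q / 2 * y' w ^+ 4 - y w ^+ 2 * y' w ^+ 2 =
    (q / p / 2) * (y w ^+ 2 - p / q * y' w ^+ 2) ^+ 2.
    by field; rewrite !gt_eqF.
  by rewrite mulr_ge0 ?sqr_ge0// !divr_ge0// ltW.
rewrite ExD ?Ex_scale; [|by apply: am_mul => //; exact: am_exp|by apply: am_mul => //; exact: am_exp|by apply: am_scale; apply: am_mul => //; exact: am_exp|by apply: am_scale; apply: am_mul => //; exact: am_exp].
rewrite !(Ex_incr_indep hW)//.
have -> : 64 * ((s - r) * p * ((s - r) * q)) * Ex f =
  q / p / 2 * (Ex f * (64 * ((s - r) * p) ^+ 2)) +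
  p / q / 2 * (Ex f * (64 * ((s - r) * q) ^+ 2)).
  by field; rewrite !gt_eqF.
by apply: lerD; rewrite ler_wpM2l ?divr_ge0 ?(ltW p0) ?(ltW q0)// ler_wpM2l.
Qed.

Context (n : nat) (xi : 'I_n -> Xi) (I : Type) (u : seq I) (a : I -> 'I_n -> R).

(** When [a v k] is the form of [v] with the [k]-th vector of [H], this is the vector of [Xi] that
    represents the finite-rank operator with coefficients [c] tested against [v]. *)
Definition eta (c : 'I_n -> R) (v : I) : Xi := \sum_(k < n) (c k * a v k) *: xi k.

Definition dlin (r s : R) (c : 'I_n -> R) (v : I) (w : Om) : R :=
  \sum_(k < n) (c k * a v k) * incr W r s (xi k) w.

(** For the family [u] of [gram_schmidt] this is, by Parseval's identity, the length of the interval
    times the squared Hilbert-Schmidt seminorm of that operator: the increment of the bracket. *)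
Definition drho (r s : R) (c : 'I_n -> R) : R :=
  (s - r) * \sum_(v <- u) `|eta c v| ^+ 2.

Lemma dlin_am r s c v : t <= r -> r <= s -> s <= T -> am (dlin r s c v).
Proof. by move=> tr rs sT; apply: am_sum => k; apply: am_scale; exact: (incr_am hW). Qed.

Lemma dlinE r s c v : t <= r -> r <= s -> s <= T ->
  {ae P, forall w, dlin r s c v w = incr W r s (eta c v) w}.
Proof.
move=> tr rs sT; have := @incr_lin _ _ _ _ _ _ _ _ hW r s n (fun k => c k * a v k) xi.
rewrite tr (le_trans rs sT) (le_trans tr rs) sT => /(_ isT isT).
by apply: filterS => w ->.
Qed.

Lemma drho_ge0 r s c : r <= s -> 0 <= drho r s c.
Proof. by move=> rs; rewrite mulr_ge0 ?subr_ge0// sumr_ge0. Qed.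

(** Once the pattern is frozen, each [dlin] is almost surely one Wiener increment in the direction
    [eta c v], independent of the weight. *)
Lemma step2 r s (A : 'I_n -> set Om) f : t <= r -> r <= s -> s <= T ->
  (forall k, F r (A k)) -> ad r f -> am f -> (forall w, 0 <= f w) ->
  Ex (fun w => f w * \sum_(v <- u) dlin r s (fun k => \1_(A k) w) v w ^+ 2) <=
  8 * Ex (fun w => f w * drho r s (fun k => \1_(A k) w)).
Proof.
move=> tr rs sT FA.
apply: (@pattern_le r n A 8 (fun c w => \sum_(v <- u) dlin r s c v w ^+ 2)
  (fun c w => drho r s c)) => //.
- exact: le_trans sT.
- by move=> c; apply: am_sum => v; apply/am_exp/dlin_am.
- by move=> c; exact: am_cst.
move=> c {}f adf amf f0.
have -> : Ex (fun w => f w * drho r s c) = drho r s c * Ex f.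
  by rewrite -Ex_scale//; congr Ex; apply/funext => w; rewrite mulrC.
have -> : (fun w => f w * \sum_(v <- u) dlin r s c v w ^+ 2) =
  fun w => \sum_(v <- u) f w * dlin r s c v w ^+ 2.
  by apply/funext => w; rewrite mulr_sumr.
rewrite Ex_sum => [|v]; last by apply: am_mul => //; apply/am_exp/dlin_am.
rewrite /drho mulr_sumr mulrA [8 * _]mulr_sumr mulr_suml.
apply: ler_sum => v _.
have -> : Ex (fun w => f w * dlin r s c v w ^+ 2) =
    Ex (fun w => f w * incr W r s (eta c v) w ^+ 2).
  apply: Ex_ae.
  - by apply: (@am_meas _ _ _ P); apply: am_mul => //; apply/am_exp/dlin_am.
  - by apply: (@am_meas _ _ _ P); apply: am_mul => //; apply/am_exp/(incr_am hW).
  - by apply: filterS (dlinE c v tr rs sT) => w ->.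
rewrite (Ex_incr_indep hW)// mulrC ler_wpM2r ?Ex_ge0//.
exact: (Ex_incr2 hW).
Qed.

Lemma step4 r s (A : 'I_n -> set Om) f : t <= r -> r <= s -> s <= T ->
  (forall k, F r (A k)) -> ad r f -> am f -> (forall w, 0 <= f w) ->
  Ex (fun w => f w * (\sum_(v <- u) dlin r s (fun k => \1_(A k) w) v w ^+ 2) ^+ 2) <=
  64 * Ex (fun w => f w * drho r s (fun k => \1_(A k) w) ^+ 2).
Proof.
move=> tr rs sT FA.
apply: (@pattern_le r n A 64 (fun c w => (\sum_(v <- u) dlin r s c v w ^+ 2) ^+ 2)
  (fun c w => drho r s c ^+ 2)) => //.
- exact: le_trans sT.
- by move=> c; apply/am_exp/am_sum => v; apply/am_exp/dlin_am.
- by move=> c; exact: am_cst.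
move=> c {}f adf amf f0.
have -> : Ex (fun w => f w * drho r s c ^+ 2) = drho r s c ^+ 2 * Ex f.
  by rewrite -Ex_scale//; congr Ex; apply/funext => w; rewrite mulrC.
have -> : (fun w => f w * (\sum_(v <- u) dlin r s c v w ^+ 2) ^+ 2) =
  fun w => \sum_(v <- u) \sum_(v' <- u) f w * (dlin r s c v w ^+ 2 * dlin r s c v' w ^+ 2).
  apply/funext => w; rewrite expr2 mulr_suml mulr_sumr; apply: eq_bigr => v _.
  by rewrite mulr_sumr mulr_sumr; apply: eq_bigr => v' _; ring.
have am2 v v' : am (fun w => f w * (dlin r s c v w ^+ 2 * dlin r s c v' w ^+ 2)).
  by apply: am_mul => //; apply: am_mul; apply/am_exp/dlin_am.
rewrite Ex_sum => [|v]; last exact: am_sum.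
have -> : 64 * (drho r s c ^+ 2 * Ex f) = \sum_(v <- u) \sum_(v' <- u)
   64 * (((s - r) * `|eta c v| ^+ 2) * ((s - r) * `|eta c v'| ^+ 2)) * Ex f.
  rewrite /drho expr2 mulr_sumr mulr_suml mulr_suml mulr_sumr; apply: eq_bigr => v _.
  rewrite mulr_sumr mulr_suml mulr_sumr; apply: eq_bigr => v' _; ring.
apply: ler_sum => v _; rewrite Ex_sum//; apply: ler_sum => v' _.
apply: le_trans (Ex_incr2_pair (eta c v) (eta c v') tr rs sT adf amf f0).
rewrite le_eqVlt; apply/orP; left; apply/eqP; apply: Ex_ae.
- exact: am_meas (am2 v v').
- by apply: (@am_meas _ _ _ P); apply: am_mul => //; apply: am_mul; apply/am_exp/(incr_am hW).
- by apply: filterS2 (dlinE c v tr rs sT) (dlinE c v' tr rs sT) => w -> ->.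
Qed.

Context (pi : nat -> R).
Hypothesis pi_ge : forall j, t <= pi j.
Hypothesis pi_mono : forall j, pi j <= pi j.+1.
Hypothesis pi_le : forall j, pi j <= T.

Section martingale.
Context (A : nat -> 'I_n -> set Om).
Hypothesis FA : forall j k, F (pi j) (A j k).

(** The discrete stochastic integral in the coordinates [v] of [u]: [mD] are its increments, [mM]
    its values, [mS] its squared seminorm and [mQ] its bracket. *)
Definition mD j v w := dlin (pi j) (pi j.+1) (fun k => \1_(A j k) w) v w.
Definition mrho j w := drho (pi j) (pi j.+1) (fun k => \1_(A j k) w).
Definition mM j v w := \sum_(i < j) mD i v w.
Definition mQ j w := \sum_(i < j) mrho i w.
Definition mS j w := \sum_(v <- u) mM j v w ^+ 2.

Lemma mrho_ge0 j w : 0 <= mrho j w. Proof. exact: drho_ge0. Qed.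

Lemma mQ_ge0 j w : 0 <= mQ j w.
Proof. by apply: sumr_ge0 => i _; exact: mrho_ge0. Qed.

Lemma mS_ge0 j w : 0 <= mS j w.
Proof. by apply: sumr_ge0 => i _; exact: sqr_ge0. Qed.

Lemma indic_ad j k : ad (pi j) (\1_(A j k)).
Proof. exact: adapted_indic. Qed.

Lemma indic_am j k : am (\1_(A j k)).
Proof. exact: adapted_indicI (pi_le j) (@FA j k). Qed.

Lemma mD_am j v : am (mD j v).
Proof.
apply: am_sum => k; apply: am_mul; last exact: (incr_am hW).
by apply: am_mul; [exact: indic_am|exact: am_cst].
Qed.

Lemma mD_ad j v : ad (pi j.+1) (mD j v).
Proof.
apply: adapted_sum => k; apply: adapted_mul.
  apply: adapted_mul; last exact: adapted_cst.
  exact: adapted_mono (pi_mono j) (@indic_ad j k).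
by apply: incr_adapted.
Qed.

Lemma mrhoE j : mrho j = fun w => (pi j.+1 - pi j) * \sum_(v <- u)
  \sum_(k < n) \sum_(k' < n) (\1_(A j k) w * \1_(A j k') w) *
    (a v k * a v k' * hdot (xi k) (xi k')).
Proof.
apply/funext => w; rewrite /mrho /drho; congr (_ * _); apply: eq_bigr => v _.
rewrite -hdotxx /eta hdot_sumr; apply: eq_bigr => k _.
rewrite hdotZr hdotC hdot_sumr mulr_sumr; apply: eq_bigr => k' _.
by rewrite hdotZr; ring.
Qed.

Lemma mrho_ad j : ad (pi j) (mrho j).
Proof.
rewrite mrhoE; apply: adapted_mul; first exact: adapted_cst.
apply: adapted_sum => v; apply: adapted_sum => k; apply: adapted_sum => k'.
apply: adapted_mul; last exact: adapted_cst.
by apply: adapted_mul; exact: indic_ad.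
Qed.

Lemma mrho_am j : am (mrho j).
Proof.
rewrite mrhoE; apply: am_scale.
apply: am_sum => v; apply: am_sum => k; apply: am_sum => k'.
by apply: am_mul; [apply: am_mul; exact: indic_am|exact: am_cst].
Qed.

Lemma pi_mono_le i j : (i <= j)%N -> pi i <= pi j.
Proof.
elim: j => [|j ih]; first by rewrite leqn0 => /eqP ->.
by rewrite leq_eqVlt => /predU1P[->//|/ih h]; exact: le_trans h (pi_mono j).
Qed.

Lemma mM_ad j v : ad (pi j) (mM j v).
Proof.
apply: adapted_sum => i; apply: adapted_mono (@mD_ad i v).
exact: pi_mono_le.
Qed.

Lemma mM_am j v : am (mM j v). Proof. by apply: am_sum => i; exact: mD_am. Qed.

(** The bracket is predictable: its value after step [j] is known at the start of that step. Both
    the mixed moment and the stopping below depend on this shift. *)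
Lemma mQ_ad j : ad (pi j) (mQ j.+1).
Proof.
apply: adapted_sum => i; apply: adapted_mono (@mrho_ad i).
by apply: pi_mono_le; rewrite -ltnS.
Qed.

Lemma mQ_am j : am (mQ j). Proof. by apply: am_sum => i; exact: mrho_am. Qed.

Lemma mS_ad j : ad (pi j) (mS j).
Proof. by apply: adapted_sum => v; apply: adapted_mul; exact: mM_ad. Qed.

Lemma mS_am j : am (mS j).
Proof. by apply: am_sum => v; apply/am_exp/mM_am. Qed.

Lemma mMS j v w : mM j.+1 v w = mM j v w + mD j v w.
Proof. by rewrite /mM big_ord_recr. Qed.

Lemma mQS j w : mQ j.+1 w = mQ j w + mrho j w.
Proof. by rewrite /mQ big_ord_recr. Qed.

Definition mL j w := \sum_(v <- u) mM j v w * mD j v w.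
Definition mDD j w := \sum_(v <- u) mD j v w ^+ 2.

Lemma mDD_ge0 j w : 0 <= mDD j w.
Proof. by apply: sumr_ge0 => i _; exact: sqr_ge0. Qed.

Lemma mL_am j : am (mL j).
Proof. by apply: am_sum => v; apply: am_mul; [exact: mM_am|exact: mD_am]. Qed.

Lemma mDD_am j : am (mDD j).
Proof. by apply: am_sum => v; apply/am_exp/mD_am. Qed.

Lemma mSS j w : mS j.+1 w = mS j w + 2 * mL j w + mDD j w.
Proof.
rewrite /mS /mL /mDD mulr_sumr -!big_split/=; apply: eq_bigr => v _.
by rewrite mMS; ring.
Qed.

(** The martingale property: each term is a centred increment times a factor known at time
    [pi j]. *)
Lemma Ex_mL j f : ad (pi j) f -> am f -> Ex (fun w => f w * mL j w) = 0.
Proof.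
move=> adf amf.
have -> : (fun w => f w * mL j w) = fun w => \sum_(v <- u) \sum_(k < n)
    a v k * ((f w * mM j v w * \1_(A j k) w) * incr W (pi j) (pi j.+1) (xi k) w ^+ 1).
  apply/funext => w; rewrite mulr_sumr; apply: eq_bigr => v _.
  rewrite /mD /dlin mulrA mulr_sumr; apply: eq_bigr => k _.
  by rewrite expr1; ring.
have am1 v k : am (fun w => f w * mM j v w * \1_(A j k) w).
  by apply: am_mul; [apply: am_mul => //; exact: mM_am|exact: indic_am].
have am2 v k : am (fun w => f w * mM j v w * \1_(A j k) w * incr W (pi j) (pi j.+1) (xi k) w ^+ 1).
  by apply: am_mul => //; apply/am_exp/(incr_am hW).
rewrite Ex_sum => [|v]; last by apply: am_sum => k; apply: am_scale.
rewrite big1// => v _; rewrite Ex_sum => [|k]; last exact: am_scale.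
rewrite big1// => k _; rewrite Ex_scale// (Ex_incr_indep hW)//.
  have -> : (fun w => incr W (pi j) (pi j.+1) (xi k) w ^+ 1) = incr W (pi j) (pi j.+1) (xi k).
    by apply/funext => w; rewrite expr1.
  by rewrite (Ex_incr hW)// !mulr0.
apply: adapted_mul; last exact: indic_ad.
by apply: adapted_mul => //; exact: mM_ad.
Qed.

Lemma mart2 j : Ex (mS j) <= 8 * Ex (mQ j).
Proof.
elim: j => [|j ih].
  have -> : mS 0 = cst 0.
    by apply/funext => w; rewrite /mS big1// => v _; rewrite /mM big_ord0 expr0n.
  have -> : mQ 0 = cst 0 by apply/funext => w; rewrite /mQ big_ord0.
  by rewrite !Ex_cst mulr0.
have -> : mS j.+1 = fun w => mS j w + (2 * (1 * mL j w) + 1 * mDD j w).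
  by apply/funext => w; rewrite mSS !mul1r addrA.
have -> : mQ j.+1 = fun w => mQ j w + 1 * mrho j w.
  by apply/funext => w; rewrite mQS mul1r.
have a1 : am (fun w => 1 * mL j w) by apply: am_scale; exact: mL_am.
have a2 : am (fun w => 1 * mDD j w) by apply: am_scale; exact: mDD_am.
have a3 : am (fun w => 1 * mrho j w) by apply: am_scale; exact: mrho_am.
rewrite ExD; [|exact: mS_am|by apply: am_add => //; exact: am_scale].
rewrite ExD//; last exact: am_scale.
rewrite Ex_scale// (@Ex_mL j (cst 1)) ?mulr0 ?add0r; [|exact: adapted_cst|exact: am_cst].
rewrite ExD//; last exact: mQ_am.
rewrite mulrDr lerD//.
exact: (@step2 (pi j) (pi j.+1) (A j) (cst 1) (pi_ge j) (pi_mono j) (pi_le j.+1)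
  (@FA j) (@adapted_cst _ _ _ _ P t W (pi j) 1) (am_cst P 1) (fun=> ler01)).
Qed.

(** With the predictable weight [mQ j.+1] the cross term has mean zero. Iterated over [j], the mixed
    moment dominates the accumulated expectations of [mS j * mrho j]. *)
Lemma mart_mixed j : Ex (fun w => mS j w * mQ j w) + Ex (fun w => mS j w * mrho j w)
  <= Ex (fun w => mS j.+1 w * mQ j.+1 w).
Proof.
have aQ := mQ_am j.+1; have aS := mS_am j; have aL := mL_am j.
have aD := mDD_am j.
have -> : (fun w => mS j.+1 w * mQ j.+1 w) = fun w => (mS j w * mQ j w + mS j w * mrho j w)
  + (2 * (mQ j.+1 w * mL j w) + mQ j.+1 w * mDD j w).
  by apply/funext => w; rewrite mSS mQS; ring.
have b1 : am (fun w => mS j w * mQ j w) by apply: am_mul => //; exact: mQ_am.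
have b2 : am (fun w => mS j w * mrho j w) by apply: am_mul => //; exact: mrho_am.
have b3 : am (fun w => mQ j.+1 w * mL j w) by exact: am_mul.
have b4 : am (fun w => mQ j.+1 w * mDD j w) by exact: am_mul.
rewrite ExD; [|exact: am_add|by apply: am_add => //; exact: am_scale].
rewrite ExD// lerDl ExD//; last exact: am_scale.
rewrite Ex_scale// Ex_mL//; last exact: mQ_ad.
rewrite mulr0 add0r Ex_ge0// => w.
by rewrite mulr_ge0 ?mQ_ge0 ?mDD_ge0.
Qed.

(** The discrete form of Ito's formula for the fourth power: [64 = 8 * 8] comes from the term in
    [mS * mDD] and [192 = 3 * 64] from the term in [mDD ^ 2]. The sums over the steps are collected
    by [mart_mixed] and by superadditivity of the square. *)
Lemma mart4 j : Ex (fun w => mS j w ^+ 2) <=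
  64 * Ex (fun w => mS j w * mQ j w) + 192 * Ex (fun w => mQ j w ^+ 2).
Proof.
elim: j => [|j ih].
  have S0 : mS 0 = cst 0.
    by apply/funext => w; rewrite /mS big1// => v _; rewrite /mM big_ord0 expr0n.
  rewrite (_ : (fun _ => _ ^+ 2) = cst 0) ?Ex_cst.
    by rewrite addr_ge0// mulr_ge0// Ex_ge0// => w; rewrite ?sqr_ge0// S0 mul0r.
  by apply/funext => w; rewrite S0 expr0n.
have aQ := mQ_am j; have aS := mS_am j; have aL := mL_am j.
have aD := mDD_am j; have ar := mrho_am j.
have b1 : am (fun w => mS j w ^+ 2) by exact: am_exp.
have b2 : am (fun w => mS j w * mL j w) by exact: am_mul.
have b3 : am (fun w => mS j w * mDD j w) by exact: am_mul.
have b4 : am (fun w => 1 * mDD j w ^+ 2) by apply: am_scale; exact: am_exp.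
have h1 : Ex (fun w => mS j.+1 w ^+ 2) <= Ex (fun w => mS j w ^+ 2)
    + 64 * Ex (fun w => mS j w * mrho j w) + 192 * Ex (fun w => 1 * mrho j w ^+ 2).
  (* Expansion of [(S + 2 L + D) ^ 2], with [L ^ 2 <= S D] by Cauchy-Schwarz and
     [4 L D <= 2 L ^ 2 + 2 D ^ 2]. *)
  apply: (@le_trans _ _ (Ex (fun w => (mS j w ^+ 2 + 4 * (mS j w * mL j w)) +
      (8 * (mS j w * mDD j w) + 3 * (1 * mDD j w ^+ 2))))).
    apply: Ex_le; first exact/am_exp/mS_am.
      by apply: am_add; apply: am_add => //; exact: am_scale.
    move=> w; rewrite mSS.
    have cs : mL j w ^+ 2 <= mS j w * mDD j w by exact: sum_cs.
    have := sqr_ge0 (mL j w - mDD j w); nra.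
  rewrite ExD; [|by apply: am_add => //; exact: am_scale|by apply: am_add; exact: am_scale].
  rewrite !ExD//; [|exact: am_scale|exact: am_scale|exact: am_scale].
  rewrite (Ex_scale 4)// (Ex_scale 8)// (Ex_scale 3)// (@Ex_mL j (mS j))//.
    2: exact: mS_ad.
  rewrite mulr0 addr0.
  have s2 := @step2 (pi j) (pi j.+1) (A j) (mS j) (pi_ge j) (pi_mono j) (pi_le j.+1)
    (@FA j) (@mS_ad j) aS (mS_ge0 j).
  have s4 := @step4 (pi j) (pi j.+1) (A j) (cst 1) (pi_ge j) (pi_mono j) (pi_le j.+1)
    (@FA j) (@adapted_cst _ _ _ _ P t W (pi j) 1) (am_cst P 1) (fun=> ler01).
  rewrite -addrA lerD2l lerD//.
    by rewrite (_ : 64 = 8 * 8 :> R) -?mulrA ?ler_pM2l//; ring.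
  by rewrite (_ : 192 = 3 * 64 :> R) -?mulrA ?ler_pM2l//; ring.
have h2 := mart_mixed j.
have h3 : Ex (fun w => mQ j w ^+ 2) + Ex (fun w => 1 * mrho j w ^+ 2) <= Ex (fun w => mQ j.+1 w ^+ 2).
  rewrite -ExD; [|exact: am_exp|by apply: am_scale; exact: am_exp].
  apply: Ex_le; [|exact/am_exp/mQ_am|].
    by apply: am_add; [exact: am_exp|by apply: am_scale; exact: am_exp].
  move=> w; rewrite mQS mul1r.
  have := mulr_ge0 (mQ_ge0 j w) (mrho_ge0 j w); nra.
lra.
Qed.

(** Young's inequality absorbs half of the fourth moment, which is finite, into the left side;
    [4480 = 2 * (2048 + 192)]. *)
Lemma mart4' j : Ex (fun w => mS j w ^+ 2) <= 4480 * Ex (fun w => mQ j w ^+ 2).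
Proof.
have h := mart4 j; have aQ := mQ_am j; have aS := mS_am j.
have : 64 * Ex (fun w => mS j w * mQ j w) <=
  2^-1 * Ex (fun w => mS j w ^+ 2) + 2048 * Ex (fun w => mQ j w ^+ 2).
  have b1 : am (fun w => mS j w * mQ j w) by exact: am_mul.
  have b2 : am (fun w => mS j w ^+ 2) by exact: am_exp.
  have b3 : am (fun w => mQ j w ^+ 2) by exact: am_exp.
  rewrite -!Ex_scale// -ExD; [|exact: am_scale|exact: am_scale].
  apply: Ex_le; [exact: am_scale|by apply: am_add; exact: am_scale|].
  by move=> w; have := sqr_ge0 (mS j w - 64 * mQ j w); nra.
lra.
Qed.

Lemma mart_moment j m : (0 < m <= 2)%N ->
  Ex (fun w => mS j w ^+ m) <= mart_const R * Ex (fun w => mQ j w ^+ m).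
Proof.
rewrite /mart_const -lock; case: m => [//|[|[|//]]] _; last exact: mart4'.
rewrite (_ : (fun _ => _ ^+ _) = mS j)// (_ : (fun w => mQ j w ^+ _) = mQ j)//.
apply: (le_trans (mart2 j)); rewrite ler_wpM2r ?Ex_ge0//; last by lra.
by move=> w; exact: mQ_ge0.
Qed.

End martingale.

Section stopping.
Context (A : nat -> 'I_n -> set Om).
Hypothesis FA : forall j k, F (pi j) (A j k).
Context (m : R) (m0 : 0 <= m).

(** The index is [j.+1]: the bracket counted here includes the step about to be made, so the stopped
    bracket never overshoots [m], while predictability keeps the stopped events in the past. *)
Definition stop_set j : set Om := [set w | mQ A j.+1 w <= m].
Definition stopped j k : set Om := A j k `&` stop_set j.

Lemma stopped_F j k : F (pi j) (stopped j k).
Proof.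
apply: (@measurableI _ (g_sigma_algebraType (wiener_gen P t W (pi j)))); first exact: FA.
have := @mQ_ad A FA j measurableT `]-oo, m]%classic (measurable_itv _).
rewrite setTI; congr (measurable _); apply/seteqP; split => w /=; by rewrite in_itv.
Qed.

Lemma stop_indicE j k w : \1_(stopped j k) w = \1_(A j k) w * (mQ A j.+1 w <= m)%R%:R :> R.
Proof.
rewrite /stopped indicI !indicE; congr (_ * (nat_of_bool _)%:R).
by apply/idP/idP => [/set_mem//|h]; apply/mem_set.
Qed.

Lemma mrho_stopped j w : mrho stopped j w = (mQ A j.+1 w <= m)%R%:R * mrho A j w.
Proof.
have h k := stop_indicE j k w.
rewrite /mrho /drho mulrCA; congr (_ * _).
rewrite mulr_sumr; apply: eq_bigr => v _; rewrite /eta.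
case: (mQ A j.+1 w <= m) h => h.
  by rewrite mul1r; congr (`|_| ^+ 2); apply: eq_bigr => k _; rewrite h mulr1.
rewrite mul0r big1 ?normr0 ?expr0n// => k _.
by rewrite h mulr0 mul0r scale0r.
Qed.

Lemma mQ_stopped j w : mQ stopped j w <= Num.min (mQ A j w) m.
Proof.
elim: j => [|j]; first by rewrite /mQ !big_ord0 le_min lexx.
rewrite !mQS mrho_stopped le_min => /andP[h1 h2].
have [h|h] := leP (mQ A j.+1 w) m.
  rewrite mul1r; move: h; rewrite mQS => h.
  by rewrite le_min lerD2r h1/= (le_trans _ h)// lerD2r.
by rewrite mul0r addr0 le_min h2 (le_trans h1)//= lerDl mrho_ge0.
Qed.

Lemma mQ_mono i j w : (i <= j)%N -> mQ A i w <= mQ A j w.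
Proof.
elim: j => [|j ih]; first by rewrite leqn0 => /eqP ->.
rewrite leq_eqVlt => /predU1P[->//|/ih h]; apply: (le_trans h).
by rewrite mQS lerDl mrho_ge0.
Qed.

Lemma mS_stopped j w : mQ A j w <= m -> mS stopped j w = mS A j w.
Proof.
move=> hj; apply: eq_bigr => v _; congr (_ ^+ 2); apply: eq_bigr => i _.
apply: eq_bigr => k _; rewrite stop_indicE.
by rewrite (le_trans (mQ_mono w (ltn_ord i)) hj) mulr1.
Qed.

(** Where the bracket is at most [m], the stopped and the original sums agree, and the stopped
    bracket is at most the minimum everywhere. The moment bound is applied to the stopped
    martingale. *)
Lemma stopped_moment j p : (0 < p <= 2)%N ->
  Ex (fun w => (mQ A j w <= m)%R%:R * mS A j w ^+ p) <=
  mart_const R * Ex (fun w => Num.min (mQ A j w) m ^+ p).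
Proof.
move=> p12.
have mQm : measurable_fun setT (mQ A j) by apply: am_meas; exact: mQ_am.
have mmin : measurable_fun setT (fun w => Num.min (mQ A j w) m).
  by apply: measurable_minr => //; exact: measurable_cst.
have min0 w : 0 <= Num.min (mQ A j w) m by rewrite le_min m0 mQ_ge0.
have amin : am (fun w => Num.min (mQ A j w) m).
  apply: (@am_bounded _ _ _ _ _ m) => // w.
  by rewrite ger0_norm// ge_min lexx orbT.
have h := mart_moment stopped_F j p12.
apply: (@le_trans _ _ (mart_const R * Ex (fun w => mQ stopped j w ^+ p))).
  apply: le_trans h; apply: Ex_le.
  - apply: am_mul; last exact/am_exp/mS_am.
    apply: (@am_bounded _ _ _ _ _ 1); last first.
      by move=> w; case: (mQ A j w <= m); rewrite ?normr1 ?normr0.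
    rewrite (_ : (fun _ => _) = \1_([set w | mQ A j w <= m])).
      apply: measurable_indic; rewrite -[X in measurable X]setTI.
      have := mQm measurableT `]-oo, m]%classic (measurable_itv _).
      by congr (measurable _); apply/seteqP; split => w /=; rewrite in_itv.
    apply/funext => w; rewrite indicE; congr (nat_of_bool _)%:R.
    by apply/idP/idP => [h'|/set_mem//]; apply/mem_set.
  - by apply/am_exp/mS_am; exact: stopped_F.
  - move=> w; have [hj|hj] := leP (mQ A j w) m.
      by rewrite mul1r mS_stopped.
    by rewrite mul0r exprn_ge0// mS_ge0.
apply: ler_wpM2l; [exact: mart_const_ge0|apply: Ex_le].
- by apply/am_exp/mQ_am; exact: stopped_F.
- exact: am_exp.
- by move=> w; rewrite lerXn2r ?nnegrE// ?mQ_ge0// mQ_stopped.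
Qed.

End stopping.
End discrete.


Section integral_monotone.
Context (d : measure_display) (T : measurableType d) (R : realType).
Context (mu : {measure set T -> \bar R}).

(* Unlike [ge0_le_integral], no measurability: the integral of a nonnegative
   function is a supremum over the simple functions below it. *)
Lemma ge0_integral_mono (D : set T) (f1 f2 : T -> \bar R) :
  (forall x, D x -> (0 <= f1 x)%E) -> (forall x, D x -> (f1 x <= f2 x)%E) ->
  (\int[mu]_(x in D) f1 x <= \int[mu]_(x in D) f2 x)%E.
Proof.
move=> f0 f12; rewrite !ge0_integralE//; last first.
  by move=> x Dx; exact: le_trans (f0 x Dx) (f12 x Dx).
apply: le_ereal_sup => _ [h hf <-]; exists h => // x.
apply: le_trans (hf x) _; rewrite !patchE; case: ifPn => // /set_mem.
exact: f12.
Qed.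

End integral_monotone.

(** * Elementary integrals as discrete martingales *)

Section elementary.
Context (R : realType) (H Xi : hilbertType R) (E : onb Xi).
Context (d : measure_display) (Om : measurableType d) (P : probability Om R).
Context (t T : R) (W : R -> Xi -> Om -> R).
Hypothesis hW : reference_space P t T W.
Context (B : {linear H -> H}) (hB : psd B).
Local Notation N := (norm_m1 B).
Local Notation mu := (@lebesgue_measure R).
Local Notation am := (all_moments P).

Lemma lebesgue_measure_oc (x y : R) : x <= y -> mu `]x, y]%classic = (y - x)%:E.
Proof.
move=> xy; rewrite lebesgue_measure_itv/= lte_fin.
by move: xy; rewrite le_eqVlt => /predU1P[->|->]; rewrite ?ltxx ?subrr ?EFinB.
Qed.

Lemma parseval_sum_le (u : seq H) (y : H -> Xi) :
  ((\sum_(v <- u) `|y v| ^+ 2)%:E <=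
   \esum_(e in E) (\sum_(v <- u) hdot e (y v) ^+ 2)%:E)%E.
Proof.
elim: u => [|v u ih].
  by rewrite big_nil; apply: esum_ge0 => e _; rewrite big_nil.
rewrite big_cons EFinD (_ : esum _ _ = \esum_(e in E)
  ((hdot e (y v) ^+ 2)%:E + (\sum_(j <- u) hdot e (y j) ^+ 2)%:E)%E); last first.
  by apply: eq_esum => e _; rewrite big_cons EFinD.
rewrite esumD; first by apply: leeD => //; exact: parseval_le.
- by move=> e _; rewrite lee_fin sqr_ge0.
- by move=> e _; rewrite lee_fin sumr_ge0// => j _; rewrite sqr_ge0.
Qed.

(** The given points together with [t] and [s], sorted. Past the end of the list [nth] returns its
    default [s], so the grid is monotone on all of [nat]; repeated points give degenerate cells. *)
Lemma time_grid (s : R) (pts0 : seq R) : t <= s ->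
  (forall x, x \in pts0 -> t <= x <= s) ->
  exists (n : nat) (pi : nat -> R),
    [/\ forall j, t <= pi j <= s, forall j, pi j <= pi j.+1,
        pi 0%N = t, pi n = s & forall x j, x \in pts0 -> x <= pi j \/ pi j.+1 <= x].
Proof.
move=> ts hpts.
pose pts := sort <=%O (t :: s :: pts0).
have mem x : (x \in pts) = (x \in t :: s :: pts0) by rewrite mem_sort.
have bd x : x \in pts -> t <= x <= s.
  by rewrite mem !inE => /or3P[/eqP->|/eqP->|/hpts//]; rewrite ?lexx ?ts.
have srt : sorted <=%O pts by exact/sort_sorted/le_total.
pose pi := nth s pts.
have bpi j : t <= pi j <= s.
  have [jn|jn] := ltnP j (size pts); first by apply: bd; rewrite mem_nth.
  by rewrite /pi nth_default// lexx ts.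
have mono i j : (i <= j)%N -> pi i <= pi j.
  move=> ij; have [jn|jn] := ltnP j (size pts).
    by apply: le_sorted_leq_nth => //; rewrite inE//; exact: leq_ltn_trans jn.
  by rewrite [pi j]nth_default//; have /andP[] := bpi i.
exists (size pts), pi; split.
- exact: bpi.
- by move=> j; exact: mono.
- apply/eqP; rewrite eq_le; have /andP[-> _] := bpi 0%N; rewrite andbT.
  have tp : t \in pts by rewrite mem inE eqxx.
  by rewrite -[leRHS](nth_index s tp); exact: mono.
- by rewrite /pi nth_default.
- move=> x j xp; have xpts : x \in pts by rewrite mem !inE xp !orbT.
  have px : pi (index x pts) = x by exact: nth_index.
  have [ij|ij] := leqP (index x pts) j; [left|right]; rewrite -px; exact: mono.
Qed.

(** On a grid that contains all jump times, and in the coordinates of [gram_schmidt], the elementary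
    integral is a discrete martingale with bracket [q]. Parseval's inequality bounds the bracket by
    the integral of the squared Hilbert-Schmidt seminorms. *)
Lemma elem_moment (s : R) (Z : elem_process Xi Om H) : t <= s <= T ->
  ep_adapted (wiener_filtration P W t) t s Z ->
  measurable_fun setT (fun w => N (ep_int W Z w)) /\
  exists q : Om -> R,
    [/\ measurable_fun setT q, forall w, 0 <= q w,
      forall w, ((q w)%:E <= \int[mu]_(r in `[t, s]) hs_sum E N (ep_eval Z r w))%E
      & forall m p, 0 <= m -> (0 < p <= 2)%N ->
        (\int[P]_w ((q w <= m)%R%:R * (N (ep_int W Z w) ^+ 2) ^+ p)%:E <=
         (mart_const R)%:E * \int[P]_w (Num.min (q w) m ^+ p)%:E)%E].
Proof.
move=> /andP[ts sT] hZ.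
pose n := ep_size Z.
have [u hu] := gram_schmidt (@ep_h _ _ _ _ _ Z) hB.
pose a (v : H) (k : 'I_n) := psd_form B v (ep_h k).
have [] := @time_grid s (codom (@ep_lo _ _ _ _ _ Z) ++ codom (@ep_hi _ _ _ _ _ Z)) ts.
  move=> x; rewrite mem_cat => /orP[] /codomP[k ->]; have [h1 h2 h3 _] := hZ k.
    by rewrite h1 (le_trans h2 h3).
  by rewrite h3 (le_trans h1 h2).
move=> N0 [pi [pits pim pi0 piN gap]].
have pit j : t <= pi j by have /andP[] := pits j.
have pis j : pi j <= s by have /andP[] := pits j.
have piT j : pi j <= T by rewrite (le_trans (pis j)).
have gaplo (k : 'I_n) j : ep_lo k <= pi j \/ pi j.+1 <= ep_lo k.
  by apply: gap; rewrite mem_cat codom_f.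
have gaphi (k : 'I_n) j : ep_hi k <= pi j \/ pi j.+1 <= ep_hi k.
  by apply: gap; rewrite mem_cat codom_f orbT.
(* On a nondegenerate cell the [k]-th term is present throughout or absent; an absent term is given
   the empty event. *)
pose act j (k : 'I_n) := (ep_lo k <= pi j) && (pi j.+1 <= ep_hi k).
pose A j (k : 'I_n) : set Om := if act j k then ep_ev k else set0.
have FA j k : wiener_filtration P W t (pi j) (A j k).
  rewrite /A /act; case: ifPn => [/andP[h _]|_].
    by have [_ _ _] := hZ k; exact: filtration_mono.
  exact: (@measurable0 _ (g_sigma_algebraType (wiener_gen P t W (pi j)))).
have AE j k w : \1_(A j k) w = (act j k)%:R * \1_(ep_ev k) w :> R.
  by rewrite /A; case: (act j k); rewrite ?mul1r ?mul0r// indic0.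
have tel (k : 'I_n) (w : Om) : \sum_(i < N0) (act i k)%:R * incr W (pi i) (pi i.+1) (ep_xi k) w
    = W (ep_hi k) (ep_xi k) w - W (ep_lo k) (ep_xi k) w.
  have [h1 h2 h3 _] := hZ k.
  (* Clamping the grid to the interval of the [k]-th term makes the sum over active cells telescope.
     The four cases include the degenerate cells, where both sides vanish. *)
  pose cl x := Num.max (ep_lo k) (Num.min (ep_hi k) x).
  pose f x := W (cl x) (ep_xi k) w.
  rewrite (eq_bigr (fun i : 'I_N0 => f (pi i.+1) - f (pi i))) => [|i _]; last first.
    have := pim i; rewrite /act /f /incr.
    have [l1|l1] := gaplo k i; have [l2|l2] := gaphi k i => l3.
    - have -> : cl (pi i) = ep_hi k.
        by rewrite /cl (min_idPl l2) (max_idPr h2).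
      have -> : cl (pi i.+1) = ep_hi k.
        by rewrite /cl (min_idPl (le_trans l2 l3)) (max_idPr h2).
      rewrite l1/= subrr; have [l4|] := leP; last by rewrite mul0r.
      have -> : pi i.+1 = pi i by apply/eqP; rewrite eq_le l3 (le_trans l4 l2).
      by rewrite subrr mulr0.
    - have -> : cl (pi i) = pi i.
        by rewrite /cl (min_idPr (le_trans l3 l2)) (max_idPr l1).
      have -> : cl (pi i.+1) = pi i.+1.
        by rewrite /cl (min_idPr l2) (max_idPr (le_trans l1 l3)).
      by rewrite l1 l2 mul1r.
    - have hl : ep_hi k = ep_lo k.
        by apply/eqP; rewrite eq_le h2 andbT (le_trans l2)// (le_trans l3).
      have -> : cl (pi i) = ep_hi k.
        by rewrite /cl (min_idPl l2) (max_idPr h2).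
      have -> : cl (pi i.+1) = ep_hi k.
        by rewrite /cl (min_idPl (le_trans l2 l3)) (max_idPr h2).
      have -> : pi i.+1 = pi i.
        by apply/eqP; rewrite eq_le l3 andbT (le_trans l1)// -hl.
      by rewrite !subrr mulr0.
    - have -> : cl (pi i) = ep_lo k.
        by rewrite /cl (max_idPl _)// ge_min (le_trans l3 l1) orbT.
      have -> : cl (pi i.+1) = ep_lo k.
        by rewrite /cl (max_idPl _)// ge_min l1 orbT.
      rewrite subrr; case: (leP (ep_lo k) (pi i)) => [l4|]; last by rewrite mul0r.
      have -> : pi i.+1 = pi i by apply/eqP; rewrite eq_le l3 (le_trans l1 l4).
      by rewrite subrr mulr0.
  rewrite (big_mkord xpredT (fun i => f (pi i.+1) - f (pi i))) || rewrite -(big_mkord xpredT (fun i => f (pi i.+1) - f (pi i))).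
  rewrite telescope_sumr// /f pi0 piN /cl (min_idPl h3) (max_idPr h2).
  by rewrite (min_idPr (le_trans h1 h2)) (max_idPl h1).
pose xi (k : 'I_n) := ep_xi k.
pose x (w : Om) (k : 'I_n) : R := \1_(ep_ev k) w * (W (ep_hi k) (xi k) w - W (ep_lo k) (xi k) w).
have ME v w : mM W xi a pi A N0 v w = \sum_(k < n) x w k * a v k.
  rewrite /mM /mD /dlin exchange_big/=; apply: eq_bigr => k _.
  rewrite /x -tel mulr_sumr mulr_suml; apply: eq_bigr => i _.
  by rewrite AE; ring.
have NE w : N (ep_int W Z w) ^+ 2 = mS W xi u a pi A N0 w.
  rewrite /ep_int hu /mS; apply: eq_bigr => v _; rewrite ME form_sumr//.
  by congr (_ ^+ 2); apply: eq_bigr => k _; rewrite formZr.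
have mN : measurable_fun setT (fun w => N (ep_int W Z w)).
  rewrite (_ : (fun _ => _) = fun w => Num.sqrt (mS W xi u a pi A N0 w)); last first.
    by apply/funext => w; rewrite -NE sqrtr_sqr ger0_norm// norm_m1_ge0.
  apply: measurableT_comp.
    by apply: continuous_measurable_fun; exact: sqrt_continuous.
  by apply: am_meas; exact: (mS_am hW).
split => //; exists (mQ xi u a pi A N0); split.
- by apply: am_meas; exact: (mQ_am hW).
- by move=> w; exact: mQ_ge0.
- move=> w; pose c j k : R := \1_(A j k) w.
  pose C j := \sum_(v <- u) `|eta xi a (c j) v| ^+ 2.
  have C0 j : 0 <= C j by apply: sumr_ge0 => v _; exact: sqr_ge0.
  (* Inside a cell the integrand is constant in time, and its squared seminorm at [e] is a sum of
     squared coordinates against the vectors [eta]. *)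
  have evE j r e : pi j < r -> r <= pi j.+1 ->
      N (ep_eval Z r w e) ^+ 2 = \sum_(v <- u) hdot e (eta xi a (c j) v) ^+ 2.
    move=> jr rj; rewrite /ep_eval hu; apply: eq_bigr => v _; congr (_ ^+ 2).
    rewrite form_sumr// /eta hdot_sumr; apply: eq_bigr => k _.
    rewrite formZr// hdotZr /c AE /a.
    have -> : \1_(`]ep_lo k, ep_hi k]) r = (act j k)%:R :> R.
      rewrite indicE; congr (nat_of_bool _)%:R; apply/idP/idP.
        move/set_mem => /=; rewrite in_itv/= => /andP[l1 l2]; rewrite /act.
        have [->|l3] := gaplo k j; last by move: (le_lt_trans rj (le_lt_trans l3 l1)); rewrite ltxx.
        have [l3|->//] := gaphi k j.
        by move: (lt_le_trans jr (le_trans l2 l3)); rewrite ltxx.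
      move=> /andP[l1 l2]; apply/mem_set; rewrite /= in_itv/=.
      by rewrite (le_lt_trans l1 jr) (le_trans rj l2).
    by rewrite /xi; ring.
  have -> : ((mQ xi u a pi A N0 w)%:E = \int[mu]_(r in `[t, s])
      \sum_(j < N0) (C j * \1_(`]pi j, pi j.+1]) r)%:E)%E.
    rewrite ge0_integral_sum//; last 2 first.
    - by move=> j; apply/measurable_EFinP; apply: measurable_funM.
    - by move=> j r _; rewrite lee_fin mulr_ge0.
    rewrite /mQ -sumEFin; apply: eq_bigr => j _.
    under eq_integral do rewrite EFinM.
    rewrite ge0_integralZl//; last 2 first.
    - by apply/measurable_EFinP; apply: measurable_indic; exact: measurable_itv.
    - by rewrite lee_fin.
    rewrite integral_indic// (_ : _ `&` _ = `]pi j, pi j.+1]%classic); last first.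
      apply/seteqP; split => r /=; first by move=> [].
      rewrite !in_itv/= => /andP[l1 l2]; split; first by rewrite l1 l2.
      by rewrite (le_trans (pit j) (ltW l1)) (le_trans l2 (pis _)).
    transitivity ((C j)%:E * (pi j.+1 - pi j)%:E)%E.
      by rewrite -EFinM mulrC.
    by congr (_ * _)%E; apply/esym; exact: lebesgue_measure_oc.
  apply: ge0_integral_mono => r.
    by move=> _; apply: sume_ge0 => j _; rewrite lee_fin mulr_ge0.
  move=> _; have [[j /andP[jr rj]]|h] :=
      pselect (exists j : 'I_N0, (pi j < r) && (r <= pi j.+1)); last first.
    rewrite big1; first exact: hs_sum_nneg.
    move=> j _; rewrite indicE memNset ?mulr0// => /=; rewrite in_itv/= => hj.
    by apply: h; exists j.
  rewrite (bigD1 j)//= [X in (_ + X)%E]big1 ?adde0 => [|i ij]; last first.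
    rewrite indicE memNset ?mulr0// => /=; rewrite in_itv/= => /andP[ir ri].
    have /orP[lij|lij] : (i < j)%N || (j < i)%N by rewrite -neq_ltn.
      by move: (le_lt_trans ri (le_lt_trans (pi_mono_le pim lij) jr)); rewrite ltxx.
    by move: (le_lt_trans rj (le_lt_trans (pi_mono_le pim lij) ir)); rewrite ltxx.
  rewrite indicE mem_set/= ?in_itv/= ?jr// mulr1.
  rewrite /hs_sum (eq_esum (fun e _ => congr1 EFin (evE j r e jr rj))).
  exact: parseval_sum_le.
- move=> m p m0 p12.
  have := stopped_moment hW xi u a pit pim piT FA m0 N0 p12.
  rewrite -lee_fin [X in (_ <= X)%E]EFinM -!ExE.
  + by under eq_integral do rewrite -NE.
  + apply: am_exp; apply: (@am_bounded _ _ _ _ _ m).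
      apply: measurable_minr; last exact: measurable_cst.
      by apply: am_meas; exact: (mQ_am hW).
    by move=> w; rewrite ger0_norm ?ge_min ?lexx ?orbT// le_min m0 mQ_ge0.
  + apply: am_mul; last by apply: am_exp; exact: (mS_am hW).
    apply: (@am_bounded _ _ _ _ _ 1); last first.
      by move=> w; case: (_ <= m); rewrite ?normr1 ?normr0.
    rewrite (_ : (fun _ => _) = \1_([set w | mQ xi u a pi A N0 w <= m])).
      apply: measurable_indic; rewrite -[X in measurable X]setTI.
      have mq : measurable_fun setT (mQ xi u a pi A N0) by apply: am_meas; exact: (mQ_am hW).
      have := mq measurableT `]-oo, m]%classic (measurable_itv _).
      by congr (measurable _); apply/seteqP; split => w /=; rewrite in_itv.
    apply/funext => w; rewrite indicE; congr (nat_of_bool _)%:R.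
    by apply/idP/idP => [h'|/set_mem//]; apply/mem_set.
Qed.

End elementary.

(** * Borel measurability and Tonelli's theorem on time strips *)

Section borel_fun.
Context (R : realType) (d : measure_display) (T : measurableType d).

(* Borel measurability of a function on [D] with values in a topological space
   that carries no canonical measurable structure. *)
Definition borel_fun (Y : topologicalType) (D : set T) (f : T -> Y) :=
  forall U : set Y, open U -> measurable (D `&` f @^-1` U).

Lemma bigcup_countable_measurable (I : Type) (D : set I) (F : I -> set T) :
  countable D -> (forall i, D i -> measurable (F i)) ->
  measurable (\bigcup_(i in D) F i).
Proof.
move=> /pfcard_geP[->|[f]] mF; first by rewrite bigcup_set0.
rewrite (_ : bigcup _ _ = \bigcup_n [set w | D (f n) /\ F (f n) w]).
  apply: bigcup_measurable => n _; have [Df|Df] := pselect (D (f n)).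
    by rewrite (_ : [set w | _] = F (f n)); [exact: mF|apply/seteqP; split => w // []].
  by rewrite (_ : [set w | _] = set0)//; apply/seteqP; split => w // [].
apply/seteqP; split => w.
  by move=> [i Di Fi]; have [n _ fn] := (@surj _ _ setT D f) i Di; exists n => //=; rewrite fn.
by move=> [n _ [Dn Fn]]; exists (f n).
Qed.

(** By separability an open set of the product is a countable union of products of balls centred in
    the dense sets, with radii [1 / (n + 1)]. *)
Lemma borel_fun_pair (Y1 Y2 : normedModType R) D (f : T -> Y1) (g : T -> Y2) :
  separable Y1 -> separable Y2 -> borel_fun D f -> borel_fun D g ->
  borel_fun D (fun w => (f w, g w)).
Proof.
move=> [D1 cD1 dD1] [D2 cD2 dD2] mf mg O oO.
pose bb (z : Y1 * Y2 * nat) : set (Y1 * Y2) :=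
  ball z.1.1 z.2.+1%:R^-1 `*` ball z.1.2 z.2.+1%:R^-1.
pose I : set (Y1 * Y2 * nat) := [set z | [/\ D1 z.1.1, D2 z.1.2 & bb z `<=` O]].
have cI : countable I.
  apply: (@sub_countable _ _ _ ((D1 `*` D2) `*` [set: nat])).
    by apply: subset_card_le => z [? ? _].
  by apply: countableX => //; exact: countableX.
rewrite (_ : _ `&` _ = \bigcup_(z in I)
    ((D `&` f @^-1` ball z.1.1 z.2.+1%:R^-1) `&` (D `&` g @^-1` ball z.1.2 z.2.+1%:R^-1))).
  apply: bigcup_countable_measurable => // z _ /=.
  by apply: measurableI; [apply: mf|apply: mg]; exact: ball_open.
apply/seteqP; split => [w [Dw /= Ow]|w [z [_ _ bO] [[Dw fb] [_ gb]]]]; last first.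
  by split => //; apply: bO.
have [e /= e0 eO] : exists2 e : R, 0 < e & ball (f w, g w) e `<=` O.
  by have := open_nbhs_nbhs (conj oO Ow); rewrite -nbhs_ballE => -[e e0 eO]; exists e.
have [n ne] : exists n : nat, 2 * n.+1%:R^-1 < e.
  have e2 : 0 < e / 2 by rewrite divr_gt0.
  have [n n1] := ltr_add_invr e2.
  by exists n; move: n1; rewrite add0r -ltr_pdivlMl// mulrC.
have n0 : 0 < n.+1%:R^-1 :> R by rewrite invr_gt0.
have [d1 [d1b Dd1]] : ball (f w) n.+1%:R^-1 `&` D1 !=set0.
  by apply: dD1; [exists (f w); exact: ballxx|exact: ball_open].
have [d2 [d2b Dd2]] : ball (g w) n.+1%:R^-1 `&` D2 !=set0.
  by apply: dD2; [exists (g w); exact: ballxx|exact: ball_open].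
exists ((d1, d2), n); last by split; split => //=; exact: ball_sym.
split => //= -[y1 y2] [/= b1 b2]; apply: eO.
have two : 2 * n.+1%:R^-1 = n.+1%:R^-1 + n.+1%:R^-1 :> R by rewrite mulr2n mulrDl mul1r.
split => /=; apply: (le_ball (ltW ne)); rewrite two.
  exact: ball_triangle d1b b1.
exact: ball_triangle d2b b2.
Qed.

(** Continuity is relative to a set in which the process takes its values, as for a running cost
    that is continuous only for controls in [Lambda0]. *)
Lemma borel_fun_comp (Y1 Y2 : topologicalType) D (f : T -> Y1)
    (A : set Y1) (h : Y1 -> Y2) : {within A, continuous h} ->
  (forall w, D w -> A (f w)) -> borel_fun D f ->
  borel_fun D (fun w => h (f w)).
Proof.
move=> /continuousP ch DA mf U oU.
have /open_subspaceP[V oV VU] := ch U oU.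
rewrite (_ : _ `&` _ = D `&` f @^-1` V); first exact: mf.
apply/seteqP; split => w [Dw] /= h1; split => //.
  by have [] : (V `&` A) (f w) by rewrite VU; split => //; exact: DA.
by have [] : (h @^-1` U `&` A) (f w) by rewrite -[_ `&` _]VU; split => //; exact: DA.
Qed.

Lemma borel_fun_continuous (Y1 Y2 : topologicalType) D (f : T -> Y1)
    (h : Y1 -> Y2) : continuous h -> borel_fun D f ->
  borel_fun D (fun w => h (f w)).
Proof.
move=> ch mf U oU; apply: (mf (h @^-1` U)).
by move/continuousP : ch; apply.
Qed.

Lemma borel_fun_measurable D (f : T -> R) : measurable D ->
  borel_fun D f -> measurable_fun D f.
Proof.
move=> mD mf; apply: (measurability (@RGenOInfty.G R)).
  exact: RGenOInfty.measurableE.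
by move=> _ [_ [x ->] <-]; apply: mf; exact: interval_open.
Qed.

Lemma borel_fun_cst (Y : topologicalType) D (y : Y) : measurable D ->
  borel_fun D (fun=> y).
Proof.
move=> mD U oU; have [Uy|Uy] := pselect (U y).
  by rewrite (_ : _ `&` _ = D)//; apply/seteqP; split => w //= [].
by rewrite (_ : _ `&` _ = set0)//; apply/seteqP; split => w //= [].
Qed.

Lemma borel_fun_add (Y : normedModType R) D (f g : T -> Y) : separable Y ->
  borel_fun D f -> borel_fun D g ->
  borel_fun D (fun w => f w + g w).
Proof.
move=> sY mf mg; apply: (borel_fun_continuous (h := fun z : Y * Y => z.1 + z.2)
  _ (borel_fun_pair sY sY mf mg)).
by move=> z; apply: cvgD; [exact: cvg_fst|exact: cvg_snd].
Qed.

Lemma borel_fun_scale (Y : normedModType R) D (f : T -> Y) c :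
  borel_fun D f -> borel_fun D (fun w => c *: f w).
Proof.
apply: borel_fun_continuous => x.
by apply: cvgZr; exact: cvg_id.
Qed.

End borel_fun.

Section tonelli.
Context (R : realType) (d : measure_display) (Om : measurableType d).
Context (P : probability Om R).
Local Notation mu := (@lebesgue_measure R).
Context (t s : R).
Let D : set (measurableTypeR R * Om) := `[t, s] `*` setT.

Lemma measurable_strip : measurable D.
Proof. exact: measurableX. Qed.

Context (f : R -> Om -> \bar R).
Hypothesis mf : measurable_fun D (fun z => f z.1 z.2).
Hypothesis f0 : forall r w, t <= r <= s -> (0 <= f r w)%E.

(** Extension by zero outside the strip, so that Tonelli's theorem on the full product applies. *)
Let g (z : measurableTypeR R * Om) : \bar R := ((fun z => f z.1 z.2) \_ D) z.

Let mg : measurable_fun setT g.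
Proof. by apply/(measurable_restrictT _ measurable_strip). Qed.

Let g0 z : (0 <= g z)%E.
Proof.
rewrite /g patchE; case: ifPn => // /set_mem[/=]; rewrite in_itv/= => h _.
exact: f0.
Qed.

Let gE r w : g (r, w) = ((f ^~ w) \_ `[t, s]) r.
Proof.
rewrite /g !patchE; congr (if _ then _ else _).
apply/idP/idP => /set_mem h; apply/mem_set; first by case: h.
by split.
Qed.

Let gE2 r w : t <= r <= s -> g (r, w) = f r w.
Proof. by move=> h; rewrite gE patchE mem_set//= in_itv. Qed.

Lemma tonelli_time : (\int[P]_w \int[mu]_(r in `[t, s]) f r w =
  \int[mu]_(r in `[t, s]) \int[P]_w f r w)%E.
Proof.
have -> : (\int[P]_w \int[mu]_(r in `[t, s]) f r w = \int[P]_w \int[mu]_r g (r, w))%E.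
  apply: eq_integral => w _; rewrite integral_mkcond; apply: eq_integral => r _.
  by rewrite gE.
rewrite -(@fubini_tonelli _ _ _ _ _ mu P g)// [RHS]integral_mkcond.
apply: eq_integral => r _; rewrite patchE; case: ifPn => [/set_mem/=|/negP rn].
  by rewrite in_itv/= => h; apply: eq_integral => w _; rewrite gE2.
rewrite integral0_eq// => w _; rewrite gE patchE ifF//.
exact/negP.
Qed.

Lemma measurable_time_integral :
  measurable_fun setT (fun w => \int[mu]_(r in `[t, s]) f r w)%E.
Proof.
rewrite (_ : (fun _ => _) = fun w => \int[mu]_r g (r, w))%E.
  exact: (measurable_fun_fubini_tonelli_G g mg g0).
apply/funext => w; rewrite integral_mkcond; apply: eq_integral => r _.
by rewrite gE.
Qed.

Lemma measurable_expect_integral :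
  measurable_fun (`[t, s] : set (measurableTypeR R)) (fun r => \int[P]_w f r w)%E.
Proof.
apply: (eq_measurable_fun (fun r => \int[P]_w g (r, w))%E).
  move=> r /set_mem/=; rewrite in_itv/= => h.
  by apply: eq_integral => w _; rewrite gE2.
apply: measurable_funTS.
exact: (measurable_fun_fubini_tonelli_F g mg g0).
Qed.

Lemma measurable_section_expect r : t <= r <= s -> measurable_fun setT (f r).
Proof.
move=> h; rewrite (_ : f r = fun w => g (r, w)); last by apply/funext => w; rewrite gE2.
exact: measurableT_comp.
Qed.

Lemma measurable_section_time w :
  measurable_fun (`[t, s] : set (measurableTypeR R)) (f ^~ w).
Proof.
apply: (eq_measurable_fun (fun r => g (r, w))).
  by move=> r /set_mem/=; rewrite in_itv/= => h; rewrite gE2.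
by apply: measurable_funTS; exact: measurableT_comp.
Qed.

End tonelli.

Section progressive.
Context (R : realType) (Xi : hilbertType R).
Context (d : measure_display) (Om : measurableType d) (P : probability Om R).
Context (t T : R) (W : R -> Xi -> Om -> R).
Hypothesis hW : reference_space P t T W.

(** Progressive measurability at the final time gives a set generated by rectangles whose second
    sides lie in the filtration, hence a set of the product sigma-algebra. *)
Lemma progressive_borel_fun (Y : topologicalType) s (f : R -> Om -> Y) :
  t <= s <= T -> progressive (wiener_filtration P W t) t s f ->
  borel_fun (`[t, s] `*` setT : set (measurableTypeR R * Om)) (fun z => f z.1 z.2).
Proof.
move=> /andP[ts sT] pf U oU.
have := pf s; rewrite ts lexx => /(_ isT U oU) + .
rewrite (_ : [set z : R * Om | U (f z.1 z.2)] = (fun z => f z.1 z.2) @^-1` U)//.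
have mD : measurable (`[t, s] `*` setT : set (measurableTypeR R * Om)).
  exact: measurableX.
pose M : set (set (measurableTypeR R * Om)) := [set A | measurable A].
move=> hgen; suff : M (((`[t, s] `*` setT) `&` (fun z : measurableTypeR R * Om => f z.1 z.2) @^-1` U)) by [].
move: hgen; apply; split.
  split.
  - exact: measurable0.
  - by move=> C mC; exact: measurableD.
  - by move=> C mC; apply: bigcup_measurable => k _; exact: mC.
move=> _ [I [C [mI _ FC ->]]]; apply: measurableX; first exact: mI.
exact: (filtration_measurable hW sT).
Qed.

End progressive.

Lemma exprD_le (R : realType) (x y : R) n : 0 <= x -> 0 <= y ->
  (x + y) ^+ n <= 2 ^+ n * (x ^+ n + y ^+ n).
Proof.
move=> x0 y0; have [xy|yx] := leP x y.
  apply: (@le_trans _ _ ((2 * y) ^+ n)).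
    by rewrite lerXn2r ?nnegrE ?addr_ge0 ?mulr_ge0//; lra.
  by rewrite exprMn ler_wpM2l ?exprn_ge0// lerDr exprn_ge0.
apply: (@le_trans _ _ ((2 * x) ^+ n)).
  by rewrite lerXn2r ?nnegrE ?addr_ge0 ?mulr_ge0//; lra.
by rewrite exprMn ler_wpM2l ?exprn_ge0// lerDl exprn_ge0.
Qed.

Section countable_esum.
Context (R : realType) (d : measure_display) (T : measurableType d).

(** A sum over a set is a supremum over its finite subsets. Reindexing a countable set by a subset
    of [nat] turns it into a series of measurable functions. *)
Lemma esum_countable_measurable (I : choiceType) (E : set I) (D : set T)
    (a : T -> I -> \bar R) : measurable D -> countable E ->
  (forall z i, (0 <= a z i)%E) -> (forall i, E i -> measurable_fun D (a ^~ i)) ->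
  measurable_fun D (fun z => \esum_(i in E) a z i).
Proof.
move=> mD /pfcard_geP[E0|[f]] a0 ma.
  rewrite (_ : (fun _ => _) = cst 0%E); first exact: measurable_cst.
  by apply/funext => z; rewrite E0 esum_set0.
have ex i : exists n, E i -> f n = i.
  have [Ei|nEi] := pselect (E i); last by exists 0%N.
  by have [n _ fn] := (@surj _ _ setT E f) i Ei; exists n.
have [g hg] := choice ex.
pose Q : set nat := g @` E.
have bij : set_bij Q E f.
  split.
  - by move=> n [i Ei <-]; rewrite /= hg.
  - by move=> m n /set_mem[i Ei <-] /set_mem[j Ej <-]; rewrite !hg// => ->.
  - by move=> i Ei; exists (g i); [exists i|rewrite hg].
rewrite (_ : (fun _ => _) = fun z => (\sum_(n <oo | n \in Q) a z (f n))%E).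
  apply: (ge0_emeasurable_sum (P := mem Q) (h := fun n z => a z (f n))) => //.
  by move=> n /set_mem[i Ei <-]; rewrite hg//; exact: ma.
apply/funext => z; rewrite (reindex_esum Q _ f)// nneseries_esum//.
by congr esum; apply/seteqP; split => n /=; [move/mem_set|move/set_mem].
Qed.

Lemma hs_sum_measurable (Xi : hilbertType R) (E : set Xi) (V : topologicalType)
    (N : V -> R) (D : set T) (Phi : T -> Xi -> V) : measurable D -> countable E ->
  continuous N -> (forall e, E e -> borel_fun D (Phi ^~ e)) ->
  measurable_fun D (fun z => hs_sum E N (Phi z)).
Proof.
move=> mD cE cN mPhi; apply: esum_countable_measurable => //.
  by move=> z e; rewrite lee_fin sqr_ge0.
move=> e Ee; apply/measurable_EFinP; apply: measurable_funX.
apply: borel_fun_measurable => //.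
by apply: borel_fun_continuous; [exact: cN|exact: mPhi].
Qed.

End countable_esum.

(** * The Ito integral and its localized moment bounds *)

Section ito.
Context (R : realType) (H Xi : hilbertType R) (E : onb Xi).
Hypothesis sepH : separable H.
Hypothesis sepXi : separable Xi.
Context (d : measure_display) (Om : measurableType d) (P : probability Om R).
Context (t T : R) (W : R -> Xi -> Om -> R).
Hypothesis hW : reference_space P t T W.
Local Notation mu := (@lebesgue_measure R).
Local Notation F := (wiener_filtration P W t).
Local Notation strip s := (`[t, s] `*` setT : set (measurableTypeR R * Om)).
Local Notation nH := (@Num.norm R H).

(** Progressive measurability is relaxed to measurability on the strip, a property that
    [borel_fun_add] and [borel_fun_scale] carry over to linear combinations of integrands. *)
Record ito_lim (s : R) (Phi : R -> Om -> Xi -> H) (I : Om -> H) : Prop := {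
  ito_meas : forall e, borel_fun (strip s) (fun z => Phi z.1 z.2 e);
  ito_meas_lim : borel_fun setT I;
  ito_approx : exists Z : nat -> elem_process Xi Om H,
      [/\ forall n, ep_adapted F t s (Z n),
          forall eps : R, 0 < eps ->
            P [set w | (eps%:E < \int[mu]_(r in `[t, s])
                 hs_sum E nH (fun e => (Phi r w e - ep_eval (Z n) r w e)%R))%E]
              @[n --> \oo] --> 0%E
        & forall eps : R, 0 < eps ->
            P [set w | eps < `|I w - ep_int W (Z n) w|] @[n --> \oo] --> 0%E] }.

Lemma ito_integral_lim s Phi I : t <= s <= T ->
  is_ito_integral P E W t s Phi I -> ito_lim s Phi I.
Proof.
move=> tsT [pPhi mI hZ]; split => //.
  by move=> e; exact: (progressive_borel_fun hW tsT (pPhi e)).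
by move=> U oU; rewrite setTI; exact: mI.
Qed.

Lemma ep_eval_borel s (Z : elem_process Xi Om H) e : t <= s <= T -> ep_adapted F t s Z ->
  borel_fun (strip s) (fun z => ep_eval Z z.1 z.2 e).
Proof.
move=> /andP[ts sT] hZ.
have mD : measurable (strip s) by exact: measurableX.
have mev k : measurable (@ep_ev _ _ _ _ _ Z k).
  have [_ h2 h3 Fk] := hZ k.
  by apply: filtration_measurable hW _ _ _ Fk; rewrite (le_trans h2)// (le_trans h3).
pose c k (z : measurableTypeR R * Om) : R :=
  (\1_(`]ep_lo k, ep_hi k]) z.1 : R) * (\1_(@ep_ev _ _ _ _ _ Z k) z.2 : R) * hdot e (ep_xi k).
have mc k : measurable_fun setT (c k).
  apply: measurable_funM => //; apply: measurable_funM.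
    apply: (measurableT_comp (f := \1_(`]ep_lo k, ep_hi k]) : measurableTypeR R -> R)) => //.
  by apply: (measurableT_comp (f := \1_(ep_ev k) : Om -> R)) => //; exact: measurable_indic.
have bc k : borel_fun (strip s) (fun z => c k z *: ep_h k).
  apply: (borel_fun_continuous (h := fun x : R => x *: (@ep_h _ _ _ _ _ Z k))).
    by move=> x; apply: cvgZl; exact: cvg_id.
  by move=> U oU; apply: measurableI => //; rewrite -[X in measurable X]setTI; apply: mc => //; exact: open_measurable.
rewrite /ep_eval.
have -> : (fun z : measurableTypeR R * Om => \sum_(k < ep_size Z)
     ((\1_(`]ep_lo k, ep_hi k]) z.1 : R) * (\1_(ep_ev k) z.2 : R) * hdot e (ep_xi k)) *: ep_h k)
   = fun z => \sum_(k < ep_size Z) c k z *: ep_h k by [].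
have gen (s' : seq 'I_(ep_size Z)) : borel_fun (strip s) (fun z => \sum_(k <- s') c k z *: ep_h k).
  elim: s' => [|k s' ih].
    rewrite (_ : (fun _ => _) = cst 0); first exact: borel_fun_cst.
    by apply/funext => z; rewrite big_nil.
  rewrite (_ : (fun _ => _) = fun z => c k z *: ep_h k + \sum_(j <- s') c j z *: ep_h j).
    exact: borel_fun_add.
  by apply/funext => z; rewrite big_cons.
exact: gen.
Qed.

Lemma borel_fun_opp D (f : measurableTypeR R * Om -> H) : borel_fun D f -> borel_fun D (fun z => - f z).
Proof.
by apply: borel_fun_continuous => x; apply: cvgN; exact: cvg_id.
Qed.

Section ito_error.
Context (s : R) (Phi : R -> Om -> Xi -> H).
Hypothesis tsT : t <= s <= T.
Hypothesis mPhi : forall e, borel_fun (strip s) (fun z => Phi z.1 z.2 e).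

Lemma hs_strip_measurable (N : H -> R) : continuous N ->
  measurable_fun (strip s) (fun z => hs_sum E N (Phi z.1 z.2)).
Proof.
move=> cN; apply: hs_sum_measurable => //; first exact: measurableX.
exact: onb_countable.
Qed.

End ito_error.

Lemma ito_error_borel s (Phi : R -> Om -> Xi -> H) (Z : elem_process Xi Om H) : t <= s <= T ->
  (forall e, borel_fun (strip s) (fun z => Phi z.1 z.2 e)) -> ep_adapted F t s Z ->
  forall e, borel_fun (strip s) (fun z => Phi z.1 z.2 e - ep_eval Z z.1 z.2 e).
Proof.
move=> tsT mPhi hZ e; apply: borel_fun_add => //.
by apply: borel_fun_opp; exact: ep_eval_borel.
Qed.

Lemma measurable_gt_set (q : Om -> \bar R) (x : \bar R) : measurable_fun setT q ->
  measurable [set w | (x < q w)%E].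
Proof.
move=> mq; rewrite (_ : [set w | _] = setT `&` q @^-1` `]x, +oo[%classic).
  by apply: mq => //; exact: emeasurable_itv.
by rewrite setTI; apply/seteqP; split => w /=; rewrite in_itv/= andbT.
Qed.

Definition ito_error s (Phi : R -> Om -> Xi -> H) (Z : elem_process Xi Om H) w : \bar R :=
  (\int[mu]_(r in `[t, s]) hs_sum E nH (fun e => (Phi r w e - ep_eval Z r w e)%R))%E.

Lemma ito_error_measurable s (Phi : R -> Om -> Xi -> H) Z : t <= s <= T ->
  (forall e, borel_fun (strip s) (fun z => Phi z.1 z.2 e)) -> ep_adapted F t s Z ->
  measurable_fun setT (ito_error s Phi Z).
Proof.
move=> tsT mPhi hZ; apply: measurable_time_integral.
  apply: (@hs_strip_measurable s (fun r w e => Phi r w e - ep_eval Z r w e)) => //.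
    exact: ito_error_borel.
  exact: norm_continuous.
by move=> r w _; exact: hs_sum_nneg.
Qed.

Lemma ep_int_borel s (Z : elem_process Xi Om H) : t <= s <= T -> ep_adapted F t s Z ->
  borel_fun setT (ep_int W Z).
Proof.
move=> /andP[ts sT] hZ.
pose c k (w : Om) : R := (\1_(@ep_ev _ _ _ _ _ Z k) w : R) *
  (W (ep_hi k) (ep_xi k) w - W (ep_lo k) (ep_xi k) w).
have mc k : measurable_fun setT (c k).
  have [h1 h2 h3 Fk] := hZ k.
  have hT : ep_hi k <= T by exact: le_trans h3 sT.
  apply: measurable_funM.
    by apply: measurable_indic; apply: filtration_measurable hW _ _ _ Fk; exact: le_trans hT.
  by apply: measurable_funB; apply: (ref_measurable hW); rewrite ?h1 ?hT ?(le_trans h1 h2) ?(le_trans h2 hT).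
have bc k : borel_fun setT (fun w => c k w *: ep_h k).
  apply: (borel_fun_continuous (h := fun x : R => x *: (@ep_h _ _ _ _ _ Z k))).
    by move=> x; apply: cvgZl; exact: cvg_id.
  by move=> U oU; apply: mc => //; exact: open_measurable.
have gen (s' : seq 'I_(ep_size Z)) : borel_fun setT (fun w => \sum_(k <- s') c k w *: ep_h k).
  elim: s' => [|k s' ih].
    rewrite (_ : (fun _ => _) = cst 0); first exact: borel_fun_cst.
    by apply/funext => z; rewrite big_nil.
  rewrite (_ : (fun _ => _) = fun z => c k z *: ep_h k + \sum_(j <- s') c j z *: ep_h j).
    exact: borel_fun_add.
  by apply/funext => z; rewrite big_cons.
exact: gen.
Qed.

Lemma ito_dist_measurable s (Z : elem_process Xi Om H) (I : Om -> H) :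
  t <= s <= T -> ep_adapted F t s Z -> borel_fun setT I ->
  measurable_fun setT (fun w => `|I w - ep_int W Z w|).
Proof.
move=> tsT hZ mI; apply: borel_fun_measurable => //.
apply: (borel_fun_continuous (h := fun x : H => `|x|)); first exact: norm_continuous.
apply: borel_fun_add => //.
by apply: (borel_fun_continuous (h := fun x : H => - x)); [move=> x; apply: cvgN; exact: cvg_id|exact: ep_int_borel hZ].
Qed.

Lemma measurable_gt_real (f : Om -> R) (x : R) : measurable_fun setT f ->
  measurable [set w | x < f w].
Proof.
move=> mf; rewrite (_ : [set w | _] = setT `&` f @^-1` `]x, +oo[%classic).
  by apply: mf => //; exact: measurable_itv.
by rewrite setTI; apply/seteqP; split => w /=; rewrite in_itv/= andbT.
Qed.


Lemma cvge0_lt (u : nat -> \bar R) (c : R) : u n @[n --> \oo] --> 0%E -> 0 < c ->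
  \forall n \near \oo, (u n < c%:E)%E.
Proof.
move=> cu c0; apply: (cu [set y | (y < c%:E)%E]).
by apply: (@nbhs_open_ereal_lt _ 0 (fun=> c)).
Qed.

Section truncation.
Context (q : Om -> \bar R).
Hypotheses (mq : measurable_fun setT q) (q0 : forall w, (0 <= q w)%E).

Definition trunc (M : R) (w : Om) : R := fine (mine (q w) M%:E).

Lemma truncE M w : 0 <= M -> (trunc M w)%:E = mine (q w) M%:E.
Proof.
move=> M0; rewrite fineK// fin_numE; case: (q w) (q0 w) => [x| |]//= _.
  by rewrite -EFin_min.
Qed.

Lemma trunc_ge0 M w : 0 <= M -> 0 <= trunc M w.
Proof. by move=> M0; rewrite -lee_fin truncE// le_min q0 lee_fin. Qed.

Lemma trunc_le M w : 0 <= M -> trunc M w <= M.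
Proof. by move=> M0; rewrite -lee_fin truncE// ge_min lexx orbT. Qed.

Lemma trunc_measurable M : 0 <= M -> measurable_fun setT (trunc M).
Proof.
move=> M0; apply/measurable_EFinP.
rewrite (_ : _ \o _ = fun w => mine (q w) M%:E).
  by apply: measurable_mine => //; exact: measurable_cst.
by apply/funext => w; rewrite /= truncE.
Qed.

End truncation.

Section moment.
Context (B : {linear H -> H}) (hB : psd B).
Local Notation N := (norm_m1 B).
Context (s : R) (tsT : t <= s <= T) (Phi : R -> Om -> Xi -> H) (I : Om -> H).
Hypothesis hI : ito_lim s Phi I.
Context (q : Om -> \bar R).
Hypothesis mq : measurable_fun setT q.
Hypothesis hq : forall w, (\int[mu]_(r in `[t, s]) hs_sum E N (Phi r w) <= q w)%E.

Let q0 w : (0 <= q w)%E.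
Proof. by apply: le_trans (hq w); apply: integral_ge0 => r _; exact: hs_sum_nneg. Qed.

(* The approximating integrals are controlled by the integrals of their own
   integrands, which the triangle inequality compares with [q] outside a set
   of small probability; this suffices once [N I] is truncated at [L]. *)
Lemma ito_moment_trunc (M L e : R) p : 0 <= M -> 0 <= L -> 0 < e -> (0 < p <= 2)%N ->
  (\int[P]_w ((q w <= M%:E)%E%:R * Num.min ((N (I w) ^+ 2) ^+ p) L)%:E <=
   (4 ^+ p * 4 ^+ p * mart_const R)%:E * \int[P]_w (trunc q M w ^+ p)%:E +
   ((4 ^+ p * 2 ^+ p * mart_const R + 4 ^+ p) * e ^+ p + e)%:E)%E.
Proof.
move=> M0 L0 e0 p12.
have [mPhi mI [Z [hZ cZ cI]]] := hI.
have [k k0 hk] := norm_m1_bound hB.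
(* Outside an exceptional set, [q <= M] forces the bracket of the approximating integral below this
   level. *)
pose M' := 2 * M + e.
have M'0 : 0 <= M' by rewrite addr_ge0 ?mulr_ge0// ltW.
(* Makes [2 * k ^ 2 * e1 = e], the contribution of the approximation error to the bracket. *)
pose e1 := e / (2 * k ^+ 2).
have k20 : 0 < 2 * k ^+ 2 by rewrite mulr_gt0// exprn_gt0.
have e10 : 0 < e1 by rewrite divr_gt0.
pose e2 := Num.sqrt e1.
have e20 : 0 < e2 by rewrite sqrtr_gt0.
(* Both exceptional sets receive probability below [e / (C1 + L)]. Their contributions are bounded
   by [M' ^ p], with the constants in front, and by [L] twice, so that they add up to at most
   [e]. *)
pose C1 := 4 ^+ p * mart_const R * M' ^+ p + L + 1.
have C10 : 0 < C1.
  by rewrite ltr_wpDl// addr_ge0// mulr_ge0 ?exprn_ge0// mulr_ge0 ?exprn_ge0 ?mart_const_ge0.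
pose c := e / (C1 + L).
have CL : 0 < C1 + L by rewrite ltr_pwDl.
have c0 : 0 < c by rewrite divr_gt0.
have [n [Bn1 Bn2]] : exists n,
    (P [set w | (e1%:E < ito_error s Phi (Z n) w)%E] < c%:E)%E /\
    (P [set w | (e2 < `|I w - ep_int W (Z n) w|)%R] < c%:E)%E.
  have h1 := cvge0_lt (cZ _ e10) c0; have h2 := cvge0_lt (cI _ e20) c0.
  by have [n] := filter_ex (filterI h1 h2); exists n.
set B1 := [set w | (e1%:E < _)%E] in Bn1; set B2 := [set w | e2 < _] in Bn2.
have mB1 : measurable B1 by apply: measurable_gt_set; exact: ito_error_measurable.
have mB2 : measurable B2 by apply: measurable_gt_real; exact: ito_dist_measurable (hZ n) mI.
have [mJ [Q [mQ Q0 hQ hmom]]] := @elem_moment _ _ _ E _ _ _ _ _ _ hW _ hB _ _ tsT (hZ n).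
pose J := ep_int W (Z n).
have QB w : (((Q w)%:E <= 2%:E * q w + (2 * k ^+ 2)%:E * ito_error s Phi (Z n) w)%E).
  apply: (le_trans (hQ w)).
  apply: (@le_trans _ _ (2%:E * (\int[mu]_(r in `[t, s]) hs_sum E N (Phi r w)) +
      (2 * k ^+ 2)%:E * ito_error s Phi (Z n) w)%E); last first.
    by apply: leeD => //; apply: lee_wpmul2l.
  have m1 : measurable_fun (`[t, s] : set (measurableTypeR R)) (fun r => hs_sum E N (Phi r w)).
    apply: (@measurable_section_time _ _ _ t s (fun r w => hs_sum E N (Phi r w))).
    exact: hs_strip_measurable (norm_m1_continuous hB).
  have m2 : measurable_fun (`[t, s] : set (measurableTypeR R))
      (fun r => hs_sum E nH (fun e => Phi r w e - ep_eval (Z n) r w e)).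
    apply: (@measurable_section_time _ _ _ t s (fun r w => hs_sum E nH (fun e => Phi r w e - ep_eval (Z n) r w e))).
    apply: (@hs_strip_measurable s (fun r w e => Phi r w e - ep_eval (Z n) r w e)) => //.
      exact: ito_error_borel.
    exact: norm_continuous.
  rewrite /ito_error -!ge0_integralZl//; last first.
  - by move=> r _; exact: hs_sum_nneg.
  - by rewrite lee_fin ltW.
  - by move=> r _; exact: hs_sum_nneg.
  rewrite -ge0_integralD//; last 4 first.
  - by move=> r _; rewrite mule_ge0 ?hs_sum_nneg.
  - by apply: emeasurable_funM.
  - by move=> r _; rewrite mule_ge0 ?hs_sum_nneg// lee_fin ltW.
  - by apply: emeasurable_funM.
  apply: ge0_integral_mono => [r _|r _]; first exact: hs_sum_nneg.
  apply: hs_sum_le2 => [//||x _]; first exact: ltW.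
  have : N (ep_eval (Z n) r w x) <= N (Phi r w x) + k * `|Phi r w x - ep_eval (Z n) r w x|.
    rewrite -[X in N X](subrK (Phi r w x)) addrC (le_trans (norm_m1D hB _ _))//.
    by rewrite lerD2l distrC hk.
  have := norm_m1_ge0 B (ep_eval (Z n) r w x); have := norm_m1_ge0 B (Phi r w x).
  set u := N _; set v := N _; set z := `|_| => u0 v0 h.
  have z0 : 0 <= z by exact: normr_ge0.
  apply: (@le_trans _ _ ((u + k * z) ^+ 2)).
    by rewrite lerXn2r ?nnegrE// addr_ge0// mulr_ge0// ltW.
  by have := sqr_ge0 (u - k * z); nra.
have goodQ w : ~ B1 w -> (((Q w)%:E <= 2%:E * q w + e%:E)%E).
  move=> /negP; rewrite -leNgt => h; apply: (le_trans (QB w)); apply: leeD => //.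
  apply: (@le_trans _ _ ((2 * k ^+ 2)%:E * e1%:E)%E).
    by apply: lee_wpmul2l => //; rewrite lee_fin ltW.
  by rewrite -EFinM lee_fin /e1 mulrCA divff ?mulr1// gt_eqF.
(* On the exceptional set the only available bound for the bracket is the truncation level
   itself. *)
have minQ w : Num.min (Q w) M' ^+ p <= 4 ^+ p * trunc q M w ^+ p + 2 ^+ p * e ^+ p + M' ^+ p * \1_B1 w.
  have t0 := trunc_ge0 q0 w M0.
  have [Bw|Bw] := pselect (B1 w).
    rewrite indicE mem_set// mulr1 ler_wpDl//.
      by rewrite addr_ge0// mulr_ge0 ?exprn_ge0// ltW.
    by rewrite lerXn2r ?nnegrE// ?ge_min ?lexx ?orbT// le_min Q0.
  rewrite indicE memNset// mulr0 addr0.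
  apply: (@le_trans _ _ ((2 * trunc q M w + e) ^+ p)).
    rewrite lerXn2r ?nnegrE ?le_min ?Q0// ?addr_ge0 ?mulr_ge0 ?(ltW e0)//.
    rewrite -lee_fin EFinD EFinM (truncE q0)//; have := goodQ w Bw.
    have [qM|qM] := leP (q w) M%:E.
      by move=> h; apply: le_trans h; rewrite lee_fin ge_min lexx.
    by move=> _; rewrite -EFinM -EFinD lee_fin ge_min lexx orbT.
  apply: le_trans (exprD_le _ _ _) _; rewrite ?mulr_ge0 ?(ltW e0)//.
  by rewrite mulrDr exprMn mulrA -exprMn lerD2r ler_wpM2r ?exprn_ge0// lerXn2r ?nnegrE//; lra.
have pt w : (q w <= M%:E)%E%:R * Num.min ((N (I w) ^+ 2) ^+ p) L <=
   4 ^+ p * ((Q w <= M')%R%:R * (N (J w) ^+ 2) ^+ p) + 4 ^+ p * e ^+ p + L * \1_B1 w + L * \1_B2 w.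
  have rhs0 : 0 <= 4 ^+ p * ((Q w <= M')%R%:R * (N (J w) ^+ 2) ^+ p) + 4 ^+ p * e ^+ p.
    apply: addr_ge0; apply: mulr_ge0; rewrite ?exprn_ge0 ?(ltW e0)//.
    by apply: mulr_ge0 => //; apply: exprn_ge0; exact: sqr_ge0.
  have Li (A : set Om) : 0 <= L * \1_A w by rewrite mulr_ge0.
  have [qM|qM] := leP (q w) M%:E; last first.
    by rewrite mul0r; apply: addr_ge0 => //; apply: addr_ge0.
  rewrite mul1r.
  have mL : Num.min ((N (I w) ^+ 2) ^+ p) L <= L by rewrite ge_min lexx orbT.
  have [Bw|Bw] := pselect (B1 w).
    by rewrite [\1_B1 w]indicE mem_set// mulr1 -addrA ler_wpDl// ler_wpDr// mulr_ge0.
  have [Bw2|Bw2] := pselect (B2 w).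
    by rewrite [\1_B2 w]indicE mem_set// mulr1 ler_wpDl// addr_ge0// mulr_ge0.
  rewrite !indicE !memNset// !mulr0 !addr0.
  have -> : Q w <= M'.
    rewrite -lee_fin; apply: (le_trans (goodQ w Bw)).
    rewrite (_ : M'%:E = (2%:E * M%:E + e%:E)%E)//.
    by apply: leeD => //; exact: lee_wpmul2l.
  rewrite mul1r -mulrDr (_ : 4 = 2 * 2); last by ring.
  rewrite (exprMn _ 2 2) -mulrA; apply: (@le_trans _ _ ((2 * (N (J w) ^+ 2 + e)) ^+ p)).
    apply: (@le_trans _ _ ((N (I w) ^+ 2) ^+ p)); first by rewrite ge_min lexx.
    rewrite lerXn2r ?nnegrE ?sqr_ge0// ?mulr_ge0 ?addr_ge0 ?sqr_ge0 ?(ltW e0)//.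
    have h1 : N (I w) <= N (J w) + k * `|I w - J w|.
      rewrite -[X in N X](subrK (J w)) addrC (le_trans (norm_m1D hB _ _))//.
      by rewrite lerD2l hk.
    have h2 : k ^+ 2 * `|I w - J w| ^+ 2 <= e.
      apply: (@le_trans _ _ (k ^+ 2 * e1)).
        rewrite ler_wpM2l ?sqr_ge0// -[leRHS]sqr_sqrtr ?(ltW e10)// lerXn2r ?nnegrE ?sqrtr_ge0//.
        by rewrite leNgt; apply/negP.
      rewrite /e1 mulrCA -{2}[e]mulr1 ler_wpM2l ?(ltW e0)//.
      by rewrite ler_pdivrMr// mul1r; have := sqr_ge0 k; lra.
    have := norm_m1_ge0 B (I w); have := norm_m1_ge0 B (J w).
    set u := N _; set v := N _ => u0 v0.
    apply: (@le_trans _ _ ((u + k * `|I w - J w|) ^+ 2)).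
      by rewrite lerXn2r ?nnegrE// addr_ge0// mulr_ge0// ltW.
    by have := sqr_ge0 (u - k * `|I w - J w|); nra.
  rewrite exprMn ler_wpM2l ?exprn_ge0//.
  by apply: exprD_le; rewrite ?sqr_ge0// ltW.
set c4 := 4 ^+ p in pt minQ *; have c40 : 0 <= c4 by rewrite exprn_ge0.
have ep0 : 0 <= e ^+ p by rewrite exprn_ge0// ltW.
have mc0 := mart_const_ge0 R.
pose f1 w := (Q w <= M')%R%:R * (N (J w) ^+ 2) ^+ p.
have f10 w : 0 <= f1 w by rewrite mulr_ge0// exprn_ge0// sqr_ge0.
have mf1 : measurable_fun setT f1.
  apply: measurable_funM; last by do 2 apply: measurable_funX.
  rewrite (_ : (fun _ => _) = fun w => 1 - \1_([set w | M' < Q w]) w).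
    apply: measurable_funB; first exact: measurable_cst.
    by apply: measurable_indic; exact: measurable_gt_real.
  apply/funext => w; rewrite indicE; have [h|h] := leP (Q w) M'.
    by rewrite memNset ?subr0//= ltNge h.
  by rewrite mem_set ?subrr.
have mI1 (A : set Om) (x : R) : measurable A -> 0 <= x ->
    (\int[P]_w (x * \1_A w)%:E = x%:E * P A)%E.
  move=> mA x0; under eq_integral do rewrite EFinM.
  rewrite ge0_integralZl//; first by rewrite integral_indic// setIT.
  by apply/measurable_EFinP; exact: measurable_indic.
have mt : measurable_fun setT (fun w => trunc q M w ^+ p).
  by apply: measurable_funX; exact: (trunc_measurable mq q0).
have mx (A : set Om) (x : R) : measurable A -> measurable_fun setT (fun w => (x * \1_A w)%:E).
  by move=> mA; apply/measurable_EFinP; apply: measurable_funM => //; exact: measurable_indic.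
have Lm0 w (A : set Om) (x : R) : 0 <= x -> (0 <= (x * \1_A w)%:E)%E.
  by move=> x0; rewrite lee_fin mulr_ge0.
have I1 : (\int[P]_w ((q w <= M%:E)%E%:R * Num.min ((N (I w) ^+ 2) ^+ p) L)%:E <=
    c4%:E * \int[P]_w (f1 w)%:E + (c4 * e ^+ p)%:E + L%:E * P B1 + L%:E * P B2)%E.
  apply: (@le_trans _ _ (\int[P]_w (((c4%:E * (f1 w)%:E + (c4 * e ^+ p)%:E) +
      (L * \1_B1 w)%:E) + (L * \1_B2 w)%:E))%E).
    apply: ge0_integral_mono => w _.
      by rewrite lee_fin mulr_ge0// le_min L0 exprn_ge0// sqr_ge0.
    by rewrite -EFinM -!EFinD lee_fin; exact: pt.
  have c1 : measurable_fun setT (fun w => c4%:E * (f1 w)%:E)%E.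
    by apply: emeasurable_funM => //; exact/measurable_EFinP.
  have d1 w : (0 <= c4%:E * (f1 w)%:E)%E by rewrite mule_ge0// lee_fin.
  have d2 : (0 <= (c4 * e ^+ p)%:E)%E by rewrite lee_fin mulr_ge0.
  have c2 : measurable_fun setT (fun w => c4%:E * (f1 w)%:E + (c4 * e ^+ p)%:E)%E.
    by apply: emeasurable_funD.
  rewrite ge0_integralD//; [|by move=> w _; rewrite !adde_ge0 ?Lm0|by apply: emeasurable_funD => //; exact: mx|by move=> w _; exact: Lm0|exact: mx].
  rewrite ge0_integralD//; [|by move=> w _; rewrite !adde_ge0|by move=> w _; exact: Lm0|exact: mx].
  rewrite ge0_integralD//.
  rewrite !mI1// int_probability_cst ge0_integralZl//; first exact/measurable_EFinP.
  by move=> w _; rewrite lee_fin.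
have I3 : (\int[P]_w (Num.min (Q w) M' ^+ p)%:E <= c4%:E * \int[P]_w (trunc q M w ^+ p)%:E
    + (2 ^+ p * e ^+ p)%:E + (M' ^+ p)%:E * P B1)%E.
  have M'p : 0 <= M' ^+ p by rewrite exprn_ge0.
  have tp0 w : 0 <= trunc q M w ^+ p by rewrite exprn_ge0// (trunc_ge0 q0).
  apply: (@le_trans _ _ (\int[P]_w ((c4%:E * (trunc q M w ^+ p)%:E + (2 ^+ p * e ^+ p)%:E) +
      (M' ^+ p * \1_B1 w)%:E))%E).
    apply: ge0_integral_mono => w _.
      by rewrite lee_fin exprn_ge0// le_min Q0.
    by rewrite -EFinM -!EFinD lee_fin; exact: minQ.
  have c1 : measurable_fun setT (fun w => c4%:E * (trunc q M w ^+ p)%:E)%E.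
    by apply: emeasurable_funM => //; exact/measurable_EFinP.
  have d1 w : (0 <= c4%:E * (trunc q M w ^+ p)%:E)%E by rewrite mule_ge0// lee_fin.
  have d2 : (0 <= (2 ^+ p * e ^+ p)%:E)%E by rewrite lee_fin mulr_ge0// exprn_ge0.
  rewrite ge0_integralD//; [|by move=> w _; rewrite !adde_ge0|by apply: emeasurable_funD|by move=> w _; exact: Lm0|exact: mx].
  rewrite ge0_integralD//.
  rewrite !mI1// int_probability_cst ge0_integralZl//; first exact/measurable_EFinP.
  by move=> w _; rewrite lee_fin.
have I2 := hmom M' p M'0 p12.
have tfin : (\int[P]_w (trunc q M w ^+ p)%:E)%E \is a fin_num.
  rewrite ge0_fin_numE; last first.
    by apply: integral_ge0 => w _; rewrite lee_fin exprn_ge0// (trunc_ge0 q0).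
  apply: (@le_lt_trans _ _ (\int[P]_w (M ^+ p)%:E)%E); last by rewrite int_probability_cst ltry.
  apply: ge0_integral_mono => w _; rewrite lee_fin.
    by rewrite exprn_ge0// (trunc_ge0 q0).
  by rewrite lerXn2r ?nnegrE ?(trunc_ge0 q0)// (trunc_le q0).
rewrite -(fineK tfin) in I3 *; set x := fine _ in I3 *.
have {}I3 : (\int[P]_w (Num.min (Q w) M' ^+ p)%:E <= (c4 * x + 2 ^+ p * e ^+ p + M' ^+ p * c)%:E)%E.
  apply: (le_trans I3); rewrite !EFinD EFinM leeD// EFinM.
  by apply: lee_wpmul2l; [rewrite lee_fin exprn_ge0|exact: ltW].
have {}I2 : (\int[P]_w (f1 w)%:E <= (mart_const R * (c4 * x + 2 ^+ p * e ^+ p + M' ^+ p * c))%:E)%E.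
  by apply: (le_trans I2); rewrite EFinM; apply: lee_wpmul2l; rewrite ?lee_fin.
apply: (@le_trans _ _ ((c4 * (mart_const R * (c4 * x + 2 ^+ p * e ^+ p + M' ^+ p * c)) +
    c4 * e ^+ p + L * c + L * c)%:E)).
  apply: (le_trans I1); rewrite !EFinD; apply: leeD; [apply: leeD; [apply: leeD => //|]|].
  - by rewrite EFinM; apply: lee_wpmul2l; rewrite ?lee_fin.
  - by rewrite EFinM; apply: lee_wpmul2l; [rewrite lee_fin|exact: ltW].
  - by rewrite EFinM; apply: lee_wpmul2l; [rewrite lee_fin|exact: ltW].
rewrite -EFinM -EFinD lee_fin.
have ce : (C1 + L) * c = e by rewrite /c mulrC divfK// gt_eqF.
have : (c4 * mart_const R * M' ^+ p + 2 * L) * c <= e.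
  by rewrite -[leRHS]ce ler_wpM2r ?(ltW c0)// /C1 -/c4; lra.
set y := 2 ^+ p; set z := M' ^+ p; set m := mart_const R; set ee := e ^+ p; nra.
Qed.

(** Bounds [4 ^ p * 4 ^ p * mart_const] for [p <= 2]: one factor [4 ^ p] compares [I] with its
    approximation, the other compares the energies. *)
Definition ito_const : R := 16 ^+ 2 * mart_const R.

(** A localized Burkholder inequality, in which [q] is any measurable majorant of the energy,
    possibly infinite or not integrable; the mild equation can thus be localized by the energy of
    its coefficients. First [e] tends to 0 at a fixed truncation of [N I], then that truncation is
    removed. *)
Lemma ito_moment (M : R) p : 0 <= M -> (0 < p <= 2)%N ->
  (\int[P]_w ((q w <= M%:E)%E%:R * (N (I w) ^+ 2) ^+ p)%:E <=
   ito_const%:E * \int[P]_w (trunc q M w ^+ p)%:E)%E.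
Proof.
move=> M0 p12; have [_ mI _] := hI.
have mNI : measurable_fun setT (fun w => N (I w)).
  apply: borel_fun_measurable => //; apply: borel_fun_continuous mI.
  exact: norm_m1_continuous.
have mi : measurable_fun setT (fun w => (q w <= M%:E)%E%:R : R).
  rewrite (_ : (fun _ => _) = fun w => 1 - \1_([set w | (M%:E < q w)%E]) w).
    apply: measurable_funB; first exact: measurable_cst.
    by apply: measurable_indic; exact: measurable_gt_set.
  apply/funext => w; rewrite indicE; have [h|h] := leP (q w) M%:E.
    by rewrite memNset ?subr0//= ltNge h.
  by rewrite mem_set ?subrr.
apply: integral_trunc_le => //.
  by apply: measurable_funM => //; do 2 apply: measurable_funX.
  by move=> w; rewrite mulr_ge0// exprn_ge0// sqr_ge0.
move=> n; apply/lee_addgt0Pr => e e0.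
have mc0 := mart_const_ge0 R.
pose D : R := 4 ^+ p * 2 ^+ p * mart_const R + 4 ^+ p + 1.
have D0 : 0 < D by rewrite ltr_wpDl// addr_ge0// !mulr_ge0// exprn_ge0.
pose e' := Num.min 1 (e / D).
have e'0 : 0 < e' by rewrite lt_min ltr01 divr_gt0.
have e'p : e' ^+ p <= e'.
  by rewrite -[leRHS]expr1 ler_wiXn2l// ?(ltW e'0) ?ge_min ?lexx//; case/andP: p12.
have e'D : D * e' <= e by rewrite mulrC -ler_pdivlMr// ge_min lexx orbT.
apply: (@le_trans _ _ (\int[P]_w ((q w <= M%:E)%E%:R * Num.min ((N (I w) ^+ 2) ^+ p) n%:R)%:E)%E).
  apply: ge0_integral_mono => w _; rewrite lee_fin.
    by rewrite le_min ler0n mulr_ge0// exprn_ge0// sqr_ge0.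
  case: (q w <= M%:E)%E; rewrite ?mul1r// !mul0r.
  by rewrite ge_min lexx.
apply: (le_trans (ito_moment_trunc M0 (ler0n _ n) e'0 p12)).
have t0 : (0 <= \int[P]_w (trunc q M w ^+ p)%:E)%E.
  by apply: integral_ge0 => w _; rewrite lee_fin exprn_ge0// (trunc_ge0 q0).
apply: leeD.
  apply: lee_wpmul2r => //; rewrite lee_fin /ito_const ler_wpM2r//.
  rewrite -exprMn (_ : 4 * 4 = 16); last by ring.
  by rewrite ler_weXn2l//; [lra|case/andP: p12].
rewrite lee_fin; apply: le_trans e'D; rewrite /D [leRHS]mulrDl mul1r lerD2r.
by rewrite ler_wpM2l// addr_ge0// !mulr_ge0// exprn_ge0.
Qed.

End moment.

End ito.

(** * Quasi-contractivity of the semigroup for the weak seminorm *)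

Section semigroup.
Context (R : realType) (H : hilbertType R).
Context (DA : set H) (A : H -> H) (S : R -> {linear H -> H}).
Hypothesis hS : contraction_semigroup S.
Hypothesis hAS : generates DA A S.
Hypothesis hAdense : dense DA.
Context (B : {linear H -> H}).

Lemma sps_psd : strictly_positive_selfadjoint B -> psd B.
Proof.
move=> hB; split; [exact: sps_bounded|exact: sps_selfadjoint|].
move=> x; have [->|x0] := eqVneq x 0; last exact/ltW/(sps_pos hB).
by rewrite linear0 hdotC hdot0r.
Qed.

Lemma nbhs_right0_ex (Q : set R) : (\forall h \near 0^'+, Q h) ->
  exists2 e : R, 0 < e & forall h, 0 < h -> h < e -> Q h.
Proof.
move=> [e /= e0 he]; exists e => // h h0 hlt; apply: he => //=.
by rewrite sub0r normrN gtr0_norm.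
Qed.

(* Explicit Euler steps of length [s / n]; the error of a step from [S r x]
   is o(s / n) uniformly in [r] because [S r] is a contraction commuting with
   the difference quotients. *)
Lemma semigroup_m1 : psd B -> weak_B_condition DA A B ->
  exists2 c0 : R, 0 <= c0 & forall s x, 0 <= s ->
    norm_m1 B (S s x) <= expR (c0 * s) * norm_m1 B x.
Proof.
move=> hB [AB [c0 [cAB adj c00 hc]]]; exists c0 => // s x s0.
have [k k0 hk] := norm_m1_bound hB.
have [kb kb0 hkb] := linear_bound (psd_cont hB).
pose N := norm_m1 B.
have N0 y : 0 <= N y by exact: norm_m1_ge0.
(* Density of the domain: [S s] is a contraction in [H] and [N] is bounded by [k] times the norm, so
   both sides vary little with [y]. *)
suff dom y : DA y -> N (S s y) <= expR (c0 * s) * N y.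
  apply/ler_addgt0Pr => e e0.
  pose e' := e / (k * (1 + expR (c0 * s))).
  have ex0 := expR_gt0 (c0 * s).
  have kk0 : 0 < k * (1 + expR (c0 * s)) by rewrite mulr_gt0// addr_gt0.
  have e'0 : 0 < e' by rewrite divr_gt0.
  have [y [yb Dy]] : ball x e' `&` DA !=set0.
    by apply: hAdense; [exists x; exact: ballxx|exact: ball_open].
  have {}yb : `|x - y| < e' by move: yb; rewrite -ball_normE.
  have h1 : N (S s x) <= N (S s y) + k * e'.
    rewrite -[in X in X <= _](subrK y x) linearD addrC (le_trans (norm_m1D hB _ _))// lerD2l.
    rewrite (le_trans (hk _))// ler_pM2l// (le_trans (semigroup_contraction hS _ s0))//.
    exact: ltW.
  have h2 : N y <= N x + k * e'.
    rewrite -[in X in X <= _](subrK x y) addrC (le_trans (norm_m1D hB _ _))// lerD2l.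
    by rewrite (le_trans (hk _))// ler_pM2l// distrC ltW.
  have ee : k * e' + expR (c0 * s) * (k * e') = e.
    rewrite /e'; field; rewrite gt_eqF//=.
    by rewrite gt_eqF// addr_gt0.
  have h3 := dom y Dy; have h4 := ler_wpM2l (ltW ex0) h2; rewrite mulrDr in h4.
  rewrite -!/(N _); lra.
move=> Dy.
pose eps h := `|h^-1 *: (S h y - y) - A y|.
have ceps : forall e : R, 0 < e -> exists2 d : R, 0 < d & forall h, 0 < h -> h < d -> eps h <= e.
  move=> e e0; apply: nbhs_right0_ex.
  have /hAS : DA y /\ A y = A y by [].
  by move/cvgrPdist_le => /(_ e e0); apply: filterS => h; rewrite /eps distrC.
(* The weak B-condition tested at [z], after the pairing of [A z] with [B z] has been moved to the
   adjoint. *)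
have gA z : DA z -> psd_form B z (A z) <= c0 * N z ^+ 2.
  move=> Dz; rewrite norm_m1_sqr// /psd_form hdotC (adj z z Dz).
  by have := hc z; rewrite hdotDl hdotNl hdotZl (hdotC z); lra.
have step r h : 0 <= r -> 0 < h ->
    N (S (r + h) y) ^+ 2 <= (1 + 2 * h * c0) * N (S r y) ^+ 2 +
      h * (2 * (kb * `|y|) * eps h + h * (k * (`|A y| + eps h)) ^+ 2).
  move=> r0 h0; set z := S r y; pose dl := h^-1 *: (S h z - z).
  have dlE h' : 0 < h' -> h'^-1 *: (S h' z - z) = S r (h'^-1 *: (S h' y - y)).
    move=> h'0; have e1 : S h' (S r y) = S r (S h' y).
      by rewrite -!(semigroupD hS)// ?(ltW h'0)// addrC.
    by rewrite /z e1 -linearB -linearZ.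
  have Dz : DA z /\ A z = S r (A y).
    apply/hAS; apply/cvgrPdist_le => e e0.
    have [d d0 hd] := ceps e e0; near=> h'.
    have h'0 : 0 < h' by near: h'; exact: nbhs_right_gt.
    rewrite dlE// -linearB (le_trans (semigroup_contraction hS _ r0))// distrC.
    by apply: hd => //; near: h'; exact: nbhs_right_lt.
  have dlA : `|dl - A z| <= eps h.
    rewrite Dz.2 /dl dlE// -linearB; exact: semigroup_contraction.
  have SE : S (r + h) y = z + h *: dl.
    rewrite /dl scalerA divff ?gt_eqF// scale1r [RHS]addrC subrK /z.
    by rewrite -(semigroupD hS)// ?(ltW h0)// addrC.
  have zy : `|z| <= `|y| by exact: semigroup_contraction.
  have Azy : `|A z| <= `|A y| by rewrite Dz.2; exact: semigroup_contraction.
  have e0 : 0 <= eps h by exact: normr_ge0.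
  have g1 : psd_form B z dl <= c0 * N z ^+ 2 + kb * `|y| * eps h.
    rewrite -[dl](subrK (A z)) addrC formDr// lerD ?gA//; first by case: Dz.
    apply: (le_trans (ler_norm _)); rewrite /psd_form (le_trans (hdot_cs _ _))//.
    by rewrite ler_pM// (le_trans (hkb _))// ler_pM2l.
  have g2 : N dl ^+ 2 <= (k * (`|A y| + eps h)) ^+ 2.
    rewrite lerXn2r ?nnegrE ?mulr_ge0 ?addr_ge0 ?(ltW k0)//.
    rewrite (le_trans (hk _))// ler_pM2l// -[dl](subrK (A z)) addrC.
    by rewrite (le_trans (ler_normD _ _))// lerD.
  clearbody dl; rewrite SE /N norm_m1_sqr//.
  have -> : psd_form B (z + h *: dl) (z + h *: dl) =
      N z ^+ 2 + 2 * h * psd_form B z dl + h * h * N dl ^+ 2.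
    rewrite formDl !formDr// !formZl !formZr// (formC hB dl z) /N !norm_m1_sqr//.
    by ring.
  have p1 := ler_wpM2l (ltW h0) g1; have p2 := ler_wpM2l (mulr_ge0 (ltW h0) (ltW h0)) g2.
  rewrite !mulrDr in p1; rewrite -/(N z); set n2 := N z ^+ 2 in p1 *.
  set n3 := N dl ^+ 2 in p2 *; set n4 := (_ * (_ + _)) ^+ 2 in p2 *.
  set n5 := psd_form _ _ _ in p1 *.
  have -> : (1 + 2 * h * c0) * n2 + h * (2 * (kb * `|y|) * eps h + h * n4) =
    n2 + 2 * (h * (c0 * n2)) + 2 * (h * (kb * `|y| * eps h)) + h * h * n4 by ring.
  by rewrite -(mulrA 2 h n5); lra.
suff sq : N (S s y) ^+ 2 <= expR (2 * c0 * s) * N y ^+ 2.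
  rewrite -(@ler_pXn2r _ 2) ?nnegrE ?mulr_ge0 ?expR_ge0// exprMn.
  by rewrite -expRM_natl (_ : 2%:R * (c0 * s) = 2 * c0 * s)//; ring.
apply/ler_addgt0Pr => e e0.
have [->|sn0] := eqVneq s 0.
  by rewrite mulr0 expR0 mul1r (semigroup0 hS) lerDl ltW.
have s1 : 0 < s by rewrite lt_neqAle eq_sym sn0.
pose E2 := expR (2 * c0 * s); have E20 : 0 < E2 by exact: expR_gt0.
(* After all the steps the accumulated error is at most [E2 * s * eta], which fixes the tolerance
   for the error rate [eta] of one step. *)
pose e1 := e / (E2 * s).
have e10 : 0 < e1 by rewrite divr_gt0// mulr_gt0.
(* With [a1] and [a2] each of the two terms of [eta] is at most [e1 / 2]; the summands 1 keep them
   positive. *)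
pose a1 := 4 * (kb * `|y|) + 1.
have a10 : 0 < a1 by rewrite ltr_wpDl// !mulr_ge0// ltW.
have min0 : 0 < Num.min 1 (e1 / a1) by rewrite lt_min ltr01 divr_gt0.
have [d d0 hd] := ceps _ min0.
pose a2 := 2 * (k * (`|A y| + 1)) ^+ 2 + 1.
have a20 : 0 < a2 by rewrite ltr_wpDl// mulr_ge0// sqr_ge0.
have [n [n1 n2]] : exists n : nat, s / n.+1%:R < d /\ s / n.+1%:R < e1 / a2.
  have [m1 hm1] := ltr_add_invr (divr_gt0 d0 s1).
  have [m2 hm2] := ltr_add_invr (divr_gt0 (divr_gt0 e10 a20) s1).
  have inv m : (m <= maxn m1 m2)%N -> s / (maxn m1 m2).+1%:R <= s / m.+1%:R.
    by move=> mm; rewrite ler_pM2l// lef_pV2 ?posrE// ler_nat.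
  exists (maxn m1 m2); split.
    apply: le_lt_trans (inv m1 (leq_maxl _ _)) _.
    by move: hm1; rewrite add0r ltr_pdivlMr// mulrC.
  apply: le_lt_trans (inv m2 (leq_maxr _ _)) _.
  by move: hm2; rewrite add0r ltr_pdivlMr// mulrC.
set h := s / n.+1%:R in n1 n2; have h0 : 0 < h by rewrite divr_gt0.
pose eta := 2 * (kb * `|y|) * eps h + h * (k * (`|A y| + eps h)) ^+ 2.
have eh : eps h <= 1 /\ eps h <= e1 / a1.
  by have := hd h h0 n1; rewrite le_min => /andP.
have ky0 : 0 <= kb * `|y| by rewrite mulr_ge0// ltW.
have eps0 : 0 <= eps h by exact: normr_ge0.
have eta0 : 0 <= eta.
  apply: addr_ge0; first exact: mulr_ge0 (mulr_ge0 _ ky0) eps0.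
  by apply: mulr_ge0; [exact: ltW|exact: sqr_ge0].
have etae : eta <= e1.
  have t1 : 2 * (kb * `|y|) * eps h <= e1 / 2.
    apply: (@le_trans _ _ (2 * (kb * `|y|) * (e1 / a1))).
      by rewrite ler_wpM2l//; [exact: mulr_ge0|case: eh].
    have -> : 2 * (kb * `|y|) * (e1 / a1) = (2 * (kb * `|y|) * e1) / a1 by ring.
    rewrite ler_pdivrMr// /a1.
    have := mulr_ge0 ky0 (ltW e10); set q := kb * _ => hq.
    by rewrite -mulrA mulrDr mulr1 [e1 / 2 * _]mulrC; lra.
  have t2 : h * (k * (`|A y| + eps h)) ^+ 2 <= e1 / 2.
    apply: (@le_trans _ _ ((e1 / a2) * (k * (`|A y| + 1)) ^+ 2)).
      apply: ler_pM; [exact: ltW|exact: sqr_ge0|exact: ltW|].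
      rewrite lerXn2r ?nnegrE ?mulr_ge0 ?addr_ge0 ?(ltW k0)//.
      by rewrite ler_pM2l// lerD2l; case: eh.
    have := sqr_ge0 (k * (`|A y| + 1)); rewrite /a2; set q := _ ^+ 2 => q0.
    have -> : e1 / (2 * q + 1) * q = (e1 * q) / (2 * q + 1) by ring.
    rewrite ler_pdivrMr; last by lra.
    have -> : e1 / 2 * (2 * q + 1) = q * e1 + e1 / 2 by field.
    by rewrite mulrC lerDl divr_ge0// ltW.
  by rewrite /eta; lra.
pose b := 1 + 2 * h * c0.
have b1 : 1 <= b by rewrite lerDl !mulr_ge0// ltW.
have iter j : N (S (j%:R * h) y) ^+ 2 <= b ^+ j * (N y ^+ 2 + j%:R * (h * eta)).
  elim: j => [|j ih]; first by rewrite !mul0r (semigroup0 hS) expr0 mul1r addr0.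
  have -> : j.+1%:R * h = j%:R * h + h by rewrite -natr1 mulrDl mul1r.
  apply: (le_trans (step (j%:R * h) h _ h0)); first by rewrite mulr_ge0// ltW.
  rewrite -/b -/eta; have b0 : 0 <= b by lra.
  have := ler_wpM2l b0 ih; rewrite (exprS b j) -natr1 (mulrDl j%:R) mul1r mulrA => h1.
  have h2 : h * eta <= b * b ^+ j * (h * eta).
    rewrite ler_peMl ?mulr_ge0 ?(ltW h0)//.
    by rewrite -exprS exprn_ege1.
  rewrite addrA [X in _ <= X]mulrDr; lra.
have sh : n.+1%:R * h = s by rewrite /h mulrC divfK.
have := iter n.+1; rewrite sh => /le_trans; apply.
have bE : b ^+ n.+1 <= E2.
  have -> : E2 = expR (2 * h * c0) ^+ n.+1.
    by rewrite -expRM_natl /E2 -sh; congr expR; ring.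
  by rewrite lerXn2r ?nnegrE ?expR_ge0 ?expR_ge1Dx//; lra.
apply: (@le_trans _ _ (E2 * (N y ^+ 2 + n.+1%:R * (h * eta)))).
  by rewrite ler_wpM2r// addr_ge0 ?sqr_ge0// !mulr_ge0// ltW.
rewrite mulrDr lerD2l.
have -> : E2 * (n.+1%:R * (h * eta)) = eta * (E2 * (n.+1%:R * h)) by ring.
by rewrite sh -ler_pdivlMr ?mulr_gt0.
Unshelve. all: by end_near. Qed.

End semigroup.

(** * Convexity remainders along a segment *)

Section taylor.
Context (R : realType).

(** The mean value theorem on [[0, lam]] and on [[lam, 1]] turns the remainder into
    [lam * (1 - lam)] times a difference of derivatives at two points of the unit interval. *)
Lemma lipschitz_derivative_remainder (f df : R -> R) (K lam : R) :
  (forall x : R, is_derive x (1 : R) f (df x)) ->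
  (forall x y, `|df x - df y| <= K * `|x - y|) -> 0 <= lam <= 1 ->
  `|lam * f 1 + (1 - lam) * f 0 - f lam| <= lam * (1 - lam) * K.
Proof.
move=> hf hK /andP[l0 l1].
have [->|ln0] := eqVneq lam 0.
  by rewrite !mul0r add0r subr0 mul1r subrr normr0.
have [->|ln1] := eqVneq lam 1.
  by rewrite subrr mulr0 !mul0r mul1r addr0 subrr normr0.
have {}l0 : 0 < lam by rewrite lt_neqAle eq_sym ln0.
have {}l1 : lam < 1 by rewrite lt_neqAle ln1.
have cf (a b : R) : {within `[a, b], continuous f}.
  apply: continuous_subspaceT => x.
  by apply: differentiable_continuous; apply/derivable1_diffP; exact: (@ex_derive _ _ _ _ _ _ _ (hf x)).
have [x1 x1i e1] := MVT l1 (fun x _ => hf x) (cf _ _).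
have [x0 x0i e0] := MVT l0 (fun x _ => hf x) (cf _ _).
have -> : lam * f 1 + (1 - lam) * f 0 - f lam = lam * (1 - lam) * (df x1 - df x0).
  have -> : f 1 = f lam + df x1 * (1 - lam) by rewrite -e1 addrC subrK.
  have -> : f 0 = f lam - df x0 * lam by move: e0; rewrite subr0 => <-; rewrite opprB addrC subrK.
  ring.
have ll0 : 0 <= lam * (1 - lam) by rewrite mulr_ge0 ?subr_ge0 ?(ltW l0) ?(ltW l1).
rewrite normrM ger0_norm// ler_wpM2l// (le_trans (hK _ _))//.
have K0 : 0 <= K by have := hK 0 1; rewrite sub0r normrN normr1 mulr1; exact: le_trans.
rewrite -[leRHS]mulr1 ler_wpM2l// ler_norml.
by move: x1i x0i; rewrite !in_itv/= => /andP[? ?] /andP[? ?]; apply/andP; split; lra.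
Qed.

Lemma is_derive_line (V Z : normedModType R) (f : V -> Z) (L : {linear Z -> R}) (a v : V) (x : R) :
  continuous L -> (forall y, differentiable f y) ->
  is_derive x 1 (fun r => L (f (a + r *: v))) (L ('d f (a + x *: v) v)).
Proof.
move=> cL df; set b := a + x *: v.
have := @diff_derivable _ _ _ f b v (df b) => /cvg_ex[/= l hl].
have lE : l = 'd f b v by rewrite -deriveE// /derive; apply/esym/cvg_lim.
have h1 : h^-1 *: (((fun r => L (f (a + r *: v))) \o shift x) (h *: (1 : R)) - L (f b)) @[h --> 0^'] --> L l.
  have -> : (fun h : R => h^-1 *: (((fun r => L (f (a + r *: v))) \o shift x) (h *: (1 : R)) - L (f b)))
      = fun h => L (h^-1 *: ((f \o shift b) (h *: v) - f b)).
    apply/funext => h /=.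
    have -> : a + ((h *: (1 : R) : R) + x) *: v = h *: v + b.
      by rewrite /b [h *: (1 : R)]mulr1 scalerDl addrCA.
    by rewrite [RHS]linearZ [in RHS]linearB.
  by apply: continuous_cvg => //; exact: cL.
by apply: DeriveDef; [apply/cvg_ex; exists (L l)|rewrite -lE; apply/cvg_lim].
Qed.

(** The mean value theorem concerns real functions, so the vector-valued remainder is observed
    through a continuous functional along the segment. *)
Lemma taylor_functional (V Z : normedModType R) (f : V -> Z) (L : {linear Z -> R})
    (x x' : V) (K lam : R) : continuous L -> (forall y, differentiable f y) ->
  (forall r1 r2, `|L ('d f (x' + r1 *: (x - x')) (x - x')
                     - 'd f (x' + r2 *: (x - x')) (x - x'))| <= K * `|r1 - r2|) ->
  0 <= lam <= 1 ->
  `|L (lam *: f x + (1 - lam) *: f x' - f (lam *: x + (1 - lam) *: x'))|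
    <= lam * (1 - lam) * K.
Proof.
move=> cL df hK l01.
have := @lipschitz_derivative_remainder (fun r => L (f (x' + r *: (x - x'))))
  (fun r => L ('d f (x' + r *: (x - x')) (x - x'))) K lam.
move=> /(_ (fun r => is_derive_line x' (x - x') r cL df)) h.
have {h} := h (fun r1 r2 => _) l01.
have -> : x' + 1 *: (x - x') = x by rewrite scale1r addrC subrK.
have -> : x' + 0 *: (x - x') = x' by rewrite scale0r addr0.
have -> : x' + lam *: (x - x') = lam *: x + (1 - lam) *: x'.
  by rewrite scalerBr scalerBl scale1r addrCA.
rewrite linearB linearD !linearZ/=; apply.
by move=> r1 r2; rewrite -linearB; exact: hK.
Qed.

End taylor.

(** * Linearity of the Ito integral *)

Section ito_linear.
Context (R : realType) (H Xi : hilbertType R) (E : onb Xi).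
Hypothesis sepH : separable H.
Hypothesis sepXi : separable Xi.
Context (d : measure_display) (Om : measurableType d) (P : probability Om R).
Context (t T : R) (W : R -> Xi -> Om -> R).
Hypothesis hW : reference_space P t T W.
Local Notation mu := (@lebesgue_measure R).
Local Notation F := (wiener_filtration P W t).
Local Notation nH := (@Num.norm R H).

(** The terms of an elementary process may overlap in time, so a linear combination is a
    concatenation, with the scalars moved into the vectors of [H]. *)
Definition ep_lin (a b : R) (Z1 Z2 : elem_process Xi Om H) : elem_process Xi Om H :=
  let sel X (f : 'I_(ep_size Z1) -> X) (g : 'I_(ep_size Z2) -> X)
      (k : 'I_(ep_size Z1 + ep_size Z2)) :=
    match fintype.split k with inl i => f i | inr j => g j end in
  @ElemProcess _ _ _ _ _ (ep_size Z1 + ep_size Z2)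
    (sel _ (@ep_lo _ _ _ _ _ Z1) (@ep_lo _ _ _ _ _ Z2))
    (sel _ (@ep_hi _ _ _ _ _ Z1) (@ep_hi _ _ _ _ _ Z2))
    (sel _ (@ep_ev _ _ _ _ _ Z1) (@ep_ev _ _ _ _ _ Z2))
    (sel _ (@ep_xi _ _ _ _ _ Z1) (@ep_xi _ _ _ _ _ Z2))
    (sel _ (fun i => a *: @ep_h _ _ _ _ _ Z1 i) (fun j => b *: @ep_h _ _ _ _ _ Z2 j)).

Lemma ep_lin_eval a b Z1 Z2 r w e :
  ep_eval (ep_lin a b Z1 Z2) r w e = a *: ep_eval Z1 r w e + b *: ep_eval Z2 r w e.
Proof.
rewrite /ep_eval /= big_split_ord /= !scaler_sumr; congr (_ + _); apply: eq_bigr => k _.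
  by rewrite (unsplitK (inl k)) !scalerA mulrC.
by rewrite (unsplitK (inr k)) !scalerA mulrC.
Qed.

Lemma ep_lin_int a b Z1 Z2 w :
  ep_int W (ep_lin a b Z1 Z2) w = a *: ep_int W Z1 w + b *: ep_int W Z2 w.
Proof.
rewrite /ep_int /= big_split_ord /= !scaler_sumr; congr (_ + _); apply: eq_bigr => k _.
  by rewrite (unsplitK (inl k)) !scalerA mulrC.
by rewrite (unsplitK (inr k)) !scalerA mulrC.
Qed.

Lemma ep_lin_adapted a b Z1 Z2 s : ep_adapted F t s Z1 -> ep_adapted F t s Z2 ->
  ep_adapted F t s (ep_lin a b Z1 Z2).
Proof. by move=> h1 h2 k /=; case: (fintype.split k). Qed.

Lemma cvg_measure_subset (C C1 C2 : nat -> set Om) :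
  (forall n, measurable (C n)) -> (forall n, measurable (C1 n)) ->
  (forall n, measurable (C2 n)) -> (forall n, C n `<=` C1 n `|` C2 n) ->
  P (C1 n) @[n --> \oo] --> 0%E -> P (C2 n) @[n --> \oo] --> 0%E ->
  P (C n) @[n --> \oo] --> 0%E.
Proof.
move=> mC m1 m2 CC c1 c2.
have c12 : (P (C1 n) + P (C2 n))%E @[n --> \oo] --> 0%E.
  by rewrite -[X in _ --> X]adde0; apply: cvgeD.
apply: (squeeze_cvge _ _ c12); last exact: cvg_cst.
apply: nearW => n; rewrite measure_ge0/=.
apply: (@le_trans _ _ (P (C1 n `|` C2 n))).
  by apply: le_measure => //; rewrite inE//; exact: measurableU.
exact: measureU2.
Qed.

(** The approximating sequences are combined termwise, and an error above [eps] forces one of the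
    two errors above [eps / c]. With one scalar equal to 0 this also multiplies an integral by a
    constant. *)
Lemma ito_lim_lin (a b : R) s (Phi Psi : R -> Om -> Xi -> H) (I J : Om -> H) :
  t <= s <= T -> ito_lim E P t W s Phi I -> ito_lim E P t W s Psi J ->
  ito_lim E P t W s (fun r w e => a *: Phi r w e + b *: Psi r w e)
    (fun w => a *: I w + b *: J w).
Proof.
move=> tsT [mPhi mI [Z1 [h1 c1 k1]]] [mPsi mJ [Z2 [h2 c2 k2]]].
have mPP e : borel_fun (`[t, s] `*` setT : set (measurableTypeR R * Om))
    (fun z => a *: Phi z.1 z.2 e + b *: Psi z.1 z.2 e).
  by apply: borel_fun_add => //; exact: borel_fun_scale.
have mErr Ph Z := @ito_error_measurable _ _ _ E sepH sepXi _ _ _ _ _ _ hW s Ph Z tsT.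
have mDist Z K := @ito_dist_measurable _ _ _ sepH _ _ _ _ _ _ hW s Z K tsT.
have hlin n := @ep_lin_adapted a b (Z1 n) (Z2 n) s (h1 n) (h2 n).
have mIJ : borel_fun setT (fun w => a *: I w + b *: J w).
  by apply: borel_fun_add => //; exact: borel_fun_scale.
split => //; exists (fun n => ep_lin a b (Z1 n) (Z2 n)); split.
- by move=> n; exact: ep_lin_adapted.
- move=> eps eps0.
  pose c := 2 * a ^+ 2 + 2 * b ^+ 2 + 1.
  have c0 : 0 < c by rewrite ltr_wpDl// addr_ge0// mulr_ge0// sqr_ge0.
  have e0 : 0 < eps / c by rewrite divr_gt0.
  apply: (cvg_measure_subset _ _ _ _ (c1 _ e0) (c2 _ e0)).
  + move=> n; apply: measurable_gt_set.
    exact: mErr mPP (hlin n).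
  + move=> n; apply: measurable_gt_set.
    exact: mErr mPhi (h1 n).
  + move=> n; apply: measurable_gt_set.
    exact: mErr mPsi (h2 n).
  move=> n w /= hw; apply: contrapT => /not_orP[/negP + /negP].
  rewrite -!leNgt => l1 l2; move: hw; apply/negP; rewrite -leNgt.
  set e1 := (\int[mu]_(r in _) _)%E in l1; set e2 := (\int[mu]_(r in _) _)%E in l2.
  apply: (@le_trans _ _ ((2 * a ^+ 2)%:E * e1 + (2 * b ^+ 2)%:E * e2)%E); last first.
    apply: (@le_trans _ _ ((2 * a ^+ 2)%:E * (eps / c)%:E + (2 * b ^+ 2)%:E * (eps / c)%:E)%E).
      by apply: leeD; apply: lee_wpmul2l => //; rewrite lee_fin mulr_ge0// sqr_ge0.
    rewrite -!EFinM -EFinD lee_fin -mulrDl mulrA ler_pdivrMr// mulrC ler_wpM2l ?(ltW eps0)//.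
    by rewrite /c lerDl.
  have mm (Ph : R -> Om -> Xi -> H) (Z : elem_process Xi Om H) :
      (forall e, borel_fun (`[t, s] `*` setT : set (measurableTypeR R * Om)) (fun z => Ph z.1 z.2 e)) ->
      ep_adapted F t s Z ->
      measurable_fun (`[t, s] : set (measurableTypeR R))
        (fun r => hs_sum E nH (fun e => Ph r w e - ep_eval Z r w e)).
    move=> mPh hZ.
    apply: (@measurable_section_time _ _ _ t s (fun r w => hs_sum E nH (fun e => Ph r w e - ep_eval Z r w e))).
    apply: (@hs_strip_measurable _ _ _ E sepXi _ _ t s (fun r w e => Ph r w e - ep_eval Z r w e)).
      exact: (ito_error_borel sepH hW).
    exact: norm_continuous.
  rewrite /e1 /e2 -!ge0_integralZl//; last 6 first.
  - exact: mm.
  - by move=> r _; exact: hs_sum_nneg.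
  - by rewrite lee_fin mulr_ge0// sqr_ge0.
  - exact: mm.
  - by move=> r _; exact: hs_sum_nneg.
  - by rewrite lee_fin mulr_ge0// sqr_ge0.
  rewrite -ge0_integralD//; last 4 first.
  - by move=> r _; rewrite mule_ge0 ?hs_sum_nneg// lee_fin mulr_ge0// sqr_ge0.
  - by apply: emeasurable_funM => //; exact: mm.
  - by move=> r _; rewrite mule_ge0 ?hs_sum_nneg// lee_fin mulr_ge0// sqr_ge0.
  - by apply: emeasurable_funM => //; exact: mm.
  apply: ge0_integral_mono => [r _|r _]; first exact: hs_sum_nneg.
  apply: hs_sum_le2; [exact: mulr_ge0 (ler0n _ 2) (sqr_ge0 _)|exact: mulr_ge0 (ler0n _ 2) (sqr_ge0 _)|move=> x _].
  rewrite ep_lin_eval.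
  set u := Phi r w x - _; set v := Psi r w x - _.
  have -> : a *: Phi r w x + b *: Psi r w x - (a *: ep_eval (Z1 n) r w x + b *: ep_eval (Z2 n) r w x)
    = a *: u + b *: v by rewrite /u /v !scalerBr opprD addrACA.
  apply: (@le_trans _ _ ((`|a| * `|u| + `|b| * `|v|) ^+ 2)).
    rewrite lerXn2r ?nnegrE ?addr_ge0 ?mulr_ge0// (le_trans (ler_normD _ _))//.
    by rewrite !normrZ.
  rewrite -(real_normK (num_real a)) -(real_normK (num_real b)).
  by have := sqr_ge0 (`|a| * `|u| - `|b| * `|v|); nra.
- move=> eps eps0.
  pose c := `|a| + `|b| + 1.
  have c0 : 0 < c by rewrite ltr_wpDl// addr_ge0.
  have e0 : 0 < eps / c by rewrite divr_gt0.
  apply: (cvg_measure_subset _ _ _ _ (k1 _ e0) (k2 _ e0)).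
  + move=> n; apply: measurable_gt_real.
    exact: mDist (hlin n) mIJ.
  + move=> n; apply: measurable_gt_real; exact: mDist (h1 n) mI.
  + move=> n; apply: measurable_gt_real; exact: mDist (h2 n) mJ.
  move=> n w /= hw; apply: contrapT => /not_orP[/negP + /negP].
  rewrite -!leNgt => l1 l2; move: hw; apply/negP; rewrite -leNgt ep_lin_int.
  set u := I w - _ in l1; set v := J w - _ in l2.
  have -> : a *: I w + b *: J w - (a *: ep_int W (Z1 n) w + b *: ep_int W (Z2 n) w)
    = a *: u + b *: v by rewrite /u /v !scalerBr opprD addrACA.
  rewrite (le_trans (ler_normD _ _))// !normrZ.
  apply: (@le_trans _ _ (`|a| * (eps / c) + `|b| * (eps / c))).
    by rewrite lerD// ler_wpM2l.
  rewrite -mulrDl mulrA ler_pdivrMr// mulrC ler_wpM2l ?(ltW eps0)//.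
  by rewrite /c lerDl.
Qed.

End ito_linear.

(** * The Bochner integral in the weak seminorm *)

Section bochner_bound.
Context (R : realType) (H : hilbertType R) (B : {linear H -> H}).
Hypotheses (hB : psd B) (sepH : separable H).
Local Notation N := (norm_m1 B).
Local Notation mu := (@lebesgue_measure R).

Lemma borel_fun_lincomb (d : measure_display) (T : measurableType d) (D : set T)
    (I : Type) (s : seq I) (c : I -> T -> R) (v : I -> H) :
  measurable D -> (forall k, measurable_fun setT (c k)) ->
  borel_fun D (fun z => \sum_(k <- s) c k z *: v k).
Proof.
move=> mD mc; elim: s => [|k s ih].
  rewrite (_ : (fun _ => _) = cst 0); first exact: borel_fun_cst.
  by apply/funext => z; rewrite big_nil.
rewrite (_ : (fun _ => _) = fun z => c k z *: v k + \sum_(j <- s) c j z *: v j).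
  apply: borel_fun_add => //.
  apply: (borel_fun_continuous (h := fun x : R => x *: v k)).
    by move=> x; apply: cvgZl; exact: cvg_id.
  move=> U oU; apply: measurableI => //.
  by rewrite -[X in measurable X]setTI; apply: mc => //; exact: open_measurable.
by apply/funext => z; rewrite big_cons.
Qed.

Lemma indic_lincomb_integral (D : set R) (I : Type) (s : seq I) (A : I -> set R) (c : I -> R) :
  measurable (D : set (measurableTypeR R)) -> (mu D < +oo)%E ->
  (forall k, measurable (A k : set (measurableTypeR R))) ->
  mu.-integrable D (EFin \o (fun r : measurableTypeR R => \sum_(k <- s) (\1_(A k) r : R) * c k)) /\
  (\int[mu]_(r in D) (\sum_(k <- s) (\1_(A k) r : R) * c k)%:E
    = (\sum_(k <- s) fine (mu (A k `&` D)) * c k)%:E)%E.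
Proof.
move=> mD Doo mA; elim: s => [|k s [ih1 ih2]].
  have -> : EFin \o (fun r : measurableTypeR R => \sum_(k <- [::]) (\1_(A k) r : R) * c k) = cst 0%E.
    by apply/funext => r /=; rewrite big_nil.
  split; first exact: integrable0.
  by under eq_integral do rewrite big_nil; rewrite integral0 big_nil.
have fAD : mu (A k `&` D) \is a fin_num.
  rewrite ge0_fin_numE//; apply: le_lt_trans Doo; apply: le_measure; rewrite ?inE//.
  exact: measurableI.
have i1 : mu.-integrable D (EFin \o (\1_(A k) : measurableTypeR R -> R)).
  apply/integrableP; split.
    by apply/measurable_EFinP; apply: measurable_funTS; exact: measurable_indic.
  under eq_integral do rewrite /= ger0_norm//.
  rewrite integral_indic//; move: fAD; rewrite ge0_fin_numE//.
have e1 : (\int[mu]_(r in D) (\1_(A k) r : R)%:E = (fine (mu (A k `&` D)))%:E)%E.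
  by rewrite integral_indic// fineK.
have i2 := integrableZl mD (c k) i1.
have fE r : (\sum_(j <- k :: s) (\1_(A j) r : R) * c j)%:E
    = ((c k)%:E * (\1_(A k) r)%:E + (\sum_(j <- s) (\1_(A j) r : R) * c j)%:E)%E.
  by rewrite big_cons EFinD EFinM muleC.
split.
  have := integrableD mD i2 ih1; apply: eq_integrable => // r _.
  by rewrite /= fE.
under eq_integral do rewrite fE.
by rewrite integralD// integralZl//= e1 ih2 big_cons EFinD EFinM muleC.
Qed.

(** By duality: tested against [psd_form B u], step integrals become real integrals, and in the
    limit [psd_form B u J <= N u * q]. Taking [u] equal to [J] and cancelling one factor [N J]
    concludes. *)
Lemma bochner_norm_le (a b : R) (f : R -> H) (J : H) :
  is_bochner_integral `[a, b] f J ->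
  ((N J)%:E <= \int[mu]_(r in `[a, b]) (N (f r))%:E)%E.
Proof.
move=> [mf [z [mz cz cJ]]].
set D := [set` `[a, b]] in mf cz cJ *.
have [k k0 hk] := norm_m1_bound hB.
have bf : borel_fun (D : set (measurableTypeR R)) f by exact: mf.
have mD : measurable (D : set (measurableTypeR R)) by exact: measurable_itv.
have Doo : (mu D < +oo)%E by rewrite lebesgue_measure_itv/=; case: ifP; rewrite ?ltry.
have mNf : measurable_fun (D : set (measurableTypeR R)) (fun r => (N (f r))%:E).
  apply/measurable_EFinP; apply: borel_fun_measurable => //.
  exact: borel_fun_continuous (norm_m1_continuous hB) bf.
have mst n : measurable_fun (D : set (measurableTypeR R)) (fun r => `|f r - step_eval (z n) r|%:E).
  apply/measurable_EFinP; apply: borel_fun_measurable => //.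
  apply: (borel_fun_continuous (h := fun x : H => `|x|)); first exact: norm_continuous.
  apply: borel_fun_add => //.
  apply: (borel_fun_continuous (h := fun x : H => - x)).
    by move=> x; apply: cvgN; exact: cvg_id.
  by apply: borel_fun_lincomb => // j; apply: measurable_indic; exact: mz.
have [Ioo|] := eqVneq (\int[mu]_(r in D) (N (f r))%:E)%E +oo%E; first by rewrite Ioo leey.
have I0 : (0 <= \int[mu]_(r in D) (N (f r))%:E)%E.
  by apply: integral_ge0 => r _; rewrite lee_fin norm_m1_ge0.
rewrite -ltey -ge0_fin_numE// => Ifin.
rewrite -(fineK Ifin) in I0 *; set q := fine _ in I0 *; rewrite lee_fin in I0 *.
pose er n := fine (\int[mu]_(r in D) (`|f r - step_eval (z n) r|)%:E)%E.
have step u n : (\int[mu]_(r in D) (`|f r - step_eval (z n) r|)%:E)%E \is a fin_num ->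
    psd_form B u (step_int D (z n)) <= N u * (q + k * er n).
  move=> fin; have [i1 i2] := @indic_lincomb_integral D _ (index_enum 'I_(step_size (z n)))
    (@step_set _ _ (z n)) (fun j => psd_form B u (step_val j)) mD Doo (mz n).
  have -> : psd_form B u (step_int D (z n)) = \sum_(j < step_size (z n))
      fine (mu (step_set j `&` D)) * psd_form B u (step_val j).
    by rewrite /step_int form_sumr//; apply: eq_bigr => j _; rewrite formZr.
  rewrite -lee_fin -i2; apply: (le_trans (lee_abs _)).
  apply: (le_trans (le_abse_integral _ mD (measurable_int _ i1))).
  apply: (@le_trans _ _ (\int[mu]_(r in D)
     ((N u)%:E * ((N (f r))%:E + k%:E * (`|f r - step_eval (z n) r|)%:E)))%E).
    apply: ge0_integral_mono => r _ /=; first by rewrite lee_fin.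
    rewrite -[(k%:E * _)%E]EFinM -EFinD -EFinM lee_fin.
    have -> : \sum_(j < step_size (z n)) (\1_(step_set j) r : R) * psd_form B u (step_val j)
       = psd_form B u (step_eval (z n) r).
      by rewrite /step_eval form_sumr//; apply: eq_bigr => j _; rewrite formZr.
    rewrite (le_trans (form_cs hB _ _))// ler_wpM2l ?norm_m1_ge0//.
    rewrite -[X in N X](subKr (f r)) (le_trans (norm_m1D hB _ _))// lerD2l norm_m1N//.
  rewrite ge0_integralZl//; last 3 first.
  - by apply: emeasurable_funD => //; apply: emeasurable_funM.
  - by move=> r _; rewrite adde_ge0// ?lee_fin ?norm_m1_ge0// mulr_ge0// ltW.
  - by rewrite lee_fin norm_m1_ge0.
  rewrite EFinM; apply: lee_wpmul2l; first by rewrite lee_fin norm_m1_ge0.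
  rewrite ge0_integralD//; last 3 first.
  - by move=> r _; rewrite lee_fin norm_m1_ge0.
  - by move=> r _; rewrite mule_ge0// lee_fin ltW.
  - exact: emeasurable_funM.
  rewrite ge0_integralZl//; last by rewrite lee_fin ltW.
  by rewrite -(fineK Ifin) -(fineK fin) -/q -/(er n) -EFinM -EFinD.
have JJ u : psd_form B u J <= N u * q.
  apply/ler_addgt0Pr => e e0.
  pose e1 := e / 2 / (N u * k + 1).
  have Nuk : 0 <= N u * k by rewrite mulr_ge0 ?norm_m1_ge0// ltW.
  have e10 : 0 < e1 by rewrite !divr_gt0// ltr_wpDl.
  have c1 : psd_form B u (step_int D (z n)) @[n --> \oo] --> psd_form B u J.
    by apply: continuous_cvg => //; exact: form_continuous.
  have /cvgrPdist_le/(_ _ (divr_gt0 e0 (ltr0n _ 2))) [n1 _ h1] := c1.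
  have /fine_cvgP[[n2 _ h2] /cvgrPdist_le/(_ _ e10) [n3 _ h3]] := cz.
  pose n := maxn n1 (maxn n2 n3).
  have := h1 n; have := h2 n; have := h3 n; rewrite /n/= !leq_max !leqnn !orbT/=.
  rewrite -/n => /(_ isT) h3' /(_ isT) h2' /(_ isT) h1'.
  have := step u n h2'; rewrite sub0r normrN in h3'.
  have er1 : er n <= e1 := le_trans (ler_norm _) h3'.
  have : N u * k * er n <= e / 2.
    apply: (@le_trans _ _ (N u * k * e1)); first exact: ler_wpM2l.
    rewrite /e1 mulrA ler_pdivrMr ?ltr_wpDl// mulrC ler_wpM2l ?divr_ge0 ?(ltW e0)//.
    by rewrite lerDl.
  have := le_trans (ler_norm _) h1'; rewrite mulrDr mulrA; lra.
have := JJ J; rewrite -norm_m1_sqr// expr2.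
have := norm_m1_ge0 B J; rewrite le_eqVlt => /predU1P[<-//|NJ].
by rewrite ler_pM2l.
Qed.

End bochner_bound.

(** * Convexity remainders of the drift and diffusion coefficients *)

Section semiconcave_remainder.
Context (R : realType) (H : hilbertType R) (B : {linear H -> H}).
Hypothesis hB : psd B.
Local Notation N := (norm_m1 B).

(* Pairing the remainder with itself reduces the estimate to a real function of one variable. *)
Lemma form_remainder (V Z : normedModType R) n (pr : 'I_n -> {linear Z -> H})
    (f : V -> Z) (x x' : V) (K lam : R) :
  (forall i, continuous (pr i)) -> (forall y, differentiable f y) -> 0 <= K ->
  (forall r1 r2, \sum_i N (pr i ('d f (x' + r1 *: (x - x')) (x - x')
     - 'd f (x' + r2 *: (x - x')) (x - x'))) ^+ 2 <= (K * `|r1 - r2|) ^+ 2) ->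
  0 <= lam <= 1 ->
  \sum_i N (pr i (lam *: f x + (1 - lam) *: f x' - f (lam *: x + (1 - lam) *: x'))) ^+ 2
    <= (lam * (1 - lam) * K) ^+ 2.
Proof.
move=> cpr df K0 hK l01; set rem := _ - f _.
pose L0 (y : Z) : R := \sum_i psd_form B (pr i rem) (pr i y).
have L0lin : linear L0.
  move=> c y y'; rewrite /L0 scaler_sumr -big_split/=; apply: eq_bigr => i _.
  by rewrite linearP formDr// formZr.
pose Llin := GRing.isLinear.Build _ _ _ _ L0 L0lin.
pose L : {linear Z -> R} := HB.pack L0 Llin.
have cL : continuous L.
  move=> y; rewrite /L/= /L0; elim: (index_enum 'I_n) => [|i sq ih].
    by rewrite (_ : (fun _ => _) = cst 0); [exact: cvg_cst|apply/funext => y'; rewrite big_nil].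
  rewrite (_ : (fun _ => _) = fun y' => psd_form B (pr i rem) (pr i y') +
    \sum_(j <- sq) psd_form B (pr j rem) (pr j y')).
    apply: cvgD => //.
    by apply: (continuous_comp (cpr i y)); exact: form_continuous.
  by apply/funext => y'; rewrite big_cons.
set A := \sum_i _.
have A0 : 0 <= A by apply: sumr_ge0 => i _; exact: sqr_ge0.
have AE : L rem = A by apply: eq_bigr => i _; rewrite norm_m1_sqr.
have := @taylor_functional _ V Z f L x x' (Num.sqrt A * K) lam cL df _ l01.
rewrite -/rem AE ger0_norm// => h.
have {h} h : A <= lam * (1 - lam) * (Num.sqrt A * K).
  apply: h => r1 r2; rewrite /L/= /L0.
  set y := _ - _.
  apply: (@le_trans _ _ (\sum_i N (pr i rem) * N (pr i y))).
    apply: (le_trans (ler_norm_sum _ _ _)); apply: ler_sum => i _; exact: form_cs.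
  rewrite -mulrA -(@ler_pXn2r _ 2) ?nnegrE ?mulr_ge0 ?sqrtr_ge0//; last first.
    by apply: sumr_ge0 => i _; rewrite mulr_ge0 ?norm_m1_ge0.
  rewrite (le_trans (sum_cs _ _ _))// exprMn sqr_sqrtr//; apply: ler_wpM2l => //; exact: hK.
have [l0 l1] := andP l01.
have ll : 0 <= lam * (1 - lam) * K by rewrite !mulr_ge0// subr_ge0.
have : A = Num.sqrt A ^+ 2 by rewrite sqr_sqrtr.
have := sqrtr_ge0 A; rewrite le_eqVlt => /predU1P[<- ->|sA AA].
  by rewrite expr0n/= sqr_ge0.
rewrite AA lerXn2r ?nnegrE ?(ltW sA)// -(ler_pM2l sA).
by rewrite -expr2 -AA; apply: le_trans h _; rewrite mulrCA (mulrC _ K) mulrA.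
Qed.

(** Hypothesis (d) controls the difference of derivatives only in the direction joining the two
    points. On a line that direction is [(r1 - r2) *: v], and cancelling one factor [|r1 - r2|]
    leaves a Lipschitz bound in the parameter. *)
Lemma derivative_scale (r : R) (m : R) (K v : R) : 0 <= m -> 
  (r = 0 -> m = 0) -> `|r| * m <= K * (`|r| * v) ^+ 2 -> m <= K * v ^+ 2 * `|r|.
Proof.
move=> m0 rm h; have [r0|rn0] := eqVneq r 0; first by rewrite rm// r0 normr0 mulr0.
have r0 : 0 < `|r| by rewrite normr_gt0.
by rewrite -(ler_pM2l r0); apply: le_trans h _; rewrite exprMn; nra.
Qed.

Lemma drift_remainder (b : H -> H) (C lam : R) (x x' : H) : 0 <= C ->
  (forall y, differentiable b y) ->
  (forall y y', N ('d b y (y - y') - 'd b y' (y - y')) <= C * N (y - y') ^+ 2) ->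
  0 <= lam <= 1 ->
  N (lam *: b x + (1 - lam) *: b x' - b (lam *: x + (1 - lam) *: x'))
    <= lam * (1 - lam) * (C * N (x - x') ^+ 2).
Proof.
move=> C0 db hD l01.
have [l0 l1] := andP l01.
have K0 : 0 <= C * N (x - x') ^+ 2 by rewrite mulr_ge0 ?sqr_ge0.
have := @form_remainder H H 1 (fun=> idfun : {linear H -> H}) b x x' (C * N (x - x') ^+ 2) lam.
move=> /(_ (fun _ _ => cvg_id) db K0).
rewrite big_ord1/= => h.
rewrite -(@ler_pXn2r _ 2) ?nnegrE ?norm_m1_ge0//; last by rewrite mulr_ge0// mulr_ge0// subr_ge0.
apply: h => // r1 r2; rewrite big_ord1/=.
apply: lerXn2r; [exact: norm_m1_ge0|exact: mulr_ge0|].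
apply: derivative_scale; first exact: norm_m1_ge0.
  by move/eqP; rewrite subr_eq0 => /eqP ->; rewrite subrr norm_m1_0.
have := hD (x' + r1 *: (x - x')) (x' + r2 *: (x - x')).
have dZ y c v : 'd b y (c *: v) = c *: 'd b y v by exact: linearZ.
by rewrite opprD addrACA subrr add0r -scalerBl !dZ -scalerBr !norm_m1Z.
Qed.

Context (Xi : hilbertType R) (E : onb Xi).

Lemma hs_eval_le (f : hs E H) e : onb_set E e -> `|f e| <= `|f|.
Proof.
move=> Ee; rewrite -(@ler_pXn2r _ 2) ?nnegrE// hs_normE -lee_fin -hs_norm_sqr; last exact: hs_fin.
apply: esum_ge; exists [set e]; first by split=> // _ ->.
by rewrite fsbig_set1.
Qed.

Lemma hs_norm_m1_fin (f : hs E H) : (hs_sum E N f < +oo)%E.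
Proof.
have [k k0 hk] := norm_m1_bound hB.
apply: (@le_lt_trans _ _ ((k ^+ 2)%:E * hs_sum E (@Num.norm R H) f)%E).
  apply: hs_sum_le1; first exact: sqr_ge0.
  by move=> e _; rewrite -exprMn lerXn2r ?nnegrE ?norm_m1_ge0 ?mulr_ge0// ltW.
by rewrite hs_norm_sqr ?hs_fin// -EFinM ltry.
Qed.

Lemma hs_norm_m1Z_ge (c : R) (f : hs E H) :
  `|c| * hs_norm E N f <= hs_norm E N (c *: f : hs E H).
Proof.
have [->|c0] := eqVneq c 0; first by rewrite normr0 mul0r sqrtr_ge0.
have fin (u : hs E H) : hs_sum E N u \is a fin_num.
  by rewrite ge0_fin_numE ?hs_sum_nneg// hs_norm_m1_fin.
rewrite -sqrtr_sqr -sqrtrM ?sqr_ge0// ler_sqrt ?fine_ge0 ?hs_sum_nneg//.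
rewrite -lee_fin EFinM !fineK// -lee_pdivlMl ?exprn_even_gt0//.
apply: hs_sum_le1; first by rewrite invr_ge0 sqr_ge0.
move=> e _; rewrite [(c *: f : hs E H) e](_ : _ = c *: f e)// norm_m1Z// exprMn real_normK ?num_real//.
by rewrite mulrA mulVf ?mul1r// sqrf_eq0.
Qed.

(** The Hilbert-Schmidt sum is a supremum over finite sets of basis vectors. On each of them
    [form_remainder] applies to the evaluations at these vectors, which are continuous for the
    Hilbert-Schmidt norm. *)
Lemma diffusion_remainder (s : H -> hs E H) (C lam : R) (x x' : H) : 0 <= C ->
  (forall y, differentiable s y) ->
  (forall y y', hs_norm E N ('d s y (y - y') - 'd s y' (y - y') : hs E H) <= C * N (y - y') ^+ 2) ->
  0 <= lam <= 1 ->
  (hs_sum E N (lam *: s x + (1 - lam) *: s x' - s (lam *: x + (1 - lam) *: x') : hs E H)%R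
    <= ((lam * (1 - lam) * (C * N (x - x') ^+ 2)) ^+ 2)%:E)%E.
Proof.
move=> C0 ds hD l01; set rem := _ - s _.
have [l0 l1] := andP l01.
have K0 : 0 <= C * N (x - x') ^+ 2 by rewrite mulr_ge0 ?sqr_ge0.
apply: ge_ereal_sup => _ [X [finX XE]] <-.
rewrite fsbig_finite//= sumEFin lee_fin.
set X' := finmap.enum_fset (fset_set X).
have XE' (i : 'I_(size X')) : onb_set E (tnth (in_tuple X') i).
  apply: XE; have : tnth (in_tuple X') i \in X' by exact: mem_tnth.
  by rewrite in_fset_set// => /set_mem.
have evlin e : linear (fun f : hs E H => (f : Xi -> H) e) by [].
pose ev e : {linear hs E H -> H} := HB.pack (fun f : hs E H => (f : Xi -> H) e)
  (GRing.isLinear.Build _ _ _ _ (fun f : hs E H => (f : Xi -> H) e) (evlin e)).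
have cev e : onb_set E e -> continuous (ev e).
  move=> Ee; apply/linear_bounded_continuous; apply/linear_boundedP.
  exists 1; split => [|r /ltW r1 f]; first exact: num_real.
  rewrite (le_trans (hs_eval_le f Ee))// ler_peMl//.
have := @form_remainder H (hs E H) _ (fun i => ev (tnth (in_tuple X') i)) s x x'
   (C * N (x - x') ^+ 2) lam (fun i => cev _ (XE' i)) ds K0.
rewrite -/rem => h.
rewrite (big_tnth _ _ X'); apply: h => // r1 r2.
set D1 := 'd s _ _; set D2 := 'd s _ _.
apply: (@le_trans _ _ (hs_norm E N (D1 - D2) ^+ 2)).
  have fin := hs_norm_m1_fin (D1 - D2).
  rewrite -lee_fin sqr_sqrtr ?fine_ge0 ?hs_sum_nneg// fineK ?ge0_fin_numE ?hs_sum_nneg//.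
  apply: esum_ge; exists X => //.
  by rewrite fsbig_finite//= sumEFin lee_fin -/X' (big_tnth _ _ X').
apply: lerXn2r; [exact: sqrtr_ge0|exact: mulr_ge0|].
apply: derivative_scale; first exact: sqrtr_ge0.
  move/eqP; rewrite subr_eq0 => /eqP r12; rewrite /D1 /D2 r12 subrr /hs_norm /hs_sum esum1 ?sqrtr0//.
  by move=> e _; rewrite norm_m1_0 expr0n.
have := hD (x' + r1 *: (x - x')) (x' + r2 *: (x - x')).
have dZ y c v : 'd s y (c *: v) = c *: 'd s y v by exact: linearZ.
rewrite opprD addrACA subrr add0r -scalerBl !dZ -scalerBr norm_m1Z//.
by apply: le_trans; exact: hs_norm_m1Z_ge.
Qed.

End semiconcave_remainder.

(** * Time integrals, exit times and Gronwall's lemma *)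

Section time_integrals.
Context (R : realType).
Local Notation mu := (@lebesgue_measure R).
Implicit Types (t s : R).

Lemma measurable_time_itv t s : measurable (`[t, s] : set (measurableTypeR R)).
Proof. exact: measurable_itv. Qed.

Lemma measurable_decay (a s : R) (D : set (measurableTypeR R)) :
  measurable_fun D (fun r => (expR (a * (s - r)))%:E).
Proof.
apply: measurable_funTS; apply/measurable_EFinP; apply: continuous_measurable_fun => r.
apply: continuous_comp; last exact: continuous_expR.
by apply: cvgM; [exact: cvg_cst|apply: cvgB; [exact: cvg_cst|exact: cvg_id]].
Qed.

Lemma decay_integral_le (a t s : R) : 0 < a -> t <= s ->
  (\int[mu]_(r in `[t, s]) (expR (- a * (s - r)))%:E <= (a^-1)%:E)%E.
Proof.
move=> a0; rewrite le_eqVlt => /predU1P[<-|ts].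
  by rewrite set_itv1 integral_set1 lee_fin invr_ge0 ltW.
pose F (r : R) : R := a^-1 * expR (- a * (s - r)).
have dF (x : R) : is_derive x (1 : R) F (expR (- a * (s - x))).
  have h1 : is_derive x (1 : R) (fun r => - a * (s - r)) a.
    by apply: is_derive_eq; rewrite add0r /GRing.scale/= mul1r mulrN1 opprK.
  have h2 := is_deriveZ a^-1 (@is_derive1_comp _ expR (fun r => - a * (s - r)) x _ _ (is_derive_expR _) h1).
  apply: (is_derive_eq h2).
  by rewrite /GRing.scale/= mulrCA mulVf ?gt_eqF// mulr1.
have cF : continuous F.
  by move=> x; apply: differentiable_continuous; apply/derivable1_diffP; exact: (@ex_derive _ _ _ _ _ _ _ (dF x)).
rewrite (@continuous_FTC2 _ _ F)//.
- rewrite -EFinB lee_fin /F subrr mulr0 expR0 mulr1 gerBl mulr_ge0 ?expR_ge0// invr_ge0 ltW//.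
- apply: continuous_subspaceT => r; apply: continuous_comp; last exact: continuous_expR.
  by apply: cvgM; [exact: cvg_cst|apply: cvgB; [exact: cvg_cst|exact: cvg_id]].
- split; first by move=> x _; exact: (@ex_derive _ _ _ _ _ _ _ (dF x)).
  + by apply: cvg_at_right_filter; exact: cF.
  + by apply: cvg_at_left_filter; exact: cF.
- by move=> x _; rewrite derive1E (@derive_val _ _ _ _ _ _ _ (dF x)).
Qed.

(** Cauchy-Schwarz for a weight of mass at most 1, through Young's inequality with a parameter:
    [e = sqrt c] is optimal, and [e] tends to 0 when [c = 0]. *)
Lemma weighted_cs t s (w phi : measurableTypeR R -> R) (c : R) :
  measurable_fun (`[t, s] : set (measurableTypeR R)) w ->
  measurable_fun (`[t, s] : set (measurableTypeR R)) phi ->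
  (forall r, t <= r <= s -> 0 <= w r) ->
  (\int[mu]_(r in `[t, s]) (w r)%:E <= 1)%E -> 0 <= c ->
  (\int[mu]_(r in `[t, s]) (w r * phi r ^+ 2)%:E <= c%:E)%E ->
  (\int[mu]_(r in `[t, s]) (w r * `|phi r|)%:E <= (Num.sqrt c)%:E)%E.
Proof.
move=> mw mphi w0 w1 c0 hc.
have mD := measurable_time_itv t s.
have w0' r : [set` `[t, s]] r -> 0 <= w r by move=> /=; rewrite in_itv/=; exact: w0.
have young e : 0 < e ->
    (\int[mu]_(r in `[t, s]) (w r * `|phi r|)%:E <= (e / 2 + (2 * e)^-1 * c)%:E)%E.
  move=> e0; have e20 : 0 <= e / 2 by rewrite divr_ge0// ltW.
  have e21 : 0 <= (2 * e)^-1 by rewrite invr_ge0 mulr_ge0// ltW.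
  apply: (@le_trans _ _ (\int[mu]_(r in `[t, s])
    ((e / 2)%:E * (w r)%:E + ((2 * e)^-1)%:E * (w r * phi r ^+ 2)%:E))%E).
    apply: ge0_integral_mono => r Dr; first by rewrite lee_fin mulr_ge0// w0'.
    rewrite -!EFinM -EFinD lee_fin.
    have -> : e / 2 * w r + (2 * e)^-1 * (w r * phi r ^+ 2)
       = w r * (e / 2 + (2 * e)^-1 * `|phi r| ^+ 2).
      by rewrite real_normK ?num_real//; ring.
    rewrite ler_wpM2l ?w0'// -subr_ge0.
    have -> : e / 2 + (2 * e)^-1 * `|phi r| ^+ 2 - `|phi r| = (2 * e)^-1 * (`|phi r| - e) ^+ 2.
      by field; rewrite gt_eqF.
    by rewrite mulr_ge0 ?sqr_ge0.
  have m1 : measurable_fun (`[t, s] : set (measurableTypeR R)) (fun r => (w r)%:E).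
    exact/measurable_EFinP.
  have m2 : measurable_fun (`[t, s] : set (measurableTypeR R)) (fun r => (w r * phi r ^+ 2)%:E).
    by apply/measurable_EFinP; apply: measurable_funM => //; exact: measurable_funX.
  rewrite ge0_integralD//; last 4 first.
  - by move=> r /w0' h; rewrite mule_ge0.
  - exact: emeasurable_funM.
  - by move=> r /w0' h; rewrite mule_ge0// lee_fin mulr_ge0// sqr_ge0.
  - exact: emeasurable_funM.
  rewrite !ge0_integralZl//; last by move=> r /w0' h; rewrite lee_fin mulr_ge0// sqr_ge0.
  rewrite EFinD EFinM; apply: leeD; last by rewrite EFinM; apply: lee_wpmul2l; rewrite ?lee_fin.
  by rewrite -[leRHS]mule1; apply: lee_wpmul2l; rewrite ?lee_fin.
have := c0; rewrite le_eqVlt => /predU1P[cz|cp].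
  rewrite -cz sqrtr0; apply/lee_addgt0Pr => e e0; rewrite add0e.
  apply: (le_trans (young e e0)); rewrite lee_fin -cz; lra.
have s0 : 0 < Num.sqrt c by rewrite sqrtr_gt0.
apply: (le_trans (young _ s0)); rewrite lee_fin.
rewrite -[c in X in _ + _ * X](sqr_sqrtr c0) expr2.
have -> : Num.sqrt c / 2 + (2 * Num.sqrt c)^-1 * (Num.sqrt c * Num.sqrt c) = Num.sqrt c.
  by field; rewrite gt_eqF.
exact: lexx.
Qed.

(* At the level [M], the energy accumulated up to the exit time is [M], by
   continuity of the energy in the upper bound of integration. *)
Lemma stopped_energy t s (phi : measurableTypeR R -> R) (M : R) : t <= s -> 0 <= M ->
  measurable_fun (`[t, s] : set (measurableTypeR R)) phi ->
  (forall r, t <= r <= s -> 0 <= phi r) ->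
  (\int[mu]_(r in `[t, s]) (phi r)%:E < +oo)%E ->
  (mine (\int[mu]_(r in `[t, s]) (phi r)%:E) M%:E <=
   \int[mu]_(r in `[t, s])
     (((\int[mu]_(r' in `[t, r]) (phi r')%:E <= M%:E)%E%:R * phi r)%:E))%E.
Proof.
move=> ts M0 mphi phi0 fin.
pose Q r := (\int[mu]_(r' in `[t, r]) (phi r')%:E)%E.
have phi0' r : [set` `[t, s]] r -> (0 <= (phi r)%:E)%E.
  by move=> /=; rewrite in_itv/= lee_fin; exact: phi0.
have mE : measurable_fun (`[t, s] : set (measurableTypeR R)) (fun r => (phi r)%:E) by exact/measurable_EFinP.
have sub r r' : r <= r' -> [set` `[t, r]] `<=` [set` `[t, r']].
  by move=> rr x /=; rewrite !in_itv/= => /andP[-> /le_trans]; apply.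
have Qmono r r' : r <= r' -> r' <= s -> (Q r <= Q r')%E.
  move=> rr rs; apply: ge0_subset_integral => //.
  - by apply: measurable_funS mE; [|exact: sub].
  - by move=> x /(sub _ _ rs); exact: phi0'.
  - exact: sub.
have Q0 r : r <= s -> (0 <= Q r)%E.
  by move=> rs; apply: integral_ge0 => x /(sub _ _ rs); exact: phi0'.
have Qfin r : r <= s -> Q r \is a fin_num.
  move=> rs; rewrite ge0_fin_numE ?Q0//; apply: le_lt_trans fin; exact: Qmono.
have int : mu.-integrable `[t, s] (EFin \o phi).
  apply/integrableP; split => //.
  rewrite (eq_integral (fun r => (phi r)%:E))// => r /set_mem/phi0' h.
  by rewrite gee0_abs.
(* Here [rho] is a time at which the level [M] is attained, or [s] if the level is not exceeded.
   Before it the indicator is 1, because [Q] is monotone. *)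
have [rho [rts Qrho hr]] : exists rho, [/\ t <= rho <= s, (Q rho <= M%:E)%E & (mine (Q s) M%:E <= Q rho)%E].
  have [sM|Ms] := leP (Q s) M%:E.
    by exists s; split => //; rewrite ?ts ?lexx// min_l.
  have := parameterized_integral_continuous ts int => cQ.
  have PE r : r <= s -> parameterized_integral mu t r phi = fine (Q r) by [].
  have Qt : Q t = 0%E by rewrite /Q set_itv1 integral_set1.
  have [||rho] := @IVT _ (fun x => parameterized_integral mu t x phi) t s M ts.
  - exact: cQ.
  - rewrite !PE// Qt/= min_l; last by rewrite fine_ge0// Q0.
    rewrite M0/= le_max; apply/orP; right; rewrite -lee_fin fineK ?Qfin//; exact: ltW.
  rewrite in_itv/= => /andP[tr rs]; rewrite PE// => QM.
  have QE : Q rho = M%:E by rewrite -QM fineK ?Qfin.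
  by exists rho; split; rewrite ?tr ?QE// ge_min lexx orbT.
have /andP[tr rs] := rts.
apply: (le_trans hr); rewrite /Q.
apply: (@le_trans _ _ (\int[mu]_(r in `[t, rho]) (((Q r <= M%:E)%E%:R * phi r)%:E))%E).
  apply: ge0_integral_mono => r rr; first by apply: phi0'; exact: sub rr.
  have rrho : r <= rho by move: rr; rewrite /= in_itv/= => /andP[].
  by rewrite (le_trans (Qmono _ _ rrho rs) Qrho) mul1r.
rewrite [leLHS]integral_mkcond [leRHS]integral_mkcond.
have p0 r : [set` `[t, s]] r -> (0 <= ((Q r <= M%:E)%E%:R * phi r)%:E)%E.
  by move=> rr; rewrite lee_fin mulr_ge0// -lee_fin; exact: phi0'.
apply: ge0_integral_mono => r _; rewrite !patchE.
  by case: ifPn => [/set_mem/(sub _ _ rs)/p0|].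
case: ifPn => [/set_mem/(sub _ _ rs) rr|_]; first by rewrite mem_set.
by case: ifPn => [/set_mem/p0|].
Qed.

(** The function [u] is only known to be bounded, by a constant [D0] that must not appear in the
    conclusion. The integral inequality is iterated: each round halves what remains of [D0] in the
    bound. *)
Lemma gronwall_decay t s0 (u F : measurableTypeR R -> \bar R) (K c D0 : R) :
  t <= s0 -> 0 < K -> 0 <= c -> 0 <= D0 ->
  measurable_fun (`[t, s0] : set (measurableTypeR R)) F ->
  (forall r, t <= r <= s0 -> (0 <= F r)%E) ->
  (forall r, t <= r <= s0 -> (0 <= u r <= D0%:E)%E) ->
  (forall s, t <= s <= s0 ->
    (u s <= K%:E * (c%:E + \int[mu]_(r in `[t, s]) ((expR (s - r))%:E * (u r + F r))))%E) ->
  (u s0 <= (expR ((1 + 2 * K) * (s0 - t)) * (2 * K))%:E *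
    (c%:E + \int[mu]_(r in `[t, s0]) F r))%E.
Proof.
move=> ts0 K0 c0 D00 mF F0 uD hu.
have K20 : 0 < 2 * K by rewrite mulr_gt0.
have sub s : s <= s0 -> [set` `[t, s]] `<=` [set` `[t, s0]].
  by move=> rr x /=; rewrite !in_itv/= => /andP[-> /le_trans]; apply.
have F0' r : [set` `[t, s0]] r -> (0 <= F r)%E by rewrite /= in_itv/=; exact: F0.
have iF0 : (0 <= \int[mu]_(r in `[t, s0]) F r)%E by exact: integral_ge0.
have [->|] := eqVneq (\int[mu]_(r in `[t, s0]) F r)%E +oo%E.
  by rewrite addey// gt0_muley ?leey// lte_fin mulr_gt0// expR_gt0.
rewrite -ltey -ge0_fin_numE// => iFfin.
rewrite -(fineK iFfin); set phi := fine _.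
have phi0 : 0 <= phi by exact: fine_ge0.
(* In the supremum norm weighted by [exp (lam * (s - t))], the operator with kernel
   [K * expR (s - r)] has norm at most [K / (2 * K) = 1 / 2]; the 1 in [lam] compensates the growth
   of the kernel. *)
pose lam := 1 + 2 * K; pose A := 2 * K * (c + phi).
have A0 : 0 <= A by rewrite mulr_ge0 ?addr_ge0// ltW.
have ind n : forall s, t <= s <= s0 -> (u s <= (expR (lam * (s - t)) * (A + D0 / 2 ^+ n))%:E)%E.
  elim: n => [|n ih] s sts.
    have /andP[ts ss] := sts; have /andP[_ /le_trans] := uD s sts; apply.
    rewrite lee_fin expr0 divr1 (@le_trans _ _ (A + D0))// ?lerDr// ler_peMl ?addr_ge0//.
    rewrite -expR0 ler_expR mulr_ge0 ?subr_ge0// /lam; lra.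
  have /andP[ts ss] := sts; apply: (le_trans (hu s sts)).
  set D := A + D0 / 2 ^+ n in ih.
  have D'0 : 0 <= D by rewrite addr_ge0// divr_ge0// exprn_ge0.
  set e := expR (lam * (s - t)).
  have e0 : 0 <= e by exact: expR_ge0.
  have e1 : 1 <= e.
    by rewrite -expR0 ler_expR mulr_ge0 ?subr_ge0// /lam; lra.
  have mFs : measurable_fun (`[t, s] : set (measurableTypeR R)) F.
    by apply: measurable_funS mF; [|exact: sub].
  have int : (\int[mu]_(r in `[t, s]) ((expR (s - r))%:E * (u r + F r)) <=
     (e * (D / (2 * K) + phi))%:E)%E.
    apply: (@le_trans _ _ (\int[mu]_(r in `[t, s])
       ((e * D)%:E * (expR (- (2 * K) * (s - r)))%:E + e%:E * F r))%E).
      have rD r : [set` `[t, s]] r -> t <= r <= s0.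
        by move=> /(sub _ ss); rewrite /= in_itv/=.
      apply: ge0_integral_mono => r rr; have rts := rD r rr.
        by have /andP[u0 _] := uD r rts; rewrite mule_ge0 ?lee_fin ?expR_ge0// adde_ge0 ?F0.
      have rs : r <= s by move: rr; rewrite /= in_itv/= => /andP[].
      have [tr _] := andP rts; have [u0 _] := andP (uD _ rts).
      rewrite muleDr//; last by rewrite ge0_adde_def// inE F0.
      apply: leeD.
        apply: (@le_trans _ _ ((expR (s - r))%:E * (expR (lam * (r - t)) * D)%:E)%E).
          by apply: lee_wpmul2l; rewrite ?lee_fin ?expR_ge0// ih.
        rewrite -!EFinM lee_fin mulrA -expRD mulrAC /e -expRD ler_wpM2r//.
        by rewrite ler_expR /lam; nra.
      apply: lee_wpmul2r; first exact: F0.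
      rewrite lee_fin ler_expR /lam; nra.
    have mdec := @measurable_decay (- (2 * K)) s [set` `[t, s]].
    have p1 r : [set` `[t, s]] r -> (0 <= F r)%E by move=> rr; apply: F0'; exact: sub rr.
    have p2 r : [set` `[t, s]] r -> (0 <= (expR (- (2 * K) * (s - r)))%:E)%E.
      by move=> _; rewrite lee_fin expR_ge0.
    have p3 : (0 <= (e * D)%:E)%E by rewrite lee_fin mulr_ge0.
    have p4 : (0 <= e%:E)%E by rewrite lee_fin.
    rewrite ge0_integralD//; first rewrite !ge0_integralZl//; last first.
    - exact: emeasurable_funM.
    - by move=> r rr; rewrite mule_ge0// p1.
    - by apply: emeasurable_funM => //; exact: mdec.
    - by move=> r rr; rewrite mule_ge0// p2.
    have -> : e * (D / (2 * K) + phi) = e * D * (2 * K)^-1 + e * phi by rewrite [LHS]mulrDr mulrA.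
    rewrite EFinD; apply: leeD.
      rewrite [leRHS]EFinM; apply: lee_wpmul2l => //.
      exact: decay_integral_le.
    rewrite EFinM; apply: lee_wpmul2l => //.
    rewrite fineK//; apply: ge0_subset_integral => //; try exact: measurable_time_itv.
    exact: sub.
  apply: (@le_trans _ _ (K%:E * (c%:E + (e * (D / (2 * K) + phi))%:E))%E).
    by apply: lee_wpmul2l; rewrite ?lee_fin ?(ltW K0)//; exact: leeD2l.
  rewrite -EFinD -EFinM lee_fin.
  have -> : K * (c + e * (D / (2 * K) + phi)) = K * c + e * (D / 2 + K * phi).
    by field; rewrite gt_eqF.
  have -> : e * (A + D0 / 2 ^+ n.+1) = e * (K * c) + e * (D / 2 + K * phi).
    by rewrite -mulrDr /D /A exprS; congr (e * _); field; rewrite expf_neq0.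
  by rewrite lerD2r ler_peMl// mulr_ge0// ltW.
have final : (u s0 <= (expR (lam * (s0 - t)) * A)%:E)%E.
  apply/lee_addgt0Pr => e e0.
  set E := expR _ in ind *.
  have E0 : 0 <= expR (lam * (s0 - t)) * D0 by rewrite mulr_ge0 ?expR_ge0.
  have d0 : 0 < e / (expR (lam * (s0 - t)) * D0 + 1) by rewrite divr_gt0// ltr_wpDl.
  have [n hn] := ltr_add_invr d0.
  have := ind n s0; rewrite ts0 lexx => /(_ isT) /le_trans; apply.
  rewrite -EFinD lee_fin mulrDr lerD2l mulrA.
  apply: (@le_trans _ _ (expR (lam * (s0 - t)) * D0 * n.+1%:R^-1)).
    rewrite ler_wpM2l// lef_pV2 ?posrE ?exprn_gt0//.
    by rewrite -natrX ler_nat ltn_expl.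
  move: hn; rewrite add0r => /ltW hn; apply: (le_trans (ler_wpM2l E0 hn)).
  rewrite mulrA ler_pdivrMr ?ltr_wpDl// mulrC ler_wpM2l ?(ltW e0)//.
  by rewrite lerDl.
by apply: (le_trans final); rewrite -EFinD -EFinM lee_fin /A mulrA.
Qed.

End time_integrals.

(** * Moments of processes satisfying a mild equation *)

Section energy.
Context (R : realType) (d : measure_display) (Om : measurableType d).
Context (t T : R).
Local Notation mu := (@lebesgue_measure R).
Let D : set (measurableTypeR R * Om) := `[t, T] `*` setT.
Context (phi : R -> Om -> R).
Hypothesis mphi : measurable_fun D (fun z => phi z.1 z.2).
Hypothesis phi0 : forall r w, t <= r <= T -> 0 <= phi r w.

(** Joint measurability in the upper bound and in chance: the variable bound is written as the
    indicator of [r' <= r], and the integral becomes a Tonelli section. *)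
Lemma energy_measurable :
  measurable_fun D (fun z => \int[mu]_(r in `[t, z.1]) (phi r z.2)%:E)%E.
Proof.
pose g (z : measurableTypeR R * Om) : \bar R := ((fun z => (phi z.1 z.2)%:E) \_ D) z.
have mD : measurable D by exact: measurable_strip.
have mg : measurable_fun setT g.
  by apply/(measurable_restrictT _ mD); exact/measurable_EFinP.
have g0 z : (0 <= g z)%E.
  rewrite /g patchE; case: ifPn => // /set_mem[/=]; rewrite in_itv/= => h _.
  by rewrite lee_fin; exact: phi0.
pose G (z : measurableTypeR R * Om * measurableTypeR R) : \bar R :=
  (((z.2 <= z.1.1)%R%:R : R)%:E * g (z.2, z.1.2))%E.
have mG : measurable_fun setT G.
  apply: emeasurable_funM.
    apply/measurable_EFinP.
    rewrite (_ : (fun _ => _) = \1_([set z : measurableTypeR R * Om * measurableTypeR R | (z.2 : R) <= z.1.1])); last first.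
      by apply/funext => z; rewrite indicE; case: (boolP (_ <= _)%R) => h; [rewrite mem_set|rewrite memNset//=; exact/negP].
    apply: measurable_indic.
    pose h (z : measurableTypeR R * Om * measurableTypeR R) : R := (z.1.1 : R) - z.2.
    have mh : measurable_fun setT h.
      have m1 := measurableT_comp (@measurable_fst _ _ (measurableTypeR R) Om)
        (@measurable_fst _ _ (measurableTypeR R * Om)%type (measurableTypeR R)).
      have m2 := @measurable_snd _ _ (measurableTypeR R * Om)%type (measurableTypeR R).
      by apply: measurable_funB; [exact: m1|exact: m2].
    rewrite (_ : [set z | _] = setT `&` h @^-1` `[0, +oo[%classic).
      by apply: mh => //; exact: measurable_itv.
    by rewrite setTI; apply/seteqP; split => z /=; rewrite in_itv/= andbT subr_ge0.
  apply: (measurableT_comp mg).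
  by apply: measurable_fun_pair => //=; apply: measurableT_comp.
have G0 z : (0 <= G z)%E by rewrite mule_ge0 ?lee_fin.
have := @measurable_fun_fubini_tonelli_F _ _ _ _ R mu G mG G0.
move=> h; apply: (@eq_measurable_fun _ _ _ _ D (fubini_F mu G)); last exact: measurable_funTS.
move=> [r w] /set_mem[/=]; rewrite in_itv/= => /andP[tr rT] _.
rewrite /fubini_F [RHS]integral_mkcond; apply: eq_integral => r' _.
rewrite /G /g /= !patchE; have [rr|rr] := leP r' r; last first.
  by rewrite mul0e memNset//= in_itv/= => /andP[_]; rewrite leNgt rr.
rewrite mul1e; case: ifPn => [/set_mem[/=]|].
  rewrite in_itv/= => /andP[tr' _] _; rewrite mem_set//= in_itv/= tr'//.
move=> /negP hn; rewrite memNset// => hn'; apply: hn; apply/mem_set; split => //=.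
by move: hn'; rewrite /= !in_itv/= => /andP[-> /le_trans]; apply.
Qed.

End energy.

Section moment_gronwall.
Context (R : realType) (H Xi : hilbertType R) (E : onb Xi).
Hypotheses (sepH : separable H) (sepXi : separable Xi).
Context (d : measure_display) (Om : measurableType d) (P : probability Om R).
Context (t T : R) (W : R -> Xi -> Om -> R).
Hypothesis hW : reference_space P t T W.
Hypothesis tT : t <= T.
Context (B : {linear H -> H}) (hB : psd B).
Local Notation N := (norm_m1 B).
Local Notation mu := (@lebesgue_measure R).
Local Notation strip s := (`[t, s] `*` setT : set (measurableTypeR R * Om)).
Context (S : R -> {linear H -> H}) (c0 C : R) (p : nat).
Hypotheses (c00 : 0 <= c0) (C0 : 0 <= C) (p12 : (0 < p <= 2)%N).
Hypothesis hS : forall s x, 0 <= s -> N (S s x) <= expR (c0 * s) * N x.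
Context (Y : R -> Om -> H) (y : H) (beta : R -> Om -> H) (Psi : R -> Om -> Xi -> H).
Context (f : R -> Om -> R).
Hypothesis mY : borel_fun (strip T) (fun z => Y z.1 z.2).
Hypothesis cY : forall w, {within `[t, T], continuous (fun s => Y s w)}.
Hypothesis f0 : forall r w, t <= r <= T -> 0 <= f r w.
Hypothesis mf : measurable_fun (strip T) (fun z => f z.1 z.2).
Hypothesis fint : (\int[P]_w \int[mu]_(r in `[t, T]) ((f r w ^+ 2) ^+ p)%:E < +oo)%E.
Hypothesis hbeta : forall r w, t <= r <= T -> N (beta r w) <= C * (N (Y r w) + f r w).
Hypothesis hPsi : forall r w, t <= r <= T ->
  (hs_sum E N (Psi r w) <= ((C * (N (Y r w) + f r w)) ^+ 2)%:E)%E.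
Hypothesis hmild : forall s, t <= s <= T ->
  exists2 I : Om -> H,
    ito_lim E P t W s (fun r w e => S (s - r) (Psi r w e)) I &
    {ae P, forall w, exists2 J : H,
      ((N J)%:E <= \int[mu]_(r in `[t, s]) (N (S (s - r) (beta r w)))%:E)%E &
      Y s w = S (s - t) y + J + I w}.

(* The discount exceeds the growth rate of the semigroup by 1, which makes the
   convolution of the drift bounded by the energy uniformly in the horizon. *)
Let c1 := c0 + 1.
(** [k] bounds the discounted coefficients, [n] is the discounted seminorm of the solution, and [q]
    is the energy by which the equation is localized. *)
Let k r w : R := expR (- c1 * (r - t)) * (C * (N (Y r w) + f r w)).
Let n r w : R := expR (- c1 * (r - t)) * N (Y r w).
Let q s w : \bar R := (\int[mu]_(r in `[t, s]) (k r w ^+ 2)%:E)%E.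

Let k0 r w : t <= r <= T -> 0 <= k r w.
Proof.
by move=> rT; apply: mulr_ge0; rewrite ?expR_ge0// mulr_ge0// addr_ge0 ?norm_m1_ge0 ?f0.
Qed.

Let n0 r w : 0 <= n r w.
Proof. by rewrite mulr_ge0 ?expR_ge0 ?norm_m1_ge0. Qed.

Let mdisc : measurable_fun (strip T) (fun z => expR (- c1 * (z.1 - t))).
Proof.
apply: measurable_funTS.
apply: (measurableT_comp (f := fun r : measurableTypeR R => expR (- c1 * (r - t)) : R)) => //.
apply: continuous_measurable_fun => r.
apply: continuous_comp; last exact: continuous_expR.
by apply: cvgM; [exact: cvg_cst|apply: cvgB; [exact: cvg_id|exact: cvg_cst]].
Qed.

Let mNY : measurable_fun (strip T) (fun z => N (Y z.1 z.2)).
Proof.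
apply: borel_fun_measurable; first exact: measurable_strip.
exact: borel_fun_continuous (norm_m1_continuous hB) mY.
Qed.

Let mk : measurable_fun (strip T) (fun z => k z.1 z.2).
Proof.
by apply: measurable_funM => //; apply: measurable_funM => //; exact: measurable_funD.
Qed.

Let mn : measurable_fun (strip T) (fun z => n z.1 z.2).
Proof. exact: measurable_funM. Qed.

Let strip_sub s : s <= T -> strip s `<=` strip T.
Proof. by move=> sT [r w] [/=]; rewrite !in_itv/= => /andP[-> /le_trans->]. Qed.

Let mstrip dZ (Z : measurableType dZ) s (h : measurableTypeR R * Om -> Z) : s <= T ->
  measurable_fun (strip T) h -> measurable_fun (strip s) h.
Proof.
by move=> sT; apply: measurable_funS; [exact: measurable_strip|exact: strip_sub].
Qed.

Let q0 s w : s <= T -> (0 <= q s w)%E.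
Proof. by move=> sT; apply: integral_ge0 => r _; rewrite lee_fin sqr_ge0. Qed.

Let mq s : s <= T -> measurable_fun setT (q s).
Proof.
move=> sT; apply: (@measurable_time_integral _ _ _ t s (fun r w => (k r w ^+ 2)%:E)).
  by apply/measurable_EFinP; apply: measurable_funX; exact: mstrip.
by move=> r w _; rewrite lee_fin sqr_ge0.
Qed.

Let measurable_le_ind (M : R) : measurable_fun setT (fun x : \bar R => (x <= M%:E)%E%:R : R).
Proof.
rewrite (_ : (fun _ => _) = \1_([set` `]-oo, M%:E]])).
  by apply: measurable_indic; exact: emeasurable_itv.
apply/funext => x; rewrite indicE; case: (boolP (_ <= _)%E) => h'.
  by rewrite mem_set//= in_itv/=.
by rewrite memNset//= in_itv/=; exact/negP.
Qed.

Let mqle (M : R) : measurable_fun (strip T) (fun z => (q z.1 z.2 <= M%:E)%E%:R : R).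
Proof.
have mD : measurable (strip T) by exact: measurable_strip.
have h : measurable_fun (strip T) (fun z => q z.1 z.2).
  apply: (@energy_measurable _ _ _ t T (fun r w => k r w ^+ 2)).
    exact: measurable_funX.
  by move=> r w _; exact: sqr_ge0.
exact: measurableT_comp (measurable_le_ind M) h.
Qed.

Let pow_le1D (x : R) : 0 <= x -> x <= 1 + x ^+ p.
Proof.
move=> x0; have [x1|x1] := leP x 1; first by rewrite (le_trans x1)// lerDl exprn_ge0.
by rewrite (@le_trans _ _ (x ^+ p))// ?lerDr// ler_eXnr ?(ltW x1)//; case/andP: p12.
Qed.

Let disc_le1 r : t <= r -> expR (- c1 * (r - t)) <= 1.
Proof.
by move=> tr; rewrite -expR0 ler_expR mulNr oppr_le0 mulr_ge0 ?subr_ge0// addr_ge0.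
Qed.

Let decay_le1 (r s : R) : r <= s -> expR (-1 * (s - r)) <= 1.
Proof. by move=> rs; rewrite -[leRHS]expR0 ler_expR; lra. Qed.

Let decay_inv (r s : R) : expR (-1 * (s - r)) * expR (s - r) = 1.
Proof. by rewrite -expRD -[RHS]expR0; congr expR; ring. Qed.

Let ic0 : 0 <= ito_const R.
Proof. by rewrite mulr_ge0 ?sqr_ge0// mart_const_ge0. Qed.

Let k_le r w : t <= r <= T -> k r w ^+ 2 <= 2 * C ^+ 2 * (n r w ^+ 2 + f r w ^+ 2).
Proof.
move=> rT; have /andP[tr _] := rT.
have e1 := disc_le1 tr; have e0 := expR_ge0 (- c1 * (r - t)).
have fr := f0 w rT; have n0' := n0 r w.
have kC : k r w <= C * (n r w + f r w).
  rewrite /k /n mulrCA ler_wpM2l// mulrDr lerD2l; exact: ler_piMl.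
apply: (@le_trans _ _ ((C * (n r w + f r w)) ^+ 2)).
  by apply: lerXn2r; rewrite ?nnegrE ?k0// mulr_ge0// addr_ge0.
rewrite exprMn -subr_ge0.
have -> : 2 * C ^+ 2 * (n r w ^+ 2 + f r w ^+ 2) - C ^+ 2 * (n r w + f r w) ^+ 2
  = (C * (n r w - f r w)) ^+ 2 by ring.
exact: sqr_ge0.
Qed.

Let mfp : measurable_fun (strip T) (fun z => ((f z.1 z.2 ^+ 2) ^+ p)%:E).
Proof. by apply/measurable_EFinP; do 2 apply: measurable_funX. Qed.

(** No moment of [Y] is involved: a continuous path is bounded in seminorm on [[t, T]], and the
    source [f] has finite energy for almost every [w]. *)
Let q_fin : {ae P, forall w, (q T w < +oo)%E}.
Proof.
pose qf w := (\int[mu]_(r in `[t, T]) ((f r w ^+ 2) ^+ p)%:E)%E.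
have fp0 r w : (0 <= ((f r w ^+ 2) ^+ p)%:E)%E by rewrite lee_fin exprn_ge0// sqr_ge0.
have mqf : measurable_fun setT qf.
  exact: (@measurable_time_integral _ _ _ t T (fun r w => ((f r w ^+ 2) ^+ p)%:E)).
have qf0 w : (0 <= qf w)%E by exact: integral_ge0.
have : P.-integrable setT qf.
  apply/integrableP; split => //.
  by under eq_integral do rewrite gee0_abs//.
move/(integrable_ae measurableT); apply: filterS => w /(_ Logic.I) wfin.
have cN : {within `[t, T], continuous (fun s => N (Y s w))}.
  by move=> x; apply: continuous_comp; [exact: cY|exact: norm_m1_continuous].
have [m _ hm] := EVT_max tT cN; set a := N (Y m w) in hm.
pose K := 2 * C ^+ 2.
have K0 : 0 <= K by rewrite mulr_ge0 ?sqr_ge0.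
have a0 : 0 <= a by exact: norm_m1_ge0.
have aK : 0 <= K * (a ^+ 2 + 1) by rewrite mulr_ge0// addr_ge0// sqr_ge0.
apply: (@le_lt_trans _ _ (\int[mu]_(r in `[t, T])
   ((K * (a ^+ 2 + 1))%:E + K%:E * ((f r w ^+ 2) ^+ p)%:E))%E).
  apply: ge0_integral_mono => r; rewrite /= in_itv/= => rT; first by rewrite lee_fin sqr_ge0.
  rewrite -EFinM -EFinD lee_fin (le_trans (k_le w rT))// -mulrDr ler_wpM2l//.
  rewrite -addrA lerD//; last by rewrite pow_le1D ?sqr_ge0.
  apply: lerXn2r; rewrite ?nnegrE//.
  have /andP[tr _] := rT.
  rewrite (@le_trans _ _ (N (Y r w)))//; first by rewrite /n ler_piMl ?norm_m1_ge0// disc_le1.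
  by apply: hm; rewrite in_itv.
have mfw : measurable_fun (`[t, T] : set (measurableTypeR R)) (fun r => ((f r w ^+ 2) ^+ p)%:E).
  exact: (@measurable_section_time _ _ _ t T (fun r w => ((f r w ^+ 2) ^+ p)%:E)).
rewrite ge0_integralD//; last 2 first.
- by move=> r _; rewrite mule_ge0.
- exact: emeasurable_funM.
rewrite ge0_integralZl// integral_cst//= lebesgue_measure_itv/= -/(qf w).
rewrite -(fineK wfin) -EFinM; case: ifP => _; last by rewrite mule0 add0e ltry.
by rewrite -EFinB -EFinM -EFinD ltry.
Qed.

(** In [12 ^ p], the factor [3 ^ p] comes from the square of a sum of three terms and
    [2 ^ p * 2 ^ p] from splitting the [p]-th power twice. *)
Let sq3_le (u v z x : R) : 0 <= x -> 0 <= u -> 0 <= v -> 0 <= z -> x <= u + v + z ->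
  (x ^+ 2) ^+ p <= 12 ^+ p * ((u ^+ 2) ^+ p + (v ^+ 2) ^+ p + (z ^+ 2) ^+ p).
Proof.
move=> x0 u0 v0 z0 hx.
have h1 : x ^+ 2 <= 3 * (u ^+ 2 + v ^+ 2 + z ^+ 2).
  apply: (@le_trans _ _ ((u + v + z) ^+ 2)).
    by apply: lerXn2r; rewrite ?nnegrE// !addr_ge0.
  have := sqr_ge0 (u - v); have := sqr_ge0 (u - z); have := sqr_ge0 (v - z); nra.
have s0 (b : R) : 0 <= b ^+ 2 by exact: sqr_ge0.
apply: (@le_trans _ _ ((3 * (u ^+ 2 + v ^+ 2 + z ^+ 2)) ^+ p)).
  by apply: lerXn2r; rewrite ?nnegrE ?mulr_ge0 ?addr_ge0.
rewrite exprMn.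
have -> : 12 ^+ p = 3 ^+ p * (2 ^+ p * 2 ^+ p) :> R by rewrite -!exprMn; congr (_ ^+ p); ring.
rewrite -mulrA ler_wpM2l ?exprn_ge0//.
apply: (le_trans (exprD_le p (addr_ge0 (s0 u) (s0 v)) (s0 z))).
rewrite -mulrA ler_wpM2l ?exprn_ge0// mulrDr lerD// ?exprD_le//.
by rewrite ler_peMl ?exprn_ge0// exprn_ege1// ler1n.
Qed.

(** Multiplied by the discount at [s], the mild equation has three terms: one bounded by the initial
    value, a drift bounded by the square root of [q s], and an Ito integral of energy at most [q s].
    Where [q s <= M], the energy equals its truncation. *)
Let moment_step s (M : R) : t <= s <= T -> 0 <= M ->
  (\int[P]_w ((q s w <= M%:E)%E%:R * (n s w ^+ 2) ^+ p)%:E <=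
   (12 ^+ p)%:E * (((N y ^+ 2) ^+ p)%:E +
     (1 + ito_const R)%:E * \int[P]_w (trunc (q s) M w ^+ p)%:E))%E.
Proof.
move=> tsT M0; have /andP[ts sT] := tsT.
have [I hI hae] := hmild tsT.
pose a := expR (- c1 * (s - t)).
have a0 : 0 < a by exact: expR_gt0.
(* With second coefficient 0, this multiplies the integral by the deterministic discount [a]. *)
have hI' := ito_lim_lin sepH sepXi hW a 0 tsT hI hI.
set Phi' := (fun (r : R) (w : Om) (e : Xi) => _) in hI'; set I' := (fun w : Om => _) in hI'.
have rle r : [set` `[t, s]] r -> t <= r <= s by rewrite /= in_itv.
have rle' r : [set` `[t, s]] r -> t <= r <= T.
  by move=> /rle/andP[-> /le_trans->].
have hq w : (\int[mu]_(r in `[t, s]) hs_sum E N (Phi' r w) <= q s w)%E.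
  apply: ge0_integral_mono => r rr; first exact: hs_sum_nneg.
  have rT := rle' r rr; have /andP[tr rs] := rle r rr.
  pose b := a * expR (c0 * (s - r)).
  have b0 : 0 <= b by rewrite mulr_ge0 ?expR_ge0.
  apply: (@le_trans _ _ ((b ^+ 2)%:E * hs_sum E N (Psi r w))%E).
    apply: hs_sum_le1; first exact: sqr_ge0.
    move=> e _; rewrite /Phi' scale0r addr0 norm_m1Z// gtr0_norm// -exprMn.
    apply: lerXn2r; rewrite ?nnegrE ?mulr_ge0 ?norm_m1_ge0 ?(ltW a0)//.
    by rewrite /b -mulrA ler_wpM2l ?(ltW a0)// hS// subr_ge0.
  apply: (@le_trans _ _ ((b ^+ 2)%:E * ((C * (N (Y r w) + f r w)) ^+ 2)%:E)%E).
    by apply: lee_wpmul2l; rewrite ?lee_fin ?sqr_ge0// hPsi.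
  rewrite -EFinM lee_fin -exprMn.
  have h0 : 0 <= C * (N (Y r w) + f r w) by rewrite mulr_ge0// addr_ge0 ?norm_m1_ge0 ?f0.
  apply: lerXn2r; rewrite ?nnegrE ?k0//; first exact: mulr_ge0.
  rewrite /k ler_wpM2r// /b /a -expRD ler_expR /c1; nra.
have mom := ito_moment sepH sepXi hW hB tsT hI' (mq sT) hq M0 p12.
have q0s w : (0 <= q s w)%E by exact: q0.
have tr0 w : 0 <= trunc (q s) M w by exact: trunc_ge0.
pose ind w : R := (q s w <= M%:E)%E%:R.
have pt : {ae P, forall w, [set: Om] w -> ((ind w * (n s w ^+ 2) ^+ p)%:E <=
   (12 ^+ p)%:E * (((N y ^+ 2) ^+ p)%:E + (trunc (q s) M w ^+ p)%:E + (ind w * (N (I' w) ^+ 2) ^+ p)%:E))%E}.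
  apply: filterS hae => w [J hJ Yw] _; rewrite -!EFinD -EFinM lee_fin.
  have s1 (b : R) : 0 <= (b ^+ 2) ^+ p by rewrite exprn_ge0// sqr_ge0.
  rewrite /ind; have [qM|qM] := boolP (q s w <= M%:E)%E; last first.
    by rewrite !mul0r addr0 mulr_ge0 ?exprn_ge0// addr_ge0 ?s1// exprn_ge0.
  rewrite !mul1r.
  have trE : (trunc (q s) M w)%:E = q s w by rewrite truncE// min_l.
  (* Because [c1 = c0 + 1], the factor [a * expR (c0 * (s - r))] is the discount at [r] times
     [exp (- (s - r))], a weight of mass at most 1; Cauchy-Schwarz gives the square root of the
     energy. *)
  have aJ : a * N J <= Num.sqrt (trunc (q s) M w).
    have mkw : measurable_fun (`[t, s] : set (measurableTypeR R)) (k ^~ w).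
      apply/measurable_EFinP.
      apply: (@measurable_section_time _ _ _ t s (fun r w => (k r w)%:E)).
      by apply/measurable_EFinP; exact: mstrip.
    have mdec := @measurable_decay R (-1) s [set` `[t, s]].
    have mw : measurable_fun (`[t, s] : set (measurableTypeR R)) (fun r => expR (-1 * (s - r))).
      by apply/measurable_EFinP; exact: mdec.
    have cs : (\int[mu]_(r in `[t, s]) (expR (-1 * (s - r)) * `|k r w|)%:E <=
        (Num.sqrt (trunc (q s) M w))%:E)%E.
      apply: weighted_cs => //.
        by apply: (le_trans (decay_integral_le ltr01 ts)); rewrite invr1.
      rewrite trE; apply: ge0_integral_mono => r rr.
        by rewrite lee_fin mulr_ge0 ?expR_ge0 ?sqr_ge0.
      have /andP[_ rs] := rle r rr.
      by rewrite lee_fin ler_piMl ?sqr_ge0// decay_le1.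
    rewrite -ler_pdivlMl// -lee_fin EFinM; apply: (le_trans hJ).
    apply: le_trans (lee_wpmul2l _ cs); last by rewrite lee_fin invr_ge0 ltW.
    have pm : measurable_fun (`[t, s] : set (measurableTypeR R)) (fun r => (expR (-1 * (s - r)) * `|k r w|)%:E).
      apply/measurable_EFinP; apply: measurable_funM => //.
      by apply: measurableT_comp mkw.
    have pp r : [set` `[t, s]] r -> (0 <= (expR (-1 * (s - r)) * `|k r w|)%:E)%E.
      by move=> _; rewrite lee_fin mulr_ge0 ?expR_ge0.
    have pa : (0 <= (a^-1)%:E)%E by rewrite lee_fin invr_ge0 ltW.
    rewrite -ge0_integralZl//.
    apply: ge0_integral_mono => r rr; first by rewrite lee_fin norm_m1_ge0.
    have rT := rle' r rr; have /andP[tr rs] := rle r rr.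
    rewrite -EFinM lee_fin ger0_norm ?k0//.
    have sr : 0 <= s - r by rewrite subr_ge0.
    apply: (le_trans (hS _ sr)).
    apply: (le_trans (ler_wpM2l (expR_ge0 _) (hbeta w rT))).
    rewrite /k /a -expRN; set D := C * _; rewrite !mulrA -!expRD.
    have -> // : - (- c1 * (s - t)) + -1 * (s - r) + - c1 * (r - t) = c0 * (s - r) by rewrite /c1; ring.
  have nle : n s w <= N y + Num.sqrt (trunc (q s) M w) + N (I' w).
    rewrite /n -/a Yw.
    apply: (@le_trans _ _ (a * (N (S (s - t) y) + N J + N (I w)))).
      rewrite ler_wpM2l ?(ltW a0)// (le_trans (norm_m1D hB _ _))// lerD2r.
      exact: norm_m1D.
    rewrite !mulrDr /I' scale0r addr0 norm_m1Z// gtr0_norm// lerD2r lerD//.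
    have st : 0 <= s - t by rewrite subr_ge0.
    apply: (le_trans (ler_wpM2l (ltW a0) (hS y st))).
    by rewrite mulrA ler_piMl ?norm_m1_ge0// /a -expRD -expR0 ler_expR /c1; nra.
  have := sq3_le (n0 s w) (norm_m1_ge0 B y) (sqrtr_ge0 _) (norm_m1_ge0 B _) nle.
  by rewrite (sqr_sqrtr (tr0 w)).
have mtr : measurable_fun setT (fun w => (trunc (q s) M w ^+ p)%:E).
  by apply/measurable_EFinP; apply: measurable_funX; apply: trunc_measurable => //; exact: mq.
have mind : measurable_fun setT ind by exact: measurableT_comp (measurable_le_ind M) (mq sT).
have mns : measurable_fun setT (n s).
  apply/measurable_EFinP; apply: (@measurable_section_expect _ _ _ t T (fun r w => (n r w)%:E)) => //.
  exact/measurable_EFinP.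
have mNI : measurable_fun setT (fun w => N (I' w)).
  apply: borel_fun_measurable => //; apply: borel_fun_continuous (norm_m1_continuous hB) _.
  exact: (ito_meas_lim hI').
have mlast : measurable_fun setT (fun w => (ind w * (N (I' w) ^+ 2) ^+ p)%:E).
  by apply/measurable_EFinP; apply: measurable_funM => //; do 2 apply: measurable_funX.
have s1 (b : R) : 0 <= (b ^+ 2) ^+ p by rewrite exprn_ge0// sqr_ge0.
have i0 w : 0 <= ind w by [].
have p1 w : [set: Om] w -> (0 <= (trunc (q s) M w ^+ p)%:E)%E by rewrite lee_fin exprn_ge0.
have p2 w : [set: Om] w -> (0 <= (ind w * (N (I' w) ^+ 2) ^+ p)%:E)%E by rewrite lee_fin mulr_ge0.
have p3 w : [set: Om] w -> (0 <= ((N y ^+ 2) ^+ p)%:E + (trunc (q s) M w ^+ p)%:E)%E.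
  by move=> _; rewrite adde_ge0 ?p1// lee_fin.
have p4 w : [set: Om] w -> (0 <= ((N y ^+ 2) ^+ p)%:E + (trunc (q s) M w ^+ p)%:E + (ind w * (N (I' w) ^+ 2) ^+ p)%:E)%E.
  by move=> _; rewrite adde_ge0 ?p2// ?p3.
have p5 : (0 <= (12 ^+ p)%:E :> \bar R)%E by rewrite lee_fin exprn_ge0.
have p6 w : [set: Om] w -> (0 <= ((N y ^+ 2) ^+ p)%:E)%E by rewrite lee_fin.
have m3 : measurable_fun setT (fun w => ((N y ^+ 2) ^+ p)%:E + (trunc (q s) M w ^+ p)%:E)%E.
  exact: emeasurable_funD.
have m4 : measurable_fun setT (fun w => ((N y ^+ 2) ^+ p)%:E + (trunc (q s) M w ^+ p)%:E + (ind w * (N (I' w) ^+ 2) ^+ p)%:E)%E.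
  exact: emeasurable_funD.
apply: (@le_trans _ _ (\int[P]_w ((12 ^+ p)%:E * (((N y ^+ 2) ^+ p)%:E + (trunc (q s) M w ^+ p)%:E + (ind w * (N (I' w) ^+ 2) ^+ p)%:E)))%E).
  apply: ae_ge0_le_integral => //.
  - by move=> w _; rewrite lee_fin mulr_ge0.
  - by apply/measurable_EFinP; apply: measurable_funM => //; do 2 apply: measurable_funX.
  - by move=> w _; rewrite mule_ge0// p4.
  - exact: emeasurable_funM.
rewrite ge0_integralZl//; apply: lee_wpmul2l => //.
rewrite ge0_integralD// ge0_integralD// int_probability_cst -addeA; apply: leeD2l.
rewrite EFinD ge0_muleDl ?lee_fin// mul1e.
by apply: leeD2l; exact: mom.
Qed.

Let ind_moment s (M : R) : (\int[P]_w ((q s w <= M%:E)%E%:R * (n s w ^+ 2) ^+ p)%:E >= 0)%E.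
Proof.
by apply: integral_ge0 => w _; rewrite lee_fin mulr_ge0// exprn_ge0// sqr_ge0.
Qed.

(** By [stopped_energy] the truncated energy is at most the energy accumulated while [q r <= M]. The
    kernel [expR (s - r)] is the price of bringing the power [p] under the time integral uniformly
    in the horizon. *)
Let trunc_step s (M : R) : t <= s <= T -> 0 <= M ->
  (\int[P]_w (trunc (q s) M w ^+ p)%:E <=
   \int[mu]_(r in `[t, s]) ((expR (s - r))%:E *
     \int[P]_w ((q r w <= M%:E)%E%:R * (k r w ^+ 2) ^+ p)%:E))%E.
Proof.
move=> tsT M0; have /andP[ts sT] := tsT.
pose F r w : R := expR (s - r) * ((q r w <= M%:E)%E%:R * (k r w ^+ 2) ^+ p).
have F0 r w : (0 <= (F r w)%:E)%E.
  by rewrite lee_fin mulr_ge0 ?expR_ge0// mulr_ge0// exprn_ge0// sqr_ge0.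
have mF : measurable_fun (strip s) (fun z => (F z.1 z.2)%:E).
  apply/measurable_EFinP; apply: measurable_funM.
    apply: measurable_funTS.
    apply: (measurableT_comp (f := fun r : measurableTypeR R => expR (s - r) : R)) => //.
    apply: continuous_measurable_fun => r.
    apply: continuous_comp; last exact: continuous_expR.
    by apply: cvgB; [exact: cvg_cst|exact: cvg_id].
  apply: mstrip => //; apply: measurable_funM => //.
  by do 2 apply: measurable_funX.
have mG : measurable_fun (strip s) (fun z => ((q z.1 z.2 <= M%:E)%E%:R * (k z.1 z.2 ^+ 2) ^+ p)%:E).
  apply/measurable_EFinP; apply: mstrip => //; apply: measurable_funM => //.
  by do 2 apply: measurable_funX.
have q0s w : (0 <= q s w)%E by exact: q0.
have tr0 w : 0 <= trunc (q s) M w by exact: trunc_ge0.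
apply: (@le_trans _ _ (\int[P]_w \int[mu]_(r in `[t, s]) (F r w)%:E)%E); last first.
  rewrite (@tonelli_time _ _ _ P t s (fun r w => (F r w)%:E))//.
  apply: ge0_integral_mono => r rr; first by exact: integral_ge0.
  have rT : t <= r <= s by move: rr; rewrite /= in_itv.
  have mGr := measurable_section_expect (f := fun r w => ((q r w <= M%:E)%E%:R * (k r w ^+ 2) ^+ p)%:E) mG rT.
  rewrite -ge0_integralZl ?lee_fin ?expR_ge0//.
  by move=> w _; rewrite lee_fin mulr_ge0// exprn_ge0// sqr_ge0.
apply: ae_ge0_le_integral => //.
- by move=> w _; rewrite lee_fin exprn_ge0.
- by apply/measurable_EFinP; apply: measurable_funX; apply: trunc_measurable => //; exact: mq.
- by move=> w _; exact: integral_ge0.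
- exact: (@measurable_time_integral _ _ _ t s (fun r w => (F r w)%:E)).
apply: filterS q_fin => w qT _.
have qs : (q s w < +oo)%E.
  apply: le_lt_trans qT; apply: ge0_subset_integral => //.
  - apply/measurable_EFinP; apply: measurable_funX; apply/measurable_EFinP.
    apply: (@measurable_section_time _ _ _ t T (fun r w => (k r w)%:E)).
    exact/measurable_EFinP.
  - by move=> r _; rewrite lee_fin sqr_ge0.
  - by move=> r /=; rewrite !in_itv/= => /andP[-> /le_trans->].
have mkw : measurable_fun (`[t, s] : set (measurableTypeR R)) (k ^~ w).
  apply/measurable_EFinP.
  apply: (@measurable_section_time _ _ _ t s (fun r w => (k r w)%:E)).
  by apply/measurable_EFinP; exact: mstrip.
pose G r : R := (q r w <= M%:E)%E%:R * k r w ^+ 2.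
have mGw : measurable_fun (`[t, s] : set (measurableTypeR R)) G.
  apply: measurable_funM; last exact: measurable_funX.
  apply/measurable_EFinP.
  apply: (@measurable_section_time _ _ _ t s (fun r w => ((q r w <= M%:E)%E%:R : R)%:E)).
  by apply/measurable_EFinP; exact: mstrip.
have G0 r : 0 <= G r by rewrite mulr_ge0// sqr_ge0.
have G2 r : G r ^+ p = (q r w <= M%:E)%E%:R * (k r w ^+ 2) ^+ p.
  rewrite exprMn; case: (q r w <= M%:E)%E; rewrite ?expr1n// expr0n.
  by case: (p) p12 => // p'; rewrite mul0r.
have FE r : F r w = expR (s - r) * G r ^+ p by rewrite G2.
clearbody F.
have en : (\int[mu]_(r in `[t, s]) (G r)%:E >= (trunc (q s) M w)%:E)%E.
  rewrite truncE//; apply: (@stopped_energy R t s (fun r => k r w ^+ 2)) => //.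
  - exact: measurable_funX.
  - by move=> r _; exact: sqr_ge0.
have I0 : (0 <= \int[mu]_(r in `[t, s]) (F r w)%:E)%E by exact: integral_ge0.
have [->|] := eqVneq (\int[mu]_(r in `[t, s]) (F r w)%:E)%E +oo%E; first exact: leey.
rewrite -ltey -ge0_fin_numE// => Ifin; rewrite -(fineK Ifin) lee_fin.
have e1 r : [set` `[t, s]] r -> 1 <= expR (s - r).
  by rewrite /= in_itv/= => /andP[_ rs]; rewrite -expR0 ler_expR subr_ge0.
have [p1|p2] : p = 1%N \/ p = 2%N by move: p12; case: (p) => [|[|[|]]]//; [left|right].
  suff : ((trunc (q s) M w)%:E <= \int[mu]_(r in `[t, s]) (F r w)%:E)%E.
    by rewrite p1 expr1 -lee_fin (fineK Ifin).
  apply: (le_trans en).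
  apply: ge0_integral_mono => r rr; rewrite lee_fin// FE p1 expr1.
  by rewrite ler_peMl// e1.
rewrite p2; have c0' := fine_ge0 I0; set c := fine _ in c0' *.
rewrite -(sqr_sqrtr c0'); apply: lerXn2r; rewrite ?nnegrE ?sqrtr_ge0//.
rewrite -lee_fin; apply: (le_trans en).
have mdec := @measurable_decay R (-1) s [set` `[t, s]].
have mw : measurable_fun (`[t, s] : set (measurableTypeR R)) (fun r => expR (-1 * (s - r))).
  by apply/measurable_EFinP; exact: mdec.
have mw' : measurable_fun (`[t, s] : set (measurableTypeR R)) (fun r => expR (s - r)).
  apply: measurable_funTS; apply: continuous_measurable_fun => r.
  apply: continuous_comp; last exact: continuous_expR.
  by apply: cvgB; [exact: cvg_cst|exact: cvg_id].
(* For [p = 2], Cauchy-Schwarz with the weight [exp (- (s - r))]; the inverse weight is the kernel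
   of the statement. *)
pose G' r : R := expR (s - r) * G r.
have G'0 r : 0 <= G' r by rewrite mulr_ge0 ?expR_ge0.
have G'1 r : expR (-1 * (s - r)) * G' r = G r by rewrite /G' mulrA decay_inv mul1r.
have G'2 r : expR (-1 * (s - r)) * G' r ^+ 2 = F r w by rewrite FE p2 expr2 mulrA G'1 expr2 /G' mulrCA.
have cs : (\int[mu]_(r in `[t, s]) (expR (-1 * (s - r)) * `|G' r|)%:E <= (Num.sqrt c)%:E)%E.
  apply: weighted_cs => //.
  - exact: measurable_funM.
  - by apply: (le_trans (decay_integral_le ltr01 ts)); rewrite invr1.
  rewrite /c fineK//; under eq_integral do rewrite G'2.
  exact: lexx.
apply: le_trans cs; apply: ge0_integral_mono => r rr; first by rewrite lee_fin.
by rewrite lee_fin ger0_norm// G'1.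
Qed.

Let pow2 (b : R) : 0 <= (b ^+ 2) ^+ p.
Proof. by rewrite exprn_ge0// sqr_ge0. Qed.

Let c2 : R := (4 * C ^+ 2) ^+ p.

Let k_pow r w : t <= r <= T ->
  (k r w ^+ 2) ^+ p <= c2 * ((n r w ^+ 2) ^+ p + (f r w ^+ 2) ^+ p).
Proof.
move=> rT; apply: (@le_trans _ _ ((2 * C ^+ 2 * (n r w ^+ 2 + f r w ^+ 2)) ^+ p)).
  by apply: lerXn2r; rewrite ?nnegrE ?sqr_ge0 ?mulr_ge0 ?addr_ge0 ?sqr_ge0 ?k_le.
rewrite exprMn /c2.
have -> : (4 * C ^+ 2) ^+ p = (2 * C ^+ 2) ^+ p * 2 ^+ p by rewrite -exprMn; congr (_ ^+ p); ring.
rewrite -mulrA ler_wpM2l ?exprn_ge0 ?mulr_ge0 ?sqr_ge0//.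
by apply: exprD_le; exact: sqr_ge0.
Qed.

Let Fp r : \bar R := (\int[P]_w ((f r w ^+ 2) ^+ p)%:E)%E.
Let u (M : R) r : \bar R := (\int[P]_w ((q r w <= M%:E)%E%:R * (n r w ^+ 2) ^+ p)%:E)%E.

Let energy_expect r (M : R) : t <= r <= T ->
  (\int[P]_w ((q r w <= M%:E)%E%:R * (k r w ^+ 2) ^+ p)%:E <= c2%:E * (u M r + Fp r))%E.
Proof.
move=> rT; have /andP[tr rT'] := rT.
have c20 : 0 <= c2 by rewrite exprn_ge0// mulr_ge0// sqr_ge0.
have mfr : measurable_fun setT (fun w => ((f r w ^+ 2) ^+ p)%:E).
  exact: (measurable_section_expect (f := fun r w => ((f r w ^+ 2) ^+ p)%:E) mfp rT).
have mnr : measurable_fun setT (fun w => ((q r w <= M%:E)%E%:R * (n r w ^+ 2) ^+ p)%:E).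
  apply: (measurable_section_expect (t := t) (s := T)
    (f := fun r w => ((q r w <= M%:E)%E%:R * (n r w ^+ 2) ^+ p)%:E)) => //.
  by apply/measurable_EFinP; apply: measurable_funM => //; do 2 apply: measurable_funX.
have h1 w : [set: Om] w -> (0 <= ((q r w <= M%:E)%E%:R * (n r w ^+ 2) ^+ p)%:E)%E.
  by move=> _; rewrite lee_fin mulr_ge0.
have h2 w : [set: Om] w -> (0 <= ((f r w ^+ 2) ^+ p)%:E)%E by move=> _; rewrite lee_fin.
have h3 w : [set: Om] w -> (0 <= ((q r w <= M%:E)%E%:R * (n r w ^+ 2) ^+ p)%:E + ((f r w ^+ 2) ^+ p)%:E)%E.
  by move=> _; rewrite adde_ge0 ?h1 ?h2.
have mD := emeasurable_funD mnr mfr.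
have c20' : (0 <= c2%:E)%E by rewrite lee_fin.
rewrite /u /Fp -ge0_integralD// -ge0_integralZl//.
apply: ge0_integral_mono => w _; first by rewrite lee_fin mulr_ge0.
rewrite -EFinD -EFinM lee_fin; case: (q r w <= M%:E)%E; last first.
  by rewrite !mul0r add0r mulr_ge0.
by rewrite !mul1r k_pow.
Qed.

(** Combines the factors of [moment_step] and [energy_expect]; the leading 1 accounts for the
    initial value. *)
Let K3 : R := 12 ^+ p * (1 + (1 + ito_const R) * c2).

Let truncated_moment s (M : R) : t <= s <= T -> 0 <= M ->
  (u M s <= (expR ((1 + 2 * K3) * (s - t)) * (2 * K3))%:E *
    (((N y ^+ 2) ^+ p)%:E + \int[mu]_(r in `[t, s]) Fp r))%E.
Proof.
move=> tsT M0; have /andP[ts sT] := tsT.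
have c20 : 0 <= c2 by rewrite exprn_ge0// mulr_ge0// sqr_ge0.
have ic1 : 0 <= 1 + ito_const R by rewrite addr_ge0.
have K30 : 0 < K3 by rewrite mulr_gt0 ?exprn_gt0// ltr_wpDr// mulr_ge0.
(* The a priori bound required by Gronwall's lemma, obtained from [trunc <= M]. It grows with [M]
   but leaves no trace in the conclusion. *)
pose D0 := 12 ^+ p * ((N y ^+ 2) ^+ p + (1 + ito_const R) * M ^+ p).
have D00 : 0 <= D0 by rewrite mulr_ge0 ?exprn_ge0// addr_ge0// mulr_ge0// exprn_ge0.
apply: (@gronwall_decay R t s (u M) Fp K3 _ D0) => //.
- apply: (@measurable_expect_integral _ _ _ P t s (fun r w => ((f r w ^+ 2) ^+ p)%:E)).
    exact: mstrip.
  by move=> r w _; rewrite lee_fin.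
- by move=> r _; apply: integral_ge0 => w _; rewrite lee_fin.
- move=> r /andP[tr rs]; rewrite ind_moment/=.
  have rT : t <= r <= T by rewrite tr (le_trans rs).
  apply: (le_trans (moment_step rT M0)); rewrite /D0 EFinM; apply: lee_wpmul2l.
    by rewrite lee_fin exprn_ge0.
  rewrite [leRHS]EFinD; apply: leeD2l; rewrite EFinM; apply: lee_wpmul2l; first by rewrite lee_fin.
  rewrite -(int_probability_cst P (M ^+ p)).
  have q0r w : (0 <= q r w)%E by apply: q0; exact: le_trans sT.
  apply: ge0_integral_mono => w _; first by rewrite lee_fin exprn_ge0// trunc_ge0.
  by rewrite lee_fin; apply: lerXn2r; rewrite ?nnegrE ?trunc_ge0 ?trunc_le.
move=> r /andP[tr rs]; have rT : t <= r <= T by rewrite tr (le_trans rs).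
apply: (le_trans (moment_step rT M0)).
set II := (\int[mu]_(x in `[t, r]) _)%E.
have II0 : (0 <= II)%E.
  apply: integral_ge0 => x _; rewrite mule_ge0 ?lee_fin ?expR_ge0// adde_ge0 ?ind_moment//.
  by apply: integral_ge0 => w _; rewrite lee_fin.
have h : (\int[P]_w (trunc (q r) M w ^+ p)%:E <= c2%:E * II)%E.
  apply: (le_trans (trunc_step rT M0)).
  have mu' : measurable_fun (`[t, r] : set (measurableTypeR R)) (fun x => (expR (r - x))%:E * (u M x + Fp x))%E.
    apply: emeasurable_funM.
      have := @measurable_decay R 1 r [set` `[t, r]]; apply: eq_measurable_fun => x _.
      by rewrite mul1r.
    apply: emeasurable_funD.
      apply: (@measurable_expect_integral _ _ _ P t r (fun r w => ((q r w <= M%:E)%E%:R * (n r w ^+ 2) ^+ p)%:E)).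
        apply: mstrip; first by case/andP: rT.
        by apply/measurable_EFinP; apply: measurable_funM => //; do 2 apply: measurable_funX.
      by move=> x w _; rewrite lee_fin mulr_ge0.
    apply: (@measurable_expect_integral _ _ _ P t r (fun r w => ((f r w ^+ 2) ^+ p)%:E)).
      by apply: mstrip => //; case/andP: rT.
    by move=> x w _; rewrite lee_fin.
  have pu x : [set` `[t, r]] x -> (0 <= (expR (r - x))%:E * (u M x + Fp x))%E.
    move=> _; rewrite mule_ge0 ?lee_fin ?expR_ge0// adde_ge0 ?ind_moment//.
    by apply: integral_ge0 => w _; rewrite lee_fin.
  rewrite /II -ge0_integralZl ?lee_fin//.
  apply: ge0_integral_mono => x xr.
    rewrite mule_ge0 ?lee_fin ?expR_ge0//; apply: integral_ge0 => w _.
    by rewrite lee_fin mulr_ge0.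
  rewrite muleCA; apply: lee_wpmul2l; first by rewrite lee_fin expR_ge0.
  apply: energy_expect; move: xr; rewrite /= in_itv/= => /andP[-> xr].
  by case/andP: rT => _; exact: le_trans.
rewrite /K3 EFinM -muleA; apply: lee_wpmul2l; first by rewrite lee_fin exprn_ge0.
set NyII := (((N y ^+ 2) ^+ p)%:E + II)%E.
have -> : ((1 + (1 + ito_const R) * c2)%:E * NyII = NyII + (1 + ito_const R)%:E * c2%:E * NyII)%E.
  by rewrite EFinD ge0_muleDl ?lee_fin ?mulr_ge0// mul1e EFinM.
have -> : ((1 + ito_const R)%:E * c2%:E * NyII = (1 + ito_const R)%:E * c2%:E * ((N y ^+ 2) ^+ p)%:E + (1 + ito_const R)%:E * (c2%:E * II))%E.
  by rewrite /NyII ge0_muleDr ?lee_fin// -!muleA.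
apply: leeD; first by rewrite leeDl.
apply: (@le_trans _ _ ((1 + ito_const R)%:E * (c2%:E * II))%E).
  by apply: lee_wpmul2l; rewrite ?lee_fin.
by rewrite leeDr// -!EFinM lee_fin !mulr_ge0.
Qed.

(** [2 * K3] comes from Gronwall's lemma and [4 * c1] from undoing the discount in a power
    [2 * p <= 4]. It depends on [c0], [C] and [p] alone, hence neither on the horizon nor on the
    control. *)
Definition moment_const : R := 2 * K3 + 4 * c1.

Lemma moment_const_ge0 : 0 <= moment_const.
Proof.
have c20 : 0 <= c2 by rewrite exprn_ge0// mulr_ge0// sqr_ge0.
have K30 : 0 <= K3 by rewrite mulr_ge0 ?exprn_ge0// addr_ge0// mulr_ge0// addr_ge0.
by rewrite addr_ge0// mulr_ge0// addr_ge0.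
Qed.

(** The localization is removed by monotone convergence along the integers, [q] being finite almost
    surely, and the discount is then undone. *)
Lemma moment_gronwall s : t <= s <= T ->
  (\int[P]_w ((N (Y s w) ^+ 2) ^+ p)%:E <=
    (moment_const * expR ((1 + moment_const) * (s - t)))%:E *
    (((N y ^+ 2) ^+ p)%:E + \int[mu]_(r in `[t, s]) \int[P]_w ((f r w ^+ 2) ^+ p)%:E))%E.
Proof.
move=> tsT; have /andP[ts sT] := tsT.
have c20 : 0 <= c2 by rewrite exprn_ge0// mulr_ge0// sqr_ge0.
have K30 : 0 <= K3 by rewrite mulr_ge0 ?exprn_ge0// addr_ge0// mulr_ge0// addr_ge0.
have c10 : 0 <= c1 by rewrite addr_ge0.
set rhs := (((N y ^+ 2) ^+ p)%:E + _)%E.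
have rhs0 : (0 <= rhs)%E.
  rewrite adde_ge0 ?lee_fin//; apply: integral_ge0 => r _; apply: integral_ge0 => w _.
  by rewrite lee_fin.
set b := (expR ((1 + 2 * K3) * (s - t)) * (2 * K3))%:E.
have g0 m w : (0 <= ((q s w <= (m%:R)%:E)%E%:R * (n s w ^+ 2) ^+ p)%:E)%E.
  by rewrite lee_fin mulr_ge0.
have mns : measurable_fun setT (fun w => ((n s w ^+ 2) ^+ p)%:E).
  apply: (measurable_section_expect (t := t) (s := T) (f := fun r w => ((n r w ^+ 2) ^+ p)%:E)) => //.
  by apply/measurable_EFinP; do 2 apply: measurable_funX.
have mg (m : nat) : measurable_fun setT (fun w => ((q s w <= (m%:R)%:E)%E%:R * (n s w ^+ 2) ^+ p)%:E).
  apply/measurable_EFinP; apply: measurable_funM; last exact/measurable_EFinP.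
  exact: measurableT_comp (measurable_le_ind _) (mq sT).
have nd w : [set: Om] w -> {homo (fun m : nat => ((q s w <= (m%:R)%:E)%E%:R * (n s w ^+ 2) ^+ p)%:E) : m1 m2 / (m1 <= m2)%N >-> (m1 <= m2)%E}.
  move=> _ m1 m2 m12; rewrite lee_fin ler_wpM2r// ler_nat.
  case: (boolP (q s w <= m1%:R%:E)%E) => // h1; rewrite (le_trans h1)// lee_fin ler_nat//.
have mono := cvg_monotone_convergence measurableT mg (fun m w _ => g0 m w) nd.
pose n' w : \bar R := ((q s w < +oo)%E%:R * (n s w ^+ 2) ^+ p)%:E.
have mn' : measurable_fun setT n'.
  apply/measurable_EFinP; apply: measurable_funM; last exact/measurable_EFinP.
  apply: (measurableT_comp (f := fun x : \bar R => (x < +oo)%E%:R : R)); last exact: mq.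
  rewrite (_ : (fun _ => _) = \1_([set` `]-oo, +oo%E[])).
    by apply: measurable_indic; exact: emeasurable_itv.
  apply/funext => x; rewrite indicE; case: (boolP (_ < _)%E) => h'.
    by rewrite mem_set//= in_itv/=.
  by rewrite memNset//= in_itv/=; exact/negP.
have limE w : limn (fun m : nat => ((q s w <= (m%:R)%:E)%E%:R * (n s w ^+ 2) ^+ p)%:E) = n' w.
  apply: cvg_lim => //; apply: cvg_near_cst.
  have := q0 w sT; rewrite /n'; case: (q s w) => [x||]//= _; last first.
    exact: nearW.
  near=> m; rewrite ltry lee_fin (_ : (x <= m%:R)%R)//.
  by near: m; exact: nbhs_infty_ger.
have hn : (\int[P]_w ((n s w ^+ 2) ^+ p)%:E <= b * rhs)%E.
  apply: (@le_trans _ _ (\int[P]_w n' w)%E).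
    apply: ae_ge0_le_integral => //.
    - by move=> w _; rewrite lee_fin.
    - by move=> w _; rewrite lee_fin mulr_ge0.
    apply: filterS q_fin => w qT _.
    have qs : (q s w < +oo)%E.
      apply: le_lt_trans qT; apply: ge0_subset_integral => //.
      - apply/measurable_EFinP; apply: measurable_funX; apply/measurable_EFinP.
        apply: (@measurable_section_time _ _ _ t T (fun r w => (k r w)%:E)).
        exact/measurable_EFinP.
      - by move=> r _; rewrite lee_fin sqr_ge0.
      - by move=> r /=; rewrite !in_itv/= => /andP[-> /le_trans->].
    by rewrite /n' qs mul1r.
  under eq_integral do rewrite -limE.
  rewrite -(cvg_lim _ (mono P))//; apply: lime_le; first by apply/cvg_ex; eexists; exact: mono.
  by apply: nearW => m; exact: truncated_moment.
pose e := expR (c1 * (s - t)).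
have e0 : 0 <= e by exact: expR_ge0.
have cst0 : 0 <= c1 * (s - t) by rewrite mulr_ge0// subr_ge0.
have e1 : 1 <= e by rewrite -[leLHS]expR0 ler_expR.
have NE w : (N (Y s w) ^+ 2) ^+ p = (e ^+ 2) ^+ p * (n s w ^+ 2) ^+ p.
  rewrite -!exprMn; congr ((_ ^+ 2) ^+ p).
  by rewrite /n mulrA /e -expRD mulNr addrN expR0 mul1r.
under eq_integral do rewrite NE EFinM.
have pn w : [set: Om] w -> (0 <= ((n s w ^+ 2) ^+ p)%:E)%E by rewrite lee_fin.
rewrite ge0_integralZl ?lee_fin//.
apply: (le_trans (lee_wpmul2l _ hn)); first by rewrite lee_fin.
rewrite muleA; apply: lee_wpmul2r => //; rewrite -EFinM lee_fin.
have e4 : (e ^+ 2) ^+ p <= expR (4 * c1 * (s - t)).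
  rewrite -exprM (@le_trans _ _ (e ^+ 4))//.
    by rewrite ler_weXn2l//; move: p12; case: (p) => [|[|[|]]].
  by rewrite /e -expRM_natl ler_expR mulrA.
have -> : expR ((1 + moment_const) * (s - t)) =
    expR ((1 + 2 * K3) * (s - t)) * expR (4 * c1 * (s - t)).
  by rewrite -expRD /moment_const; congr expR; ring.
set E1 := expR ((1 + _) * _); have E10 : 0 <= E1 by exact: expR_ge0.
set E2 := expR (4 * _ * _) in e4 *; have E20 : 0 <= E2 by exact: expR_ge0.
apply: (@le_trans _ _ (E2 * (E1 * (2 * K3)))).
  by rewrite ler_wpM2r// mulr_ge0// mulr_ge0.
have -> : E2 * (E1 * (2 * K3)) = 2 * K3 * (E1 * E2) by ring.
by rewrite ler_wpM2r ?mulr_ge0// lerDl mulr_ge0.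
Unshelve. all: by end_near. Qed.

End moment_gronwall.

(** * Linear combinations of mild equations *)

Section bochner_linear.
Context (R : realType) (H : hilbertType R).
Hypothesis sepH : separable H.
Local Notation mu := (@lebesgue_measure R).

Definition step_lin (a b : R) (z1 z2 : step_fun H) : step_fun H :=
  let sel X (f : 'I_(step_size z1) -> X) (g : 'I_(step_size z2) -> X)
      (k : 'I_(step_size z1 + step_size z2)) :=
    match fintype.split k with inl i => f i | inr j => g j end in
  @StepFun _ _ (step_size z1 + step_size z2)
    (sel _ (@step_set _ _ z1) (@step_set _ _ z2))
    (sel _ (fun i => a *: @step_val _ _ z1 i) (fun j => b *: @step_val _ _ z2 j)).

Lemma step_lin_eval a b z1 z2 r :
  step_eval (step_lin a b z1 z2) r = a *: step_eval z1 r + b *: step_eval z2 r.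
Proof.
rewrite /step_eval /= big_split_ord /= !scaler_sumr; congr (_ + _); apply: eq_bigr => k _.
  by rewrite (unsplitK (inl k)) !scalerA mulrC.
by rewrite (unsplitK (inr k)) !scalerA mulrC.
Qed.

Lemma step_lin_int a b z1 z2 D :
  step_int D (step_lin a b z1 z2) = a *: step_int D z1 + b *: step_int D z2.
Proof.
rewrite /step_int /= big_split_ord /= !scaler_sumr; congr (_ + _); apply: eq_bigr => k _.
  by rewrite (unsplitK (inl k)) !scalerA mulrC.
by rewrite (unsplitK (inr k)) !scalerA mulrC.
Qed.

Lemma step_dist_measurable (D : set R) (f : R -> H) (z : step_fun H) :
  measurable (D : set (measurableTypeR R)) ->
  borel_fun (D : set (measurableTypeR R)) f ->
  (forall k, measurable (@step_set _ _ z k : set (measurableTypeR R))) ->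
  measurable_fun (D : set (measurableTypeR R)) (fun r => (`|f r - step_eval z r|)%:E).
Proof.
move=> mD bf mz; apply/measurable_EFinP; apply: borel_fun_measurable => //.
apply: (borel_fun_continuous (h := fun x : H => `|x|)); first exact: norm_continuous.
apply: borel_fun_add => //.
apply: (borel_fun_continuous (h := fun x : H => - x)).
  by move=> x; apply: cvgN; exact: cvg_id.
by apply: borel_fun_lincomb => // j; apply: measurable_indic; exact: mz.
Qed.

Lemma bochner_lin (D : set R) (f g : R -> H) (I J : H) (a b : R) :
  measurable (D : set (measurableTypeR R)) ->
  is_bochner_integral D f I -> is_bochner_integral D g J ->
  is_bochner_integral D (fun r => a *: f r + b *: g r) (a *: I + b *: J).
Proof.
move=> mD [mf [z1 [mz1 c1 i1]]] [mg [z2 [mz2 c2 i2]]].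
have bf : borel_fun (D : set (measurableTypeR R)) f by exact: mf.
have bg : borel_fun (D : set (measurableTypeR R)) g by exact: mg.
split.
  have bfg : borel_fun (D : set (measurableTypeR R)) (fun r => a *: f r + b *: g r).
    by apply: borel_fun_add => //; exact: borel_fun_scale.
  exact: bfg.
exists (fun n => step_lin a b (z1 n) (z2 n)); split.
- by move=> n k /=; case: (fintype.split k) => j; [exact: mz1|exact: mz2].
- have md1 n := step_dist_measurable mD bf (mz1 n).
  have md2 n := step_dist_measurable mD bg (mz2 n).
  have lim0 : (`|a|%:E * \int[mu]_(r in D) (`|f r - step_eval (z1 n) r|)%:E
     + `|b|%:E * \int[mu]_(r in D) (`|g r - step_eval (z2 n) r|)%:E)%E @[n --> \oo] --> 0%E.
    rewrite -[X in _ --> X]adde0; apply: cvgeD => //.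
      by rewrite -[X in _ --> X](mule0 `|a|%:E); apply: cvgeZl.
    by rewrite -[X in _ --> X](mule0 `|b|%:E); apply: cvgeZl.
  apply: (squeeze_cvge _ (cvg_cst 0%E) lim0).
  apply: nearW => n; apply/andP; split; first by apply: integral_ge0.
  rewrite -!ge0_integralZl// -ge0_integralD//; last 2 first.
  - exact: emeasurable_funM.
  - exact: emeasurable_funM.
  apply: ge0_integral_mono => r _; first by rewrite lee_fin.
  rewrite -!EFinM -EFinD lee_fin step_lin_eval opprD addrACA -!scalerBr.
  by rewrite (le_trans (ler_normD _ _))// !normrZ.
- have -> : (fun n => step_int D (step_lin a b (z1 n) (z2 n))) =
    fun n => a *: step_int D (z1 n) + b *: step_int D (z2 n).
    by apply/funext => n; exact: step_lin_int.
  by apply: cvgD; exact: cvgZr.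
Qed.

End bochner_linear.

Section mild_processes.
Context (R : realType) (H Xi : hilbertType R) (E : onb Xi).
Hypotheses (sepH : separable H) (sepXi : separable Xi).
Context (d : measure_display) (Om : measurableType d) (P : probability Om R).
Context (t T : R) (W : R -> Xi -> Om -> R).
Hypothesis hW : reference_space P t T W.
Context (S : R -> {linear H -> H}).
Local Notation mu := (@lebesgue_measure R).
Local Notation strip s := (`[t, s] `*` setT : set (measurableTypeR R * Om)).

(** The coefficients are processes and not functions of the state, so the class is closed under
    linear combinations; differences and convexity gaps of solutions belong to it although they
    solve no equation of the original form. *)
Record mild_process (Y : R -> Om -> H) (y : H) (beta : R -> Om -> H)
    (Psi : R -> Om -> Xi -> H) : Prop := {
  mild_meas : borel_fun (strip T) (fun z => Y z.1 z.2);
  mild_cont : forall w, {within `[t, T], continuous (fun s => Y s w)};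
  mild_eq : forall s, t <= s <= T ->
    exists2 I : Om -> H,
      ito_lim E P t W s (fun r w e => S (s - r) (Psi r w e)) I &
      {ae P, forall w, exists2 J : H,
        is_bochner_integral `[t, s] (fun r => S (s - r) (beta r w)) J &
        Y s w = S (s - t) y + J + I w} }.

Lemma mild_lin (a b : R) Y1 y1 beta1 Psi1 Y2 y2 beta2 Psi2 :
  mild_process Y1 y1 beta1 Psi1 -> mild_process Y2 y2 beta2 Psi2 ->
  mild_process (fun r w => a *: Y1 r w + b *: Y2 r w) (a *: y1 + b *: y2)
    (fun r w => a *: beta1 r w + b *: beta2 r w)
    (fun r w e => a *: Psi1 r w e + b *: Psi2 r w e).
Proof.
move=> [m1 c1 e1] [m2 c2 e2]; split.
- by apply: borel_fun_add => //; exact: borel_fun_scale.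
- by move=> w x; apply: cvgD; apply: cvgZr; [exact: c1|exact: c2].
move=> s tsT; have [I1 hI1 ae1] := e1 s tsT; have [I2 hI2 ae2] := e2 s tsT.
exists (fun w => a *: I1 w + b *: I2 w).
  have := ito_lim_lin sepH sepXi hW a b tsT hI1 hI2.
  congr (ito_lim _ _ _ _ _ _ _); apply/funext => r; apply/funext => w; apply/funext => e.
  by rewrite linearD !linearZ.
apply: filterS2 ae1 ae2 => w [J1 hJ1 Y1E] [J2 hJ2 Y2E].
exists (a *: J1 + b *: J2).
  have := bochner_lin sepH a b (measurable_time_itv t s) hJ1 hJ2.
  congr is_bochner_integral; apply/funext => r.
  by rewrite linearD !linearZ.
have SE : S (s - t) (a *: y1 + b *: y2) = a *: S (s - t) y1 + b *: S (s - t) y2.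
  by rewrite linearD !linearZ.
rewrite Y1E Y2E SE !scalerDr.
by rewrite addrACA; congr (_ + _); rewrite addrACA.
Qed.

Lemma mild_moment (B : {linear H -> H}) (c0 C : R) (p : nat) Y y beta Psi
    (f : R -> Om -> R) : t <= T -> psd B -> 0 <= c0 -> 0 <= C -> (0 < p <= 2)%N ->
  (forall s x, 0 <= s -> norm_m1 B (S s x) <= expR (c0 * s) * norm_m1 B x) ->
  mild_process Y y beta Psi ->
  (forall r w, t <= r <= T -> 0 <= f r w) ->
  measurable_fun (strip T) (fun z => f z.1 z.2) ->
  (\int[P]_w \int[mu]_(r in `[t, T]) ((f r w ^+ 2) ^+ p)%:E < +oo)%E ->
  (forall r w, t <= r <= T -> norm_m1 B (beta r w) <= C * (norm_m1 B (Y r w) + f r w)) ->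
  (forall r w, t <= r <= T ->
    (hs_sum E (norm_m1 B) (Psi r w) <= ((C * (norm_m1 B (Y r w) + f r w)) ^+ 2)%:E)%E) ->
  forall s, t <= s <= T ->
  (\int[P]_w ((norm_m1 B (Y s w) ^+ 2) ^+ p)%:E <=
    (moment_const c0 C p * expR ((1 + moment_const c0 C p) * (s - t)))%:E *
    (((norm_m1 B y ^+ 2) ^+ p)%:E +
      \int[mu]_(r in `[t, s]) \int[P]_w ((f r w ^+ 2) ^+ p)%:E))%E.
Proof.
move=> tT hB c00 C0 p12 hS [mY cY eY] f0 mf fint hbeta hPsi.
apply: (moment_gronwall sepH sepXi hW tT hB c00 C0 p12 hS mY cY f0 mf fint hbeta hPsi).
move=> s tsT; have [I hI hae] := eY s tsT; exists I => //.
by apply: filterS hae => w [J hJ YE]; exists J => //; exact: bochner_norm_le.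
Qed.

Lemma mild_solution_process (Lambda : normedModType R) (b : H -> Lambda -> H)
    (sigma : H -> Lambda -> hs E H) (x : H) (a : R -> Om -> Lambda) (X : R -> Om -> H) :
  t <= T -> is_mild_solution P S b sigma W t T x a X ->
  mild_process X x (fun r w => b (X r w) (a r w)) (fun r w => sigma (X r w) (a r w)).
Proof.
move=> tT [prX cX eX]; split => //.
  by apply: (progressive_borel_fun hW _ prX); rewrite tT lexx.
move=> s tsT; have [I hI hae] := eX s tsT; exists I => //.
by apply: (ito_integral_lim hW tsT).
Qed.

End mild_processes.

(** * Expectations of time integrals *)

Section strip_integrals.
Context (R : realType) (d : measure_display) (Om : measurableType d).
Context (P : probability Om R) (t T : R).
Local Notation mu := (@lebesgue_measure R).
Local Notation strip s := (`[t, s] `*` setT : set (measurableTypeR R * Om)).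
Implicit Types phi psi : R -> Om -> R.

(** Only the majorant has a sign: the integral of [f] is at most that of its positive part. It
    serves for the convexity gaps of the costs, which are signed. *)
Lemma integral_le_nneg (d' : measure_display) (T' : measurableType d')
    (m : {measure set T' -> \bar R}) (D : set T') (f g : T' -> \bar R) :
  (forall x, D x -> (0 <= g x)%E) -> (forall x, D x -> (f x <= g x)%E) ->
  (\int[m]_(x in D) f x <= \int[m]_(x in D) g x)%E.
Proof.
move=> g0 fg; rewrite integralE.
apply: (@le_trans _ _ (\int[m]_(x in D) f^\+ x)%E).
  rewrite -[leRHS]sube0; apply: leeB; first exact: lexx.
  by apply: integral_ge0 => x _; exact: funeneg_ge0.
apply: ge0_integral_mono => x Dx; first exact: funepos_ge0.
by rewrite funeposE ge_max fg ?g0.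
Qed.

(** Jensen's inequality for the square, by Young's inequality with parameter [c + e], positive even
    when [c = 0]. *)
Lemma expect_le_sqrt (f : Om -> R) (c : R) : 0 <= c -> measurable_fun setT f ->
  (forall w, 0 <= f w) -> (\int[P]_w (f w ^+ 2)%:E <= (c ^+ 2)%:E)%E ->
  (\int[P]_w (f w)%:E <= c%:E)%E.
Proof.
move=> c0 mf f0 hc; apply/lee_addgt0Pr => e e0; rewrite -EFinD.
set b := c + e; have b0 : 0 < b by rewrite ltr_wpDl.
have bc : c <= b by rewrite lerDl ltW.
have mf2 : measurable_fun setT (fun w => (f w ^+ 2)%:E).
  by apply/measurable_EFinP; exact: measurable_funX.
have p1 w : [set: Om] w -> (0 <= (f w ^+ 2)%:E)%E by rewrite lee_fin sqr_ge0.
have ib0 : (0 <= ((2 * b)^-1)%:E :> \bar R)%E by rewrite lee_fin invr_ge0 mulr_ge0// ltW.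
apply: (@le_trans _ _ (\int[P]_w ((b / 2)%:E + ((2 * b)^-1)%:E * (f w ^+ 2)%:E))%E).
  apply: ge0_integral_mono => w _; first by rewrite lee_fin.
  rewrite -EFinM -EFinD lee_fin -subr_ge0.
  have -> : b / 2 + (2 * b)^-1 * f w ^+ 2 - f w = (2 * b)^-1 * (f w - b) ^+ 2.
    by field; rewrite gt_eqF.
  by rewrite mulr_ge0 ?sqr_ge0// invr_ge0 mulr_ge0// ltW.
have p2 w : [set: Om] w -> (0 <= (b / 2)%:E :> \bar R)%E by rewrite lee_fin divr_ge0// ltW.
have p3 w : [set: Om] w -> (0 <= ((2 * b)^-1)%:E * (f w ^+ 2)%:E)%E by move=> _; rewrite mule_ge0 ?p1.
have mb := emeasurable_funM (measurable_cst ((2 * b)^-1)%:E) mf2.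
rewrite ge0_integralD// ge0_integralZl// int_probability_cst.
apply: (@le_trans _ _ ((b / 2)%:E + ((2 * b)^-1)%:E * (c ^+ 2)%:E)%E).
  by apply: leeD2l; apply: lee_wpmul2l.
rewrite -EFinM -EFinD lee_fin.
have bE : b = b / 2 + (2 * b)^-1 * b ^+ 2 by field; rewrite gt_eqF.
rewrite [leRHS]bE.
rewrite lerD2l ler_wpM2l ?invr_ge0 ?mulr_ge0 ?(ltW b0)//.
by apply: lerXn2r; rewrite ?nnegrE// ltW.
Qed.

Definition time_int phi (w : Om) : \bar R := (\int[mu]_(r in `[t, T]) (phi r w)%:E)%E.

Record strip_integrable phi : Prop := {
  strip_int_meas : measurable_fun (strip T) (fun z => phi z.1 z.2);
  strip_int_fin : (\int[P]_w \int[mu]_(r in `[t, T]) (`|phi r w|)%:E < +oo)%E }.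

Let section_meas phi w : measurable_fun (strip T) (fun z => phi z.1 z.2) ->
  measurable_fun (`[t, T] : set (measurableTypeR R)) (fun r => (phi r w)%:E).
Proof.
move=> mphi; apply: (@measurable_section_time _ _ _ t T (fun r w => (phi r w)%:E)).
exact/measurable_EFinP.
Qed.

Let abs_meas phi : measurable_fun (strip T) (fun z => phi z.1 z.2) ->
  measurable_fun setT (fun w => \int[mu]_(r in `[t, T]) (`|phi r w|)%:E)%E.
Proof.
move=> mphi; apply: (@measurable_time_integral _ _ _ t T (fun r w => (`|phi r w|)%:E)).
  apply/measurable_EFinP; exact: measurableT_comp mphi.
by move=> r w _; rewrite lee_fin.
Qed.

Lemma strip_integrable_path phi : strip_integrable phi ->
  {ae P, forall w, mu.-integrable `[t, T] (fun r => (phi r w)%:E)}.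
Proof.
move=> [mphi fphi].
have q0 w : (0 <= \int[mu]_(r in `[t, T]) (`|phi r w|)%:E)%E.
  by apply: integral_ge0 => r _; rewrite lee_fin.
have : P.-integrable setT (fun w => \int[mu]_(r in `[t, T]) (`|phi r w|)%:E)%E.
  apply/integrableP; split; first exact: abs_meas.
  by under eq_integral do rewrite gee0_abs//.
move/(integrable_ae measurableT); apply: filterS => w /(_ Logic.I) wfin.
apply/integrableP; split; first exact: section_meas.
by move: wfin; rewrite ge0_fin_numE.
Qed.

Lemma time_int_integrable phi : strip_integrable phi -> P.-integrable setT (time_int phi).
Proof.
move=> [mphi fphi]; apply/integrableP; split.
  pose pos r w := maxe (phi r w)%:E 0%E; pose neg r w := maxe (- (phi r w)%:E)%E 0%E.
  rewrite (_ : time_int phi = fun w => (\int[mu]_(r in `[t, T]) pos r w -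
       \int[mu]_(r in `[t, T]) neg r w)%E); last first.
    apply/funext => w; rewrite /time_int integralE; congr (_ - _)%E.
      by apply: eq_integral => r _; rewrite funeposE.
    by apply: eq_integral => r _; rewrite funenegE.
  have mE : measurable_fun (strip T) (fun z => (phi z.1 z.2)%:E) by exact/measurable_EFinP.
  apply: emeasurable_funB.
    apply: (@measurable_time_integral _ _ _ t T pos).
      by apply: measurable_maxe => //; exact: measurable_cst.
    by move=> r w _; rewrite le_max lexx orbT.
  apply: (@measurable_time_integral _ _ _ t T neg).
    by apply: measurable_maxe; [exact: measurableT_comp mE|exact: measurable_cst].
  by move=> r w _; rewrite le_max lexx orbT.
apply: le_lt_trans fphi; apply: ge0_integral_mono => w _; first exact: abse_ge0.
exact: (le_abse_integral mu (measurable_time_itv t T) (section_meas w mphi)).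
Qed.

Lemma strip_integrable_lin (a b : R) phi psi :
  strip_integrable phi -> strip_integrable psi ->
  strip_integrable (fun r w => a * phi r w + b * psi r w).
Proof.
move=> [m1 f1] [m2 f2]; split.
  by apply: measurable_funD; apply: measurable_funM.
have p1 phi' w : [set: Om] w -> (0 <= \int[mu]_(r in `[t, T]) (`|phi' r w|)%:E)%E.
  by move=> _; apply: integral_ge0 => r _; rewrite lee_fin.
apply: (@le_lt_trans _ _ (\int[P]_w (`|a|%:E * (\int[mu]_(r in `[t, T]) (`|phi r w|)%:E)
    + `|b|%:E * (\int[mu]_(r in `[t, T]) (`|psi r w|)%:E)))%E).
  apply: ge0_integral_mono => w _; first by apply: integral_ge0 => r _; rewrite lee_fin.
  have q1 := section_meas w m1; have q2 := section_meas w m2.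
  have q3 : measurable_fun (`[t, T] : set (measurableTypeR R)) (fun r => (`|phi r w|)%:E).
    by apply/measurable_EFinP; apply: measurableT_comp => //; exact/measurable_EFinP.
  have q4 : measurable_fun (`[t, T] : set (measurableTypeR R)) (fun r => (`|psi r w|)%:E).
    by apply/measurable_EFinP; apply: measurableT_comp => //; exact/measurable_EFinP.
  rewrite -!ge0_integralZl// -ge0_integralD//; last 2 first.
  - exact: emeasurable_funM.
  - exact: emeasurable_funM.
  apply: ge0_integral_mono => r _; rewrite ?lee_fin//.
  by rewrite (le_trans (ler_normD _ _))// !normrM.
have n1 := abs_meas m1; have n2 := abs_meas m2.
rewrite ge0_integralD//; last 4 first.
- by move=> w _; rewrite mule_ge0// p1.
- exact: emeasurable_funM.
- by move=> w _; rewrite mule_ge0// p1.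
- exact: emeasurable_funM.
rewrite !ge0_integralZl//; try by move=> w _; exact: p1.
have g1 : (0 <= \int[P]_w \int[mu]_(r in `[t, T]) (`|phi r w|)%:E)%E.
  by apply: integral_ge0 => w _; exact: p1.
have g2 : (0 <= \int[P]_w \int[mu]_(r in `[t, T]) (`|psi r w|)%:E)%E.
  by apply: integral_ge0 => w _; exact: p1.
move: f1 f2; rewrite -(ge0_fin_numE g1) -(ge0_fin_numE g2) => h1 h2.
by rewrite -(fineK h1) -(fineK h2) -!EFinM -EFinD ltry.
Qed.

(** The inner integrals are linear along almost every path, namely where both are integrable, and
    the outer integral does not see the others. *)
Lemma expect_time_lin (a b : R) phi psi :
  strip_integrable phi -> strip_integrable psi ->
  (\int[P]_w time_int (fun r w => (a * phi r w + b * psi r w)%R) w =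
   a%:E * \int[P]_w time_int phi w + b%:E * \int[P]_w time_int psi w)%E.
Proof.
move=> h1 h2; have h12 := strip_integrable_lin a b h1 h2.
have i1 := time_int_integrable h1; have i2 := time_int_integrable h2.
have i12 := time_int_integrable h12.
have j1 := integrableZl measurableT a i1; have j2 := integrableZl measurableT b i2.
rewrite -!integralZl// -integralD//; apply: ae_eq_integral => //.
- exact: measurable_int i12.
- by apply: emeasurable_funD; [exact: measurable_int j1|exact: measurable_int j2].
apply: filterS2 (strip_integrable_path h1) (strip_integrable_path h2) => w w1 w2 _.
rewrite /time_int.
have mD := measurable_time_itv t T.
have k1 := integrableZl mD a w1; have k2 := integrableZl mD b w2.
by rewrite -!integralZl// -integralD//; apply: eq_integral => r _; rewrite EFinD !EFinM.
Qed.

Lemma expect_time_fin phi : strip_integrable phi ->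
  (\int[P]_w time_int phi w)%E \is a fin_num.
Proof. by move=> h; apply: integrable_fin_num => //; exact: time_int_integrable. Qed.

End strip_integrals.

(** * States driven by a common control *)

Section controlled_states.
Context (R : realType) (H Xi : hilbertType R) (Lambda : completeNormedModType R).
Hypotheses (sepH : separable H) (sepXi : separable Xi) (sepL : separable Lambda).
Context (E : onb Xi) (Lambda0 : set Lambda) (hne : Lambda0 !=set0).
Context (p : R) (hp : 2 < p) (S : R -> {linear H -> H}).
Hypothesis hS : contraction_semigroup S.
Context (b : H -> Lambda -> H) (sigma : H -> Lambda -> hs E H).
Context (B : {linear H -> H}) (hB : psd B).
Local Notation N := (norm_m1 B).
Local Notation mu := (@lebesgue_measure R).
Context (c0 : R) (c00 : 0 <= c0).
Hypothesis hSB : forall s x, 0 <= s -> N (S s x) <= expR (c0 * s) * N x.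
Context (k : R) (k0 : 0 < k) (hk : forall x, N x <= k * `|x|).
Context (Cb : R) (Cb0 : 0 < Cb).
Hypothesis hbsigma : forall x x' a, Lambda0 a ->
    [/\ `|b x a - b x' a| <= Cb * N (x - x'),
        `|sigma x a - sigma x' a| <= Cb * N (x - x'),
        `|b x a| <= Cb * (1 + `|x| + `|a|)
      & `|sigma x a| <= Cb * (1 + `|x| + `|a|)].
Context (Cd : R) (Cd0 : 0 < Cd).
Hypothesis hb_diff : forall x a, differentiable (fun y => b y a) x.
Hypothesis hsigma_diff : forall x a, differentiable (fun y => sigma y a) x.
Hypothesis hD : forall x x' a, Lambda0 a ->
    N ('d (fun y => b y a) x (x - x') - 'd (fun y => b y a) x' (x - x'))
      <= Cd * N (x - x') ^+ 2
    /\
    hs_norm E N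
      ('d (fun y => sigma y a) x (x - x') - 'd (fun y => sigma y a) x' (x - x') : hs E H)
      <= Cd * N (x - x') ^+ 2.
Context (t T : R) (tT : t <= T).
Context (d : measure_display) (Om : measurableType d) (P : probability Om R).
Context (W : R -> Xi -> Om -> R) (hW : reference_space P t T W).
Local Notation strip s := (`[t, s] `*` setT : set (measurableTypeR R * Om)).
Context (a : R -> Om -> Lambda) (ha : admissible P Lambda0 p W t T a).

Lemma admissible_in r w : t <= r <= T -> Lambda0 (a r w).
Proof. by have [h _ _] := ha; exact: h. Qed.

Lemma admissible_borel : borel_fun (strip T) (fun z => a z.1 z.2).
Proof. by have [_ h _] := ha; apply: (progressive_borel_fun hW _ h); rewrite tT lexx. Qed.

Lemma admissible_norm_measurable : measurable_fun (strip T) (fun z => `|a z.1 z.2|).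
Proof.
apply: borel_fun_measurable; first exact: measurable_strip.
by apply: borel_fun_continuous admissible_borel; exact: norm_continuous.
Qed.

Let f r w : R := 1 + `|a r w|.

Let f0 r w : 0 <= f r w. Proof. by rewrite addr_ge0. Qed.

Let mf : measurable_fun (strip T) (fun z => f z.1 z.2).
Proof. by apply: measurable_funD => //; exact: admissible_norm_measurable. Qed.

(** Since [p > 2], the power dominates the square up to constants, and admissible controls have
    finite quadratic energy. *)
Let sqr_powR (x : R) : 0 <= x -> (1 + x) ^+ 2 <= 4 + 2 * x `^ p.
Proof.
move=> x0; have x2 : x ^+ 2 <= 1 + x `^ p.
  have [x1|x1] := leP x 1.
    by apply: (@le_trans _ _ 1); [exact: exprn_ile1|rewrite lerDl powR_ge0].
  rewrite -powR_mulrn// (@le_trans _ _ (x `^ p))//; last by rewrite lerDr.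
  by apply: ler_powR; [exact: ltW|exact: ltW].
have := sqr_ge0 (x - 1); nra.
Qed.

Lemma admissible_energy_fin :
  (\int[P]_w \int[mu]_(r in `[t, T]) ((f r w ^+ 2) ^+ 1)%:E < +oo)%E.
Proof.
have [_ _ hfin] := ha.
have mp : measurable_fun (strip T) (fun z => (`|a z.1 z.2| `^ p)%:E).
  apply/measurable_EFinP; apply: (measurableT_comp (measurable_powR p)).
  exact: admissible_norm_measurable.
have mpw w : measurable_fun (`[t, T] : set (measurableTypeR R)) (fun r => (`|a r w| `^ p)%:E).
  exact: (@measurable_section_time _ _ _ t T (fun r w => (`|a r w| `^ p)%:E)).
have p0 r w : (0 <= (`|a r w| `^ p)%:E)%E by rewrite lee_fin powR_ge0.
have mI : measurable_fun setT (fun w => \int[mu]_(r in `[t, T]) (`|a r w| `^ p)%:E)%E.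
  exact: (@measurable_time_integral _ _ _ t T (fun r w => (`|a r w| `^ p)%:E)).
have I0 w : [set: Om] w -> (0 <= \int[mu]_(r in `[t, T]) (`|a r w| `^ p)%:E)%E.
  by move=> _; exact: integral_ge0.
apply: (@le_lt_trans _ _ (\int[P]_w ((4 * (T - t))%:E + 2%:E * \int[mu]_(r in `[t, T]) (`|a r w| `^ p)%:E))%E).
  apply: ge0_integral_mono => w _.
    by apply: integral_ge0 => r _; rewrite lee_fin exprn_ge0// sqr_ge0.
  rewrite -ge0_integralZl//.
  have -> : (4 * (T - t))%:E = (\int[mu]_(r in `[t, T]) (cst 4%:E r))%E.
    rewrite integral_cst//= lebesgue_measure_itv/= lte_fin.
    case: ltP => tT'; first by rewrite -EFinB -EFinM.
    by rewrite mule0 (_ : T - t = 0) ?mulr0//; apply/eqP; rewrite subr_eq0 eq_le tT' tT.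
  have c4 r : [set` `[t, T]] r -> (0 <= cst 4%:E r :> \bar R)%E by rewrite /= lee_fin.
  have m4 := emeasurable_funM (measurable_cst 2%:E) (mpw w).
  have p2 r : [set` `[t, T]] r -> (0 <= 2%:E * (`|a r w| `^ p)%:E)%E by move=> _; rewrite mule_ge0.
  rewrite -ge0_integralD//.
  apply: ge0_integral_mono => r _; first by rewrite lee_fin exprn_ge0// sqr_ge0.
  by rewrite -EFinM -EFinD lee_fin expr1 sqr_powR.
have T0 : (0 <= (4 * (T - t))%:E :> \bar R)%E by rewrite lee_fin mulr_ge0// subr_ge0.
rewrite ge0_integralD//; last 2 first.
- by move=> w _; rewrite mule_ge0// I0.
- exact: emeasurable_funM.
rewrite ge0_integralZl// int_probability_cst.
have J0 : (0 <= \int[P]_w \int[mu]_(r in `[t, T]) (`|a r w| `^ p)%:E)%E.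
  by apply: integral_ge0 => w _; exact: I0.
move: hfin; rewrite -(ge0_fin_numE J0) => h.
by rewrite -(fineK h) -EFinM -EFinD ltry.
Qed.

Let id_contraction s (x : H) : 0 <= s ->
  norm_m1 (idfun : {linear H -> H}) (S s x) <= expR (0 * s) * norm_m1 (idfun : {linear H -> H}) x.
Proof.
by move=> s0; rewrite mul0r expR0 mul1r !norm_m1_id (semigroup_contraction hS).
Qed.

Definition state_const : R := moment_const 0 Cb 1.

(** The moment estimate for the norm of [H] itself: the seminorm of [idfun], for which the semigroup
    is a contraction, and the source [1 + |a|] from linear growth. It makes the costs finite. *)
Lemma state_second_moment x (X : R -> Om -> H) s :
  is_mild_solution P S b sigma W t T x a X -> t <= s <= T ->
  (\int[P]_w (`|X s w| ^+ 2)%:E <=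
    (state_const * expR ((1 + state_const) * (s - t)))%:E *
    ((`|x| ^+ 2)%:E + \int[mu]_(r in `[t, s]) \int[P]_w ((1 + `|a r w|) ^+ 2)%:E))%E.
Proof.
move=> hX tsT; have hXp := mild_solution_process hW tT hX.
have := mild_moment (p := 1) sepH sepXi hW (B := idfun) (c0 := 0) (C := Cb) tT (psd_id H) (lexx _) (ltW Cb0) isT
  id_contraction hXp (f := f) (fun r w _ => f0 r w) mf admissible_energy_fin.
have e1 x' : norm_m1 (idfun : {linear H -> H}) x' = `|x'| by exact: norm_m1_id.
have h1 r w : t <= r <= T -> norm_m1 (idfun : {linear H -> H}) (b (X r w) (a r w)) <=
    Cb * (norm_m1 (idfun : {linear H -> H}) (X r w) + f r w).
  move=> rT; rewrite !e1; have [_ _ h _] := hbsigma (X r w) 0 (admissible_in w rT).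
  by apply: (le_trans h); rewrite /f addrCA addrA.
have h2 r w : t <= r <= T -> (hs_sum E (norm_m1 (idfun : {linear H -> H})) (sigma (X r w) (a r w)) <=
    ((Cb * (norm_m1 (idfun : {linear H -> H}) (X r w) + f r w)) ^+ 2)%:E)%E.
  move=> rT; rewrite e1; have [_ _ _ h] := hbsigma (X r w) 0 (admissible_in w rT).
  have -> : hs_sum E (norm_m1 (idfun : {linear H -> H})) (sigma (X r w) (a r w)) = (`|sigma (X r w) (a r w)| ^+ 2)%:E.
    rewrite hs_normE -hs_norm_sqr; last exact: hs_fin.
    by apply: eq_esum => e _; rewrite e1.
  rewrite lee_fin; apply: lerXn2r; rewrite ?nnegrE// ?mulr_ge0 ?addr_ge0 ?(ltW Cb0)//.
  by apply: (le_trans h); rewrite /f addrCA addrA.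
move=> /(_ h1 h2 s tsT).
under eq_integral do rewrite expr1 e1.
rewrite expr1 e1.
suff <- : (\int[mu]_(r in `[t, s]) \int[P]_w ((f r w ^+ 2) ^+ 1)%:E =
    \int[mu]_(r in `[t, s]) \int[P]_w ((1 + `|a r w|) ^+ 2)%:E)%E by [].
by apply: eq_integral => r _; apply: eq_integral => w _; rewrite expr1.
Qed.

Context (x0 x1 : H) (X0 X1 : R -> Om -> H).
Hypothesis hX0 : is_mild_solution P S b sigma W t T x0 a X0.
Hypothesis hX1 : is_mild_solution P S b sigma W t T x1 a X1.

Let K q : R := moment_const c0 (k * Cb) q.

Let sigma_lip r w x x' : t <= r <= T ->
  (hs_sum E N (sigma x (a r w) - sigma x' (a r w) : hs E H)%R <= ((k * Cb * N (x - x')) ^+ 2)%:E)%E.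
Proof.
move=> rT; have [_ h _ _] := hbsigma x x' (admissible_in w rT).
apply: (@le_trans _ _ ((k ^+ 2)%:E * hs_sum E (@Num.norm R H) (sigma x (a r w) - sigma x' (a r w) : hs E H)%R)%E).
  apply: hs_sum_le1; first exact: sqr_ge0.
  move=> e _; rewrite -exprMn.
  by apply: lerXn2r; [exact: norm_m1_ge0|rewrite nnegrE mulr_ge0// ltW|exact: hk].
rewrite hs_norm_sqr; last exact: hs_fin.
rewrite -EFinM lee_fin -exprMn; apply: lerXn2r; rewrite ?nnegrE.
- by rewrite mulr_ge0 ?(ltW k0)// hs_norm_ge0.
- by rewrite !mulr_ge0 ?norm_m1_ge0// ltW.
by rewrite -mulrA ler_wpM2l ?(ltW k0).
Qed.

Let b_lip r w x x' : t <= r <= T -> N (b x (a r w) - b x' (a r w)) <= k * Cb * N (x - x').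
Proof.
move=> rT; have [h _ _ _] := hbsigma x x' (admissible_in w rT).
by rewrite (le_trans (hk _))// -mulrA ler_wpM2l ?(ltW k0).
Qed.

(** The difference of the two states is a mild process with Lipschitz coefficients and zero source;
    [k * Cb] measures the Lipschitz constants in the weak seminorm. *)
Lemma state_difference_moment q s : (0 < q <= 2)%N -> t <= s <= T ->
  (\int[P]_w ((N (X0 s w - X1 s w) ^+ 2) ^+ q)%:E <=
    (K q * expR ((1 + K q) * (s - t)) * (N (x0 - x1) ^+ 2) ^+ q)%:E)%E.
Proof.
move=> q12 tsT.
have hp0 := mild_solution_process hW tT hX0; have hp1 := mild_solution_process hW tT hX1.
have hY := mild_lin sepH sepXi hW 1 (-1) hp0 hp1.
have dE (x x' : H) : 1 *: x + -1 *: x' = x - x' by rewrite scale1r scaleN1r.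
have h00 (r : R) (w : Om) : t <= r <= T -> 0 <= (0 : R) by [].
have m0 : measurable_fun (strip T) (fun z : measurableTypeR R * Om => (0 : R)) by exact: measurable_cst.
have q0 : (0 < q)%N by case/andP: q12.
have z0 : ((0 : R) ^+ 2) ^+ q = 0 by rewrite expr0n/= expr0n; case: (q) q0.
have fin0 : (\int[P]_w \int[mu]_(r in `[t, T]) (((0 : R) ^+ 2) ^+ q)%:E < +oo)%E.
  rewrite z0; under eq_integral do rewrite integral0.
  by rewrite integral0 ltry.
have kC0 : 0 <= k * Cb by rewrite mulr_ge0// ltW.
have := mild_moment sepH sepXi hW tT hB c00 kC0 q12 hSB hY (f := fun _ _ => 0) h00 m0 fin0.
have h1 r w : t <= r <= T ->
   N (1 *: b (X0 r w) (a r w) + -1 *: b (X1 r w) (a r w)) <=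
   k * Cb * (N (1 *: X0 r w + -1 *: X1 r w) + 0).
  by move=> rT; rewrite !dE addr0 b_lip.
have h2 r w : t <= r <= T ->
   (hs_sum E N (fun e => (1 *: sigma (X0 r w) (a r w) e + -1 *: sigma (X1 r w) (a r w) e)%R) <=
   ((k * Cb * (N (1 *: X0 r w + -1 *: X1 r w) + 0)) ^+ 2)%:E)%E.
  move=> rT; rewrite dE addr0; apply: le_trans (sigma_lip w (X0 r w) (X1 r w) rT).
  by apply: le_esum => e _; rewrite dE.
move=> /(_ h1 h2 s tsT).
under eq_integral do rewrite dE.
rewrite dE z0; under [X in (_ + X)%E]eq_integral do rewrite integral0.
by rewrite integral0 adde0 -EFinM.
Qed.

Context (lam : R) (lam01 : 0 <= lam <= 1) (X2 : R -> Om -> H).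
Hypothesis hX2 : is_mild_solution P S b sigma W t T (lam *: x0 + (1 - lam) *: x1) a X2.

Let Z r w : H := lam *: X0 r w + (1 - lam) *: X1 r w - X2 r w.
Let theta : R := lam * (1 - lam) * N (x0 - x1) ^+ 2.
Let Kz : R := moment_const c0 (2 * (Cd + k * Cb)) 1.

(** [Kz * K 2] multiplies the constants of the second moment of [Z] and of the fourth moment of
    [X0 - X1]; adding 1 makes it at most its own square, so that it survives the square root. The
    rate is the sum of the exponents [1 + Kz] and [2 + K 2]. *)
Definition gap_const : R := 1 + Kz * K 2.
Definition gap_rate : R := 3 + Kz + K 2.

Let lam0 : 0 <= lam * (1 - lam).
Proof. by have /andP[l0 l1] := lam01; rewrite mulr_ge0// subr_ge0. Qed.

Let K_ge0 q : 0 <= K q.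
Proof. by apply: moment_const_ge0 => //; rewrite mulr_ge0// ltW. Qed.

Let Kz0 : 0 <= Kz.
Proof. by apply: moment_const_ge0 => //; rewrite mulr_ge0// addr_ge0 ?mulr_ge0// ltW. Qed.

Let bX0 : borel_fun (strip T) (fun z => X0 z.1 z.2).
Proof. by have [] := mild_solution_process hW tT hX0. Qed.
Let bX1 : borel_fun (strip T) (fun z => X1 z.1 z.2).
Proof. by have [] := mild_solution_process hW tT hX1. Qed.
Let bX2 : borel_fun (strip T) (fun z => X2 z.1 z.2).
Proof. by have [] := mild_solution_process hW tT hX2. Qed.

Let borel_opp (g : measurableTypeR R * Om -> H) : borel_fun (strip T) g -> borel_fun (strip T) (fun z => - g z).
Proof. by apply: borel_fun_continuous => x; apply: cvgN; exact: cvg_id. Qed.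

Lemma state_difference_measurable : measurable_fun (strip T) (fun z => N (X0 z.1 z.2 - X1 z.1 z.2)).
Proof.
apply: borel_fun_measurable; first exact: measurable_strip.
apply: (borel_fun_continuous (norm_m1_continuous hB)).
by apply: borel_fun_add => //; exact: borel_opp.
Qed.

Let mdiff := state_difference_measurable.

Lemma convexity_gap_measurable : measurable_fun (strip T) (fun z => N (Z z.1 z.2)).
Proof.
apply: borel_fun_measurable; first exact: measurable_strip.
apply: (borel_fun_continuous (norm_m1_continuous hB)).
apply: borel_fun_add => //; last exact: borel_opp.
by apply: borel_fun_add => //; exact: borel_fun_scale.
Qed.

Let mgap := convexity_gap_measurable.

Let h r w : R := lam * (1 - lam) * N (X0 r w - X1 r w) ^+ 2.

Let h0 r w : 0 <= h r w. Proof. by rewrite mulr_ge0 ?sqr_ge0. Qed.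

Let mh : measurable_fun (strip T) (fun z => h z.1 z.2).
Proof. by apply: measurable_funM => //; exact: measurable_funX. Qed.

Let mh2 : measurable_fun (strip T) (fun z => ((h z.1 z.2 ^+ 2) ^+ 1)%:E).
Proof. by apply/measurable_EFinP; do 2 apply: measurable_funX. Qed.

(** Up to the factor [(lam * (1 - lam)) ^ 2], the square of [h] is the fourth power of the seminorm
    of [X0 - X1]: here the moments with exponent 2 enter. *)
Let h_moment s : t <= s <= T ->
  (\int[P]_w ((h s w ^+ 2) ^+ 1)%:E <= (K 2 * expR ((1 + K 2) * (s - t)) * theta ^+ 2)%:E)%E.
Proof.
move=> tsT; have := @state_difference_moment 2 s isT tsT => hm.
have hE w : ((h s w ^+ 2) ^+ 1)%:E = (((lam * (1 - lam)) ^+ 2)%:E * ((N (X0 s w - X1 s w) ^+ 2) ^+ 2)%:E)%E.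
  by rewrite -EFinM expr1 /h exprMn.
have m2 : measurable_fun setT (fun w => ((N (X0 s w - X1 s w) ^+ 2) ^+ 2)%:E).
  apply: (measurable_section_expect (t := t) (s := T) (f := fun s w => ((N (X0 s w - X1 s w) ^+ 2) ^+ 2)%:E)) => //.
  by apply/measurable_EFinP; do 2 apply: measurable_funX.
under eq_integral do rewrite hE.
rewrite ge0_integralZl ?lee_fin ?sqr_ge0//; last by move=> w _; rewrite lee_fin sqr_ge0.
apply: (le_trans (lee_wpmul2l _ hm)); first by rewrite lee_fin sqr_ge0.
rewrite -EFinM lee_fin /theta.
set Nv := N (x0 - x1); set e := expR _; set th := lam * (1 - lam).
by rewrite le_eqVlt; apply/orP; left; apply/eqP; ring.
Qed.

(** The length [s - t] of the interval is absorbed by one more unit in the exponential rate. *)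
Let h_time_moment s : t <= s <= T ->
  (\int[mu]_(r in `[t, s]) \int[P]_w ((h r w ^+ 2) ^+ 1)%:E <=
    (K 2 * expR ((2 + K 2) * (s - t)) * theta ^+ 2)%:E)%E.
Proof.
move=> /andP[ts sT].
pose c := K 2 * expR ((1 + K 2) * (s - t)) * theta ^+ 2.
have c0' : 0 <= c by exact: mulr_ge0 (mulr_ge0 (K_ge0 2) (expR_ge0 _)) (sqr_ge0 _).
apply: (@le_trans _ _ (\int[mu]_(r in `[t, s]) cst c%:E r)%E).
  apply: ge0_integral_mono => r; rewrite /= in_itv/= => /andP[tr rs].
    by apply: integral_ge0 => w _; rewrite lee_fin exprn_ge0// sqr_ge0.
  have rT : t <= r <= T by rewrite tr (le_trans rs).
  apply: (le_trans (h_moment rT)); rewrite lee_fin ler_wpM2r ?sqr_ge0// ler_wpM2l//.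
  have rst : (r : R) - t <= s - t by rewrite lerD2r.
  by rewrite ler_expR; apply: ler_wpM2l rst; rewrite addr_ge0.
rewrite integral_cst//= lebesgue_measure_itv/= lte_fin.
have st0 : 0 <= s - t by rewrite subr_ge0.
have -> : K 2 * expR ((2 + K 2) * (s - t)) * theta ^+ 2 = c * expR (s - t).
  rewrite /c (_ : (2 + K 2) * (s - t) = (1 + K 2) * (s - t) + (s - t)); last by ring.
  have gen (u v e1 e2 : R) : u * (e1 * e2) * v = u * e1 * v * e2 by ring.
  by rewrite (expRD ((1 + K 2) * (s - t))); exact: (gen (K 2) (theta ^+ 2)).
case: ltP => _; last by rewrite mule0 lee_fin mulr_ge0 ?expR_ge0.
rewrite -EFinB -EFinM lee_fin ler_wpM2l// (le_trans _ (expR_ge1Dx _))//.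
by rewrite lerDr.
Qed.

(** [Z] starts at 0. At the convex combination [xm] its coefficients split into a convexity
    remainder, at most [Cd * h] by (d), and a Lipschitz increment from [xm] to [X2]. The second
    moment is estimated with source [h], and Jensen's inequality gives the first. *)
Lemma convexity_gap_moment s : t <= s <= T ->
  (\int[P]_w (N (Z s w))%:E <= (gap_const * expR (gap_rate * (s - t)) * theta)%:E)%E.
Proof.
move=> tsT; have /andP[ts sT] := tsT.
have st0 : 0 <= s - t by rewrite subr_ge0.
have theta0 : 0 <= theta by rewrite mulr_ge0 ?sqr_ge0.
have KK : 0 <= Kz * K 2 by exact: mulr_ge0.
have gap0 : 0 <= gap_const by exact: addr_ge0.
have rate0 : 0 <= gap_rate := addr_ge0 (addr_ge0 (ler0n _ 3) Kz0) (K_ge0 2).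
have hp0 := mild_solution_process hW tT hX0; have hp1 := mild_solution_process hW tT hX1.
have hp2 := mild_solution_process hW tT hX2.
have hY := mild_lin sepH sepXi hW 1 (-1) (mild_lin sepH sepXi hW lam (1 - lam) hp0 hp1) hp2.
have dE (x x' : H) : 1 *: x + -1 *: x' = x - x' by rewrite scale1r scaleN1r.
have C20 : 0 <= 2 * (Cd + k * Cb) by rewrite mulr_ge0// addr_ge0 ?mulr_ge0// ltW.
have TT : t <= T <= T by rewrite tT lexx.
have fin : (\int[P]_w \int[mu]_(r in `[t, T]) ((h r w ^+ 2) ^+ 1)%:E < +oo)%E.
  rewrite (@tonelli_time _ _ _ P t T (fun r w => ((h r w ^+ 2) ^+ 1)%:E))//.
    by apply: le_lt_trans (h_time_moment TT) _; rewrite ltry.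
  by move=> r w _; rewrite lee_fin exprn_ge0// sqr_ge0.
have := mild_moment (p := 1) sepH sepXi hW tT hB c00 C20 isT hSB hY (fun r w _ => h0 r w) mh fin.
have NZ0 r w : 0 <= N (Z r w) by exact: norm_m1_ge0.
have kC0 : 0 <= k * Cb by rewrite mulr_ge0// ltW.
have h1 r w : t <= r <= T ->
   N (1 *: (lam *: b (X0 r w) (a r w) + (1 - lam) *: b (X1 r w) (a r w)) + -1 *: b (X2 r w) (a r w)) <=
   2 * (Cd + k * Cb) * (N (1 *: (lam *: X0 r w + (1 - lam) *: X1 r w) + -1 *: X2 r w) + h r w).
  move=> rT; rewrite !dE -/(Z r w).
  set xm := lam *: X0 r w + (1 - lam) *: X1 r w.
  have r1 := drift_remainder hB (X0 r w) (X1 r w) (ltW Cd0) (fun y => hb_diff y (a r w))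
    (fun y y' => (hD y y' (admissible_in w rT)).1) lam01.
  have r2 := b_lip w xm (X2 r w) rT.
  apply: (@le_trans _ _ (Cd * h r w + k * Cb * N (Z r w))).
    have -> : lam *: b (X0 r w) (a r w) + (1 - lam) *: b (X1 r w) (a r w) - b (X2 r w) (a r w) =
      (lam *: b (X0 r w) (a r w) + (1 - lam) *: b (X1 r w) (a r w) - b xm (a r w)) + (b xm (a r w) - b (X2 r w) (a r w)).
      by rewrite addrA subrK.
    apply: (le_trans (norm_m1D hB _ _)); apply: lerD => //.
    by apply: (le_trans r1); rewrite /h mulrCA.
  have p1 := mulr_ge0 (ltW Cd0) (NZ0 r w); have p2 := mulr_ge0 kC0 (h0 r w).
  have p3 := mulr_ge0 (ltW Cd0) (h0 r w); have p4 := mulr_ge0 kC0 (NZ0 r w).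
  have -> : 2 * (Cd + k * Cb) * (N (Z r w) + h r w) = 2 * (Cd * N (Z r w)) + 2 * (k * Cb * h r w)
    + 2 * (Cd * h r w) + 2 * (k * Cb * N (Z r w)) by ring.
  lra.
have h2 r w : t <= r <= T ->
   (hs_sum E N (fun e => (1 *: (lam *: sigma (X0 r w) (a r w) e + (1 - lam) *: sigma (X1 r w) (a r w) e)
       + -1 *: sigma (X2 r w) (a r w) e)%R) <=
   ((2 * (Cd + k * Cb) * (N (1 *: (lam *: X0 r w + (1 - lam) *: X1 r w) + -1 *: X2 r w) + h r w)) ^+ 2)%:E)%E.
  move=> rT; rewrite dE -/(Z r w).
  set xm := lam *: X0 r w + (1 - lam) *: X1 r w.
  have r1 := diffusion_remainder hB (X0 r w) (X1 r w) (ltW Cd0) (fun y => hsigma_diff y (a r w))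
    (fun y y' => (hD y y' (admissible_in w rT)).2) lam01.
  have r2 := sigma_lip w xm (X2 r w) rT.
  rewrite -/xm in r1; set D1 : hs E H := (lam *: _ + _ - _) in r1; set D2 : hs E H := (_ - _) in r2.
  apply: (@le_trans _ _ (2%:E * hs_sum E N D1 + 2%:E * hs_sum E N D2)%E).
    apply: hs_sum_le2 => // e _.
    have -> : 1 *: (lam *: sigma (X0 r w) (a r w) e + (1 - lam) *: sigma (X1 r w) (a r w) e) + -1 *: sigma (X2 r w) (a r w) e
      = D1 e + D2 e.
      by rewrite dE /D1 /D2 /= addrA subrK.
    apply: (@le_trans _ _ ((N (D1 e) + N (D2 e)) ^+ 2)).
      by apply: lerXn2r; [exact: norm_m1_ge0|rewrite nnegrE addr_ge0 ?norm_m1_ge0|exact: norm_m1D].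
    by have := sqr_ge0 (N (D1 e) - N (D2 e)); nra.
  apply: (@le_trans _ _ (2%:E * ((Cd * h r w) ^+ 2)%:E + 2%:E * ((k * Cb * N (Z r w)) ^+ 2)%:E)%E).
    apply: leeD; apply: lee_wpmul2l => //.
    by apply: (le_trans r1); rewrite lee_fin /h mulrCA.
  rewrite -!EFinM -EFinD lee_fin.
  have p1 := mulr_ge0 (ltW Cd0) (NZ0 r w); have p2 := mulr_ge0 kC0 (h0 r w).
  have p3 := mulr_ge0 (ltW Cd0) (h0 r w); have p4 := mulr_ge0 kC0 (NZ0 r w).
  apply: (@le_trans _ _ ((2 * (Cd * h r w + k * Cb * N (Z r w))) ^+ 2)).
    set u := Cd * h r w in p3 *; set v := k * Cb * N (Z r w) in p4 *.
    have := mulr_ge0 p3 p4; have := sqr_ge0 u; have := sqr_ge0 v; nra.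
  apply: lerXn2r; rewrite ?nnegrE.
  - by rewrite mulr_ge0// addr_ge0.
  - by rewrite mulr_ge0// addr_ge0.
  have -> : 2 * (Cd + k * Cb) * (N (Z r w) + h r w) = 2 * (Cd * N (Z r w)) + 2 * (k * Cb * h r w)
    + 2 * (Cd * h r w) + 2 * (k * Cb * N (Z r w)) by ring.
  lra.
move=> /(_ h1 h2 s tsT).
under eq_integral do rewrite dE -/(Z s _) expr1.
rewrite dE subrr norm_m1_0 expr1 expr0n/= add0e => hm.
apply: expect_le_sqrt.
- exact: mulr_ge0 (mulr_ge0 gap0 (expR_ge0 _)) theta0.
- apply/measurable_EFinP; apply: (measurable_section_expect (t := t) (s := T) (f := fun s w => (N (Z s w))%:E)) => //.
  exact/measurable_EFinP.
- by move=> w; exact: norm_m1_ge0.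
apply: (le_trans hm).
apply: (le_trans (lee_wpmul2l _ (h_time_moment tsT))).
  by rewrite lee_fin mulr_ge0 ?expR_ge0.
rewrite -EFinM lee_fin -/Kz.
have e1 : 1 <= expR (gap_rate * (s - t)).
  by rewrite -[leLHS]expR0 ler_expR; exact: mulr_ge0 rate0 st0.
have eE : expR ((1 + Kz) * (s - t)) * expR ((2 + K 2) * (s - t)) = expR (gap_rate * (s - t)).
  have gen (u v w : R) : (1 + u) * w + (2 + v) * w = (3 + u + v) * w by ring.
  by rewrite -expRD gen.
have gc : Kz * K 2 <= gap_const ^+ 2 by rewrite /gap_const; nra.
have gen (u v e1' e2 th : R) : u * e1' * (v * e2 * th ^+ 2) = u * v * (e1' * e2) * th ^+ 2 by ring.
rewrite gen eE [leRHS]exprMn; apply: ler_wpM2r; first exact: sqr_ge0.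
rewrite [leRHS]exprMn; apply: ler_pM => //.
by rewrite expr2 ler_peMl ?expR_ge0.
Qed.

Lemma semiconcave_gap (Cs Cl : R) s : 0 <= Cs -> 0 <= Cl -> t <= s <= T ->
  (\int[P]_w (Cs * h s w + Cl * N (Z s w))%:E <=
    ((Cs * K 1 + Cl * gap_const) * expR ((1 + K 1 + gap_rate) * (s - t)) * theta)%:E)%E.
Proof.
move=> Cs0 Cl0 tsT; have /andP[ts sT] := tsT.
have st0 : 0 <= s - t by rewrite subr_ge0.
have theta0 : 0 <= theta by rewrite mulr_ge0 ?sqr_ge0.
have gap0 : 0 <= gap_const by rewrite /gap_const addr_ge0// mulr_ge0.
have rate0 : 0 <= gap_rate := addr_ge0 (addr_ge0 (ler0n _ 3) Kz0) (K_ge0 2).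
have mNd : measurable_fun setT (fun w => (N (X0 s w - X1 s w) ^+ 2)%:E).
  apply: (measurable_section_expect (t := t) (s := T) (f := fun s w => (N (X0 s w - X1 s w) ^+ 2)%:E)) => //.
  by apply/measurable_EFinP; apply: measurable_funX.
have mNZ : measurable_fun setT (fun w => (N (Z s w))%:E).
  apply: (measurable_section_expect (t := t) (s := T) (f := fun s w => (N (Z s w))%:E)) => //.
  exact/measurable_EFinP.
have hE w : (Cs * h s w + Cl * N (Z s w))%:E =
    ((Cs * (lam * (1 - lam)))%:E * (N (X0 s w - X1 s w) ^+ 2)%:E + Cl%:E * (N (Z s w))%:E)%E.
  by rewrite -[((Cs * _)%:E * _)%E]EFinM -[(Cl%:E * _)%E]EFinM -EFinD /h mulrA.
under eq_integral do rewrite hE.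
have c1 : (0 <= (Cs * (lam * (1 - lam)))%:E :> \bar R)%E by rewrite lee_fin mulr_ge0.
have p1 w : [set: Om] w -> (0 <= (N (X0 s w - X1 s w) ^+ 2)%:E)%E by rewrite lee_fin sqr_ge0.
have p2 w : [set: Om] w -> (0 <= (N (Z s w))%:E)%E by rewrite lee_fin norm_m1_ge0.
have p3 w : [set: Om] w -> (0 <= (Cs * (lam * (1 - lam)))%:E * (N (X0 s w - X1 s w) ^+ 2)%:E)%E.
  by move=> _; rewrite mule_ge0 ?p1.
have p4 w : [set: Om] w -> (0 <= Cl%:E * (N (Z s w))%:E)%E by move=> _; rewrite mule_ge0 ?p2// lee_fin.
have m3 := emeasurable_funM (measurable_cst (Cs * (lam * (1 - lam)))%:E) mNd.
have m4 := emeasurable_funM (measurable_cst Cl%:E) mNZ.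
rewrite ge0_integralD// !ge0_integralZl ?lee_fin//.
have d1 := @state_difference_moment 1 s isT tsT.
have {}d1 : (\int[P]_w (N (X0 s w - X1 s w) ^+ 2)%:E <=
    (K 1 * expR ((1 + K 1) * (s - t)) * N (x0 - x1) ^+ 2)%:E)%E.
  by move: d1; under eq_integral do rewrite expr1; rewrite expr1.
apply: (le_trans (leeD (lee_wpmul2l c1 d1) (lee_wpmul2l _ (convexity_gap_moment tsT)))).
  by rewrite lee_fin.
rewrite -!EFinM -EFinD lee_fin.
set E1 := expR ((1 + K 1) * _); set E2 := expR (gap_rate * _); set E3 := expR ((1 + K 1 + gap_rate) * _).
have E13 : E1 <= E3 by rewrite ler_expR ler_wpM2r// lerDl.
have E23 : E2 <= E3 by rewrite ler_expR ler_wpM2r// lerDr addr_ge0.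
have gen1 (c l q e v : R) : c * l * (q * e * v) = c * q * (l * v) * e by ring.
have gen2 (c g e th : R) : c * (g * e * th) = c * g * th * e by ring.
have gen3 (c q l g e th : R) : (c * q + l * g) * e * th = c * q * th * e + l * g * th * e by ring.
rewrite (gen1 Cs (lam * (1 - lam)) (K 1)) -/theta (gen2 Cl gap_const E2 theta).
rewrite (gen3 Cs (K 1) Cl gap_const E3 theta).
apply: lerD; apply: ler_wpM2l => //; apply: mulr_ge0 => //; exact: mulr_ge0.
Qed.

End controlled_states.

(** * The cost of a fixed control *)

Lemma integral_ge_opp_cst (R : realType) (d : measure_display) (T : measurableType d)
    (m : {measure set T -> \bar R}) (D : set T) (f : T -> \bar R) (c : R) :
  measurable D -> m D \is a fin_num -> 0 <= c -> (forall x, D x -> ((- c)%:E <= f x)%E) ->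
  ((- (c * fine (m D)))%:E <= \int[m]_(x in D) f x)%E.
Proof.
move=> mD finD c0 cf; rewrite integralE EFinN -[leLHS]add0e; apply: leeD.
  by apply: integral_ge0 => x _; exact: funepos_ge0.
rewrite leeN2 EFinM fineK// -integral_cst//; apply: ge0_integral_mono => x Dx.
  exact: funeneg_ge0.
by rewrite funenegE ge_max/= lee_fin c0 andbT leeNl -EFinN cf.
Qed.

Lemma add_convexity_gaps (R : realFieldType) (lam u0 u1 u2 v0 v1 v2 x y : R) :
  1 * (lam * u0 + (1 - lam) * u1) + (-1) * u2 <= x ->
  1 * (lam * v0 + (1 - lam) * v1) + (-1) * v2 <= y ->
  lam * (u0 + v0) + (1 - lam) * (u1 + v1) <= u2 + v2 + (x + y).
Proof. lra. Qed.

Section costs.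
Context (R : realType) (H Xi : hilbertType R) (Lambda : completeNormedModType R).
Hypotheses (sepH : separable H) (sepXi : separable Xi) (sepL : separable Lambda).
Context (E : onb Xi) (Lambda0 : set Lambda) (hne : Lambda0 !=set0).
Context (p : R) (hp : 2 < p) (S : R -> {linear H -> H}).
Hypothesis hS : contraction_semigroup S.
Context (b : H -> Lambda -> H) (sigma : H -> Lambda -> hs E H).
Context (B : {linear H -> H}) (hB : psd B).
Local Notation N := (norm_m1 B).
Local Notation mu := (@lebesgue_measure R).
Context (c0 : R) (c00 : 0 <= c0).
Hypothesis hSB : forall s x, 0 <= s -> N (S s x) <= expR (c0 * s) * N x.
Context (k : R) (k0 : 0 < k) (hk : forall x, N x <= k * `|x|).
Context (Cb : R) (Cb0 : 0 < Cb).
Hypothesis hbsigma : forall x x' a, Lambda0 a ->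
    [/\ `|b x a - b x' a| <= Cb * N (x - x'),
        `|sigma x a - sigma x' a| <= Cb * N (x - x'),
        `|b x a| <= Cb * (1 + `|x| + `|a|)
      & `|sigma x a| <= Cb * (1 + `|x| + `|a|)].
Context (Cd : R) (Cd0 : 0 < Cd).
Hypothesis hb_diff : forall x a, differentiable (fun y => b y a) x.
Hypothesis hsigma_diff : forall x a, differentiable (fun y => sigma y a) x.
Hypothesis hD : forall x x' a, Lambda0 a ->
    N ('d (fun y => b y a) x (x - x') - 'd (fun y => b y a) x' (x - x'))
      <= Cd * N (x - x') ^+ 2
    /\
    hs_norm E N
      ('d (fun y => sigma y a) x (x - x') - 'd (fun y => sigma y a) x' (x - x') : hs E H)
      <= Cd * N (x - x') ^+ 2.
Context (l : H -> Lambda -> R) (g : H -> R).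
Hypothesis hl_cont : {within [set z : H * Lambda | Lambda0 z.2],
                continuous (fun z => l z.1 z.2)}.
Context (Cl : R) (Cl0 : 0 < Cl).
Hypothesis hlg : forall x x' a, Lambda0 a ->
    [/\ `|l x a - l x' a| <= Cl * N (x - x'),
        `|l x a| <= Cl * (1 + `|x| + `|a| ^+ 2)
      & `|g x - g x'| <= Cl * N (x - x')].
Context (Csl Csg : R) (Csl0 : 0 <= Csl) (Csg0 : 0 <= Csg).
Hypothesis hl_sc : forall a, Lambda0 a -> semiconcave_m1 B (fun x => l x a) Csl.
Hypothesis hg_sc : semiconcave_m1 B g Csg.
Context (t T : R) (tT : t <= T).
Context (d : measure_display) (Om : measurableType d) (P : probability Om R).
Context (W : R -> Xi -> Om -> R) (hW : reference_space P t T W).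
Local Notation strip s := (`[t, s] `*` setT : set (measurableTypeR R * Om)).
Context (a : R -> Om -> Lambda) (ha : admissible P Lambda0 p W t T a).


Let TT : t <= T <= T. Proof. by rewrite tT lexx. Qed.

Let length_cst (c : R) : (\int[mu]_(r in `[t, T]) cst c%:E r = (c * (T - t))%:E)%E.
Proof.
rewrite integral_cst//= lebesgue_measure_itv/= lte_fin.
case: ltP => tT'; first by rewrite -EFinB -EFinM.
by rewrite mule0 (_ : T - t = 0) ?mulr0//; apply/eqP; rewrite subr_eq0 eq_le tT' tT.
Qed.

(** The bounds on the absolute value of the cost depend on the control through this number only, and
    monotonically. For bounded [Lambda0] it is bounded uniformly over the controls. *)
Definition control_energy : R :=
  fine (\int[mu]_(r in `[t, T]) \int[P]_w ((1 + `|a r w|) ^+ 2)%:E)%E.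

Let ma2 : measurable_fun (strip T) (fun z => ((1 + `|a z.1 z.2|) ^+ 2)%:E).
Proof.
apply/measurable_EFinP; apply: measurable_funX; apply: measurable_funD => //.
exact: (@admissible_norm_measurable _ _ _ _ _ _ _ tT _ _ _ _ hW _ ha).
Qed.

Let sq0 (x : R) : (0 <= (x ^+ 2)%:E :> \bar R)%E. Proof. by rewrite lee_fin sqr_ge0. Qed.

Let energy0 : (0 <= \int[mu]_(r in `[t, T]) \int[P]_w ((1 + `|a r w|) ^+ 2)%:E)%E.
Proof. by apply: integral_ge0 => r _; apply: integral_ge0 => w _. Qed.

Let energyE :
  (\int[mu]_(r in `[t, T]) \int[P]_w ((1 + `|a r w|) ^+ 2)%:E = control_energy%:E)%E.
Proof.
rewrite fineK// ge0_fin_numE//.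
rewrite -(@tonelli_time _ _ _ P t T (fun r w => ((1 + `|a r w|) ^+ 2)%:E))//.
have := admissible_energy_fin hp tT hW ha.
suff -> : (\int[P]_w \int[mu]_(r in `[t, T]) (((1 + `|a r w|) ^+ 2) ^+ 1)%:E =
   \int[P]_w \int[mu]_(r in `[t, T]) ((1 + `|a r w|) ^+ 2)%:E)%E by [].
by apply: eq_integral => w _; apply: eq_integral => r _; rewrite expr1.
Qed.

Let ce0 : 0 <= control_energy. Proof. exact: fine_ge0. Qed.

Lemma control_energy_le (M : R) : (forall r w, t <= r <= T -> `|a r w| <= M) ->
  control_energy <= (T - t) * (1 + M) ^+ 2.
Proof.
move=> aM; rewrite -lee_fin -energyE.
apply: (@le_trans _ _ (\int[mu]_(r in `[t, T]) cst ((1 + M) ^+ 2)%:E r)%E).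
  apply: ge0_integral_mono => r; rewrite /= in_itv/= => rT; first exact: integral_ge0.
  rewrite -(int_probability_cst P ((1 + M) ^+ 2)); apply: ge0_integral_mono => w _//.
  have := aM r w rT; have := normr_ge0 (a r w) => h0 hM.
  by rewrite lee_fin; apply: lerXn2r; rewrite ?nnegrE ?addr_ge0 ?lerD2l// (le_trans h0 hM).
by rewrite length_cst lee_fin mulrC.
Qed.

Definition energy_bound (x : H) (e : R) : R :=
  state_const Cb * expR ((1 + state_const Cb) * (T - t)) * (`|x| ^+ 2 + e).

Let sc0 : 0 <= state_const Cb. Proof. exact: (moment_const_ge0 _ 1 (lexx 0)). Qed.

Lemma energy_bound_ge0 x e : 0 <= e -> 0 <= energy_bound x e.
Proof. by move=> e0; rewrite mulr_ge0 ?mulr_ge0 ?expR_ge0// addr_ge0 ?sqr_ge0. Qed.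

Section one_state.
Context (x : H) (X : R -> Om -> H).
Hypothesis hX : is_mild_solution P S b sigma W t T x a X.

Let bX : borel_fun (strip T) (fun z => X z.1 z.2).
Proof. by have [] := mild_solution_process hW tT hX. Qed.

Let mX2 : measurable_fun (strip T) (fun z => (`|X z.1 z.2| ^+ 2)%:E).
Proof.
apply/measurable_EFinP; apply: measurable_funX.
apply: borel_fun_measurable; first exact: measurable_strip.
by apply: borel_fun_continuous bX; exact: norm_continuous.
Qed.

Let state_le s : t <= s <= T ->
  (\int[P]_w (`|X s w| ^+ 2)%:E <= (energy_bound x control_energy)%:E)%E.
Proof.
move=> tsT; have /andP[ts sT] := tsT.
apply: (le_trans (state_second_moment sepH sepXi hp hS Cb0 hbsigma tT hW ha hX tsT)).
have h1 : (\int[mu]_(r in `[t, s]) \int[P]_w ((1 + `|a r w|) ^+ 2)%:E <= control_energy%:E)%E.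
  rewrite -energyE; apply: ge0_subset_integral => //.
  - exact: (@measurable_expect_integral _ _ _ P t T (fun r w => ((1 + `|a r w|) ^+ 2)%:E)).
  - by move=> r _; exact: integral_ge0.
  - by move=> r /=; rewrite !in_itv/= => /andP[-> /le_trans->].
apply: (le_trans (lee_wpmul2l _ (leeD2l _ h1))).
  by rewrite lee_fin mulr_ge0 ?expR_ge0.
rewrite -EFinD -EFinM lee_fin /energy_bound ler_wpM2r ?addr_ge0 ?sqr_ge0//.
apply: ler_wpM2l => //; rewrite ler_expR; apply: ler_wpM2l; first by rewrite addr_ge0.
by rewrite lerD2r.
Qed.

Let running r w : R := l (X r w) (a r w).

Let mrunning : measurable_fun (strip T) (fun z => running z.1 z.2).
Proof.
apply: borel_fun_measurable; first exact: measurable_strip.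
apply: (borel_fun_comp (f := fun z : measurableTypeR R * Om => (X z.1 z.2, a z.1 z.2)) hl_cont).
  by move=> [r w] [/= rT _]; move: rT; rewrite in_itv/= => rT; exact: (admissible_in ha w rT).
apply: borel_fun_pair => //; exact: (@admissible_borel _ _ _ _ _ _ _ tT _ _ _ _ hW _ ha).
Qed.

Definition running_bound (e : R) : R :=
  Cl * ((T - t) * (2 + energy_bound x e) + e).

Lemma running_cost_le :
  (\int[P]_w \int[mu]_(r in `[t, T]) (`|running r w|)%:E <= (running_bound control_energy)%:E)%E.
Proof.
pose G r w : R := 2 + `|X r w| ^+ 2 + (1 + `|a r w|) ^+ 2.
have G0 r w : 0 <= G r w by rewrite !addr_ge0 ?sqr_ge0.
have mG : measurable_fun (strip T) (fun z => (G z.1 z.2)%:E).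
  apply/measurable_EFinP; apply: measurable_funD; last exact/measurable_EFinP.
  by apply: measurable_funD => //; exact/measurable_EFinP.
have eb0 := energy_bound_ge0 x ce0.
apply: (@le_trans _ _ (\int[P]_w (Cl%:E * \int[mu]_(r in `[t, T]) (G r w)%:E))%E).
  apply: ge0_integral_mono => w _; first by apply: integral_ge0 => r _; rewrite lee_fin.
  have mGw := @measurable_section_time _ _ _ t T (fun r w => (G r w)%:E) mG w.
  rewrite -ge0_integralZl ?lee_fin ?(ltW Cl0)//; last by move=> r _; rewrite lee_fin.
  apply: ge0_integral_mono => r; rewrite /= in_itv/= => rT; first by rewrite lee_fin.
  have [_ h _] := hlg (X r w) 0 (admissible_in ha w rT).
  rewrite -EFinM lee_fin (le_trans h)// ler_wpM2l ?(ltW Cl0)// /G.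
  have := normr_ge0 (a r w); have := sqr_ge0 (`|X r w| - 1); nra.
have mGI := @measurable_time_integral _ _ _ t T (fun r w => (G r w)%:E) mG (fun r w _ => G0 r w).
rewrite ge0_integralZl ?lee_fin ?(ltW Cl0)//; last by move=> w _; apply: integral_ge0 => r _; rewrite lee_fin.
rewrite /running_bound EFinM; apply: lee_wpmul2l; first by rewrite lee_fin ltW.
rewrite (@tonelli_time _ _ _ P t T (fun r w => (G r w)%:E))//; last by move=> r w _; rewrite lee_fin.
pose c := 2 + energy_bound x control_energy.
have c0' : (0 <= c%:E :> \bar R)%E by rewrite lee_fin addr_ge0.
have mA := @measurable_expect_integral _ _ _ P t T (fun r w => ((1 + `|a r w|) ^+ 2)%:E) ma2 (fun r w _ => sq0 _).
apply: (@le_trans _ _ (\int[mu]_(r in `[t, T]) (cst c%:E r + \int[P]_w ((1 + `|a r w|) ^+ 2)%:E))%E).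
  apply: ge0_integral_mono => r; rewrite /= in_itv/= => rT.
    by apply: integral_ge0 => w _; rewrite lee_fin.
  have m1 := measurable_section_expect (t := t) (s := T) (f := fun r w => (`|X r w| ^+ 2)%:E) mX2 rT.
  have m2 := measurable_section_expect (t := t) (s := T) (f := fun r w => ((1 + `|a r w|) ^+ 2)%:E) ma2 rT.
  have GE w : (G r w)%:E = (2%:E + (`|X r w| ^+ 2)%:E + ((1 + `|a r w|) ^+ 2)%:E)%E by rewrite -!EFinD.
  under eq_integral do rewrite GE.
  have p1 w : [set: Om] w -> (0 <= 2%:E + (`|X r w| ^+ 2)%:E)%E by move=> _; rewrite adde_ge0.
  have m3 : measurable_fun setT (fun w => 2%:E + (`|X r w| ^+ 2)%:E)%E by exact: emeasurable_funD.
  have p3 w : [set: Om] w -> (0 <= ((1 + `|a r w|) ^+ 2)%:E :> \bar R)%E by move=> _; exact: sq0.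
  have p4 w : [set: Om] w -> (0 <= (`|X r w| ^+ 2)%:E :> \bar R)%E by move=> _; exact: sq0.
  have p5 w : [set: Om] w -> (0 <= 2%:E :> \bar R)%E by rewrite lee_fin.
  rewrite ge0_integralD//; apply: leeD => //.
  rewrite ge0_integralD// int_probability_cst /c [leRHS]EFinD; apply: leeD2l; exact: state_le.
have p1 r : [set` `[t, T]] r -> (0 <= cst c%:E r)%E by [].
have p2 r : [set` `[t, T]] r -> (0 <= \int[P]_w ((1 + `|a r w|) ^+ 2)%:E)%E by move=> _; exact: integral_ge0.
rewrite ge0_integralD// energyE length_cst [leRHS]EFinD; apply: leeD => //.
by rewrite lee_fin mulrC.
Qed.

Lemma running_integrable : strip_integrable P t T running.
Proof. by split; [exact: mrunning|exact: le_lt_trans running_cost_le (ltry _)]. Qed.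

Let gX w : R := g (X T w).

Let g_lip y y' : `|g y - g y'| <= Cl * N (y - y').
Proof. by have [a0 ha0] := hne; have [] := hlg y y' ha0. Qed.

Let g_cont : continuous g.
Proof.
move=> y; apply/cvgrPdist_le => e e0; near=> y'.
rewrite (le_trans (g_lip _ _))// (le_trans (ler_wpM2l (ltW Cl0) (hk _)))//.
rewrite mulrA -ler_pdivlMl ?mulr_gt0// mulrC.
by near: y'; apply: cvgr_dist_le; [exact: cvg_id|rewrite divr_gt0// mulr_gt0].
Unshelve. all: by end_near. Qed.

Let mgX : measurable_fun setT gX.
Proof.
have m : measurable_fun (strip T) (fun z => (g (X z.1 z.2))%:E).
  apply/measurable_EFinP; apply: borel_fun_measurable; first exact: measurable_strip.
  exact: borel_fun_continuous g_cont bX.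
apply/measurable_EFinP.
exact: (measurable_section_expect (t := t) (s := T) (f := fun r w => (g (X r w))%:E) m TT).
Qed.

Definition terminal_bound (e : R) : R := `|g 0| + Cl * k * (1 + energy_bound x e).

Lemma terminal_cost_le :
  (\int[P]_w (`|gX w|)%:E <= (terminal_bound control_energy)%:E)%E.
Proof.
have m1 := measurable_section_expect (t := t) (s := T) (f := fun r w => (`|X r w| ^+ 2)%:E) mX2 TT.
have ck0 : 0 <= Cl * k by rewrite mulr_ge0// ltW.
apply: (@le_trans _ _ (\int[P]_w ((`|g 0| + Cl * k)%:E + (Cl * k)%:E * (`|X T w| ^+ 2)%:E))%E).
  apply: ge0_integral_mono => w _; first by rewrite lee_fin.
  rewrite -EFinM -EFinD lee_fin.
  have h1 : `|gX w| <= `|g 0| + Cl * (k * `|X T w|).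
    have := g_lip (X T w) 0; rewrite subr0 => h.
    rewrite -[gX w](subrK (g 0)) addrC (le_trans (ler_normD _ _))// lerD2l (le_trans h)//.
    by rewrite ler_wpM2l ?(ltW Cl0).
  apply: (le_trans h1); rewrite -addrA lerD2l mulrA -{2}(mulr1 (Cl * k)) -mulrDr ler_wpM2l//.
  by have := sqr_ge0 (`|X T w| - 1); nra.
have c1 : (0 <= (`|g 0| + Cl * k)%:E :> \bar R)%E by rewrite lee_fin addr_ge0.
have p1 w : [set: Om] w -> (0 <= (Cl * k)%:E * (`|X T w| ^+ 2)%:E)%E by move=> _; rewrite mule_ge0.
have m2 := emeasurable_funM (measurable_cst (Cl * k)%:E) m1.
rewrite ge0_integralD// int_probability_cst ge0_integralZl ?lee_fin//.
apply: (le_trans (leeD2l _ (lee_wpmul2l _ (state_le TT)))); first by rewrite lee_fin.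
by rewrite -EFinM -EFinD lee_fin /terminal_bound mulrDr mulr1 addrA.
Qed.

Lemma terminal_integrable : P.-integrable setT (fun w => (gX w)%:E).
Proof.
apply/integrableP; split; first exact/measurable_EFinP.
by apply: le_lt_trans terminal_cost_le _; rewrite ltry.
Qed.

Lemma costE : cost P l g t T a X =
  (\int[P]_w time_int t T running w + \int[P]_w (gX w)%:E)%E.
Proof.
rewrite /cost -integralD//; last exact: terminal_integrable.
exact: time_int_integrable running_integrable.
Qed.

(** Besides finiteness of the cost, this yields, for bounded [Lambda0], a lower bound common to all
    controls. *)
Lemma cost_abs_le :
  (`|cost P l g t T a X| <= (running_bound control_energy + terminal_bound control_energy)%:E)%E.
Proof.
rewrite costE EFinD; apply: (le_trans (lee_abs_add _ _)).
have i1 := time_int_integrable running_integrable; have i2 := terminal_integrable.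
apply: leeD.
  apply: (le_trans (le_abse_integral P measurableT (measurable_int _ i1))).
  apply: le_trans running_cost_le.
  apply: ge0_integral_mono => w _; first exact: abse_ge0.
  apply: (le_abse_integral mu (measurable_time_itv t T)).
  apply: (@measurable_section_time _ _ _ t T (fun r w => (running r w)%:E)).
  by apply/measurable_EFinP; exact: mrunning.
apply: (le_trans (le_abse_integral P measurableT (measurable_int _ i2))).
exact: terminal_cost_le.
Qed.

Lemma cost_fin : cost P l g t T a X \is a fin_num.
Proof. by rewrite fin_num_abs; apply: le_lt_trans cost_abs_le _; rewrite ltry. Qed.

Lemma cost_ge (c : R) : 0 <= c ->
  (forall y, - c <= g y /\ forall a', Lambda0 a' -> - c <= l y a') ->
  ((- (c * (T - t) + c))%:E <= cost P l g t T a X)%E.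
Proof.
move=> cge hc.
have cT0 : 0 <= c * (T - t) by rewrite mulr_ge0// subr_ge0.
rewrite costE -[c * (T - t)]mulr1 -{2}[c]mulr1 opprD EFinD.
have PT : fine (P setT) = 1 by rewrite probability_setT.
have PTf : P setT \is a fin_num by rewrite probability_setT.
apply: leeD.
  rewrite -PT; apply: integral_ge_opp_cst => // w _.
  rewrite -[T - t](_ : fine (mu `[t, T]) = _); last first.
    by have := length_cst 1; rewrite integral_cst//= mul1e mul1r => ->.
  apply: integral_ge_opp_cst => //.
    by have := length_cst 1; rewrite integral_cst//= mul1e => ->.
  move=> r; rewrite /= in_itv/= => rT; rewrite lee_fin.
  by have [_] := hc (X r w); apply; exact: (admissible_in ha w rT).
rewrite -PT; apply: integral_ge_opp_cst => // w _.
by rewrite lee_fin; case: (hc (X T w)).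
Qed.

End one_state.

Section three_states.
Context (x0 x1 : H) (X0 X1 : R -> Om -> H).
Hypothesis hX0 : is_mild_solution P S b sigma W t T x0 a X0.
Hypothesis hX1 : is_mild_solution P S b sigma W t T x1 a X1.
Context (lam : R) (lam01 : 0 <= lam <= 1) (X2 : R -> Om -> H).
Hypothesis hX2 : is_mild_solution P S b sigma W t T (lam *: x0 + (1 - lam) *: x1) a X2.

Let Z r w : H := lam *: X0 r w + (1 - lam) *: X1 r w - X2 r w.
Let theta : R := lam * (1 - lam) * N (x0 - x1) ^+ 2.
Let K : R := moment_const c0 (k * Cb) 1.
Let Gc : R := gap_const c0 k Cb Cd.
Let h r w : R := lam * (1 - lam) * N (X0 r w - X1 r w) ^+ 2.

(** Running and terminal parts are added: each brings its semiconcavity constant times the constant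
    of the squared difference, and [Cl] times that of the gap. In the rate, one unit beyond
    [1 + K + gap_rate] absorbs the length [T - t] of the running cost. *)
Definition cost_const : R := (Csl + Csg) * moment_const c0 (k * Cb) 1 + 2 * (Cl * gap_const c0 k Cb Cd).
Definition cost_rate : R := 2 + moment_const c0 (k * Cb) 1 + gap_rate c0 k Cb Cd.

Let lam0 : 0 <= lam * (1 - lam).
Proof. by have /andP[l0 l1] := lam01; rewrite mulr_ge0// subr_ge0. Qed.

Let K0 : 0 <= K. Proof. exact: (moment_const_ge0 _ 1 c00). Qed.
Let K20 : 0 <= moment_const c0 (k * Cb) 2. Proof. exact: (moment_const_ge0 _ 2 c00). Qed.
Let Kz0 : 0 <= moment_const c0 (2 * (Cd + k * Cb)) 1. Proof. exact: (moment_const_ge0 _ 1 c00). Qed.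
Let Gc0 : 0 <= Gc. Proof. by rewrite /Gc /gap_const addr_ge0// mulr_ge0. Qed.
Let rate0 : 0 <= gap_rate c0 k Cb Cd. Proof. exact: (addr_ge0 (addr_ge0 (ler0n _ 3) Kz0) K20). Qed.
Let theta0 : 0 <= theta. Proof. by rewrite mulr_ge0 ?sqr_ge0. Qed.
Let h0 r w : 0 <= h r w. Proof. by rewrite mulr_ge0 ?sqr_ge0. Qed.

Lemma cost_const_ge0 : 0 <= cost_const.
Proof.
exact: (addr_ge0 (mulr_ge0 (addr_ge0 Csl0 Csg0) K0) (mulr_ge0 (ler0n _ 2) (mulr_ge0 (ltW Cl0) Gc0))).
Qed.

Lemma cost_rate_ge0 : 0 <= cost_rate.
Proof. exact: (addr_ge0 (addr_ge0 (ler0n _ 2) K0) rate0). Qed.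

(** Passes through the convex combination of [X0] and [X1]: semiconcavity compares with its value
    there, and the Lipschitz bound pays for the distance [Z] to the actual state [X2]. *)
Let semiconcave_lip (v : H -> R) (C : R) r w :
  semiconcave_m1 B v C -> (forall y y', `|v y - v y'| <= Cl * N (y - y')) ->
  1 * (lam * v (X0 r w) + (1 - lam) * v (X1 r w)) + (-1) * v (X2 r w)
  <= C * h r w + Cl * N (Z r w).
Proof.
move=> vsc vlip; have h1 := vsc lam (X0 r w) (X1 r w) lam01.
have h2 := vlip (lam *: X0 r w + (1 - lam) *: X1 r w) (X2 r w).
have h3 := le_trans (ler_norm _) h2.
have := lerD h1 h3; rewrite /h /Z; set y := v (_ + _).
have gen (u v1 v2 y' e c1 c2 : R) : u + v1 - y' + (y' - v2) <= c1 + c2 ->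
   1 * (u + v1) + (-1) * v2 <= c1 + c2 by lra.
by rewrite -2!(mulrA C); rewrite mulrA; exact: gen.
Qed.

Let gap_le (Cs : R) s : 0 <= Cs -> t <= s <= T ->
  (\int[P]_w (Cs * h s w + Cl * N (Z s w))%:E <=
    ((Cs * K + Cl * Gc) * expR ((1 + K + gap_rate c0 k Cb Cd) * (T - t)) * theta)%:E)%E.
Proof.
move=> Cs0 tsT; have /andP[ts sT] := tsT.
have hh := (semiconcave_gap sepH sepXi hB c00 hSB k0 hk Cb0 hbsigma Cd0 hb_diff
    hsigma_diff hD tT hW ha hX0 hX1 lam01 hX2 Cs0 (ltW Cl0) tsT).
apply: (le_trans hh).
rewrite lee_fin; apply: ler_wpM2r => //; apply: ler_wpM2l.
  by rewrite addr_ge0// mulr_ge0// ltW.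
rewrite ler_expR; apply: ler_wpM2l; last by rewrite lerD2r.
exact: (addr_ge0 (addr_ge0 ler01 K0) rate0).
Qed.

Let mbound (Cs : R) : measurable_fun (strip T) (fun z => (Cs * h z.1 z.2 + Cl * N (Z z.1 z.2))%:E).
Proof.
have md := state_difference_measurable sepH hB tT hW hX0 hX1.
have mZ := convexity_gap_measurable sepH hB tT hW hX0 hX1 hX2.
apply/measurable_EFinP; apply: measurable_funD; apply: measurable_funM => //.
by apply: measurable_funM => //; exact: measurable_funX.
Qed.

Let f (X : R -> Om -> H) r w : R := l (X r w) (a r w).

(** The factors 1 and -1 put the integrand in the form of two nested linear combinations, as
    [expect_time_lin] expects. *)
Let running_gap :
  (\int[P]_w time_int t T (fun r w => (1 * (lam * f X0 r w + (1 - lam) * f X1 r w) + (-1) * f X2 r w)%R) w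
   <= ((Csl * K + Cl * Gc) * expR (cost_rate * (T - t)) * theta)%:E)%E.
Proof.
pose c := (Csl * K + Cl * Gc) * expR ((1 + K + gap_rate c0 k Cb Cd) * (T - t)) * theta.
have A0 : 0 <= Csl * K + Cl * Gc.
  exact: (addr_ge0 (mulr_ge0 Csl0 K0) (mulr_ge0 (ltW Cl0) Gc0)).
have cpos : 0 <= c by rewrite mulr_ge0// mulr_ge0// expR_ge0.
have G0 r w : 0 <= Csl * h r w + Cl * N (Z r w).
  exact: (addr_ge0 (mulr_ge0 Csl0 (h0 r w)) (mulr_ge0 (ltW Cl0) (norm_m1_ge0 B _))).
apply: (@le_trans _ _ (\int[P]_w \int[mu]_(r in `[t, T]) (Csl * h r w + Cl * N (Z r w))%:E)%E).
  apply: integral_le_nneg => w _; first by apply: integral_ge0 => r _; rewrite lee_fin.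
  apply: integral_le_nneg => r; first by rewrite lee_fin.
  rewrite /= in_itv/= => rT; rewrite lee_fin.
  apply: (semiconcave_lip (v := fun y => l y (a r w))).
    exact: hl_sc (admissible_in ha w rT).
  by move=> y y'; have [] := hlg y y' (admissible_in ha w rT).
rewrite (@tonelli_time _ _ _ P t T (fun r w => (Csl * h r w + Cl * N (Z r w))%:E)); last 2 first.
- exact: mbound.
- by move=> r w _; rewrite lee_fin.
apply: (@le_trans _ _ (\int[mu]_(r in `[t, T]) cst c%:E r)%E).
  apply: ge0_integral_mono => r; rewrite /= in_itv/= => rT.
    by apply: integral_ge0 => w _; rewrite lee_fin.
  exact: gap_le.
rewrite length_cst lee_fin.
have -> : (Csl * K + Cl * Gc) * expR (cost_rate * (T - t)) * theta = c * expR (T - t).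
  rewrite /c (_ : cost_rate * (T - t) = (1 + K + gap_rate c0 k Cb Cd) * (T - t) + (T - t)); last first.
    by rewrite /cost_rate -/K; ring.
  have gen (u v e1 e2 : R) : u * (e1 * e2) * v = u * e1 * v * e2 by ring.
  by rewrite (expRD ((1 + K + gap_rate c0 k Cb Cd) * (T - t))); exact: gen.
by apply: ler_wpM2l => //; rewrite (le_trans _ (expR_ge1Dx _))// lerDr.
Qed.

Let gT (X : R -> Om -> H) w : R := g (X T w).

Let terminal_gap :
  (\int[P]_w (1 * (lam * gT X0 w + (1 - lam) * gT X1 w) + (-1) * gT X2 w)%:E
   <= ((Csg * K + Cl * Gc) * expR (cost_rate * (T - t)) * theta)%:E)%E.
Proof.
have A0 : 0 <= Csg * K + Cl * Gc.
  exact: (addr_ge0 (mulr_ge0 Csg0 K0) (mulr_ge0 (ltW Cl0) Gc0)).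
apply: (@le_trans _ _ (\int[P]_w (Csg * h T w + Cl * N (Z T w))%:E)%E).
  apply: integral_le_nneg => w _; rewrite lee_fin.
    exact: (addr_ge0 (mulr_ge0 Csg0 (h0 T w)) (mulr_ge0 (ltW Cl0) (norm_m1_ge0 B _))).
  apply: (semiconcave_lip (v := g)) => // y y'.
  by have [a0 ha0] := hne; have [] := hlg y y' ha0.
apply: (le_trans (gap_le Csg0 TT)); rewrite lee_fin; apply: ler_wpM2r => //.
apply: ler_wpM2l => //; rewrite ler_expR; apply: ler_wpM2r; first by rewrite subr_ge0.
by rewrite /cost_rate -/K !lerD2r ler1n.
Qed.

(** All the costs are finite, so the combination of the three is the sum of the integrals of the
    running and terminal gaps. *)
Lemma cost_semiconcave :
  lam * fine (cost P l g t T a X0) + (1 - lam) * fine (cost P l g t T a X1)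
  <= fine (cost P l g t T a X2) + cost_const * expR (cost_rate * (T - t)) * theta.
Proof.
have r0 := running_integrable hX0; have r1 := running_integrable hX1.
have r2 := running_integrable hX2; have r01 := strip_integrable_lin lam (1 - lam) r0 r1.
have g0 := terminal_integrable hX0; have g1 := terminal_integrable hX1.
have g2 := terminal_integrable hX2.
have hr := running_gap; rewrite expect_time_lin// expect_time_lin// in hr.
have hg := terminal_gap.
have g01 := integrableD measurableT (integrableZl measurableT lam g0) (integrableZl measurableT (1 - lam) g1).
have j01 := integrableZl measurableT 1 g01; have j2 := integrableZl measurableT (-1) g2.
have j0 := integrableZl measurableT lam g0; have j1 := integrableZl measurableT (1 - lam) g1.
have gE : (\int[P]_w (1 * (lam * gT X0 w + (1 - lam) * gT X1 w) + (-1) * gT X2 w)%:E =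
  1%:E * (lam%:E * \int[P]_w (gT X0 w)%:E + (1 - lam)%:E * \int[P]_w (gT X1 w)%:E)
   + (-1)%:E * \int[P]_w (gT X2 w)%:E)%E.
  transitivity (\int[P]_w (1%:E * (lam%:E * (gT X0 w)%:E + (1 - lam)%:E * (gT X1 w)%:E)
      + (-1)%:E * (gT X2 w)%:E))%E.
    by apply: eq_integral => w _; rewrite !(EFinD, EFinM).
  by rewrite integralD// integralZl// integralD// !integralZl.
rewrite gE in hg.
rewrite (costE hX0) (costE hX1) (costE hX2).
have e0 := fineK (expect_time_fin r0); have e1 := fineK (expect_time_fin r1).
have e2 := fineK (expect_time_fin r2).
have q0 := fineK (integrable_fin_num measurableT g0).
have q1 := fineK (integrable_fin_num measurableT g1).
have q2 := fineK (integrable_fin_num measurableT g2).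
move: hr hg; rewrite -e0 -e1 -e2 -q0 -q1 -q2.
have gen (v0 v1 v2 M : R) :
  (1%:E * (lam%:E * v0%:E + (1 - lam)%:E * v1%:E) + (-1)%:E * v2%:E <= M%:E)%E ->
  1 * (lam * v0 + (1 - lam) * v1) + (-1) * v2 <= M by [].
move=> /gen hr /gen hg; rewrite /=.
rewrite /cost_const -/K -/Gc.
have -> : ((Csl + Csg) * K + 2 * (Cl * Gc)) * expR (cost_rate * (T - t)) * theta =
  (Csl * K + Cl * Gc) * expR (cost_rate * (T - t)) * theta +
  (Csg * K + Cl * Gc) * expR (cost_rate * (T - t)) * theta by ring.
exact: add_convexity_gaps hr hg.
Qed.

End three_states.

End costs.

(** * The value function *)

(** The same control is used at the three points: a control that is nearly optimal for the
    combination is admissible for both ends. The lower bounds and a control keep the infimum finite,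
    so that it is a real function. *)
Lemma ereal_inf_semiconcave (R : realType) (H : hilbertType R) (B : H -> H) (I : Type)
    (A : set I) (c : H -> I -> R) (C : R) :
  A !=set0 -> (forall x, exists m, forall a, A a -> m <= c x a) ->
  (forall a x x' lam, A a -> 0 <= lam <= 1 ->
    lam * c x a + (1 - lam) * c x' a <= c (lam *: x + (1 - lam) *: x') a
      + C * (lam * (1 - lam) * norm_m1 B (x - x') ^+ 2)) ->
  exists V : H -> R, (forall x, ereal_inf [set (c x a)%:E | a in A] = (V x)%:E) /\
    semiconcave_m1 B V C.
Proof.
move=> [a0 Aa0] clow csc; pose v x := ereal_inf [set (c x a)%:E | a in A].
have vle x a : A a -> (v x <= (c x a)%:E)%E by move=> Aa; apply: ereal_inf_lbound; exists a.
have vfin x : v x \is a fin_num.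
  have [m hm] := clow x; rewrite fin_real// (le_lt_trans (vle x a0 Aa0)) ?ltry// andbT.
  apply: (@lt_le_trans _ _ m%:E); first exact: ltNyr.
  by apply: le_ereal_inf_tmp => _ [a Aa <-]; rewrite lee_fin hm.
exists (fine \o v); split=> [x|lam x x' lam01]; first by rewrite /= fineK.
have /andP[l0 l1] := lam01; have l1' : 0 <= 1 - lam by rewrite subr_ge0.
rewrite /= lerBlDr -lerBlDl -lee_fin (fineK (vfin (_ + _))).
apply: le_ereal_inf_tmp => _ [a Aa <-]; rewrite lee_fin lerBlDl.
apply: (@le_trans _ _ (lam * c x a + (1 - lam) * c x' a)).
  by apply: lerD; apply: ler_wpM2l => //; rewrite -lee_fin fineK// vle.
by rewrite [leRHS]addrC; apply: (le_trans (csc a x x' lam Aa lam01)); rewrite !mulrA.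
Qed.

(** Provides a control, so that the infimum is not taken over the empty set; a constant process is
    measurable for the trivial sigma-algebra and the horizon is finite. *)
Lemma constant_admissible (R : realType) (Xi : hilbertType R)
    (d : measure_display) (Om : measurableType d) (P : probability Om R)
    (Lambda : normedModType R) (Lambda0 : set Lambda) (p : R)
    (W : R -> Xi -> Om -> R) (t T : R) (a : Lambda) :
  Lambda0 a -> admissible P Lambda0 p W t T (fun _ _ => a).
Proof.
move=> La; split=> //.
  move=> s tsT U oU; have [Ua|Ua] := pselect (U a).
    rewrite (_ : [set _ : R * Om | U a] = setT); last by apply/seteqP; split=> z.
    rewrite setIT -[X in _ X]setD0; apply: sigma_algebraCD; exact: sigma_algebra0.
  rewrite (_ : [set _ : R * Om | U a] = set0); last by apply/seteqP; split=> z.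
  by rewrite setI0; exact: sigma_algebra0.
have itv_fin : (@lebesgue_measure R `[t, T] < +oo)%E.
  by rewrite lebesgue_measure_itv/=; case: ifP => _; rewrite ?ltry// -EFinB ltry.
have -> : (\int[P]_(_ in setT) \int[@lebesgue_measure R]_(_ in `[t, T]) (`|a| `^ p)%:E =
    (`|a| `^ p)%:E * @lebesgue_measure R `[t, T])%E.
  rewrite -[RHS]mule1 -(probability_setT P) -integral_cst//.
  by apply: eq_integral => w _; rewrite integral_cst.
by rewrite lte_mul_pinfty// lee_fin powR_ge0.
Qed.

Section bound_monotonicity.
Context (R : realType) (H : hilbertType R).
Context (Cb Cl k t T : R) (Cl0 : 0 <= Cl) (k0 : 0 <= k) (tT : t <= T) (x : H).

Let energy_bound_le e e' : e <= e' -> energy_bound Cb t T x e <= energy_bound Cb t T x e'.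
Proof.
move=> ee; apply: ler_wpM2l; last by rewrite lerD2l.
by rewrite mulr_ge0 ?expR_ge0//; exact: (moment_const_ge0 _ 1 (lexx 0)).
Qed.

Lemma running_bound_le e e' : e <= e' -> running_bound Cb Cl t T x e <= running_bound Cb Cl t T x e'.
Proof.
move=> ee; apply: ler_wpM2l => //; apply: lerD => //; apply: ler_wpM2l; first by rewrite subr_ge0.
by rewrite lerD2l energy_bound_le.
Qed.

Lemma terminal_bound_le g e e' : e <= e' ->
  terminal_bound k Cb g Cl t T x e <= terminal_bound k Cb g Cl t T x e'.
Proof.
by move=> ee; rewrite lerD2l ler_wpM2l ?mulr_ge0// lerD2l energy_bound_le.
Qed.

End bound_monotonicity.

Lemma semiconcave_m1_le (R : realType) (H : hilbertType R) (B : H -> H) (v : H -> R) (C C' : R) :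
  C <= C' -> semiconcave_m1 B v C -> semiconcave_m1 B v C'.
Proof.
move=> CC vsc lam x x' lam01; apply: (le_trans (vsc lam x x' lam01)).
have /andP[l0 l1] := lam01.
by do 3 (apply: ler_wpM2r; first by rewrite ?sqr_ge0 ?subr_ge0).
Qed.


Theorem theorem5p10 (R : realType) (H Xi : hilbertType R)
  (Lambda : completeNormedModType R)
  (hH : separable H) (hXi : separable Xi) (hLambda : separable Lambda)
  (E : onb Xi)
  (Lambda0 : set Lambda)
  (hconv : convex_set (Lambda0 : set (convex_lmodType Lambda)))
  (hne : Lambda0 !=set0)
  (p : R) (hp : 2 < p)
  (DA : set H) (A : H -> H) (S : R -> {linear H -> H})
  (hAlin : linear_on DA A) (hAdense : dense DA)
  (hAdiss : maximal_dissipative DA A)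
  (hS : contraction_semigroup S) (hAS : generates DA A S)
  (b : H -> Lambda -> H) (sigma : H -> Lambda -> hs E H)
  (l : H -> Lambda -> R) (g : H -> R)
  (* (a) *)
  (B : {linear H -> H})
  (hB : strictly_positive_selfadjoint B)
  (hAB : weak_B_condition DA A B)
  (* (b) *)
  (hb_cont : {within [set z : H * Lambda | Lambda0 z.2],
                continuous (fun z => b z.1 z.2)})
  (hsigma_cont : {within [set z : H * Lambda | Lambda0 z.2],
                continuous (fun z => sigma z.1 z.2)})
  (hbsigma : exists2 C : R, 0 < C & forall x x' a, Lambda0 a ->
    [/\ `|b x a - b x' a| <= C * norm_m1 B (x - x'),
        `|sigma x a - sigma x' a| <= C * norm_m1 B (x - x'),
        `|b x a| <= C * (1 + `|x| + `|a|)
      & `|sigma x a| <= C * (1 + `|x| + `|a|)])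
  (* (c) *)
  (hl_cont : {within [set z : H * Lambda | Lambda0 z.2],
                continuous (fun z => l z.1 z.2)})
  (hlg : exists2 C : R, 0 < C & forall x x' a, Lambda0 a ->
    [/\ `|l x a - l x' a| <= C * norm_m1 B (x - x'),
        `|l x a| <= C * (1 + `|x| + `|a| ^+ 2)
      & `|g x - g x'| <= C * norm_m1 B (x - x')])
  (hlg_below : ~ bounded_set Lambda0 ->
    exists m : R, forall x, m <= g x /\ forall a, Lambda0 a -> m <= l x a)
  (* (d) *)
  (hb_diff : forall x a, differentiable (fun y => b y a) x)
  (hsigma_diff : forall x a, differentiable (fun y => sigma y a) x)
  (hD : exists2 C : R, 0 < C & forall x x' a, Lambda0 a ->
    norm_m1 B ('d (fun y => b y a) x (x - x') - 'd (fun y => b y a) x' (x - x'))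
      <= C * norm_m1 B (x - x') ^+ 2
    /\
    hs_norm E (norm_m1 B)
      ('d (fun y => sigma y a) x (x - x') - 'd (fun y => sigma y a) x' (x - x'))
      <= C * norm_m1 B (x - x') ^+ 2)
  (* (e) *)
  (hl_sc : exists C : R, forall a, Lambda0 a ->
    semiconcave_m1 B (fun x => l x a) C)
  (hg_sc : exists C : R, semiconcave_m1 B g C) :
  exists C1 C2 : R, [/\ 0 <= C1, 0 <= C2 &
    forall (T t : R), 0 < T -> 0 <= t <= T ->
    forall (d : measure_display) (Om : measurableType d)
      (P : probability Om R) (W : R -> Xi -> Om -> R),
      reference_space P t T W ->
    forall X : H -> (R -> Om -> Lambda) -> R -> Om -> H,
      (forall x a, admissible P Lambda0 p W t T a ->
         is_mild_solution P S b sigma W t T x a (X x a)) ->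
    exists V : H -> R,
      (forall x, value_function P Lambda0 p l g W t T X x = (V x)%:E) /\
      semiconcave_m1 B V (C1 * expR (C2 * (T - t)))].
Proof.
have Bpsd := sps_psd hB.
have [c0 c00 hSB] := semigroup_m1 hS hAS hAdense Bpsd hAB.
have [k k0 hk] := norm_m1_bound Bpsd.
have [Cb Cb0 hbsigma'] := hbsigma.
have [Cl Cl0 hlg'] := hlg.
have [Cd Cd0 hD'] := hD.
have [Csl hl_sc'] := hl_sc; have [Csg hg_sc'] := hg_sc.
(* A semiconcavity constant may be negative; its absolute value is also one and makes the final
   constant nonnegative. *)
have hl_sc'' a : Lambda0 a -> semiconcave_m1 B (fun x => l x a) `|Csl|.
  by move=> La; exact: semiconcave_m1_le (ler_norm _) (hl_sc' a La).
have hg_sc'' := semiconcave_m1_le (ler_norm _) hg_sc'.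
(* Both constants are fixed before [T], [t], the probability space and the states are introduced. *)
exists (cost_const c0 k Cb Cd Cl `|Csl| `|Csg|), (cost_rate c0 k Cb Cd).
split; [exact: cost_const_ge0|exact: cost_rate_ge0|].
move=> T t T0 /andP[t0 tT] d Om P W hW X hX.
have cfin x a : admissible P Lambda0 p W t T a -> cost P l g t T a (X x a) \is a fin_num.
  move=> ha; exact: (cost_fin hH hXi hLambda hne hp hS k0 hk Cb0 hbsigma' hl_cont Cl0 hlg' tT hW ha (hX x a ha)).
pose c x a := fine (cost P l g t T a (X x a)).
have [||a x x' lam ha lam01|V [VE Vsc]] := @ereal_inf_semiconcave R H B _
    (admissible P Lambda0 p W t T) c
    (cost_const c0 k Cb Cd Cl `|Csl| `|Csg| * expR (cost_rate c0 k Cb Cd * (T - t))).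
- by have [a0 La0] := hne; exists (fun _ _ => a0); exact: constant_admissible.
(* A lower bound uniform in the control: for bounded [Lambda0] from the uniformly bounded control
   energy, otherwise from the lower bounds of [l] and [g]. *)
- move=> x; have [[M [Mr hM]]|/hlg_below[m hm]] := pselect (bounded_set Lambda0).
    (* [bounded_set] bounds norms by every number above [M], hence [M + 1]. *)
    pose e := (T - t) * (1 + (M + 1)) ^+ 2.
    exists (- (running_bound Cb Cl t T x e + terminal_bound k Cb g Cl t T x e)) => a ha.
    have aM r w : t <= r <= T -> `|a r w| <= M + 1.
      by move=> rT; apply: (hM (M + 1)); [rewrite ltrDl|exact: (admissible_in ha w rT)].
    have he := control_energy_le hp tT hW ha aM.
    have hc := cost_abs_le hH hXi hLambda hne hp hS k0 hk Cb0 hbsigma' hl_cont Cl0 hlg' tT hW ha (hX x a ha).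
    rewrite -(fineK (cfin x a ha)) lee_fin -/(c x a) in hc.
    have h1 := running_bound_le Cb (ltW Cl0) tT x he.
    have h2 := terminal_bound_le Cb t T (ltW Cl0) (ltW k0) x g he.
    have := le_trans hc (lerD h1 h2).
    by rewrite ler_norml => /andP[].
  exists (- (`|m| * (T - t) + `|m|)) => a ha.
  have hm' y : - `|m| <= g y /\ forall a', Lambda0 a' -> - `|m| <= l y a'.
    have mm : - `|m| <= m by rewrite lerNl -normrN ler_norm.
    have [h1 h2] := hm y; split; first exact: le_trans mm h1.
    by move=> a' La'; exact: le_trans mm (h2 a' La').
  have := cost_ge hH hXi hLambda hne hp hS k0 hk Cb0 hbsigma' hl_cont Cl0 hlg' tT hW ha (hX x a ha) (normr_ge0 m) hm'.
  by rewrite -(fineK (cfin x a ha)) lee_fin.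
- exact: (cost_semiconcave hH hXi hLambda hne hp hS Bpsd c00 hSB k0 hk Cb0 hbsigma' Cd0 hb_diff hsigma_diff
    hD' hl_cont Cl0 hlg' (normr_ge0 _) (normr_ge0 _) hl_sc'' hg_sc'' tT hW ha (hX x a ha) (hX x' a ha) lam01
    (hX _ a ha)).
exists V; split=> // x; rewrite -VE /value_function; congr ereal_inf.
by apply/seteqP; split=> _ [a ha <-]; exists a => //; rewrite /c fineK// cfin.
Qed.
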